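(* Let $n\in\{2,3\}$ and let $\Omega\subset\mathbb R^n$ be a bounded Lipschitz domain that is simply connected with connected boundary. Then $$\boldsymbol H^{-1}(\operatorname{div},\Omega)=\nabla H_0^1(\Omega)\oplus\operatorname{curl}\big(\boldsymbol L^2(\Omega)/\ker(\operatorname{curl})\big)$$ (direct sum). For $n=2$ this reads $\boldsymbol H^{-1}(\operatorname{div},\Omega)=\nabla H_0^1(\Omega)\oplus\operatorname{curl}L_0^2(\Omega)$, and for $n=3$ it reads $\boldsymbol H^{-1}(\operatorname{div},\Omega)=\nabla H_0^1(\Omega)\oplus\operatorname{curl}\big(\boldsymbol L^2(\Omega;\mathbb R^3)/\nabla H^1(\Omega)\big)$.
   Context: $\boldsymbol H^{-1}(\operatorname{div},\Omega):=\{\boldsymbol\phi\in\boldsymbol H^{-1}(\Omega;\mathbb R^n):\operatorname{div}\boldsymbol\phi\in H^{-1}(\Omega)\}$ with squared norm $\|\boldsymbol\phi\|_{-1}^2+\|\operatorname{div}\boldsymbol\phi\|_{-1}^2$. For $n=2$, $\operatorname{curl}$ acts on scalar functions, $\operatorname{curl}v=(\partial_2v,-\partial_1v)^{\intercal}$, and the space $\boldsymbol L^2(\Omega)$ on which $\operatorname{curl}$ acts is the scalar space $L^2(\Omega)$; for $n=3$, $\operatorname{curl}$ is the usual curl of vector fields and $\boldsymbol L^2(\Omega)=\boldsymbol L^2(\Omega;\mathbb R^3)$. All derivatives are distributional. $\ker(\operatorname{curl})$ is the kernel of $\operatorname{curl}$ on $\boldsymbol L^2(\Omega)$. $L_0^2(\Omega)$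 is the space of $L^2$ functions with zero mean. *)

(* Defs.v *)
From HB Require Import structures.
From mathcomp Require Import all_boot all_order all_algebra.
From mathcomp Require Import all_classical all_reals all_analysis.

Set Implicit Arguments.
Unset Strict Implicit.
Unset Printing Implicit Defensive.

Import Order.TTheory GRing.Theory Num.Theory.
Import numFieldNormedType.Exports.

Local Open Scope classical_set_scope.
Local Open Scope ring_scope.

(* 'rV[R]_n is given the sigma-algebra generated by the coordinates, i.e. the
   Borel one, and lebesgue_rV is the n-dimensional Lebesgue measure, built as an
   iterated product of the one-dimensional one. *)
Definition rV_display : measure_display -> measure_display.
Proof. exact. Qed.

Section measurable_rV.
Context (R : realType) (n : nat).

Let coors : 'I_n -> 'rV[R]_n -> measurableTypeR R := fun i x => x 0 i.

Let rV_set0 : g_sigma_preimage coors set0.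
Proof. exact: sigma_algebra0. Qed.

Let rV_setC A : g_sigma_preimage coors A -> g_sigma_preimage coors (~` A).
Proof. exact: sigma_algebraC. Qed.

Let rV_bigcup (F : _^nat) : (forall i, g_sigma_preimage coors (F i)) ->
  g_sigma_preimage coors (\bigcup_i (F i)).
Proof. exact: sigma_algebra_bigcup. Qed.

HB.instance Definition _ :=
  @isMeasurable.Build (rV_display default_measure_display)
    'rV[R]_n (g_sigma_preimage coors) rV_set0 rV_setC rV_bigcup.

Lemma measurable_coord (i : 'I_n) :
  measurable_fun [set: 'rV[R]_n] (fun x => x 0 i : measurableTypeR R).
Proof.
move=> _ Y mY; rewrite setTI; apply: sub_sigma_algebra => /=.
rewrite -bigcup_seq/=; exists i => /=; first by rewrite mem_index_enum.
by exists Y => //; rewrite setTI.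
Qed.

Lemma measurable_fun_rV d (T : measurableType d) (f : T -> 'rV[R]_n) :
  (forall i, measurable_fun setT (fun x => f x 0 i : measurableTypeR R)) ->
  measurable_fun [set: T] f.
Proof.
move=> mf _ A mA.
have : g_sigma_preimage (fun i => coors i \o f) (setT `&` f @^-1` A).
  by rewrite g_sigma_preimage_comp; exists A.
move: (_ `&` _); apply: smallest_sub; first exact: sigma_algebra_measurable.
by rewrite -bigcup_seq => _ [i _ [B mB <-]]; exact: mf.
Qed.

End measurable_rV.

Section lebesgue_rV.
Context (R : realType).

Definition rV_cons n (p : measurableTypeR R * 'rV[R]_n) : 'rV[R]_n.+1 :=
  row_mx (p.1 : R)%:M p.2 : 'rV_(1 + n).

Lemma rV_cons0 n p : @rV_cons n p 0 ord0 = p.1.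
Proof.
have -> : ord0 = lshift n (ord0 : 'I_1) by exact/val_inj.
by rewrite /rV_cons (row_mxEl (p.1 : R)%:M) mxE eqxx.
Qed.

Lemma rV_consS n p (i : 'I_n) : @rV_cons n p 0 (lift ord0 i) = p.2 0 i.
Proof.
have -> : lift ord0 i = rshift 1 i by exact/val_inj.
by rewrite /rV_cons (row_mxEr (p.1 : R)%:M).
Qed.

Lemma measurable_rV_cons n : measurable_fun setT (@rV_cons n).
Proof.
apply: measurable_fun_rV => i.
case: (unliftP ord0 i) => [j|] ->.
  under eq_fun do rewrite rV_consS.
  exact: (measurableT_comp (measurable_coord j) measurable_snd).
under eq_fun do rewrite rV_cons0.
exact: measurable_fst.
Qed.

Definition lebesgue_rV_step n
    (mu : {sigma_finite_measure set 'rV[R]_n -> \bar R}) : set 'rV[R]_n.+1 -> \bar R :=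
  pushforward ((@lebesgue_measure R) \x mu)%E (@rV_cons n).

Section step.
Context n (mu : {sigma_finite_measure set 'rV[R]_n -> \bar R}).

Let mf := @measurable_rV_cons n.

Let m0 : lebesgue_rV_step mu set0 = 0%E.
Proof. exact: measure0. Qed.

Let m_ge0 A : (0 <= lebesgue_rV_step mu A)%E.
Proof. exact: measure_ge0. Qed.

Let m_sigma_additive : semi_sigma_additive (lebesgue_rV_step mu).
Proof. exact: measure_semi_sigma_additive. Qed.

HB.instance Definition _ := isMeasure.Build _ _ _ (lebesgue_rV_step mu)
  m0 m_ge0 m_sigma_additive.

Let m_sigma_finite : sigma_finite setT (lebesgue_rV_step mu).
Proof.
have /sigma_finiteP[F [TF ndF Foo]] := sigma_finiteT (@lebesgue_measure R).
have /sigma_finiteP[G [TG ndG Goo]] := sigma_finiteT mu.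
pose tl (x : 'rV[R]_n.+1) : measurableTypeR R * 'rV[R]_n := 
  (x 0 ord0, \row_i x 0 (lift ord0 i)).
have mtl : measurable_fun setT tl.
  apply/measurable_fun_pair; first exact: measurable_coord.
  apply: measurable_fun_rV => i; under eq_fun do rewrite mxE.
  exact: measurable_coord.
have tlK p : tl (rV_cons p) = p.
  case: p => x v; rewrite /tl rV_cons0; congr (_, _).
  by apply/rowP => i; rewrite mxE rV_consS.
exists (fun k => tl @^-1` (F k `*` G k)).
  rewrite -preimage_bigcup; apply/esym/seteqP; split => // x _ /=.
  have : (\bigcup_k F k) (tl x).1 by rewrite -TF.
  have : (\bigcup_k G k) (tl x).2 by rewrite -TG.
  move=> [j _ Gj] [i _ Fi]; exists (maxn i j) => //; split.
  - by move: Fi; exact/subsetPset/ndF/leq_maxl.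
  - by move: Gj; exact/subsetPset/ndG/leq_maxr.
move=> k; have [mF Fk] := Foo k; have [mG Gk] := Goo k; split.
  by rewrite -[X in measurable X]setTI; apply: mtl => //; exact: measurableX.
rewrite /lebesgue_rV_step /pushforward -comp_preimage.
rewrite (_ : tl \o _ = id); last by apply/funext => p; exact: tlK.
by rewrite preimage_id product_measure1E// lte_mul_pinfty// ge0_fin_numE.
Qed.

HB.instance Definition _ :=
  Measure_isSigmaFinite.Build _ _ _ (lebesgue_rV_step mu)
  m_sigma_finite.

End step.

Fixpoint lebesgue_rV n : {sigma_finite_measure set 'rV[R]_n -> \bar R} :=
  if n is m.+1 then lebesgue_rV_step (lebesgue_rV m) else \d_(0 : 'rV[R]_0).

End lebesgue_rV.

Section distributions.
Context (R : realType) (n : nat).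
Notation E := 'rV[R]_n.
Notation mu := (lebesgue_rV R n).

Definition partial (i : 'I_n) (f : E -> R) : E -> R := 'D_(delta_mx 0 i) f.

(* All iterated partial derivatives exist and are continuous. *)
Definition smooth (f : E -> R) := forall s : seq 'I_n,
  continuous (foldr partial f s) /\
  forall i x, derivable (foldr partial f s) x (delta_mx 0 i).

Definition tsupport (f : E -> R) : set E := closure [set x | f x != 0].

Record testfun (Omega : set E) := TestFun {
  testfun_fun :> E -> R ;
  testfun_smooth : smooth testfun_fun ;
  testfun_compact : compact (tsupport testfun_fun) ;
  testfun_sub : tsupport testfun_fun `<=` Omega }.

Lemma smooth_partial i f : smooth f -> smooth (partial i f).
Proof. by move=> sf s; have := sf (rcons s i); rewrite foldr_rcons. Qed.

Lemma tsupport_partial i f : tsupport (partial i f) `<=` tsupport f.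
Proof.
rewrite {1}/tsupport closureE; apply: smallest_sub; first exact: closed_closure.
move=> x; apply: contra_neqP => nfx.
have f0 : \forall y \near x, f y = 0.
  have : nbhs x (~` tsupport f).
    by apply: open_nbhs_nbhs; split => //; exact/closed_openC/closed_closure.
  apply: filterS => y fy; apply/eqP; apply: contra_notT fy => fy0.
  exact: subset_closure.
rewrite /partial (_ : 'D_(delta_mx 0 i) f x = 'D_(delta_mx 0 i) (cst 0) x).
  by rewrite derive_cst.
exact: near_eq_derive.
Qed.

Section on_domain.
Variable Omega : set E.

Definition test_partial (i : 'I_n) (phi : testfun Omega) : testfun Omega :=
  TestFun (smooth_partial i (@testfun_smooth _ phi))
    (subclosed_compact (@closed_closure _ _) (@testfun_compact _ phi)
      (@tsupport_partial i phi))
    (subset_trans (@tsupport_partial i phi) (@testfun_sub _ phi)).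

(* Functionals on test functions. Linearity and continuity are not imposed:
   they hold for every functional in the spaces below, and equality of
   functionals is equality as distributions. *)
Definition distr := testfun Omega -> R.

Definition distr_of (f : E -> R) : distr :=
  fun phi => \int[mu]_(x in Omega) (f x * phi x).

Definition dpartial (i : 'I_n) (T : distr) : distr :=
  fun phi => - T (test_partial i phi).

Definition grad (T : distr) : 'I_n -> distr := fun i => dpartial i T.

Definition div (T : 'I_n -> distr) : distr := \sum_i dpartial i (T i).

(* Functions on Omega are represented by functions on the whole space, of which
   only the values on Omega matter; classes modulo a.e. equality are not formed.
   f \_ Omega extends f by zero outside of Omega. *)
Definition L2 : set (E -> R) := [set f | f \_ Omega \in Lfun mu 2%:E].

Definition L20 : set (E -> R) :=
  [set f | L2 f /\ \int[mu]_(x in Omega) f x = 0].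

Definition L2v m : set ('I_m -> E -> R) := [set A | forall i, L2 (A i)].

Definition is_weak_partial i (u g : E -> R) :=
  L2 g /\ dpartial i (distr_of u) = distr_of g.

(* Unique up to a.e. equality on Omega whenever it exists. *)
Definition weak_partial i (u : E -> R) : E -> R :=
  xget (cst 0) [set g | is_weak_partial i u g].

Definition H1 : set (E -> R) :=
  [set u | L2 u /\ forall i, exists g, is_weak_partial i u g].

Definition H1_norm (u : E -> R) : R :=
  Num.sqrt (\int[mu]_(x in Omega) (u x ^+ 2) +
    \sum_i \int[mu]_(x in Omega) (weak_partial i u x ^+ 2)).

Definition H10 : set (E -> R) := [set u | H1 u /\
  forall e, 0 < e -> exists phi : testfun Omega,
    H1_norm (fun x => u x - phi x) < e].

(* The dual of H10, each bounded linear form being identified with its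
   restriction to the (dense) test functions. *)
Definition Hm1 : set distr := [set T | exists (F : (E -> R) -> R) (C : R),
  [/\ forall a u v, H10 u -> H10 v ->
        F (fun x => a * u x + v x) = a * F u + F v,
      forall u, H10 u -> `|F u| <= C * H1_norm u &
      forall phi : testfun Omega, T phi = F phi]].

Definition Hm1_div : set ('I_n -> distr) :=
  [set T | (forall i, Hm1 (T i)) /\ Hm1 (div T)].

Definition grad_H10 : set ('I_n -> distr) :=
  [set grad (distr_of u) | u in H10].

(* The gradients of H1 functions, as a space of vector fields. *)
Definition grad_H1 : set ('I_n -> E -> R) :=
  [set g | exists2 u, H1 u & forall i, is_weak_partial i u (g i)].

End on_domain.
End distributions.
Arguments distr_of {R n} Omega f.
Arguments L2 {R n} Omega _.
Arguments L20 {R n} Omega _.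
Arguments L2v {R n} Omega m _.
Arguments H1 {R n} Omega _.
Arguments H1_norm {R n} Omega u.
Arguments H10 {R n} Omega _.
Arguments Hm1 {R n} Omega _.
Arguments Hm1_div {R n} Omega _.
Arguments grad_H10 {R n} Omega _.
Arguments grad_H1 {R n} Omega _.
Arguments is_weak_partial {R n} Omega i u g.
Arguments weak_partial {R n} Omega i u.

Section curl.
Context (R : realType).

Definition curl2 (Omega : set 'rV[R]_2) (v : 'rV[R]_2 -> R) :
    'I_2 -> distr Omega :=
  tnth [tuple dpartial 1 (distr_of Omega v); - dpartial 0 (distr_of Omega v)].

Definition curl3 (Omega : set 'rV[R]_3) (v : 'I_3 -> 'rV[R]_3 -> R) :
    'I_3 -> distr Omega :=
  let d i j := dpartial i (distr_of Omega (v j)) in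
  tnth [tuple d 1 2 - d 2 1; d 2 0 - d 0 2; d 0 1 - d 1 0].

End curl.
Arguments curl2 {R} Omega v.
Arguments curl3 {R} Omega v.

Section sums_and_quotients.
Context {X Y : zmodType}.

(* H is the internal direct sum of the subspaces A and B. *)
Definition direct_sum (H A B : set Y) :=
  H = [set a + b | a in A & b in B] /\ A `&` B = [set 0].

Definition ker_on (L : set X) (c : X -> Y) : set X :=
  [set x | L x /\ c x = 0].

(* L / K as the set of cosets x + K with x in L. *)
Definition quotient (L K : set X) : set (set X) :=
  [set [set x + k | k in K] | x in L].

(* The image of a set of cosets under the map induced by c: the value of the
   induced map at a coset is the constant value of c on it. *)
Definition quotient_image (c : X -> Y) (Q : set (set X)) : set Y :=
  [set y | exists2 C, Q C & c @` C = [set y]].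

End sums_and_quotients.

Section domains.
Context (R : realType) (n : nat).
Notation E := 'rV[R]_n.+1.

Definition bdry (A : set E) : set E := closure A `\` A°.

Definition path_connected (A : set E) := forall x y, A x -> A y ->
  exists g : R -> E, [/\ {within `[0, 1], continuous g},
    forall t, t \in `[0, 1] -> A (g t), g 0 = x & g 1 = y].

(* Path connected, and every loop contracts to its base point inside A. *)
Definition simply_connected (A : set E) := path_connected A /\
  forall g : R -> E, {within `[0, 1], continuous g} ->
    (forall t, t \in `[0, 1] -> A (g t)) -> g 0 = g 1 ->
  exists H : R * R -> E,
    [/\ {within `[0, 1] `*` `[0, 1], continuous H},
        forall s t, s \in `[0, 1] -> t \in `[0, 1] -> A (H (s, t)),
        forall t, t \in `[0, 1] -> H (0, t) = g t /\ H (1, t) = g 0 &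
        forall s, s \in `[0, 1] -> H (s, 0) = g 0 /\ H (s, 1) = g 0].

(* Near each boundary point, and in the orthonormal coordinates y *m Q, Omega
   is the strict epigraph of a Lipschitz function of the first n coordinates. *)
Definition lipschitz_boundary (Omega : set E) := forall x0, bdry Omega x0 ->
  exists (Q : 'M[R]_n.+1) (z : 'rV[R]_n -> R) (k r : R),
    [/\ Q *m Q^T = 1%:M, k.-lipschitz z, 0 < r &
        forall y, ball x0 r y ->
          (Omega y <-> z (col' ord_max (y *m Q)) < (y *m Q) 0 ord_max)].

Definition bounded_lipschitz_domain (Omega : set E) :=
  [/\ Omega !=set0, open Omega, connected Omega, bounded_set Omega &
      lipschitz_boundary Omega].

End domains.

(* Main.v *)
Require Import Defs.
From HB Require Import structures.
From mathcomp Require Import all_boot all_order all_algebra.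
From mathcomp Require Import all_classical all_reals all_analysis.
From mathcomp Require Import measurable_realfun ring lra.
Import Order.TTheory GRing.Theory Num.Theory.
Import numFieldNormedType.Exports.
Local Open Scope classical_set_scope.
Local Open Scope ring_scope.
Set Implicit Arguments.
Unset Strict Implicit.
Unset Printing Implicit Defensive.

(** The proof is the same in both dimensions up to the last step. Let T be in H^-1(div). Solving
a Dirichlet problem by Riesz representation (dirichlet) gives u in H^1_0 such that S = T - grad
u is divergence free; so S, on fields phi of test functions, vanishes on gradients. One looks
for a skew matrix w of L2 functions with S phi = sum_ij <w_ij, d_j phi_i>, since the curls of L2
are exactly the functionals of this form. By Riesz representation again (rot_represent) w exists
as soon as |S phi| <= C |rot phi|, with L2 norms, where rot phi is the skew part of the Jacobian
of phi.

S is bounded for the H1 norm, hence by rot phi and div phi (grad_rot_dv). As S vanishes on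
gradients, phi may be changed by the gradient of a test function, which turns div phi, up to a
small error, into its projection g on the harmonic functions of L2. So everything rests on the
estimate |g| <= C |rot phi| (hpart_rot):

- |g|^2 = <g, div phi>. Near a boundary point the domain is the strict epigraph, in a direction
  v, of a Lipschitz function. Put G = int_0^h g(. + s v) ds. Integrating by parts along v bounds
  <g, div phi> by |rot phi| times the gradient of G, up to an interior term. The derivative of G
  along v is a difference of translates of g, and the Rellich identity bounds the other
  derivatives by this one: |grad G| <= C |g| (K_patch). Gluing gives |g| <= C (|rot phi| +
  |phi|) (Kb_global).
- The term |phi| is removed by compactness. A sequence of counterexamples has a limit
  (rellich_ultra) without rotation, extended by zero to the whole space, so it has a primitive
  q, constant on the connected components of the exterior. As the boundary is connected, q
  vanishes outside of the closure of the domain (exterior_lc). The divergences tend to the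
  Laplacian of q, and q can be pushed into the domain by translations near the boundary, so this
  Laplacian is orthogonal to harmonic functions (harmonic_limit), in particular to g: a
  contradiction.

The sum is direct because curls are divergence free and a divergence free gradient of u in H^1_0
is orthogonal to itself (skew_direct_sum).

In dimension two a skew matrix is one function, and the kernel of curl consists of the
constants, so every coset has a representative of mean zero. In dimension three a curl free
field of L2 is harmonic after subtracting the gradient of some u in H^1_0 (curl_free_grad),
hence smooth (weyl); its line integrals are locally path independent, so it has a potential on
the simply connected domain (potential_exists). Near the boundary this potential differs from an
inner translate of itself by an average of the field along v, so it is in L2 (c1_sq_at). *)

Local Notation mfun := (measurable_fun setT).
Local Notation "f +' g" := (fun x => f x + g x) (at level 50, left associativity).
Local Notation "f -' g" := (fun x => f x - g x) (at level 50, left associativity).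
Local Notation "f *' g" := (fun x => f x * g x) (at level 40, left associativity).
Local Notation "''d_' i" := (partial i) (at level 8, i at level 2, format "''d_' i").

(** * Integrable and square integrable functions *)

Section integrals.
Context d (T : measurableType d) (R : realType).
Context (mu : {measure set T -> \bar R}).
Implicit Types f g h : T -> R.

Definition itg f := mu.-integrable setT (EFin \o f).
Notation "'intg' f" := (Rintegral mu setT f) (at level 10, f at next level).
Lemma itg_meas f: itg f -> mfun f.
by case/integrableP => /measurable_EFinP. Qed.

Lemma itg_le f g: mfun f -> (forall x, `|f x| <= g x) ->
 itg g -> itg f.
move=> mf fg; apply: le_integrable => //; first exact/measurable_EFinP.
by move=> x; rewrite lee_fin (le_trans (fg x))// ler_norm.
Qed.

Lemma itgD f g: itg f -> itg g -> itg (f +' g).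
by move=> If Ig; have := integrableD measurableT If Ig. Qed.
Lemma itgN f: itg f -> itg (fun x => - f x).
by move=> If; have := integrableN If. Qed.
Lemma itgB f g: itg f -> itg g -> itg (f -' g).
by move=> If /itgN; exact: itgD. Qed.
Lemma itgZ a f: itg f -> itg (fun x => a * f x).
by move=> If; have := integrableZl measurableT a If. Qed.
Lemma itgZr a f: itg f -> itg (fun x => f x * a).
by move=> /(itgZ a); under eq_fun do rewrite mulrC. Qed.
Lemma itg0: itg (fun=> 0).
exact: integrable0. Qed.
Lemma itg_abs f: itg f -> itg (fun x => `|f x|).
by move=> If; have := integrable_norm If. Qed.

Lemma itg_sum (I : Type) (s : seq I) (F : I -> T -> R):
 (forall i, itg (F i)) -> itg (fun x => \sum_(i <- s) F i x).
move=> IF; elim: s => [|i s ih].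
 by under eq_fun do rewrite big_nil; exact: itg0.
by under eq_fun do rewrite big_cons; exact: itgD.
Qed.

Lemma intD f g: itg f -> itg g ->
 intg (f +' g) = intg f + intg g.
exact: RintegralD. Qed.
Lemma intZ a f: itg f -> intg (fun x => a * f x) = a * intg f.
exact: RintegralZl. Qed.
Lemma int0: intg (fun=> 0) = 0.
by rewrite /Rintegral integral0. Qed.
Lemma int_eq0 f: (forall x, f x = 0) -> intg f = 0.
by move=> f0; rewrite -[RHS]int0; congr (intg _); apply/funext. Qed.
Lemma intN f: itg f -> intg (fun x => - f x) = - intg f.
move=> If; under eq_Rintegral do rewrite -mulN1r.
by rewrite (intZ (-1) If) mulN1r.
Qed.
Lemma intB f g: itg f -> itg g ->
 intg (f -' g) = intg f - intg g.
exact: RintegralB. Qed.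

Lemma int_sum (I : Type) (s : seq I) (F : I -> T -> R):
 (forall i, itg (F i)) ->
 intg (fun x => \sum_(i <- s) F i x) = \sum_(i <- s) intg (F i).
move=> IF; elim: s => [|i s ih].
 by rewrite big_nil; under eq_Rintegral do rewrite big_nil; exact: int0.
under eq_Rintegral do rewrite big_cons.
by rewrite big_cons intD ?ih//; exact: itg_sum.
Qed.

Lemma int_ge0 f: (forall x, 0 <= f x) -> 0 <= intg f.
by move=> f0; apply: Rintegral_ge0. Qed.
Lemma int_le f g: itg f -> itg g -> (forall x, f x <= g x) -> intg f <= intg g.
by move=> If Ig fg; apply: le_Rintegral. Qed.
Lemma int_abs f: itg f -> `|intg f| <= intg (fun x => `|f x|).
exact: le_normr_Rintegral. Qed.

Lemma int_abs_le f g: itg f -> itg g -> (forall x, `|f x| <= g x) ->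
 `|intg f| <= intg g.
move=> If Ig fg; apply: (le_trans (int_abs If)); apply: int_le => //.
exact: itg_abs.
Qed.

Lemma eq_int f g: f =1 g -> intg f = intg g.
by move=> /funext ->. Qed.
Lemma int_EFin f: itg f -> (intg f)%:E = (\int[mu]_x (f x)%:E)%E.
by move=> If; rewrite fineK//; exact: integrable_fin_num. Qed.

Lemma itg_ge0P f: mfun f -> (forall x, 0 <= f x) ->
 (\int[mu]_x (f x)%:E < +oo)%E -> itg f.
move=> mf f0 foo; apply/integrableP; split; first exact/measurable_EFinP.
by under eq_integral do rewrite /= ger0_norm//.
Qed.

Lemma itg_ae f g: mfun g -> itg f -> ae_eq mu setT f g -> itg g.
move=> mg If fg; apply/integrableP; split; first exact/measurable_EFinP.
have [mf] := integrableP _ _ _ If.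
rewrite (ae_eq_integral (fun x => `|(EFin \o g) x|)%E)//.
- exact: (measurableT_comp (f := abse)).
- by apply: (measurableT_comp (f := abse)) => //; exact/measurable_EFinP.
- by apply: filterS fg => x + xT => /(_ xT) /= ->.
Qed.

Lemma int_ae f g: mfun f -> mfun g ->
 ae_eq mu setT f g -> intg f = intg g.
move=> mf mg fg; congr fine; apply: ae_eq_integral => //.
- exact/measurable_EFinP.
- exact/measurable_EFinP.
- by apply: filterS fg => x + xT => /(_ xT) /= ->.
Qed.

Lemma int_eq0_ae f: itg f -> (forall x, 0 <= f x) -> intg f = 0 ->
 ae_eq mu setT f (cst 0).
move=> If f0 f00.
have [mf _] := integrableP _ _ _ If.
have : (\int[mu]_x `|(f x)%:E| = 0)%E.
 under eq_integral do rewrite abse_EFin ger0_norm//.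
 by rewrite -int_EFin// f00.
move/(ae_eq_integral_abs mu measurableT mf).
by apply: filterS => x + xT => /(_ xT) [->].
Qed.

Definition sq f := mfun f /\ itg (fun x => f x ^+ 2).
Definition ip f g := intg (f *' g).
Lemma ipE f g: ip f g = intg (f *' g). Proof. by []. Qed.

Lemma sqM f g: sq f -> sq g -> itg (f *' g).
move=> [mf If] [mg Ig]; apply: (itg_le (g := fun x => f x ^+ 2 + g x ^+ 2)).
- exact: measurable_funM.
- move=> x; rewrite ler_norml; nra.
- exact: itgD.
Qed.

Lemma sqD f g: sq f -> sq g -> sq (f +' g).
move=> sf sg; have [mf If] := sf; have [mg Ig] := sg.
split; first exact: measurable_funD.
under eq_fun do rewrite sqrrD -mulr_natl.
by do 2 apply: itgD => //; apply: itgZ; exact: sqM.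
Qed.

Lemma sqZ a f: sq f -> sq (fun x => a * f x).
move=> [mf If]; split; first exact: measurable_funM.
by under eq_fun do rewrite exprMn; exact: itgZ.
Qed.
Lemma sqN f: sq f -> sq (fun x => - f x).
by move=> /(sqZ (-1)); under eq_fun do rewrite mulN1r. Qed.
Lemma sqB f g: sq f -> sq g -> sq (f -' g).
by move=> sf /sqN; exact: sqD. Qed.
Lemma sq0: sq (fun=> 0).
by split => //; under eq_fun do rewrite expr0n; exact: itg0. Qed.

Lemma sq_sum (I : Type) (s : seq I) (F : I -> T -> R):
 (forall i, sq (F i)) -> sq (fun x => \sum_(i <- s) F i x).
move=> IF; elim: s => [|i s ih].
 by under eq_fun do rewrite big_nil; exact: sq0.
by under eq_fun do rewrite big_cons; exact: sqD.
Qed.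

Lemma sq_le f g: mfun f -> sq g -> (forall x, `|f x| <= `|g x|) ->
 sq f.
move=> mf [mg Ig] fg; split => //.
apply: itg_le Ig; first exact: measurable_funX.
by move=> x; rewrite normrX -[leRHS]real_normK ?num_real// lerXn2r ?nnegrE.
Qed.

Lemma ipC f g: ip f g = ip g f.
by apply: eq_int => x; rewrite mulrC. Qed.

Lemma ipDl f g h: sq f -> sq g -> sq h ->
 ip (f +' g) h = ip f h + ip g h.
move=> sf sg sh; rewrite -intD; try exact: sqM.
by apply: eq_int => x; rewrite mulrDl.
Qed.

Lemma ipZl a f h: sq f -> sq h -> ip (fun x => a * f x) h = a * ip f h.
by move=> sf sh; rewrite -intZ; [apply: eq_int => x; rewrite mulrA|exact: sqM].
Qed.
Lemma ipNl f h: sq f -> sq h -> ip (fun x => - f x) h = - ip f h.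
by move=> sf sh; rewrite -intN; [apply: eq_int => x; rewrite mulNr|exact: sqM].
Qed.
Lemma ipBl f g h: sq f -> sq g -> sq h ->
 ip (f -' g) h = ip f h - ip g h.
by move=> sf sg sh; rewrite ipDl ?ipNl//; exact: sqN. Qed.

Lemma ip_sql (I : Type) (s : seq I) (F : I -> T -> R) h:
 (forall i, sq (F i)) -> sq h ->
 ip (fun x => \sum_(i <- s) F i x) h = \sum_(i <- s) ip (F i) h.
move=> sF sh; rewrite -int_sum; last by move=> i; exact: sqM.
by apply: eq_int => x; rewrite mulr_suml.
Qed.

Lemma ip_ge0 f: 0 <= ip f f.
by apply: int_ge0 => x; rewrite -expr2 sqr_ge0. Qed.

Lemma ip_ae0 f: sq f -> ip f f = 0 -> ae_eq mu setT f (cst 0).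
move=> [mf If] f0; have /int_eq0_ae := If.
move=> /(_ (fun => sqr_ge0 _)) h.
have : ae_eq mu setT (fun x => f x ^+ 2) (cst 0) by apply: h.
by apply: filterS => x + xT => /(_ xT) /eqP; rewrite sqrf_eq0 => /eqP.
Qed.

Lemma CS f g: sq f -> sq g -> ip f g ^+ 2 <= ip f f * ip g g.
move=> sf sg; set a := ip f f; set b := ip f g; set c := ip g g.
have H t: 0 <= a * t ^+ 2 - 2 * b * t + c.
 have := ip_ge0 (fun x => t * f x - g x).
 have stf := sqZ t sf.
 rewrite ipBl//; last exact: sqB.
 rewrite ipZl//; last exact: sqB.
 rewrite ![ip _ (fun => _ - _)]ipC !ipBl// !ipZl// -/a -/c.
 rewrite [ip g f]ipC -/b; lra.
have [a0|a0] := eqVneq a 0.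
 have c0: 0 <= c by exact: ip_ge0.
 have [->|b0] := eqVneq b 0; first by rewrite a0 expr0n mul0r.
 have := H ((c + 1) / (2 * b)); rewrite a0 mul0r add0r.
 suff -> : 2 * b * ((c + 1) / (2 * b)) = c + 1 by lra.
 by field.
have a1: 0 < a by rewrite lt_neqAle eq_sym a0 ip_ge0.
have := H (b / a).
have ->: a * (b / a) ^+ 2 - 2 * b * (b / a) + c = (a * c - b ^+ 2) / a by field.
by rewrite pmulr_lge0 ?invr_gt0// subr_ge0.
Qed.

End integrals.

(** * Riesz representation and completeness of L2 *)

Section riesz.
Context (R : realType) (V : Type) (lc : R -> V -> V -> V) (S : set V)
 (b : V -> V -> R) (l : V -> R) (C : R) (v0 : V).
Context (S0 : S v0) (C0 : 0 < C) (Slc : forall a u v, S u -> S v -> S (lc a u v)).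
Context (bC : forall u v, b u v = b v u).
Context (blc : forall a u v w, S u -> S v -> S w ->
 b (lc a u v) w = a * b u w + b v w).
Context (b_ge0 : forall u, S u -> 0 <= b u u).
Context (llc : forall a u v, S u -> S v -> l (lc a u v) = a * l u + l v).
Context (lb : forall u, S u -> l u ^+ 2 <= C * b u u).

(** A bounded linear form on a pre-Hilbert space is represented by a minimizing
  sequence of its energy, which is Cauchy by the parallelogram identity. *)
Lemma riesz_cauchy: exists v : nat -> V,
 [/\ forall k, S (v k),
   forall i j, b (lc (-1) (v j) (v i)) (lc (-1) (v j) (v i)) <=
    2 / i.+1%:R + 2 / j.+1%:R &
   forall k w, S w -> (b (v k) w - l w) ^+ 2 <= b w w / k.+1%:R].
pose J u := b u u - 2 * l u.
have Jlb u: S u -> - C <= J u.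
 move=> Su; rewrite /J; have LC := lb Su.
 have := sqr_ge0 (l u - C); rewrite sqrrB -mulr_natl => h1.
 have : C * (2 * l u) <= C * (b u u + C) by nra.
 rewrite ler_pM2l//; lra.
pose A := [set J u | u in S].
have infA: has_inf A.
 split; first by exists (J v0), v0.
 by exists (- C) => _ [u Su <-]; exact: Jlb.
pose m := inf A.
have mJ u: S u -> m <= J u by move=> Su; apply: ge_inf; [exact: infA.2|exists u].
have /choice[v vP] : forall k : nat, exists u, S u /\ J u <= m + k.+1%:R^-1.
 move=> k; have k0: 0 < k.+1%:R^-1 :> R by rewrite invr_gt0.
 by have [_ [u Su <-]] := inf_adherent k0 infA; exists u; split => //; exact: ltW.
exists v; split => [k|i j|k w Sw]; first by case: (vP k).
- have [Si Ji] := vP i; have [Sj Jj] := vP j.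
 have Sd := Slc (-1) Sj Si.
 have Sm := Slc (1/2) Sd Sj; have := mJ _ Sm.
 move: Ji Jj; rewrite /J.
 rewrite !(llc, blc)// ![b _ (lc _ _ _)]bC !(llc, blc)// [b (v j) (v i)]bC.
 move: (i.+1%:R^-1) (j.+1%:R^-1) => ei ej.
 lra.
- have [Sk Jk] := vP k.
 set r := b (v k) w - l w; set B := b w w; set e := k.+1%:R^-1.
 have e0: 0 < e by rewrite invr_gt0.
 have H t: 0 <= t ^+ 2 * B + 2 * t * r + e.
  have SL := Slc t Sw Sk; have := mJ _ SL; move: Jk; rewrite /J.
  rewrite !(llc, blc)// ![b _ (lc _ _ _)]bC !blc// /r -/B -/e.
  rewrite [b w (v k)]bC; nra.
 have B0: 0 <= B by exact: b_ge0.
 have [B00|Bn0] := eqVneq B 0.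
  have [->|r0] := eqVneq r 0; first by rewrite expr0n B00 mul0r.
  have := H (- (e + 1) / (2 * r)); rewrite B00 mulr0 add0r.
  suff -> : 2 * (- (e + 1) / (2 * r)) * r = - (e + 1) by lra.
  by field.
 have B1: 0 < B by lra.
 have := H (- r / B).
 have ->: (- r / B) ^+ 2 * B + 2 * (- r / B) * r + e = (e * B - r ^+ 2) / B by field.
 by rewrite pmulr_lge0 ?invr_gt0// subr_ge0 mulrC.
Qed.
End riesz.

Section completeness.
Context d (T : measurableType d) (R : realType).
Context (mu : {measure set T -> \bar R}).
Local Notation ip := (ip mu).
Local Notation sq := (sq mu).

Definition dist2 (f g : T -> R) := ip (f -' g) (f -' g).
Definition cvg2 (u : nat -> T -> R) (f : T -> R) :=
 forall e, 0 < e -> exists N, forall k, (N <= k)%N -> dist2 (u k) f < e.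
Definition cauchy2 (u : nat -> T -> R) :=
 forall e, 0 < e -> exists N, forall i j, (N <= i)%N -> (N <= j)%N ->
  dist2 (u i) (u j) < e.

Lemma limn_einf_le_near (u : (\bar R)^nat) c : (forall n, u n <= c)%E ->
 (limn_einf u <= c)%E.
move=> uc; rewrite limn_einf_lim; apply: lime_le; first exact: is_cvg_einfs.
apply: nearW => n; apply: le_trans (uc n); apply: ereal_inf_lbound.
by exists n => /=.
Qed.

Lemma ae_cvg_ip_le (v : nat -> T -> R) (f : T -> R) c:
 (forall k, sq (v k)) -> mfun f ->
 {ae mu, forall x, v ^~ x @ \oo --> f x} ->
 (forall k, ip (v k) (v k) <= c) -> sq f /\ ip f f <= c.
move=> sv mf vf vc.
have H: (\int[mu]_x ((f x) ^+ 2)%:E <= c%:E)%E.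
 apply: (@le_trans _ _ (\int[mu]_x limn_einf (fun k => ((v k x) ^+ 2)%:E))%E).
  apply: ae_ge0_le_integral => //.
  - by move=> x; rewrite lee_fin sqr_ge0.
  - by apply/measurable_EFinP; exact: measurable_funX.
  - move=> x _; rewrite limn_einf_lim; apply: lime_ge.
    exact: is_cvg_einfs.
   apply: nearW => n; apply: le_ereal_inf_tmp => _ [k _ <-].
   by rewrite lee_fin sqr_ge0.
  - rewrite (_ : (fun x => _) = (fun x => - limn_esup (-%E \o (fun k => ((v k x) ^+ 2)%:E)))%E); last first.
    by [].
   apply: measurableT_comp => //; apply: measurable_fun_limn_esup => k.
   apply: measurableT_comp => //.
   by apply/measurable_EFinP/measurable_funX; exact: (sv k).1.
  - apply: filterS vf => x vx _.
   have h: (fun k => ((v k x) ^+ 2)%:E) @ \oo --> ((f x) ^+ 2)%:E by apply: cvg_EFin; [exact: nearW|rewrite /comp; under eq_fun do rewrite expr2; rewrite expr2; exact: cvgM].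
   by rewrite is_cvg_limn_einfE ?(cvg_lim _ h)//.
 apply: (le_trans (fatou mu measurableT _ _)) => //=.
 - by move=> n; apply/measurable_EFinP/measurable_funX; exact: (sv n).1.
 - by move=> n x; rewrite lee_fin sqr_ge0.
 apply: limn_einf_le_near => n.
 have := vc n; rewrite -lee_fin int_EFin; last exact: sqM.
 by [].
have sf: sq f.
 split => //; apply: itg_ge0P => //.
 - exact: measurable_funX.
 - by move=> x; rewrite sqr_ge0.
 - exact: le_lt_trans H (ltry _).
split => //; rewrite -lee_fin int_EFin; last exact: sqM.
by [].
Qed.

Lemma geo_cvg (w : nat -> R) (C : R):
 (forall j, `|w j.+1 - w j| <= C * (1/2) ^+ j) -> cvgn w.
move=> wC; have ->: w = (fun n => w 0%N + series (telescope w) n).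
 by apply/funext => n; exact: eq_sum_telescope.
apply: is_cvgD; first exact: is_cvg_cst.
apply: normed_cvg; apply: (@series_le_cvg _ _ (geometric C (1/2))) => //.
- by move=> n; exact: normr_ge0.
- by move=> n; exact: le_trans (normr_ge0 _) (wC n).
- apply: is_cvg_geometric_series; rewrite ger0_norm; lra.
Qed.

(** A rapidly converging subsequence converges almost everywhere, since the squares of its scaled
 increments are summable; Fatou's lemma bounds the distance to the limit. *)
Lemma L2_complete (u : nat -> T -> R): (forall k, sq (u k)) -> cauchy2 u ->
 exists2 f, sq f & cvg2 u f.
move=> su cu.
have p8 j: 0 < (1/8 : R) ^+ j by [].
have [N NP] := choice (fun j => cu _ (p8 j)).
pose n j := (\max_(i < j.+1) N i)%N.
have Nn j i: (j <= i)%N -> (N j <= n i)%N.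
 move=> ji; have ji': (j < i.+1)%N by [].
 exact: (@leq_bigmax _ (fun k : 'I_i.+1 => N k) (Ordinal ji')).
pose D j x := u (n j.+1) x - u (n j) x.
have sD j: sq (D j) by exact: sqB.
have DD j: ip (D j) (D j) <= (1/8) ^+ j by apply/ltW/NP; exact: Nn.
pose S x : \bar R := (\sum_(j <oo) ((2 ^+ j * D j x) ^+ 2)%:E)%E.
have mS j: mfun (fun x => ((2 ^+ j * D j x) ^+ 2)%:E) by apply/measurable_EFinP; apply: measurable_funX; apply: measurable_funM => //; exact: (sD j).1.
have intS: (\int[mu]_x S x < +oo)%E.
 rewrite integral_nneseries//; last first.
  by move=> j x; rewrite lee_fin sqr_ge0.
 apply: (@le_lt_trans _ _ (\sum_(j <oo) ((1/2) ^+ j)%:E)%E); last first.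
  apply: (@le_lt_trans _ _ 2%:E); last exact: ltry.
  apply: lime_le.
   by apply: is_cvg_nneseries => j _.
  apply: nearW => k; rewrite sumEFin lee_fin.
  have h: series (geometric 1 (1/2)) k <= 1 * (1 - 1/2 : R)^-1 by apply: geometric_le_lim => //; (rewrite ger0_norm); lra.
  have ->: \sum_(0 <= i < k) (1/2 : R) ^+ i = series (geometric 1 (1/2)) k by apply: eq_bigr => i; rewrite [RHS]mul1r.
  by apply: le_trans h _; rewrite le_eqVlt; apply/orP; left; apply/eqP; field.
 apply: lee_nneseries.
  by move=> j _ _; apply: integral_ge0 => x; rewrite lee_fin sqr_ge0.
 move=> j _.
 have := DD j; rewrite -(ler_pM2l (_ : 0 < 4 ^+ j)) ?exprn_gt0//.
 rewrite -exprMn (_ : 4 * (1/8) = 1/2 :> R); last by field.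
 rewrite -intZ; last exact: sqM.
 rewrite -lee_fin int_EFin; last by apply: itgZ; exact: sqM.
 apply: le_trans.
 apply: ge0_le_integral => //.
 - by move=> x; rewrite lee_fin sqr_ge0.
 - by apply/measurable_EFinP; apply: measurable_funM => //; apply: measurable_funM; exact: (sD j).1.
 - move=> x _; rewrite lee_fin exprMn -exprM mulnC exprM -expr2.
  by rewrite (_ : 2 ^+ 2 = 4 :> R); lra.
have Sfin: {ae mu, forall x, S x \is a fin_num}.
 have S0 x: (0 <= S x)%E by apply: nneseries_ge0 => j; rewrite lee_fin sqr_ge0.
 have iS: mu.-integrable setT S.
  apply/integrableP; split.
   apply: ge0_emeasurable_sum => // j x; by rewrite lee_fin sqr_ge0.
  by under eq_integral do rewrite gee0_abs//.
 by have := integrable_ae measurableT iS; apply: filterS => x; apply.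
have SA x: S x \is a fin_num -> cvgn (fun j => u (n j) x).
 move=> Sx; apply: (@geo_cvg _ (fine (S x) + 1)) => j.
 have tj: (((2 ^+ j * D j x) ^+ 2)%:E <= S x)%E.
  have := @nneseries_lim_ge R (fun j => ((2 ^+ j * D j x) ^+ 2)%:E) xpredT 0 j.+1.
  move=> h; apply: le_trans (h _).
   rewrite big_nat_recr//= leeDr// sume_ge0// => k; by rewrite lee_fin sqr_ge0.
  by move=> k; rewrite lee_fin sqr_ge0.
 have : (2 ^+ j * D j x) ^+ 2 <= fine (S x) by rewrite -lee_fin fineK.
 have e2: 0 < (2 : R) ^+ j by [].
 move=> hS.
 rewrite -(ler_pM2l e2) mulrCA -exprMn (_ : 2 * (1/2) = 1 :> R) ?expr1n ?mulr1; last by field.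
 rewrite -/(D) -{1}(gtr0_norm e2) -normrM; move: (2 ^+ j * _) hS => t ts.
 rewrite ler_norml; nra.
have [N0 [mN0 N00 N0S]] := Sfin.
have {}SA x : ~ N0 x -> cvgn (fun j => u (n j) x) by move=> N0x; apply: SA; apply: contrapT => Sx; exact/N0x/N0S.
pose v j x := u (n j) x * \1_(~` N0) x.
pose f x := limn (fun j => v j x).
have mv j: mfun (v j).
 apply: measurable_funM; first exact: (su (n j)).1.
 by apply: measurable_indic; exact: measurableC.
have vf x: v ^~ x @ \oo --> f x.
 have [N0x|N0x] := pselect (N0 x).
  have v0: v ^~ x = cst 0 by apply/funext => j; rewrite /v indicE memNset ?mulr0//=.
  by rewrite /f v0 lim_cst//; exact: cvg_cst.
 have v0: v ^~ x = fun j => u (n j) x by apply/funext => j; rewrite /v indicE mem_set ?mulr1.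
 by rewrite /f v0; exact: SA.
have mf: mfun f by apply: measurable_fun_cvg => // _.
have K k j: (N j <= k)%N -> sq (fun x => u k x - f x) /\
  ip (fun x => u k x - f x) (fun x => u k x - f x) <= (1/8) ^+ j.
 move=> Nk; apply: (@ae_cvg_ip_le (fun i x => u k x - u (n (i + j)%N) x)).
 - by move=> i; exact: sqB.
 - by apply: measurable_funB => //; exact: (su k).1.
 - exists N0; split => // x nx; apply: contrapT => N0x; apply: nx.
  apply: cvgB; first exact: cvg_cst.
  rewrite (cvg_shiftn j (fun i => u (n i) x)).
  suff -> : (fun i => u (n i) x) = v ^~ x by [].
  by apply/funext => i; rewrite /v indicE mem_set ?mulr1.
 - by move=> i; apply/ltW/NP => //; apply: Nn; rewrite leq_addl.
exists f.
 have [sk _] := K _ _ (leqnn (N 0%N)).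
 by have := sqB (su (N 0%N)) sk; under eq_fun do rewrite subKr.
move=> e e0.
have : geometric 1 (1/8 : R) @ \oo --> 0 by apply: cvg_geometric; rewrite ger0_norm; lra.
move/cvgrPdist_lt => /(_ _ e0)[j _ /(_ j (leqnn _))] /=.
rewrite sub0r normrN mul1r (ger0_norm (ltW (p8 j))).
move=> je; exists (N j) => k Nk; have [_] := K _ _ Nk.
by move=> /le_lt_trans; exact.
Qed.
End completeness.

(** * Lebesgue measure on row vectors *)

Section rV_topology.
Context (R : realType) (n : nat).
Notation E := 'rV[R]_n.
Implicit Types (x y z : E).

Lemma rV_ballP x r y: ball x r y <-> 0 < r /\ forall i, `|x 0 i - y 0 i| < r.
split=> [[r0 h]|[r0 h]]; split => // i; first exact: h.
by rewrite (ord1).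
Qed.
Lemma rV_norm_coord x i: `|x 0 i| <= `|x|.
rewrite [leRHS]/Num.norm /= mx_normrE.
by apply: (le_bigmax _ _ (0, i)).
Qed.
Lemma rV_norm_le x c: 0 <= c -> (forall i, `|x 0 i| <= c) -> `|x| <= c.
move=> c0 xc; rewrite [leLHS]/Num.norm /= mx_normrE.
by apply/bigmax_leP; split => // -[i]; rewrite (ord1).
Qed.
Lemma ballP x r y: ball x r y <-> `|x - y| < r.
by rewrite -ball_normE. Qed.
Lemma ball0P x r: ball 0 r x <-> `|x| < r.
by rewrite -ball_normE /= sub0r normrN. Qed.

Lemma meas_ball x r: measurable (ball x r : set E).
have [r0|r0] := ltP 0 r; last first.
 rewrite (_ : ball x r = set0)//; apply/seteqP; split => y //= /rV_ballP[].
 by lra.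
rewrite (_ : ball x r = \bigcap_(i in [set: 'I_n])
  (fun y : E => y 0 i) @^-1` (ball (x 0 i) r)).
 apply: fin_bigcap_measurable; first exact: finite_finset.
 move=> i _; rewrite -[X in measurable X]setTI.
 by apply: (@measurable_coord) => //; exact: measurable_ball.
apply/seteqP; split => y.
 by move=> /rV_ballP[_ h] i _; exact: h.
by move=> h; apply/rV_ballP; split => // i; exact: h.
Qed.

Lemma rat_approx (x : E) (e : R): 0 < e ->
 exists q : 'rV[rat]_n, ball (map_mx ratr q : E) e x.
move=> e0.
have /choice[q qP] : forall i, exists q : rat, `|x 0 i - ratr q| < e.
 move=> i; have xe: x 0 i - e < x 0 i + e by lra.
 have [q /=] := rat_in_itvoo xe; rewrite in_itv/= => /andP[q1 q2].
 by exists q; rewrite ltr_norml; lra.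
by exists (\row_i q i); apply/rV_ballP; split => // i; rewrite !mxE distrC.
Qed.

Lemma open_bigcup_ball (A : set E): open A ->
 A = \bigcup_(p in [set p : 'rV[rat]_n * nat |
    ball (map_mx ratr p.1 : E) p.2.+1%:R^-1 `<=` A])
   ball (map_mx ratr p.1 : E) p.2.+1%:R^-1.
move=> oA; apply/seteqP; split; last by move=> x [p pA]; exact: pA.
move=> x Ax; have /nbhs_ballP[e /= e0 eA] : nbhs x A by exact: open_nbhs_nbhs.
have e20: 0 < e / 2 by lra.
have [k ke] : exists k : nat, k.+1%:R^-1 < e / 2 by exists (Num.truncn (e / 2)^-1); rewrite invf_plt ?posrE// truncnS_gt.
have k0: 0 < k.+1%:R^-1 :> R by [].
have [q qx] := rat_approx x k0.
exists (q, k) => //= y qy; apply: eA.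
apply: (@le_ball _ _ _ (k.+1%:R^-1 + k.+1%:R^-1)).
 by move: ke; move: (k.+1%:R^-1) => ?; lra.
by apply: ball_triangle qy; exact: ball_sym.
Qed.

Lemma open_meas (A : set E): open A -> measurable A.
move=> /open_bigcup_ball ->; rewrite bigcup_mkcond.
apply: countable_bigcupT_measurable; first exact: countableP.
move=> p; case: ifP => _; [exact: meas_ball|exact: measurable0].
Qed.

Lemma closed_meas (A : set E): closed A -> measurable A.
move=> cA; rewrite -[A]setCK; apply: measurableC; apply: open_meas.
exact: closed_openC.
Qed.

Lemma cts_meas (f : E -> R): continuous f ->
 mfun f.
move=> /continuousP cf; apply: (measurability _ (RGenOpens.measurableE R)).
move=> _ [_ [a [b ->]] <-]; rewrite setTI; apply: open_meas.
by apply: cf.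
Qed.

Lemma measurable_shift (z : E): mfun (fun x : E => x + z).
apply: measurable_fun_rV => i; under eq_fun do rewrite mxE.
by apply: measurable_funD => //; exact: measurable_coord.
Qed.

Lemma bddP (A : set E): bounded_set A <-> exists2 M, 0 < M & A `<=` ball 0 M.
split=> [[M [Mr MA]]|[M M0 AM]].
 exists (`|M| + 2); first by apply: ltr_wpDl.
 move=> x Ax; apply/ball0P.
 apply: le_lt_trans (MA (`|M| + 1) _ _ Ax) _; last by rewrite ltrD2l ltr1n.
 by rewrite (le_lt_trans (ler_norm _))// ltrDl.
exists M; split; first exact: num_real.
move=> t Mt x /AM /ball0P => /ltW xM.
exact: le_trans (ltW Mt).
Qed.

Lemma compact_bounded_ball (A : set E): compact A -> exists2 M, 0 < M & A `<=` ball 0 M.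
by move=> /compact_bounded/bddP. Qed.

End rV_topology.

Section lebesgue_translation.
Context (R : realType).
Local Open Scope ereal_scope.

Lemma lebesgue_measure_translation (c : R) (A : set (measurableTypeR R)) :
 measurable A ->
 pushforward (@lebesgue_measure R) ((fun x => x + c)%R : measurableTypeR R -> measurableTypeR R) A
  = @lebesgue_measure R A.
move=> mA.
have mf: mfun ((fun x => x + c)%R : measurableTypeR R -> measurableTypeR R) by apply: measurable_funD.
apply/esym/lebesgue_measure_unique => //= _ [[a b]] _ <-.
rewrite /pushforward.
rewrite (_ : _ @^-1` _ = `](a - c)%R, (b - c)%R]%classic); last first.
 by apply/seteqP; split => x /=; rewrite !in_itv/= => /andP[? ?]; lra.
rewrite !lebesgue_measure_itv/= !lte_fin ltrD2r; case: ifP => // _.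
by congr EFin; lra.
Qed.

Lemma integral_translation1 (c : R) (f : measurableTypeR R -> \bar R):
 mfun f -> (forall x, 0 <= f x) ->
 \int[@lebesgue_measure R]_x f (x + c)%R = \int[@lebesgue_measure R]_x f x.
move=> mf f0.
have mg: mfun ((fun x => x + c)%R : measurableTypeR R -> measurableTypeR R) by apply: measurable_funD.
pose g := (fun x => x + c)%R : measurableTypeR R -> measurableTypeR R.
transitivity (\int[pushforward (@lebesgue_measure R) g]_x f x).
 by rewrite ge0_integral_pushforward// preimage_setT.
by apply: eq_measure_integral => A mA _; exact: lebesgue_measure_translation.
Qed.

Lemma integral_rVS n (f : 'rV[R]_n.+1 -> \bar R):
 mfun f -> (forall x, 0 <= f x) ->
 \int[lebesgue_rV R n.+1]_x f x =
 \int[@lebesgue_measure R]_t \int[lebesgue_rV R n]_y f (rV_cons (t, y)).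
move=> mf f0; rewrite /= ge0_integral_pushforward//; last exact: measurable_rV_cons.
rewrite (fubini_tonelli1 (f \o @rV_cons R n))//.
 by apply: measurableT_comp => //; exact: measurable_rV_cons.
by move=> x; exact: f0.
Qed.

Lemma rV_consD n (t : R) (y : 'rV[R]_n) (z : 'rV[R]_n.+1):
 (rV_cons (t, y) + z =
 rV_cons (t + z 0 ord0, y + \row_i z 0 (lift ord0 i)))%R.
apply/rowP => i; rewrite mxE; case: (unliftP ord0 i) => [j|] ->.
 by rewrite !rV_consS !mxE.
by rewrite !rV_cons0.
Qed.

Lemma integral_translation n (z : 'rV[R]_n) (f : 'rV[R]_n -> \bar R):
 mfun f -> (forall x, 0 <= f x) ->
 \int[lebesgue_rV R n]_x f (x + z)%R = \int[lebesgue_rV R n]_x f x.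
elim: n z f => [|n ih] z f mf f0.
 by apply: eq_integral => x _; congr f; apply/rowP => -[].
rewrite (@integral_rVS n (fun x => f (x + z)%R))//; last first.
 by apply: measurableT_comp => //; exact: measurable_shift.
apply: (etrans _ (esym (integral_rVS mf f0))).
under eq_integral => t _.
 under eq_integral do rewrite rV_consD.
 rewrite (ih _ (fun y => f (rV_cons ((t + z 0 ord0)%R, y))))//; last first.
  apply: measurableT_comp => //; apply: measurableT_comp; first exact: measurable_rV_cons.
  exact: measurable_pair1.
 over.
rewrite (@integral_translation1 (z 0%R ord0) (fun t => \int[lebesgue_rV R n]_y f (rV_cons (t, y))))//.
 apply: (measurable_fun_fubini_tonelli_F (f \o @rV_cons R n)) => //.
  by apply: measurableT_comp => //; exact: measurable_rV_cons.
 by move=> x; exact: f0.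
by move=> x; apply: integral_ge0.
Qed.

Lemma measure_translation n (z : 'rV[R]_n) (A : set 'rV[R]_n): measurable A ->
 pushforward (lebesgue_rV R n) (fun x => x + z)%R A = lebesgue_rV R n A.
move=> mA.
have mA': measurable ((fun x => x + z)%R @^-1` A) by rewrite -[X in measurable X]setTI; exact: measurable_shift.
have mi: mfun (EFin \o (\1_A : _ -> R)) by apply/measurable_EFinP.
have i0 x: 0 <= (EFin \o (\1_A : _ -> R)) x by rewrite lee_fin.
have := integral_translation z mi i0.
by rewrite !integral_indic// !setIT.
Qed.

Lemma lebesgue_rV_ball n (x : 'rV[R]_n) (r : R): (0 < r)%R ->
 lebesgue_rV R n (ball x r) = ((r *+ 2) ^+ n)%:E.
move=> r0; elim: n x => [|n ih] x.
 rewrite (_ : ball x r = setT) ?expr0//.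
  by rewrite /= diracT.
 by apply/seteqP; split => // y _; apply/rV_ballP; split => // -[].
rewrite /= /lebesgue_rV_step /pushforward.
rewrite (_ : _ @^-1` _ = ball (x 0%R ord0) r `*` ball (\row_i x 0 (lift ord0 i))%R r); last first.
 apply/seteqP; split => -[t y] /=.
  move=> /rV_ballP[_ h]; split; first by have := h ord0; rewrite rV_cons0.
  by apply/rV_ballP; split => // i; have := h (lift ord0 i); rewrite rV_consS mxE.
 move=> [h1 /rV_ballP[_ h]]; apply/rV_ballP; split => // i.
 case: (unliftP ord0 i) => [j|] ->; last by rewrite rV_cons0.
 by rewrite rV_consS; have := h j; rewrite mxE.
rewrite product_measure1E//; [|exact: measurable_ball|exact: meas_ball].
by rewrite ih [X in (X * _)%E](lebesgue_measure_ball _ (ltW r0)) exprS.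
Qed.

End lebesgue_translation.

(** * Dominated convergence and the norm of L2 *)

Lemma continuous_epsP (R : realType) n (f : 'rV[R]_n -> R):
 (forall x e, 0 < e -> exists2 r, 0 < r & forall y, `|x - y| < r -> `|f x - f y| <= e) ->
 continuous f.
move=> H x A /nbhs_ballP[e /= e0 eA]; have e20: 0 < e / 2 by rewrite divr_gt0.
have [r r0 rP] := H x _ e20; apply/nbhs_ballP; exists r => //= y /ballP xy.
apply: eA; apply: le_lt_trans (rP y xy) _.
by lra.
Qed.

Section dominated.
Context d (T : measurableType d) (R : realType) (nu : {measure set T -> \bar R}).

Lemma cvg_eventually (u : nat -> R) (c : R) N: (forall k, (N <= k)%N -> u k = c) -> u @ \oo --> c.
move=> uc; apply/cvgrPdist_le => e e0; exists N => // k /= Nk.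
by rewrite uc// subrr normr0 ltW.
Qed.

Lemma int_dct (f_ : nat -> T -> R) (f h : T -> R):
 (forall k, mfun (f_ k)) -> mfun f -> itg nu h ->
 (forall k x, `|f_ k x| <= h x) -> (forall x, f_ ^~ x @ \oo --> f x) ->
 Rintegral nu setT (f_ k) @[k --> \oo] --> Rintegral nu setT f.
move=> mf_ mf Ih fh ff.
have Ifk k: itg nu (f_ k) by exact: itg_le (fh k) Ih.
have [||||If _ H] := @dominated_convergence _ _ _ nu setT measurableT (fun k => EFin \o f_ k)
 (EFin \o f) (EFin \o h) _ _ _ Ih _.
- by move=> k; exact/measurable_EFinP.
- exact/measurable_EFinP.
- by apply: aeW => x _; apply/cvg_EFin; [exact: nearW|exact: ff].
- by apply: aeW => x k _; exact: fh.
apply: fine_cvg; rewrite fineK; last by rewrite -int_EFin.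
exact: H.
Qed.

Lemma bigcup_int0 (g : T -> R) (F : (set T)^nat) : itg nu g ->
 (forall k, measurable (F k)) -> trivIset setT F ->
 (forall k, Rintegral nu setT (\1_(F k) *' g) = 0) ->
 Rintegral nu setT (\1_(\bigcup_k F k) *' g) = 0.
move=> Ig mF tF F0.
have mg := itg_meas Ig.
have If k: itg nu (\1_(F k) *' g).
 apply: (itg_le (g := fun x => `|g x|)) (itg_abs Ig).
  by apply: measurable_funM => //.
 by move=> x; rewrite normrM ger0_norm// ler_piMl// leq_b1.
pose f_ k x := \sum_(i < k) (\1_(F i) x * g x).
have fE k x: f_ k x = g x * (\sum_(i < k) \1_(F i) x) by rewrite /f_ mulr_sumr; apply: eq_bigr => i; rewrite mulrC.
have Fx j k x: F j x -> \sum_(i < k) \1_(F i) x = (j < k)%:R :> R.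
 move=> Fjx; have E (i : nat) : \1_(F i) x = (i == j)%:R :> R.
  have [->|ij] := eqVneq i j; first by rewrite indicE mem_set.
  rewrite indicE memNset// => Fix_; move/eqP: ij; apply.
  by apply: tF => //; exists x.
 under eq_bigr do rewrite E.
 have [jk|jk] := ltnP j k; last first.
  by rewrite big1// => i; rewrite ltn_eqF// (leq_trans (ltn_ord i)).
 rewrite (bigD1 (Ordinal jk))//= eqxx big1 ?addr0// => i /eqP ij.
 by case: eqP => // h; exfalso; apply: ij; apply/val_inj.
have Fn k x: ~ (\bigcup_k F k) x -> \sum_(i < k) \1_(F i) x = 0 :> R by move=> nx; rewrite big1// => i; rewrite indicE memNset// => h; apply: nx; exists i.
have H := @int_dct f_ (\1_(\bigcup_k F k) *' g) (fun x => `|g x|).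
have : (fun k => Rintegral nu setT (f_ k)) @ \oo --> 0.
 rewrite (_ : (fun k => _) = cst 0); first exact: cvg_cst.
 by apply/funext => k; rewrite /f_ int_sum// big1.
move=> /(@cvg_lim); rewrite -(cvg_lim _ (H _ _ _ _ _))//; last first.
- move=> x; have [[j _ Fj]|nx] := pselect ((\bigcup_k F k) x).
  rewrite indicE mem_set; last by exists j.
  by rewrite mul1r; apply: (@cvg_eventually _ _ j.+1) => k jk; rewrite fE (Fx j)// jk mulr1.
 rewrite indicE memNset// mul0r; apply: (@cvg_eventually _ _ 0%N) => k _.
 by rewrite fE Fn// mulr0.
- move=> k x; rewrite fE normrM ler_piMr//.
 have [[j _ Fj]|nx] := pselect ((\bigcup_k F k) x).
  by rewrite (Fx j)// ger0_norm// lern1 leq_b1.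
 by rewrite Fn// normr0.
- exact: itg_abs.
- apply: measurable_funM => //; apply: measurable_indic.
 exact: bigcup_measurable.
- by move=> k; apply: (itg_meas (mu := nu)); apply: itg_sum.
by apply.
Qed.

(** A signed density whose integrals vanish on a generating family stable by
  intersection vanishes almost everywhere. *)
Lemma pi_system_ae0 (G : set (set T)) (g : T -> R) : @measurable _ T = <<s G >> ->
 setI_closed G -> G setT -> itg nu g ->
 (forall A, G A -> Rintegral nu setT (\1_A *' g) = 0) ->
 ae_eq nu setT g (cst 0).
move=> mG GI GT Ig G0; have mg := itg_meas Ig.
have If A: measurable A -> itg nu (\1_A *' g).
 move=> mA; apply: (itg_le (g := fun x => `|g x|)) (itg_abs Ig).
  by apply: measurable_funM => //.
 by move=> x; rewrite normrM ger0_norm// ler_piMl// leq_b1.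
have H A: measurable A -> Rintegral nu setT (\1_A *' g) = 0.
 move=> mA; apply: (dynkin_induction (P := fun A => Rintegral nu setT (\1_A *' g) = 0) mG) => //.
 - exact: G0.
 - move=> S mS S0; rewrite (@eq_int _ _ _ _ _ (fun x => \1_setT x * g x - \1_S x * g x)).
   by rewrite intB ?S0 ?G0 ?subr0//; exact: If.
  by move=> x; rewrite !indicE in_setC in_setT; case: (x \in S) => /=; ring.
 - by move=> F0; exact: bigcup_int0.
 - by rewrite -mG.
pose A := [set x | 0 <= g x].
have mA: measurable A.
 by have := mg measurableT _ (measurable_itv `[0, +oo[); rewrite setTI; congr measurable;
  apply/seteqP; split => x /=; rewrite in_itv/= andbT.
have mA': measurable (~` A) by exact: measurableC.
have z1: ae_eq nu setT (\1_A *' g) (cst 0).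
 apply: int_eq0_ae; [exact: If| |exact: H].
 move=> x; rewrite indicE; have [xA|xA] := boolP (x \in A); last by rewrite mul0r.
 by rewrite mul1r; rewrite inE in xA.
have z2: ae_eq nu setT (fun x => - (\1_(~` A) x * g x)) (cst 0).
 apply: int_eq0_ae; [exact/itgN/If| |by rewrite intN ?H ?oppr0//; exact: If].
 move=> x; rewrite indicE; have [xA|xA] := boolP (x \in ~` A); last by rewrite mul0r oppr0.
 by rewrite mul1r oppr_ge0; rewrite inE/= /A/= in xA; move/negP: xA; rewrite -ltNge => /ltW.
apply: filterS2 z1 z2 => x /(_ I) h1 /(_ I) h2 _.
move/eqP: h2; rewrite oppr_eq0 => /eqP h2.
move: h1 h2; rewrite !indicE in_setC; case: (x \in A) => /=; rewrite !mul1r//.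
Qed.
End dominated.

Section l2norm.
Context d (T : measurableType d) (R : realType) (mu : {measure set T -> \bar R}).
Implicit Types f g : T -> R.
Local Notation ip := (ip mu).
Local Notation sq := (sq mu).

Definition L2norm f := Num.sqrt (ip f f).
Local Notation nm := L2norm.

Lemma nm_ge0 f: 0 <= nm f. Proof. exact: sqrtr_ge0. Qed.
Lemma nm_sq f: nm f ^+ 2 = ip f f. Proof. by rewrite sqr_sqrtr// ip_ge0. Qed.
Lemma nm_CS f g: sq f -> sq g -> `|ip f g| <= nm f * nm g.
move=> sf sg; rewrite -(@ler_pXn2r _ 2) ?nnegrE ?mulr_ge0 ?nm_ge0//.
by rewrite real_normK ?num_real// exprMn !nm_sq; exact: CS.
Qed.
Lemma nm_le f c: 0 <= c -> ip f f <= c ^+ 2 -> nm f <= c.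
by move=> c0; rewrite -nm_sq ler_pXn2r// nnegrE nm_ge0. Qed.
Lemma nmD f g: sq f -> sq g -> nm (f +' g) <= nm f + nm g.
move=> sf sg; apply: nm_le; first by rewrite addr_ge0 ?nm_ge0.
rewrite ipDl//; last exact: sqD.
rewrite [ip f _]ipC [ip g _]ipC !ipDl//.
rewrite (ipC) sqrrD !nm_sq; have := nm_CS sf sg.
rewrite ler_norml => /andP[_]; lra.
Qed.
Lemma nmZ a f: sq f -> nm (fun x => a * f x) = `|a| * nm f.
move=> sf; rewrite /L2norm ipZl//; last exact: sqZ.
by rewrite ipC ipZl// mulrA sqrtrM ?sqr_ge0// sqrtr_sqr.
Qed.
Lemma nmN f: nm (fun x => - f x) = nm f.
by congr Num.sqrt; apply: eq_int => x; rewrite mulrNN. Qed.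
Lemma nmBC f g: nm (f -' g) = nm (g -' f).
by rewrite -nmN; congr nm; apply/funext => x; rewrite opprB. Qed.
Lemma nmB f g: sq f -> sq g -> nm (f -' g) <= nm f + nm g.
by move=> sf sg; rewrite -(nmN g); apply: nmD => //; exact: sqN. Qed.
Lemma nm_tri f g h: sq f -> sq g -> sq h ->
 nm (f -' h) <= nm (f -' g) + nm (g -' h).
move=> sf sg sh; have := nmD (sqB sf sg) (sqB sg sh); congr (_ <= _).
by congr nm; apply/funext => x; rewrite subrKA.
Qed.
Lemma nm_ae0 f: sq f -> nm f = 0 -> ae_eq mu setT f (cst 0).
by move=> sf f0; apply: ip_ae0 => //; rewrite -nm_sq f0 expr0n. Qed.
Lemma nm_ae f g: mfun f -> mfun g -> ae_eq mu setT f g ->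
 nm f = nm g.
move=> mf mg fg; congr Num.sqrt; apply: int_ae; [exact: measurable_funM|exact: measurable_funM|].
by apply: filterS fg => x + xT => /(_ xT) ->.
Qed.
Lemma nm_abs_le f g: mfun f -> sq g -> (forall x, `|f x| <= `|g x|) -> nm f <= nm g.
move=> mf sg fg; have sf := sq_le mf sg fg; apply: nm_le; first exact: nm_ge0.
rewrite nm_sq; apply: int_le; [exact: sqM|exact: sqM|].
by move=> x; rewrite -!expr2 -real_normK ?num_real// -[leRHS]real_normK ?num_real// lerXn2r ?nnegrE.
Qed.
Lemma nm_mul_le f g (c : R): sq f -> mfun g -> (forall x, `|g x| <= c) ->
 sq (f *' g) /\ nm (f *' g) <= c * nm f.
move=> sf mg gc; have mf := sf.1.
have [t|c0] := ltP c 0.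
 have nT: forall x : T, False by move=> x; have := le_trans (normr_ge0 _) (gc x); lra.
 have E (u : T -> R) : nm u = 0 by rewrite /L2norm ipE int_eq0 ?sqrtr0// => x.
 split; last by rewrite !E mulr0.
 by apply: (sq_le (g := f)) => [||x]; [exact: measurable_funM| |case: (nT)].
have H x: `|f x * g x| <= `|c * f x| by rewrite !normrM mulrC ler_wpM2r// (ger0_norm c0).
have mm: mfun (f *' g) by exact: measurable_funM.
split; first exact: sq_le (sqZ c sf) H.
by rewrite -[X in X * _](ger0_norm c0) -nmZ//; exact: nm_abs_le (sqZ c sf) H.
Qed.
Lemma ipDr f g h: sq f -> sq g -> sq h -> ip h (f +' g) = ip h f + ip h g.
by move=> sf sg sh; rewrite ipC ipDl// (ipC) (ipC mu g). Qed.
Lemma ipBr f g h: sq f -> sq g -> sq h -> ip h (f -' g) = ip h f - ip h g.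
by move=> sf sg sh; rewrite ipC ipBl// (ipC) (ipC mu g). Qed.
Lemma ipZr a f h: sq f -> sq h -> ip h (fun x => a * f x) = a * ip h f.
by move=> sf sh; rewrite ipC ipZl// (ipC). Qed.
Lemma ip_sumr (I : Type) (r : seq I) (F : I -> T -> R) h: (forall i, sq (F i)) -> sq h ->
 ip h (fun x => \sum_(i <- r) F i x) = \sum_(i <- r) ip h (F i).
by move=> sF sh; rewrite ipC ip_sql//; apply: eq_bigr => i; rewrite ipC. Qed.
End l2norm.

Lemma partialE (R : realType) (n : nat) (i : 'I_n) (f : 'rV[R]_n -> R) x d:
 is_derive x (delta_mx 0 i) f d -> 'd_i f x = d.
by move=> [_]. Qed.

(** * Connectedness and limits in L2 *)

Section connected.
Context (R : realType).

Lemma connected_lc (T : pseudoMetricType R) (V : Type) (A : set T) (c : T -> V): connected A ->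
 (forall x, A x -> exists2 r : R, 0 < r & forall y, A y -> ball x r y -> c y = c x) ->
 forall x y, A x -> A y -> c y = c x.
move=> cA H x y Ax Ay.
have H' z: exists r : R, A z -> 0 < r /\ forall y, A y -> ball z r y -> c y = c z by have [/H[r]|n] := pselect (A z); [exists r|exists 0].
have [r rP] := choice H'.
pose B := A `&` [set z | c z = c x].
have U (Q : set T) : Q `<=` A -> open (\bigcup_(z in Q) (ball z (r z))°) by move=> _; apply: bigcup_open => z _; exact: open_interior.
have int z: A z -> (ball z (r z))° z by move=> Az; apply: nbhsx_ballx; exact: (rP z Az).1.
have BA: B = A; last by move: Ay; rewrite -BA => -[].
apply: cA; first by exists x.
- exists (\bigcup_(z in B) (ball z (r z))°); first by apply: U => z [].
 apply/seteqP; split => z; first by move=> Bz; split; [exact: Bz.1|exists z => //; exact/int/Bz.1].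
 move=> [Az [w [Aw cw] /interior_subset zw]]; split => //=.
 by rewrite ((rP w Aw).2).
- exists (~` \bigcup_(z in A `\` B) (ball z (r z))°).
  by apply: open_closedC; apply: U => [].
 apply/seteqP; split => z.
  move=> [Az cz]; split => // -[w [Aw nB] /interior_subset zw]; apply: nB; split => //=.
  by rewrite -((rP w Aw).2 z).
 move=> [Az nz]; apply: contrapT => nB; apply: nz; exists z; [by split|exact: int].
Qed.

End connected.

Section l2limits.
Context d (T : measurableType d) (R : realType) (mu : {measure set T -> \bar R}).
Implicit Types (f g : T -> R) (u v : nat -> T -> R).
Local Notation ip := (ip mu).
Local Notation sq := (sq mu).
Local Notation nm := (L2norm mu).

Definition cau u := forall e, 0 < e -> exists K, forall k l, (K <= k)%N -> (K <= l)%N ->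
 nm (fun x => u k x - u l x) <= e.
Definition tends u f := forall e, 0 < e -> exists K, forall k, (K <= k)%N ->
 nm (fun x => u k x - f x) <= e.

Lemma cau_limit u (B : set T): measurable B -> (forall k, sq (u k)) -> cau u ->
 (forall k x, ~ B x -> u k x = 0) -> exists f, [/\ sq f, (forall x, ~ B x -> f x = 0) & tends u f].
move=> mB su cu uB.
have [|f sf uf] := L2_complete su.
 move=> e e0; have s0: 0 < Num.sqrt e / 2 by rewrite divr_gt0// sqrtr_gt0.
 have [K KP] := cu _ s0; exists K => i j Ki Kj; rewrite /dist2 -nm_sq.
 have h := KP i j Ki Kj; rewrite -[ltRHS](sqr_sqrtr (ltW e0)) ltr_pXn2r ?nnegrE ?nm_ge0 ?sqrtr_ge0//.
 by lra.
have bI x: `|\1_B x| <= 1 :> R by rewrite ger0_norm// leq_b1.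
have mI: mfun (\1_B : T -> R) by [].
have [s1 _] := nm_mul_le sf mI bI.
exists (f *' \1_B); split => //.
 by move=> x nx; rewrite indicE memNset// mulr0.
move=> e e0; have e20: 0 < e ^+ 2 by rewrite exprn_gt0.
have [K KP] := uf _ e20; exists K => k Kk.
apply: (@le_trans _ _ (nm (fun x => u k x - f x))).
 apply: nm_abs_le; [exact: (sqB (su k) s1).1|exact: sqB|].
 move=> x; have [Bx|nx] := pselect (B x); first by rewrite indicE mem_set// mulr1.
 by rewrite uB// indicE memNset// mulr0 subrr normr0.
apply: nm_le; first exact: ltW.
exact/ltW/KP.
Qed.

Lemma tends_ip u f g: (forall k, sq (u k)) -> sq f -> sq g -> tends u f ->
 ip (u k) g @[k --> \oo] --> ip f g.
move=> su sf sg uf; apply/cvgrPdist_le => e e0.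
have c0: 0 < nm g + 1 by rewrite ltr_wpDl// nm_ge0.
have [K KP] := uf _ (divr_gt0 e0 c0); exists K => // k /= Kk.
rewrite distrC -ipBl//; apply: le_trans (nm_CS (sqB (su k) sf) sg) _.
apply: (@le_trans _ _ (e / (nm g + 1) * (nm g + 1))); last by rewrite divfK// gt_eqF.
by apply: ler_pM; rewrite ?nm_ge0 ?lerDl//; exact: KP.
Qed.

Lemma tendsD u f v g: (forall k, sq (u k)) -> sq f -> (forall k, sq (v k)) -> sq g ->
 tends u f -> tends v g -> tends (fun k x => u k x + v k x) (f +' g).
move=> su sf sv sg uf vg e e0; have e20: 0 < e / 2 by rewrite divr_gt0.
have [K KP] := uf _ e20; have [L LP] := vg _ e20; exists (maxn K L) => k; rewrite geq_max => /andP[k1 k2].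
have ->: (fun x => u k x + v k x - (f x + g x)) = fun x => (u k x - f x) + (v k x - g x) by apply/funext => x; ring.
apply: le_trans (nmD (sqB (su k) sf) (sqB (sv k) sg)) _.
by rewrite [leRHS]splitr; apply: lerD; [exact: KP|exact: LP].
Qed.

Lemma tends0: tends (fun _ _ => 0) (fun=> 0).
move=> e e0; exists 0%N => k; rewrite /L2norm ipE int_eq0 ?sqrtr0 ?ltW// => x.
by lra.
Qed.

Lemma tends_sum (I : Type) (s : seq I) (U : I -> nat -> T -> R) (F : I -> T -> R):
 (forall i k, sq (U i k)) -> (forall i, sq (F i)) -> (forall i, tends (U i) (F i)) ->
 tends (fun k x => \sum_(i <- s) U i k x) (fun x => \sum_(i <- s) F i x).
move=> sU sF UF; elim: s => [|a s ih].
 have ->: (fun k x => \sum_(i <- [::]) U i k x) = fun _ _ => 0 by apply/funext => k; apply/funext => x; rewrite big_nil.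
 have ->: (fun x => \sum_(i <- [::]) F i x) = fun=> 0 by apply/funext => x; rewrite big_nil.
 exact: tends0.
have := tendsD (sU a) (sF a) (fun k => sq_sum s (fun i => sU i k)) (sq_sum s sF) (UF a) ih.
move=> H.
have ->: (fun k x => \sum_(i <- a :: s) U i k x) = fun k x => U a k x + \sum_(i <- s) U i k x by apply/funext => k; apply/funext => x; rewrite big_cons.
have ->: (fun x => \sum_(i <- a :: s) F i x) = fun x => F a x + \sum_(i <- s) F i x by apply/funext => x; rewrite big_cons.
exact: H.
Qed.
Lemma cvg_fsum (I : Type) (s : seq I) (F : I -> nat -> R) (l : I -> R):
 (forall i, F i @ \oo --> l i) -> (\sum_(i <- s) F i k) @[k --> \oo] --> \sum_(i <- s) l i.
move=> Fl; elim: s => [|a s ih].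
 by under eq_fun do rewrite big_nil; rewrite big_nil; exact: cvg_cst.
by under eq_fun do rewrite big_cons; rewrite big_cons; exact: cvgD.
Qed.

Lemma riesz_small (e : R): 0 < e -> exists K, forall k, (K <= k)%N -> 2 / k.+1%:R <= e / 2.
move=> e0; exists (Num.truncn (4 / e)) => k Nk; have h := truncnS_gt (4 / e).
have h2: (Num.truncn (4 / e)).+1%:R <= k.+1%:R :> R by rewrite ler_nat ltnS.
have := lt_le_trans h h2; rewrite ltr_pdivrMr// ler_pdivrMr// => h3.
by lra.
Qed.

Lemma riesz_cvg (u : nat -> R) (l c : R): 0 <= c -> (forall k, (u k - l) ^+ 2 <= c / k.+1%:R) ->
 u @ \oo --> l.
move=> c0 H; apply/cvgrPdist_le => e e0; have e20: 0 < e ^+ 2 by rewrite exprn_gt0.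
exists (Num.truncn (c / e ^+ 2)) => // k /= Kk.
have h1 := truncnS_gt (c / e ^+ 2).
have h2: (Num.truncn (c / e ^+ 2)).+1%:R <= k.+1%:R :> R by rewrite ler_nat ltnS.
have := lt_le_trans h1 h2; rewrite ltr_pdivrMr// => h3.
rewrite distrC -(@ler_pXn2r _ 2) ?nnegrE ?(ltW e0)// real_normK ?num_real//.
by apply: le_trans (H k) _; rewrite ler_pdivrMr// mulrC; exact: ltW.
Qed.
Lemma N1D f g: (fun x => -1 * f x + g x) = fun x => g x - f x.
by apply/funext => x; rewrite mulN1r addrC. Qed.

Lemma tends_cau u f: (forall k, sq (u k)) -> sq f -> tends u f -> cau u.
move=> su sf uf e e0; have [K KP] := uf _ (divr_gt0 e0 (ltr0n R 2)); exists K => k l Kk Kl.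
apply: le_trans (nm_tri (su k) sf (su l)) _; rewrite [leRHS]splitr [X in _ + X <= _]nmBC.
by apply: lerD; exact: KP.
Qed.

(** Riesz representation for the form sum_i <D_i p, D_i q>. The space S need not be complete: the
 minimizing sequence s only gives limits w_i of the D_i (s k), which is all that the
 representation needs. *)
Lemma riesz_fields (V : Type) (lc : R -> V -> V -> V) (S : set V) (v0 : V) (I : finType)
  (D : I -> V -> T -> R) (l : V -> R) (C : R) (B : set T) : measurable B -> S v0 ->
 (forall a p q, S p -> S q -> S (lc a p q)) -> (forall i p, S p -> sq (D i p)) ->
 (forall i p x, S p -> ~ B x -> D i p x = 0) ->
 (forall i a p q, S p -> S q -> D i (lc a p q) = fun x => a * D i p x + D i q x) ->
 (forall a p q, S p -> S q -> l (lc a p q) = a * l p + l q) ->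
 0 <= C -> (forall p, S p -> `|l p| <= C * \sum_i nm (D i p)) ->
 exists (s : nat -> V) (w : I -> T -> R), [/\ forall k, S (s k), forall i, sq (w i),
  forall i x, ~ B x -> w i x = 0, forall i, tends (fun k => D i (s k)) (w i) &
  forall p, S p -> l p = \sum_i ip (w i) (D i p)].
move=> mB S0 Slc sD D0 Dlc llc C0 lb; pose b p q := \sum_i ip (D i p) (D i q).
have b0 p: 0 <= b p p by apply: sumr_ge0 => i _; exact: ip_ge0.
have bi i p: ip (D i p) (D i p) <= b p p by rewrite /b (bigD1 i)//= lerDl sumr_ge0// => j _; exact: ip_ge0.
pose K := C * #|I|%:R.
have lb2 p: S p -> l p ^+ 2 <= (K ^+ 2 + 1) * b p p.
 move=> Sp; have h: `|l p| <= K * Num.sqrt (b p p).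
  apply: le_trans (lb p Sp) _; rewrite -mulrA ler_wpM2l// mulr_natl -sumr_const.
  by apply: ler_sum => i _; apply: nm_le; rewrite ?sqrtr_ge0// sqr_sqrtr.
 rewrite mulrDl mul1r -[l p ^+ 2]real_normK ?num_real//; apply: ler_wpDr => //.
 rewrite -[b p p]sqr_sqrtr// -exprMn ler_pXn2r//; exact: le_trans h.
have [|||v [cv vc vl]] := @riesz_cauchy R V lc S b l (K ^+ 2 + 1) v0 S0 _ Slc _ _ (fun p _ => b0 p) llc lb2.
- by rewrite ltr_wpDl ?sqr_ge0.
- by move=> p q; apply: eq_bigr => i _; exact: ipC.
- move=> a p q t Sp Sq St; rewrite /b mulr_sumr -big_split/=; apply: eq_bigr => i _.
 by rewrite Dlc// ipDl ?ipZl//; do ?[exact: sD|exact: sqZ (sD _ _ _)].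
have lim i: exists f, [/\ sq f, forall x, ~ B x -> f x = 0 & tends (fun k => D i (v k)) f].
 apply: (cau_limit mB (fun k => sD i _ (cv k))); last by move=> k x; exact: D0.
 move=> e e0; have [N H] := riesz_small (exprn_gt0 2 e0); exists N => k j Nk Nj.
 rewrite (_ : (fun => _) = D i (lc (-1) (v j) (v k))); last first.
  by rewrite Dlc// N1D.
 apply: nm_le; first exact: ltW.
 by apply: le_trans (bi i _) (le_trans (vc k j) _); rewrite [leRHS]splitr; apply: lerD; exact: H.
have [w wP] := choice lim; have sw i: sq (w i) by have [] := wP i.
exists v, w; split=> [//|//|i|i|p Sp]; do ?[by have [] := wP i].
have t: (fun k => b (v k) p) @ \oo --> \sum_i ip (w i) (D i p).
 apply: cvg_fsum => i; have [_ _ t] := wP i.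
 exact: tends_ip (fun k => sD i _ (cv k)) (sw i) (sD i p Sp) t.
exact: (cvg_unique _ (riesz_cvg (b0 p) (fun k => vl k p Sp))).
Qed.
End l2limits.

Lemma is_derive_int (R : realType) d (Y : measurableType d) (nu : {measure set Y -> \bar R})
  (g dg : R -> Y -> R) (G : Y -> R) (a u v : R) : u < a < v ->
 (forall t, itg nu (g t)) -> (forall (t : R) y, is_derive t 1 (g ^~ y) (dg t y)) ->
 itg nu G -> (forall y, 0 <= G y) -> (forall (t : R) y, u < t < v -> `|dg t y| <= G y) ->
 is_derive a 1 (fun t => Rintegral nu setT (g t)) (Rintegral nu setT (dg a)).
move=> uav Ig dgP IG G0 dgG.
have dE t y: partial1of2 g t y = dg t y by rewrite partial1of2E; have [_ ->] := dgP t y.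
have aI: `]u, v[%classic a by [].
have H := @cvg_differentiation_under_integral R d Y nu g setT measurableT a u v aI
 (fun t _ => Ig t) (fun t y _ _ => let: conj_of := dgP t y in @ex_derive _ _ _ _ _ _ _ conj_of) G G0 IG
 ltac:(by move=> t y /= It _; rewrite dE; apply: dgG; move: It; rewrite in_itv/=).
have E1: Rintegral nu setT (partial1of2 g a) = Rintegral nu setT (dg a) by apply: eq_int => y.
rewrite E1 in H.
have H1: (h^-1 *: (Rintegral nu setT (g (h *: 1 + a)) - Rintegral nu setT (g a))) @[h --> 0^'] --> Rintegral nu setT (dg a) by under eq_fun do rewrite [_ *: 1]mulr1.
split; first by apply/cvg_ex; exists (Rintegral nu setT (dg a)).
exact/cvg_lim.
Qed.

(** * Potentials on simply connected sets *)

Lemma within_comp (X Y Z : topologicalType) (A : set Y) (f : Y -> Z) (p : X -> Y):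
 {within A, continuous f} -> continuous p -> (forall x, A (p x)) -> continuous (f \o p).
move=> /subspace_continuousP cf cp Ap x B Bx.
have /= H : within A (nbhs (p x)) (f @^-1` B) by exact: (cf _ (Ap x)).
have h: nbhs x (p @^-1` [set y | A y -> B (f y)]) := cp x _ H.
apply: filterS h => y hy; apply: hy; exact: Ap.
Qed.

Lemma lebesgue_number (R : realType) (X Y : pseudoMetricType R) (K : set X) (Om : set Y) (G : X -> Y):
 compact K -> open Om -> continuous G -> (forall p, K p -> Om (G p)) ->
 exists2 d : R, 0 < d & forall p, K p -> exists c (r : R),
  [/\ 0 < r, ball c r `<=` Om & forall q, ball p d q -> ball c r (G q)].
move=> /compact_near_coveringP cK oO cG KO.
pose P d p := exists c (r : R), [/\ 0 < r, ball c r `<=` Om & forall q, ball p d q -> ball c r (G q)].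
have H: forall p, K p -> \forall p' \near p & d \near 0^'+, P d p'.
 move=> p Kp; have /nbhs_ballP[r r0 rO] : nbhs (G p) Om.
  by apply: open_nbhs_nbhs; split => //; exact: KO.
 have /nbhs_ballP[e /= e0 eP] : nbhs p (G @^-1` ball (G p) r) by apply: cG; exact: nbhsx_ballx.
 have e20: 0 < e / 2 by lra.
 exists (ball p (e / 2), [set d | d <= e / 2]).
  split; first exact: nbhsx_ballx.
  by near=> d => /=; near: d; exact: nbhs_right_le.
 move=> [q d] /= [pq de]; exists (G p), r; split => // w qw.
 by apply: eP; rewrite (splitr e); apply: ball_triangle pq _; exact: le_ball qw.
have [d [d0 dP]] : exists d : R, 0 < d /\ K `<=` P d.
 have H2 := cK _ _ P _ H.
 have : \forall d \near (0:R)^'+, 0 < d /\ K `<=` P d by apply: filterI; [exact: nbhs_right_gt|exact: H2].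
 exact: filter_ex.
by exists d.
Unshelve. all: by end_near. Qed.

Definition path_additive (R : realType) (V : normedModType R) (Om : set V) (I : V -> V -> R) :=
 forall c (r : R), 0 < r -> ball c r `<=` Om ->
 forall a b d, ball c r a -> ball c r b -> ball c r d -> I a b + I b d = I a d.
Definition has_potentials (R : realType) (V : normedModType R) (Om : set V) := forall I, path_additive Om I ->
 exists p : V -> R, forall c (r : R), 0 < r -> ball c r `<=` Om ->
 forall a b, ball c r a -> ball c r b -> p b = p a + I a b.

Lemma ball_segment (R : realType) (V : normedModType R) (c a b : V) (r t : R):
 ball c r a -> ball c r b -> 0 <= t <= 1 -> ball c r (a + t *: (b - a)).
rewrite -!ball_normE/= => ca cb /andP[t0 t1].
have ->: a + t *: (b - a) = (1 - t) *: a + t *: b by rewrite scalerBr scalerBl scale1r [t *: b - _]addrC addrA.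
have ->: c - ((1 - t) *: a + t *: b) = (1 - t) *: (c - a) + t *: (c - b).
 by rewrite !scalerBr addrACA -scalerDl subrK scale1r opprD.
apply: le_lt_trans (ler_normD _ _) _; rewrite !normrZ !ger0_norm ?subr_ge0//.
move: ca cb; move: `|c - a| `|c - b| => p q pr qr.
have [->|sn] := eqVneq t 0; first by rewrite subr0 mul1r mul0r addr0.
have sp: 0 < t by lra.
by nra.
Qed.

Section discrete_integral.
Context (R : realType) (V : normedModType R) (Om : set V) (I : V -> V -> R) (oO : open Om).
Context (HI : path_additive Om I).

Definition path_sum (x : nat -> V) N := \sum_(j < N) I (x j) (x j.+1).
Definition sample (g : R -> V) N (j : nat) := g (j%:R / N%:R).
Lemma path_sum_split x a b: path_sum x (a + b) = path_sum x a + path_sum (fun k => x (a + k)%N) b.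
by rewrite /path_sum big_split_ord/=; congr (_ + _); apply: eq_bigr => i; rewrite addnS. Qed.
Lemma I0 c r a: 0 < r -> ball c r `<=` Om -> ball c r a -> I a a = 0.
move=> r0 cO ca; apply: (addrI (I a a)); rewrite addr0; exact: (HI r0 cO).
Qed.
Lemma I_sym c r a b: 0 < r -> ball c r `<=` Om -> ball c r a -> ball c r b -> I b a = - I a b.
move=> r0 cO ca cb; apply/eqP; rewrite -addr_eq0; apply/eqP.
by rewrite (HI r0 cO cb ca cb) (I0 r0 cO).
Qed.

Lemma path_sum_ball x c r N: 0 < r -> ball c r `<=` Om ->
 (forall j, (j <= N)%N -> ball c r (x j)) -> path_sum x N = I (x 0%N) (x N).
move=> r0 cO; elim: N => [|N ih] xB.
 by rewrite /path_sum big_ord0 (I0 r0 cO (xB 0%N _)).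
rewrite /path_sum big_ord_recr/= -/(path_sum x N) ih; last by move=> j jN; apply: xB; exact: leqW.
by apply: (HI r0 cO); apply: xB.
Qed.

Definition in_path (g : R -> V) := continuous g /\ forall t, Om (g t).

(* all samplings that are fine enough give the same sum c *)
Definition path_val g (c : R) := exists K, forall N, (K <= N)%N -> (0 < N)%N -> path_sum (sample g N) N = c.

Lemma inv_small (d : R): 0 < d -> exists K, forall N, (K <= N)%N -> (0 < N)%N -> N%:R^-1 < d.
move=> d0; exists (Num.truncn d^-1).+1 => N KN N0; rewrite -[d]invrK ltf_pV2 ?posrE ?invr_gt0 ?ltr0n//.
by apply: lt_le_trans (truncnS_gt _) _; rewrite ler_nat.
Qed.
Lemma sample01 N j: (j <= N)%N -> `[0, 1]%classic (j%:R / N%:R : R).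
move=> jN; rewrite /= in_itv/= divr_ge0//=; have [->|N0] := posnP N; first by rewrite invr0 mulr0.
by rewrite ler_pdivrMr ?ltr0n// mul1r ler_nat.
Qed.

Lemma path_fine g: in_path g -> exists K, forall N, (K <= N)%N -> (0 < N)%N ->
 forall t, `[0, 1]%classic t -> exists c r, [/\ 0 < r, ball c r `<=` Om &
  forall u, `|t - u| <= N%:R^-1 -> ball c r (g u)].
move=> [cg gO]; have [d d0 dP] := lebesgue_number (@segment_compact R 0 1) oO cg (fun t _ => gO t).
have [K KP] := inv_small d0; exists K => N KN N0 t t01; have [c [r [r0 cO cB]]] := dP t t01.
by exists c, r; split => // u tu; apply: cB; apply: le_lt_trans tu _; exact: KP.
Qed.

Lemma path_sum_refine g N M: (0 < N)%N -> (0 < M)%N ->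
 (forall t, `[0, 1]%classic t -> exists c r, [/\ 0 < r, ball c r `<=` Om &
  forall u, `|t - u| <= N%:R^-1 -> ball c r (g u)]) ->
 path_sum (sample g (N * M)) (N * M) = path_sum (sample g N) N.
move=> N0 M0 fine; have NR: N%:R != 0 :> R by rewrite pnatr_eq0 -lt0n.
have MR: M%:R != 0 :> R by rewrite pnatr_eq0 -lt0n.
have H i: (i <= N)%N -> path_sum (sample g (N * M)) (i * M) = path_sum (sample g N) i.
 elim: i => [_|i ih iN]; first by rewrite /path_sum !big_ord0.
 rewrite mulSn addnC path_sum_split (ih (ltnW iN)) [in RHS]/path_sum big_ord_recr/= -/(path_sum); congr (_ + _).
 have [c [r [r0 cO cB]]] := fine _ (sample01 (ltnW iN)).
 have sE k: sample g (N * M) (i * M + k) = g (i%:R / N%:R + k%:R / M%:R / N%:R) by congr g; field; rewrite NR.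
 rewrite (path_sum_ball r0 cO) => [|j jM].
  by rewrite !sE mul0r mul0r addr0 divff// -mulrDl natr1.
 rewrite sE; apply: cB; rewrite opprD addrA subrr sub0r normrN normrM [`|N%:R^-1|]ger0_norm//.
 rewrite -[leRHS]mul1r ler_wpM2r// ger0_norm ?divr_ge0// ler_pdivrMr ?ltr0n// mul1r ler_nat //.
by rewrite H.
Qed.

Lemma path_val_exists g: in_path g -> exists c, path_val g c.
move=> /path_fine[K KP]; exists (path_sum (sample g K.+1) K.+1), K => N KN N0.
rewrite -(path_sum_refine (M := N) _ N0 (KP K.+1 (leqnSn _) _))// mulnC.
by rewrite (path_sum_refine N0 _ (KP N KN N0)).
Qed.

Definition clamp (t : R) : R := Num.min (Num.max t 0) 1.
Lemma clamp_continuous: continuous clamp.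
move=> t; apply: (@continuous_min _ _ (fun t : R => Num.max t 0) (fun=> 1)); last exact: cst_continuous.
by apply: (@continuous_max _ _ (fun t : R => t) (fun=> 0)); [exact: cvg_id|exact: cst_continuous].
Qed.
Lemma clamp01 t: `[0, 1]%classic (clamp t).
by rewrite /= in_itv/= le_min ler01 le_max lexx orbT/= ge_min lexx orbT. Qed.
Lemma clampE t: `[0, 1]%classic t -> clamp t = t.
by rewrite /clamp => /andP[t0 t1]; rewrite max_l// min_l. Qed.
Lemma clamp_le0 t: t <= 0 -> clamp t = 0.
by move=> t0; rewrite /clamp max_r// min_l. Qed.
Lemma clamp_ge1 t: 1 <= t -> clamp t = 1.
by move=> t1; rewrite /clamp min_r// le_max t1. Qed.

(* the sum of two continuous terms, one of which is constant on each half *)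
Definition path_cat (a b : R -> V) t := a (clamp (2 * t)) + b (clamp (2 * t - 1)) - b 0.

Lemma path_catl a b t: t <= 2^-1 -> path_cat a b t = a (clamp (2 * t)).
by move=> t2; rewrite /path_cat (@clamp_le0 (2 * t - 1)) ?addrK//; lra. Qed.
Lemma path_catr a b t: a 1 = b 0 -> 2^-1 <= t -> path_cat a b t = b (clamp (2 * t - 1)).
by move=> ab t2; rewrite /path_cat (@clamp_ge1 (2 * t)) ?ab ?[b 0 + _]addrC ?addrK//; lra. Qed.

Lemma path_cat_in a b: in_path a -> in_path b -> a 1 = b 0 -> in_path (path_cat a b).
move=> [ca aO] [cb bO] ab; split; last first.
 by move=> t; have [t2|/ltW t2] := leP t 2^-1; [rewrite path_catl|rewrite path_catr].
have c2: continuous (fun t : R => 2 * t) by move=> t; apply: cvgM; [exact: cvg_cst|exact: cvg_id].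
have c3: continuous (fun t : R => 2 * t - 1) by move=> t; apply: cvgB; [exact: c2|exact: cvg_cst].
have k2: continuous (fun t : R => clamp (2 * t)) by move=> t; exact: (continuous_comp (c2 t) (@clamp_continuous _)).
have k3: continuous (fun t : R => clamp (2 * t - 1)) by move=> t; exact: (continuous_comp (c3 t) (@clamp_continuous _)).
have c4: continuous (fun t : R => a (clamp (2 * t))) by move=> t; exact: (continuous_comp (k2 t) (ca _)).
have c5: continuous (fun t : R => b (clamp (2 * t - 1))) by move=> t; exact: (continuous_comp (k3 t) (cb _)).
by move=> t; apply: cvgB; [apply: cvgD; [exact: c4|exact: c5]|exact: cvg_cst].
Qed.

Lemma path_val_cat a b c d e: a 1 = b 0 -> path_val a c -> path_val b d ->
 path_val (path_cat a b) e -> e = c + d.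
move=> ab [K KP] [L LP] [M MP]; pose N := (maxn K (maxn L M)).+1.
have KN: (K <= N)%N by apply: leqW; exact: leq_maxl.
have LN: (L <= N)%N by apply: leqW; exact: leq_trans (leq_maxl _ _) (leq_maxr _ _).
have MN: (M <= N + N)%N by apply: leq_trans (leq_addr _ _); apply: leqW; exact: leq_trans (leq_maxr _ _) (leq_maxr _ _).
rewrite -(MP (N + N)%N)// path_sum_split -(KP N)// -(LP N)//.
have NR: N%:R != 0 :> R by rewrite pnatr_eq0.
have N20: (N + N)%:R = 2 * N%:R :> R by lra.
have N0: 0 < N%:R :> R by [].
have hl j: (j <= N)%N -> sample (path_cat a b) (N + N) j = sample a N j.
 move=> jN; have E1: 2 * (j%:R / (N + N)%:R) = j%:R / N%:R :> R by rewrite N20; field.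
 have := sample01 jN; rewrite /sample => h; rewrite path_catl ?E1 ?clampE//.
 move: h; rewrite /= in_itv/= => /andP[_]; lra.
have hr k: (k <= N)%N -> sample (path_cat a b) (N + N) (N + k) = sample b N k.
 move=> kN; have E1: 2 * ((N + k)%:R / (N + N)%:R) - 1 = k%:R / N%:R :> R by rewrite N20; field.
 have := sample01 kN; rewrite /sample => h; rewrite path_catr ?E1 ?clampE//.
 move: h; rewrite /= in_itv/= => /andP[+]; lra.
congr (_ + _); apply: eq_bigr => j _.
 by rewrite !hl// ltnW.
by rewrite !hr// ltnW.
Qed.

Lemma path_val_rev g c: in_path g -> path_val g c -> path_val (fun t => g (1 - t)) (- c).
move=> pg [K KP]; have [L LP] := path_fine pg; exists (maxn K L) => N; rewrite geq_max => /andP[KN LN] N0.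
rewrite -(KP N KN N0) /path_sum -sumrN [RHS](reindex_inj rev_ord_inj)/=; apply: eq_bigr => j _.
have NR: N%:R != 0 :> R by rewrite pnatr_eq0 -lt0n.
have E1 k: (k <= N)%N -> sample (fun t => g (1 - t)) N k = sample g N (N - k) by move=> kN; rewrite /sample natrB//; congr g; field.
rewrite !E1// ?(ltnW (ltn_ord j))// -subSn// subSS.
have jN := ltn_ord j.
have [d [r [r0 dO dB]]] := LP N LN N0 _ (sample01 (leq_subr j N)).
have b1: ball d r (sample g N (N - j)) by apply: dB; rewrite subrr normr0.
apply: (I_sym r0 dO _ b1); apply: dB; rewrite -mulrBl -natrB; last by rewrite leq_sub2l.
by rewrite -(subnSK jN) subSnn mul1r ger0_norm.
Qed.

Lemma path_val_seg c r a b: 0 < r -> ball c r `<=` Om -> ball c r a -> ball c r b ->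
 in_path (fun t => a + clamp t *: (b - a)) /\ path_val (fun t => a + clamp t *: (b - a)) (I a b).
move=> r0 cO ca cb.
have sB t: ball c r (a + clamp t *: (b - a)).
 by apply: ball_segment => //; have := clamp01 t.
split; first split.
- move=> t; apply: cvgD; first exact: cvg_cst.
 apply: (@continuous_comp _ _ _ clamp (fun s : R => s *: (b - a))); first exact: clamp_continuous.
 exact: scalel_continuous.
- by move=> t; exact: cO.
exists 0%N => N _ N0; rewrite (path_sum_ball r0 cO); last by move=> j _; exact: sB.
rewrite /sample mul0r divff ?pnatr_eq0 -?lt0n// !clampE ?bound_itvE/= ?in_itv/= ?lexx ?ler01//.
by rewrite scale0r addr0 scale1r addrC subrK.
Qed.

(** Sums along the boundaries of the cells of a fine grid vanish, so the path sum is
  the same along all rows of the grid. *)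
Lemma path_val_contract g (H : R * R -> V): in_path g -> continuous H -> (forall p, Om (H p)) ->
 (forall t, `[0, 1]%classic t -> H (0, t) = g t /\ H (1, t) = g 0) ->
 (forall s, `[0, 1]%classic s -> H (s, 0) = g 0 /\ H (s, 1) = g 0) -> path_val g 0.
move=> pg cH HO Ht Hs.
have cS: compact (`[0, 1] `*` `[0, 1] : set (R * R)) by apply: compact_setX; exact: segment_compact.
have [d d0 dP] := lebesgue_number cS oO cH (fun t _ => HO t).
have [K KP] := inv_small d0; exists K => N KN N0.
have NR: N%:R != 0 :> R by rewrite pnatr_eq0 -lt0n.
pose x k j := H (k%:R / N%:R, j%:R / N%:R).
pose D k j := I (x k j) (x k.+1 j).
have step (k j : nat) : `|k%:R / N%:R - k.+1%:R / N%:R| < d :> R by rewrite -mulrBl -natr1 opprD addrA subrr sub0r mulN1r normrN ger0_norm//; exact: KP.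
have cell k j: (k <= N)%N -> (j <= N)%N -> D k j + I (x k.+1 j) (x k.+1 j.+1) = I (x k j) (x k j.+1) + D k j.+1.
 move=> kN jN; have [c [r [r0 cO cB]]] := dP (k%:R / N%:R, j%:R / N%:R) (conj (sample01 kN) (sample01 jN)).
 have b1: ball c r (x k j) by apply: cB; exact: ballxx.
 have b2: ball c r (x k.+1 j) by apply: cB; split => /=; [exact: step|exact: ballxx].
 have b3: ball c r (x k j.+1) by apply: cB; split => /=; [exact: ballxx|exact: step].
 have b4: ball c r (x k.+1 j.+1) by apply: cB; split; exact: step.
 by rewrite /D (HI r0 cO b1 b2 b4) (HI r0 cO).
have rows k m: (k <= N)%N -> (m <= N)%N -> path_sum (x k) m + D k m = D k 0%N + path_sum (x k.+1) m.
 move=> kN; elim: m => [_|m ih mN]; first by rewrite /path_sum !big_ord0 addr0 add0r.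
 rewrite /path_sum !big_ord_recr/= -/(path_sum _ m) -/(path_sum _ m).
 by rewrite -addrA -(cell k m kN (ltnW mN)) addrA (ih (ltnW mN)) addrA.
have g0: I (g 0) (g 0) = 0.
 have [r r0 rO] : exists2 r, 0 < r & ball (g 0) r `<=` Om by have /nbhs_ballP[r] : nbhs (g 0) Om by [apply: open_nbhs_nbhs; split => //; exact: pg.2]; exists r.
 exact: (I0 r0 rO (ballxx _ r0)).
have x0 k: (k <= N)%N -> x k 0%N = g 0 by move=> kN; rewrite /x mul0r; exact: (Hs _ (sample01 kN)).1.
have xN k: (k <= N)%N -> x k N = g 0 by move=> kN; rewrite /x divff//; exact: (Hs _ (sample01 kN)).2.
have const k: (k <= N)%N -> path_sum (x 0%N) N = path_sum (x k) N.
 elim: k => // k ih kN; rewrite (ih (ltnW kN)); have := rows k N (ltnW kN) (leqnn N).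
 by rewrite /D !x0 ?xN ?(ltnW kN)// g0 addr0 add0r.
have ->: path_sum (sample g N) N = path_sum (x 0%N) N by apply: eq_bigr => j; rewrite /x /sample mul0r !(Ht _ _).1//; apply: sample01 => //; exact: ltnW.
rewrite (const N (leqnn _)) /path_sum big1// => j _; rewrite /x divff//.
by rewrite !(Ht _ _).2//; apply: sample01 => //; exact: ltnW.
Qed.
End discrete_integral.

(** The value at x is the sum of I along a path from a base point to x. Two such paths form a loop;
 it contracts, so its sum vanishes. *)
Lemma potential_exists (R : realType) n (Om : set 'rV[R]_n.+1):
 open Om -> Om !=set0 -> simply_connected Om -> has_potentials Om.
move=> oO [x0 Ox0] [pc sc] I HI.
have H x: exists p : (R -> 'rV[R]_n.+1) * R, Om x ->
  [/\ in_path Om p.1, p.1 0 = x0, p.1 1 = x & path_val I p.1 p.2].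
 have [Ox|nO] := pselect (Om x); last by exists (cst 0, 0).
 have [g [cg gO g0 g1]] := pc _ _ Ox0 Ox.
 have pg: in_path Om (g \o @clamp R).
  split; first by have := within_comp cg (@clamp_continuous R) (@clamp01 R).
  by move=> t; apply: gO; exact: clamp01.
 have [c cP] := path_val_exists oO HI pg.
 exists (g \o @clamp R, c) => _ /=; split => //.
  by rewrite clampE ?g0//= in_itv/= lexx ler01.
 by rewrite clampE ?g1//= in_itv/= lexx ler01.
have [P PP] := choice H.
exists (fun x => (P x).2) => c r r0 cO a b ca cb.
have [pa a0 a1 va] := PP a (cO a ca); have [pb b0 b1 vb] := PP b (cO b cb).
have [ps vs] := path_val_seg HI r0 cO ca cb.
set sg := (fun t => _) in ps vs.
have s0: sg 0 = a by rewrite /sg clamp_le0// scale0r addr0.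
have s1: sg 1 = b by rewrite /sg clamp_ge1// scale1r addrC subrK.
have pas: in_path Om (path_cat (P a).1 sg) by exact: (path_cat_in pa ps (etrans a1 (esym s0))).
have prb: in_path Om (fun t => (P b).1 (1 - t)).
 split; last by move=> t; exact: pb.2.
 move=> t; apply: (@continuous_comp _ _ _ (fun t : R => 1 - t) (P b).1); last exact: pb.1.
 by apply: cvgB; [exact: cvg_cst|exact: cvg_id].
have as1: path_cat (P a).1 sg 1 = (P b).1 (1 - 0) by rewrite path_catr ?s0// ?subr0 ?invf_le1 ?ler1n// clamp_ge1 ?s1//; lra.
have pl: in_path Om (path_cat (path_cat (P a).1 sg) (fun t => (P b).1 (1 - t))) by exact: (path_cat_in pas prb as1).
set lp := path_cat _ _ in pl.
have l0: lp 0 = x0 by rewrite /lp path_catl ?invr_ge0// mulr0 clamp_le0// path_catl ?invr_ge0// mulr0 clamp_le0.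
have l1: lp 1 = x0 by rewrite /lp path_catr// ?invf_le1 ?ler1n// clamp_ge1 ?subrr//; lra.
have [G [cG GO Gt Gs]] := sc lp (continuous_subspaceT pl.1) (fun t _ => pl.2 t) (etrans l0 (esym l1)).
pose cc (p : R * R) := (clamp p.1, clamp p.2).
have ccc: continuous cc.
 move=> p.
 have h1: (fun p : R * R => clamp p.1) @ p --> clamp p.1 by exact: (continuous_comp (f := fst) (g := @clamp R) (@cvg_fst _ _ _ _ _) (@clamp_continuous _ _)).
 have h2: (fun p : R * R => clamp p.2) @ p --> clamp p.2 by exact: (continuous_comp (f := snd) (g := @clamp R) (@cvg_snd _ _ _ _ _) (@clamp_continuous _ _)).
 exact: (cvg_pair h1 h2).
have vl: path_val I lp 0.
 apply: (@path_val_contract _ _ Om I oO HI lp (G \o cc)) => //.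
 - by apply: within_comp cG ccc _ => p; split; exact: clamp01.
 - by move=> p; apply: GO; exact: clamp01.
 - by move=> t t01; have [h1 h2] := Gt t t01; split; rewrite /= /cc /= (clampE t01) ?(clamp_le0 (lexx _)) ?(clamp_ge1 (lexx _)).
 - by move=> s s01; have [h1 h2] := Gs s s01; split; rewrite /= /cc /= (clampE s01) ?(clamp_le0 (lexx _)) ?(clamp_ge1 (lexx _)).
have [e ve] := path_val_exists oO HI pas.
have e1 := path_val_cat (etrans a1 (esym s0)) va vs ve.
have := path_val_cat as1 ve (path_val_rev oO HI pb vb) vl.
by rewrite e1 => /eqP; rewrite eq_sym subr_eq0 => /eqP ->.
Qed.

(** * Calculus with compactly supported functions *)

Section euclidean.
Context (R : realType) (n : nat).
Notation E := 'rV[R]_n.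
Notation mu := (lebesgue_rV R n).
Notation dot := (ip mu).
Notation RR := (measurableTypeR R).
Notation VF := ('I_n -> E -> R).
Notation leb := (@lebesgue_measure R).
Notation nm := (L2norm mu).
Notation int f := (Rintegral mu setT f).
Notation dx i := (delta_mx 0 i : E).
Implicit Types (f g u w F Lam th chi : E -> R) (x y z v : E) (e r : R) (U O Om A : set E) (phi Psi psi : VF).

Lemma itg_shift z f: itg mu f -> itg mu (fun x => f (x + z)).
move=> If; have mf := itg_meas If.
have mfz: mfun (fun x : E => f (x + z)) by apply: measurableT_comp => //; exact: measurable_shift.
have : (\int[mu]_x `|(f x)%:E| < +oo)%E by case/integrableP : If.
have mabs: mfun (fun x => `|(f x)%:E|)%E by apply: measurableT_comp => //; exact/measurable_EFinP.
rewrite -(integral_translation z)// => foo.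
by apply/integrableP; split => //; exact/measurable_EFinP.
Qed.

Lemma int_shift z f: itg mu f -> int (fun x => f (x + z)) = int f.
move=> If; have mf: mfun (EFin \o f).
 by apply/measurable_EFinP; exact: itg_meas If.
congr fine.
have If': mu.-integrable ((fun x : E => x + z) @^-1` setT) ((EFin \o f) \o (fun x : E => x + z)) by exact: itg_shift.
have := integral_pushforward (measurable_shift z) mf If' measurableT.
rewrite preimage_setT => <-.
apply: eq_measure_integral; first exact: measurable_shift.
by move=> ? A mA _; exact: measure_translation.
Qed.

Lemma sq_shift z f: sq mu f -> sq mu (fun x => f (x + z)).
move=> [mf If]; split; last exact: (itg_shift z If).
by apply: measurableT_comp => //; exact: measurable_shift.
Qed.
Lemma ip_shift z f g: sq mu f -> sq mu g ->
 dot (fun x => f (x + z)) (fun x => g (x + z)) = dot f g.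
by move=> sf sg; exact: (int_shift z (sqM sf sg)). Qed.

Lemma measure_bounded (A : set E): measurable A -> bounded_set A -> (mu A < +oo)%E.
move=> mA /bddP[M M0 AM]; apply: (@le_lt_trans _ _ (mu (ball 0 M))).
 by apply: le_measure => //; rewrite inE//; exact: meas_ball.
by rewrite lebesgue_rV_ball// ltry.
Qed.

Lemma measure_open_gt0 (A : set E): open A -> A !=set0 -> (0 < mu A)%E.
move=> oA [x Ax]; have /nbhs_ballP[e /= e0 eA] : nbhs x A by exact: open_nbhs_nbhs.
apply: (@lt_le_trans _ _ (mu (ball x e))).
 by rewrite lebesgue_rV_ball// lte_fin exprn_gt0// pmulrn_lgt0.
by apply: le_measure => //; rewrite inE; [exact: meas_ball|exact: open_meas].
Qed.

Lemma bounded_ball0 (M : R): bounded_set (ball (0 : E) M).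
apply/bddP; exists (`|M| + 1); first by rewrite ltr_wpDl.
by apply: le_ball; rewrite (le_trans (ler_norm _))// lerDl.
Qed.

Lemma itg_bounded f (M c : R): mfun f ->
 (forall x, `|f x| <= c) -> (forall x, ~ ball 0 M x -> f x = 0) -> itg mu f.
move=> mf fc f0.
have mB: measurable (ball (0 : E) M) by exact: meas_ball.
have : itg mu (fun x => c * \1_(ball (0 : E) M) x).
 apply: itgZ; apply/integrableP; split; first exact/measurable_EFinP/measurable_indic.
 rewrite (eq_integral (EFin \o \1_(ball (0 : E) M))); last first.
  by move=> x /=; rewrite ger0_norm.
 rewrite integral_indic// setIT; apply: measure_bounded => //.
 exact: bounded_ball0.
apply: itg_le => // x; rewrite indicE; have [Bx|Bx] := pselect (ball 0 M x).
 by rewrite mem_set// mulr1.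
by rewrite memNset// mulr0 f0// normr0.
Qed.

Lemma sq_bounded f (M c : R): mfun f ->
 (forall x, `|f x| <= c) -> (forall x, ~ ball 0 M x -> f x = 0) -> sq mu f.
move=> mf fc f0; split => //; apply: (@itg_bounded _ M (c ^+ 2)).
- exact: measurable_funX.
- by move=> x; rewrite normrX lerXn2r ?nnegrE//; exact: le_trans (fc x).
- by move=> x /f0 ->; rewrite expr0n.
Qed.

Lemma itg_indic (A : set E): measurable A -> bounded_set A -> itg mu \1_A.
move=> mA /bddP[M M0 AM]; apply: (@itg_bounded _ M 1).
- exact: measurable_indic.
- by move=> x; rewrite ger0_norm// leq_b1.
- by move=> x xM; rewrite indicE memNset// => /AM.
Qed.

Lemma itg_mul_bounded f g (c : R): itg mu f -> mfun g ->
 (forall x, `|g x| <= c) -> itg mu (f *' g).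
move=> If mg gc; have mf := itg_meas If.
apply: (itg_le (g := fun x => c * `|f x|)).
- exact: measurable_funM.
- by move=> x; rewrite normrM mulrC ler_wpM2r.
- exact/itgZ/itg_abs.
Qed.

Lemma sq_mul_bounded f g (c : R): sq mu f -> mfun g ->
 (forall x, `|g x| <= c) -> sq mu (f *' g).
move=> sf mg gc; have mf := sf.1.
apply: (sq_le (g := fun x => c * f x)).
- exact: measurable_funM.
- exact: sqZ.
- by move=> x; rewrite !normrM mulrC ler_wpM2r// (le_trans (gc x))// ler_norm.
Qed.

Lemma sq_itg f (M : R): sq mu f -> (forall x, ~ ball 0 M x -> f x = 0) -> itg mu f.
move=> sf f0.
have mB: measurable (ball (0 : E) M) by exact: meas_ball.
have sB: sq mu \1_(ball 0 M).
 apply: (@sq_bounded _ M 1).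
 - exact: measurable_indic.
 - by move=> x; rewrite ger0_norm// leq_b1.
 - by move=> x xM; rewrite indicE memNset.
have := sqM sf sB; congr itg; apply/funext => x; rewrite indicE.
have [Bx|Bx] := pselect (ball 0 M x); first by rewrite mem_set// mulr1.
by rewrite f0// mul0r.
Qed.

Section line_derivatives.

Lemma is_derive_epsP (V : normedModType R) (f : V -> R) (x v : V) d:
 is_derive x v f d <->
 forall e, 0 < e -> exists2 r, 0 < r &
  forall h, h != 0 -> `|h| < r -> `|h^-1 * (f (h *: v + x) - f x) - d| <= e.
split=> [fd e e0|H].
 have [df dE] := fd.
 have : (fun h => h^-1 *: ((f \o shift x) (h *: v) - f x)) @ 0^' --> d by rewrite -dE.
 move=> /cvgrPdist_le /(_ _ e0) [r /= r0 rP]; exists r => // h h0 hr.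
 by rewrite distrC; apply: rP => //=; rewrite sub0r normrN.
have fd: (fun h => h^-1 *: ((f \o shift x) (h *: v) - f x)) @ 0^' --> d.
 apply/cvgrPdist_le => e e0; have [r r0 rP] := H _ e0; exists r => //= h.
 by rewrite /= sub0r normrN => hr h0; rewrite distrC; exact: rP.
split; first by apply/cvg_ex; exists d.
exact: (cvg_lim (@Rhausdorff R)).
Qed.

Lemma is_derive_line f y v t d: is_derive (y + t *: v) v f d ->
 is_derive t 1 (fun s : R => f (y + s *: v)) d.
move=> [df dE].
have K: (fun h : R => h^-1 *: (((fun s : R => f (y + s *: v)) \o shift t) (h *: 1) - f (y + t *: v)))
  = (fun h => h^-1 *: ((f \o shift (y + t *: v)) (h *: v) - f (y + t *: v))).
 by apply/funext => h /=; rewrite [h%:A]mulr1 scalerDl addrCA.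
split; first by rewrite /derivable K.
by rewrite /derive K.
Qed.

Lemma is_deriveZ_dir f x v a d: is_derive x v f d -> is_derive x (a *: v) f (a * d).
move=> /is_derive_epsP H; apply/is_derive_epsP => e e0.
have [->|a0] := eqVneq a 0.
 exists 1 => // h _ _; rewrite scale0r scaler0 add0r subrr mulr0 mul0r subrr normr0.
 exact: ltW.
have ea: 0 < e / `|a| by rewrite divr_gt0// normr_gt0.
have [r r0 rP] := H _ ea; exists (r / `|a|); first by rewrite divr_gt0// normr_gt0.
move=> h h0 hr; rewrite scalerA.
have := rP (h * a); rewrite mulf_neq0// normrM -ltr_pdivlMr ?normr_gt0// => /(_ isT hr).
rewrite ler_pdivlMr ?normr_gt0// -normrM; congr (`|_| <= _).
field; by rewrite ?h0 ?a0.
Qed.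

Lemma continuous_bigsum (I : Type) (r : seq I) (F : I -> E -> R):
 (forall i, continuous (F i)) -> continuous (fun x => \sum_(i <- r) F i x).
move=> cF; elim: r => [|i r ih].
 rewrite (_ : (fun x => _) = cst 0); first exact: cst_continuous.
 by apply/funext => x; rewrite big_nil.
under eq_fun do rewrite big_cons.
by move=> x; apply: continuousD; [exact: cF|exact: ih].
Qed.

Definition pd v f x := \sum_i v 0 i * 'd_i f x.
Definition C1 f := continuous f /\ forall i,
 (forall x, derivable f x (dx i)) /\ continuous ('d_i f).
Lemma C1_partial f i x: C1 f -> is_derive x (dx i) f ('d_i f x).
by move=> [_ /(_ i)[d]]. Qed.

Lemma mvt0 (g dg : R -> R) (t : R): (forall s : R, is_derive s 1 g (dg s)) ->
 exists2 c, `|c| <= `|t| & g t - g 0 = dg c * t.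
move=> gd.
have cg: continuous g.
 move=> s; apply/differentiable_continuous/derivable1_diffP.
 by [].
have [t0|/ltW t0] := leP 0 t.
 have [c] := @MVT_segment R g dg 0 t t0 (fun _ _ => gd _) (continuous_subspaceT cg).
 rewrite in_itv/= => /andP[c0 ct] ->; exists c; last by rewrite subr0.
 by rewrite !ger0_norm.
have [c] := @MVT_segment R g dg t 0 t0 (fun _ _ => gd _) (continuous_subspaceT cg).
rewrite in_itv/= => /andP[ct c0] H; exists c; last by rewrite -opprB H sub0r mulrN opprK.
by rewrite !ler0_norm// lerN2.
Qed.

Let trunc (v : E) (k : nat) : E := \row_j (if (j < k)%N then v 0 j else 0).
Let trunc_norm v k : `|trunc v k| <= `|v|.
apply: rV_norm_le => // i; rewrite mxE; case: ifP => _; first exact: rV_norm_coord.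
by rewrite normr0.
Qed.

Let truncS v (k : 'I_n) : trunc v k.+1 = v 0 k *: dx k + trunc v k.
apply/rowP => j; rewrite !mxE /= ltnS; have [->|jk] := eqVneq j k.
 by rewrite leqnn ltnn mulr1 addr0.
rewrite mulr0 add0r leq_eqVlt; case: eqP => //= jk'.
by move: jk; rewrite (val_inj jk') eqxx.
Qed.

(** Telescope along the coordinates and apply the mean value theorem to each step. *)
Lemma C1_is_derive f x v: C1 f -> is_derive x v f (pd v f x).
move=> Cf; apply/is_derive_epsP => e e0.
have c0: 0 < e / (\sum_(i < n) `|v 0 i| + 1) by rewrite divr_gt0// ltr_wpDl// sumr_ge0.
have /choice[r rP] : forall i, exists r, 0 < r /\ forall y, `|x - y| < r ->
  `|'d_i f x - 'd_i f y| <= e / (\sum_(i < n) `|v 0 i| + 1).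
 move=> i; have /cvgrPdist_le/(_ _ c0)/nbhs_ballP[r /= r0 rP] := (Cf.2 i).2 x.
 by exists r; split=> // y xy; apply: rP; exact/ballP.
pose r0 := \big[Num.min/1]_i r i.
have r00: 0 < r0 by apply: lt_bigmin => // i _; exact: (rP i).1.
have v10: 0 < 2 * `|v| + 1 by [].
exists (r0 / (2 * `|v| + 1)); first by rewrite divr_gt0.
move=> h h0 hr.
have tel k: (k <= n)%N -> `|h^-1 * (f (h *: trunc v k + x) - f x) -
  \sum_(i < n | (i < k)%N) v 0 i * 'd_i f x| <=
  \sum_(i < n | (i < k)%N) `|v 0 i| * (e / (\sum_(i < n) `|v 0 i| + 1)).
 elim: k => [_|k ih kn].
  rewrite !big_pred0//; rewrite (_ : trunc v 0 = 0); last by apply/rowP => j; rewrite !mxE ltn0.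
  by rewrite scaler0 add0r subrr mulr0 subr0 normr0.
 pose k' := Ordinal kn.
 have kE: forall i : 'I_n, ((i < k.+1)%N && (i != k')) = (i < k)%N.
  move=> i; rewrite ltnS; apply/idP/idP => [/andP[ik ne]|ik].
   rewrite ltn_neqAle ik andbT; apply: contra ne => /eqP ik'.
   by apply/eqP/val_inj.
  by rewrite ltnW//=; apply/eqP => H; move: ik; rewrite H ltnn.
 rewrite (bigD1 k')//= [leRHS](bigD1 k')//=.
 under eq_bigl do rewrite kE.
 under [X in _ <= _ + X]eq_bigl do rewrite kE.
 have := ih (ltnW kn); set S1 := (\sum_(i < n | _) _); set S2 := (\sum_(i < n | _) _) => ihk.
 pose y := h *: trunc v k + x.
 have [c ch cE] := @mvt0 (fun t => f (y + t *: dx k')) (fun t => 'd_k' f (y + t *: dx k'))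
  (h * v 0 k') (fun s => is_derive_line (C1_partial _ _ Cf)).
 move: cE; rewrite scale0r addr0 => cE.
 have yE: h *: trunc v k.+1 + x = y + (h * v 0 k') *: dx k' by rewrite /y (truncS v k') scalerDr scalerA [in RHS]addrC addrA.
 have dE: h^-1 * (f (h *: trunc v k.+1 + x) - f x) =
   h^-1 * (f y - f x) + v 0 k' * 'd_k' f (y + c *: dx k').
  rewrite yE -(subrK (f y) (f (_ + _ *: _))) cE.
  by field.
 rewrite dE.
 have pk: `|'d_k' f x - 'd_k' f (y + c *: dx k')| <= e / (\sum_(i < n) `|v 0 i| + 1).
  apply: (rP k').2; apply: lt_le_trans (_ : r0 <= _); last exact: bigmin_le_cond.
  rewrite /y (addrC) -!addrA (addNKr) || idtac.
  rewrite (_ : x - (h *: trunc v k + x + c *: dx k') = - (h *: trunc v k + c *: dx k')); last first.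
   by rewrite subrK || (apply/rowP => j; rewrite !mxE; ring).
  rewrite normrN (le_lt_trans (ler_normD _ _))// !normrZ.
  have d1: `|dx k'| <= 1.
   apply: rV_norm_le => // i; rewrite mxE /=; case: eqP => _; by rewrite ?normr1 ?normr0.
  have := trunc_norm v k; have := rV_norm_coord v k' => vk tv.
  rewrite ltr_pdivlMr// in hr; apply: le_lt_trans hr.
  move: ch; rewrite normrM => ch.
  have h1: `|c| * `|dx k'| <= `|h| * `|v|.
   rewrite (le_trans (ler_piMr _ d1))// (le_trans ch)// ler_wpM2l//.
  have h2: `|h| * `|trunc v k| <= `|h| * `|v| by rewrite ler_wpM2l.
  have : 0 <= `|h| by []. lra.
 have := normr_ge0 (v 0 k').
 move: pk; rewrite distrC.
 set p1 := 'd_k' f _; set p2 := 'd_k' f x; set q := e / _ => pk vk.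
 rewrite (_ : _ - _ = (h^-1 * (f y - f x) - S1) + v 0 k' * (p1 - p2)); last by ring.
 apply: le_trans (ler_normD _ _) _; rewrite addrC lerD// normrM ler_wpM2l//.
have := tel n (leqnn n).
rewrite (_ : trunc v n = v); last by apply/rowP => j; rewrite mxE ltn_ord.
under eq_bigl do rewrite ltn_ord.
under [X in _ <= X]eq_bigl do rewrite ltn_ord.
move=> /le_trans; apply.
have S0: 0 < \sum_(i < n) `|v 0 i| + 1 by rewrite ltr_wpDl// sumr_ge0.
by rewrite -mulr_suml mulrA ler_pdivrMr// mulrC ler_wpM2l ?ltW// ltrDl.
Qed.

Lemma C1_line f y v (t : R): C1 f ->
 is_derive t 1 (fun s : R => f (y + s *: v)) (pd v f (y + t *: v)).
by move=> Cf; apply: is_derive_line; exact: C1_is_derive. Qed.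

Lemma C1_mvt f y v (t : R): C1 f ->
 exists2 c, `|c| <= `|t| & f (y + t *: v) - f y = pd v f (y + c *: v) * t.
move=> Cf; have [c ct] := mvt0 t (fun s => C1_line y v s Cf).
by rewrite scale0r addr0 => ?; exists c.
Qed.

Lemma continuous_line f y v: continuous f -> continuous (fun s : R => f (y + s *: v)).
move=> cf s; apply: continuous_comp; last exact: cf.
by apply: cvgD; [exact: cvg_cst|exact: scalel_continuous].
Qed.
Lemma continuous_pd f v: C1 f -> continuous (pd v f).
move=> Cf; apply: continuous_bigsum => i x.
by apply: continuousM; [exact: cst_continuous|exact: (Cf.2 i).2].
Qed.

Lemma C1_ftc f y v (h : R): 0 < h -> C1 f ->
 f (y + h *: v) - f y =
 \int[@lebesgue_measure R]_(s in `[0, h]) pd v f (y + s *: v).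
move=> h0 Cf.
have cg: continuous (fun s : R => f (y + s *: v)) by apply: continuous_line; exact: Cf.1.
have cdg: continuous (fun s : R => pd v f (y + s *: v)) by apply: continuous_line; exact: continuous_pd.
rewrite /Rintegral (@continuous_FTC2 R _ (fun s : R => f (y + s *: v)) 0)//=.
- by rewrite scale0r addr0.
- exact: continuous_subspaceT.
- split.
 + by move=> s; have [] := C1_line y v s Cf.
 + by apply: cvg_at_right_filter; exact: cg.
 + by apply: cvg_at_left_filter; exact: cg.
- by move=> s; rewrite derive1E; have [_ ->] := C1_line y v s Cf.
Qed.

End line_derivatives.

Definition bsupp f := exists M, forall x, ~ ball 0 M x -> f x = 0.

Lemma bsupp_gt0 f: bsupp f -> exists2 M, 0 < M & forall x, ~ ball 0 M x -> f x = 0.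
move=> [M fM]; exists (`|M| + 1); first by rewrite ltr_wpDl.
move=> x xM; apply: fM => xM'; apply: xM; apply: le_ball xM'.
by rewrite (le_trans (ler_norm _))// lerDl.
Qed.

Lemma bsuppMl f g: bsupp f -> bsupp (f *' g).
by move=> [M fM]; exists M => x /fM ->; rewrite mul0r. Qed.
Lemma bsuppMr f g: bsupp g -> bsupp (f *' g).
by move=> [M fM]; exists M => x /fM ->; rewrite mulr0. Qed.
Lemma bsuppZ a f: bsupp f -> bsupp (fun x => a * f x).
exact: bsuppMr. Qed.

Lemma bsuppD f g: bsupp f -> bsupp g -> bsupp (f +' g).
move=> /bsupp_gt0[M M0 fM] /bsupp_gt0[N N0 gN]; exists (M + N) => x xM.
rewrite fM ?gN ?addr0// => h; apply: xM; apply: le_ball h.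
 by lra.
by lra.
Qed.

Lemma bsupp_sum (I : Type) (r : seq I) (F : I -> E -> R):
 (forall i, bsupp (F i)) -> bsupp (fun x => \sum_(i <- r) F i x).
move=> bF; elim: r => [|i r ih].
 by exists 0 => x; rewrite big_nil.
under eq_fun do rewrite big_cons.
exact: bsuppD.
Qed.

Lemma bsupp_shift z f: bsupp f -> bsupp (fun x => f (x + z)).
move=> /bsupp_gt0[M M0 fM]; exists (M + `|z|) => x xM; apply: fM => xM'; apply: xM.
move/ballP: xM'; rewrite !sub0r !normrN => xM'; apply/ball0P.
rewrite -(addrK z x) (le_lt_trans (ler_normB _ _)); lra.
Qed.

Lemma closed_ball_compact (M : R): compact [set x : E | `|x| <= M].
apply: bounded_closed_compact.
 apply/bddP; exists (`|M| + 1); first by rewrite ltr_wpDl.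
 move=> x /= xM; apply/ball0P.
 by rewrite (le_lt_trans xM)// (le_lt_trans (ler_norm _))// ltrDl.
have ->: [set x : E | `|x| <= M] = Num.norm @^-1` [set r : R | r <= M] by [].
by apply: closed_comp; [move=> x _; exact: norm_continuous|exact: closed_le].
Qed.

Lemma bsupp_bounded f: continuous f -> bsupp f -> exists2 c, 0 < c & forall x, `|f x| <= c.
move=> cf /bsupp_gt0[M M0 fM].
have /compact_bounded[c [cr cP]] : compact (f @` [set x : E | `|x| <= M]).
 apply: continuous_compact; last exact: closed_ball_compact.
 exact: continuous_subspaceT.
exists (`|c| + 1); first by rewrite ltr_wpDl.
move=> x; have [xM|xM] := leP `|x| M.
 by apply: cP; [rewrite (le_lt_trans (ler_norm _))// ltrDl|exists x].
rewrite fM ?normr0; first by rewrite addr_ge0.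
by move/ball0P; rewrite ltNge ltW.
Qed.

Lemma continuous_itg f: continuous f -> bsupp f -> itg mu f.
move=> cf bf; have [c c0 fc] := bsupp_bounded cf bf; have [M fM] := bf.
by apply: (@itg_bounded _ M) => //; exact: cts_meas.
Qed.
Lemma continuous_sq f: continuous f -> bsupp f -> sq mu f.
move=> cf bf; have [c c0 fc] := bsupp_bounded cf bf; have [M fM] := bf.
by apply: (@sq_bounded _ M) => //; exact: cts_meas.
Qed.

Lemma bsupp_unif f: continuous f -> bsupp f -> forall e, 0 < e ->
 exists2 r, 0 < r & forall x y, `|x - y| < r -> `|f x - f y| <= e.
move=> cf /bsupp_gt0[M M0 fM] e e0.
have /compact_near_coveringP K := @closed_ball_compact (M + 1).
have e20: 0 < e / 2 by lra.
have := K R (0^'+) (fun r x => forall y, `|x - y| < r -> `|f x - f y| <= e) _.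
case.
 move=> x _; have /cvgrPdist_lt /(_ _ e20) /nbhs_ballP[r /= r0 rP] := cf x.
 exists (ball x (r / 2), [set d | d < r / 2]) => /=.
  split; first by apply: nbhsx_ballx; rewrite divr_gt0.
  by apply: nbhs_right_lt; rewrite divr_gt0.
 move=> [x' d] [/= xx' dr] y x'y.
 have xy: ball x r y.
  rewrite [r]splitr; apply: ball_triangle xx' _.
  by apply/ballP; exact: lt_trans dr.
 have := rP _ xy; have := rP x' (le_ball _ xx'); rewrite ler_pdivrMr// ler_pMr// ler1n => /(_ isT).
 rewrite -[f x' - f y](subrKA (f x)) => h1 h2.
 rewrite (le_trans (ler_normD _ _))// (distrC (f x')); lra.
move=> r /= r0 rP.
exists (Num.min (r / 2) 1); first by rewrite lt_min divr_gt0//=.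
move=> x y; rewrite lt_min => /andP[xyr xy1].
have H: forall x y, `|x - y| < r / 2 -> `|x| <= M + 1 -> `|f x - f y| <= e.
 move=> x1 y1 xyr1 xM; apply: (rP (r / 2)) => //=; last by rewrite divr_gt0.
 by rewrite sub0r normrN ger0_norm ?ltW ?divr_gt0// ltr_pdivrMr// ltr_pMr// ltr1n.
have [xM|xM] := leP `|x| (M + 1); first exact: H.
have [yM|yM] := leP `|y| (M + 1); first by rewrite distrC; apply: H => //; rewrite distrC.
rewrite !fM ?subrr ?normr0 ?ltW// => /ball0P; lra.
Qed.

Lemma bsupp_partial i f: bsupp f -> bsupp ('d_i f).
move=> /bsupp_gt0[M M0 fM]; exists (M + 1) => x xM.
rewrite /partial (_ : 'D_(dx i) f x = 'D_(dx i) (cst 0) x); first by rewrite derive_cst.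
apply: near_eq_derive; apply/nbhs_ballP; exists 1 => //= y xy; apply: fM => yM.
apply: xM; apply: ball_triangle yM _; exact: ball_sym.
Qed.

Lemma bsupp_pd v f: bsupp f -> bsupp (pd v f).
by move=> bf; apply: bsupp_sum => i; apply: bsuppZ; exact: bsupp_partial. Qed.

Lemma C1_unif f v: C1 f -> bsupp f -> forall e, 0 < e ->
 exists2 r, 0 < r & forall h y, h != 0 -> `|h| < r ->
  `|h^-1 * (f (h *: v + y) - f y) - pd v f y| <= e.
move=> Cf bf e e0.
have [r r0 rP] := bsupp_unif (continuous_pd Cf) (bsupp_pd v bf) e0.
exists (r / (`|v| + 1)); first by rewrite divr_gt0// ltr_wpDl.
move=> h y h0 hr; have [c ch] := C1_mvt y v h Cf.
rewrite (addrC (h *: v)) => ->; rewrite mulrCA mulVf// mulr1; apply: rP.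
rewrite addrC addKr normrZ.
rewrite ltr_pdivlMr in hr; last by rewrite ltr_wpDl.
apply: le_lt_trans hr; rewrite mulrDr mulr1.
by rewrite (le_trans (ler_wpM2r _ ch))// lerDl.
Qed.

(** The integral of a derivative vanishes: by translation invariance so do the
  integrals of the difference quotients, which converge uniformly. *)
Lemma int_pd0 f v: C1 f -> bsupp f -> int (pd v f) = 0.
move=> Cf bf; have [M M0 fM] := bsupp_gt0 bf.
have cf := Cf.1; have If := continuous_itg cf bf.
have Ip := continuous_itg (continuous_pd Cf) (bsupp_pd v bf).
pose B : set E := ball 0 (M + `|v| + 1).
have mB: measurable B by exact: meas_ball.
have IB: itg mu \1_B by apply: itg_indic => //; exact: bounded_ball0.
apply/eqP; rewrite -normr_eq0 -[_ == 0]negbK; apply/negP => n0.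
have p0: 0 < `|int (pd v f)| by rewrite lt_neqAle eq_sym n0/=.
set I := `|_| in p0; set J := int \1_B.
have J0: 0 <= J by apply: int_ge0.
have e0: 0 < I / (2 * (J + 1)) by rewrite divr_gt0// mulr_gt0// ltr_wpDl.
have [r r0 rP] := C1_unif v Cf bf e0.
pose h := Num.min (r / 2) 1.
have h0: 0 < h by rewrite lt_min divr_gt0//=.
have hr: `|h| < r by rewrite gtr0_norm// /h gt_min ltr_pdivrMr// ltr_pMr// ltr1n.
have h1: `|h| <= 1 by rewrite gtr0_norm// /h ge_min lexx orbT.
have Iq: itg mu (fun x => h^-1 * (f (h *: v + x) - f x)) by apply: itgZ; apply: itgB => //; under eq_fun do rewrite addrC; exact: itg_shift.
have q0: int (fun x => h^-1 * (f (h *: v + x) - f x)) = 0.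
 rewrite intZ ?intB//; last first.
 - by apply: itgB => //; under eq_fun do rewrite addrC; exact: itg_shift.
 - by under eq_fun do rewrite addrC; exact: itg_shift.
 - under [X in X - _]eq_Rintegral do rewrite addrC.
  by rewrite int_shift// subrr mulr0.
have : I <= I / (2 * (J + 1)) * J.
 have IE: I = `|int (fun x => h^-1 * (f (h *: v + x) - f x) - pd v f x)| by rewrite intB// q0 sub0r normrN.
 rewrite [leLHS]IE -intZ//; apply: int_abs_le.
 - exact: itgB.
 - exact: itgZ.
 - move=> x; rewrite indicE; have [Bx|Bx] := pselect (B x).
   by rewrite mem_set// mulr1; apply: rP => //; rewrite gt_eqF.
  have nb c: `|c| <= 1 -> ~ ball 0 M (c *: v + x).
   move=> c1 /ball0P => xM; apply: Bx.
   apply/ball0P; rewrite -(addKr (c *: v) x).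
   rewrite (le_lt_trans (ler_normD _ _))// normrN normrZ.
   have : `|c| * `|v| <= `|v| by rewrite ler_piMl.
   by lra.
  rewrite fM; last exact: nb.
  rewrite fM; last by have := nb 0; rewrite scale0r add0r normr0; apply.
  rewrite subrr mulr0 sub0r normrN /pd big1 ?normr0//; first by rewrite mulr_ge0// ltW.
  move=> i; have ->: 'd_i f x = 'D_(dx i) (cst 0) x; last by rewrite derive_cst mulr0.
  apply: near_eq_derive; apply/nbhs_ballP; exists 1 => //= y xy; apply: fM => yM.
  apply: Bx; apply: (@le_ball _ _ _ (M + 1)); first by rewrite -addrA lerD2l lerDr.
  by apply: ball_triangle yM _; exact: ball_sym.
rewrite leNgt => /negP; apply.
rewrite mulrAC ltr_pdivrMr; last by rewrite mulr_gt0// ltr_wpDl.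
nra.
Qed.

Section smooth_algebra.

Lemma pd_dx i f x: pd (dx i) f x = 'd_i f x.
rewrite /pd (bigD1 i)//= mxE !eqxx mul1r big1 ?addr0// => j ji.
by rewrite mxE (negPf ji) mul0r.
Qed.

Fixpoint ksm k f := match k with
 | 0%N => continuous f
 | k'.+1 => continuous f /\
   forall i, (forall x, derivable f x (dx i)) /\ ksm k' ('d_i f) end.

Lemma ksm_continuous k f: ksm k f -> continuous f.
by case: k => k []. Qed.
Lemma ksmW k f: ksm k.+1 f -> ksm k f.
elim: k f => [f []//|k ih f [cf df]]; split => // i.
by have [? ?] := df i; split => //; exact: ih.
Qed.
Lemma ksm_C1 k f: ksm k.+1 f -> C1 f.
by move=> [cf df]; split => // i; have [? /ksm_continuous] := df i. Qed.

Lemma smoothP f: smooth f <-> forall k, ksm k f.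
split=> [sf k|kf s].
 elim: k f sf => [f sf|k ih f sf]; first exact: (sf [::]).1.
 split; first exact: (sf [::]).1.
 by split; [exact: (sf [::]).2|exact/ih/smooth_partial].
have : ksm (size s).+1 f by [].
elim/last_ind: s f {kf} => [f /= [cf df]|s i ih f].
 by split => // i; exact: (df i).1.
by rewrite size_rcons foldr_rcons => -[_ /(_ i)[_ /ih]].
Qed.

Lemma smooth_C1 f: smooth f -> C1 f.
by move=> /smoothP /(_ 1%N) /ksm_C1. Qed.
Lemma smooth_continuous f: smooth f -> continuous f.
by move=> /smooth_C1[]. Qed.

Lemma partial_add i f g: C1 f -> C1 g ->
 'd_i (f +' g) = (fun x => 'd_i f x + 'd_i g x).
move=> Cf Cg; apply/funext => x.
by have [_ <-] := is_deriveD (C1_partial i x Cf) (C1_partial i x Cg).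
Qed.

Lemma derivable_add i f g x: C1 f -> C1 g -> derivable (f +' g) x (dx i).
by move=> Cf Cg; have [] := is_deriveD (C1_partial i x Cf) (C1_partial i x Cg).
Qed.

Lemma is_derive_mul (V : normedModType R) (x v : V) (f g : V -> R) df dg: is_derive x v f df -> is_derive x v g dg ->
 is_derive x v (fun y : V => f y * g y) (df * g x + f x * dg).
move=> [Df <-] [Dg <-]; split; first exact: (derivableM Df).
by have := deriveM Df Dg => ->; rewrite addrC [in RHS]mulrC.
Qed.

Lemma partial_mul i f g: C1 f -> C1 g ->
 'd_i (f *' g) = (fun x => 'd_i f x * g x + f x * 'd_i g x).
move=> Cf Cg; apply/funext => x.
by have [_ <-] := is_derive_mul (C1_partial i x Cf) (C1_partial i x Cg).
Qed.

Lemma derivable_mul i f g x: C1 f -> C1 g -> derivable (f *' g) x (dx i).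
by move=> Cf Cg; have [] := is_derive_mul (C1_partial i x Cf) (C1_partial i x Cg).
Qed.
Lemma continuous_add f g: continuous f -> continuous g -> continuous (f +' g).
by move=> cf cg x; apply: continuousD; [exact: cf|exact: cg]. Qed.
Lemma cts_mul f g: continuous f -> continuous g -> continuous (f *' g).
by move=> cf cg x; apply: continuousM; [exact: cf|exact: cg]. Qed.

Lemma C1D f g: C1 f -> C1 g -> C1 (f +' g).
move=> Cf Cg; split; first exact: continuous_add Cf.1 Cg.1.
split; first by move=> x; exact: derivable_add.
by rewrite partial_add//; apply: continuous_add; [exact: (Cf.2 i).2|exact: (Cg.2 i).2].
Qed.

Lemma C1M f g: C1 f -> C1 g -> C1 (f *' g).
move=> Cf Cg; split; first exact: cts_mul Cf.1 Cg.1.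
split; first by move=> x; exact: derivable_mul.
rewrite partial_mul//; apply: continuous_add.
 exact: (cts_mul (Cf.2 i).2 Cg.1).
exact: (cts_mul Cf.1 (Cg.2 i).2).
Qed.

Lemma ksmD k f g: ksm k f -> ksm k g -> ksm k (f +' g).
elim: k f g => [f|k ih f g Kf Kg]; first exact: continuous_add.
have Cf := ksm_C1 Kf; have Cg := ksm_C1 Kg; have [cf df] := Kf; have [cg dg] := Kg.
split; first exact: continuous_add.
split; first by move=> x; exact: derivable_add.
by rewrite partial_add//; apply: ih; [exact: (df i).2|exact: (dg i).2].
Qed.

Lemma ksmM k f g: ksm k f -> ksm k g -> ksm k (f *' g).
elim: k f g => [f|k ih f g Kf Kg]; first exact: cts_mul.
have Cf := ksm_C1 Kf; have Cg := ksm_C1 Kg; have [cf df] := Kf; have [cg dg] := Kg.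
split; first exact: cts_mul.
split; first by move=> x; exact: derivable_mul.
rewrite partial_mul//; apply: ksmD.
 exact: (ih _ _ (df i).2 (ksmW Kg)).
exact: (ih _ _ (ksmW Kf) (dg i).2).
Qed.

Lemma partial_cst i c: 'd_i (fun=> c : R) = (fun=> 0) :> (E -> R).
by apply/funext => x; rewrite /partial derive_cst. Qed.

Lemma ksm_cst k c: ksm k (fun=> c).
elim: k c => [c|k ih c]; first by move=> x; exact: cst_continuous.
split; first by move=> x; exact: cst_continuous.
by split; [move=> x; exact: derivable_cst|rewrite partial_cst; exact: ih].
Qed.

Lemma smooth_cst c: smooth ((fun=> c) : E -> R).
by apply/smoothP => k; exact: ksm_cst. Qed.
Lemma C1_cst c: C1 ((fun=> c) : E -> R).
exact: smooth_C1 (smooth_cst c). Qed.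
Lemma smoothD f g: smooth f -> smooth g -> smooth (f +' g).
by move=> /smoothP sf /smoothP sg; apply/smoothP => k; exact: ksmD. Qed.
Lemma smoothM f g: smooth f -> smooth g -> smooth (f *' g).
by move=> /smoothP sf /smoothP sg; apply/smoothP => k; exact: ksmM. Qed.
Lemma smoothZ a f: smooth f -> smooth (fun x => a * f x).
by apply: smoothM; exact: smooth_cst. Qed.

Lemma smooth_sum (I : Type) (r : seq I) (F : I -> E -> R):
 (forall i, smooth (F i)) -> smooth (fun x => \sum_(i <- r) F i x).
move=> bF; elim: r => [|i r ih].
 have ->: (fun x => \sum_(i <- [::]) F i x) = fun=> 0 by apply/funext => x; rewrite big_nil.
 exact: smooth_cst.
have ->: (fun x => \sum_(j <- i :: r) F j x) = fun x => F i x + \sum_(j <- r) F j x by apply/funext => x; rewrite big_cons.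
exact: (smoothD (bF i)).
Qed.

Lemma is_derive_shift_arg f x v z d: is_derive (x + z) v f d ->
 is_derive x v (fun y => f (y + z)) d.
move=> /is_derive_epsP H; apply/is_derive_epsP => e e0; have [r r0 rP] := H e e0.
by exists r => // hr; rewrite -addrA; exact: rP.
Qed.

Lemma is_derive_opp_arg f x v d: is_derive (- x) v f d ->
 is_derive x v (fun y => f (- y)) (- d).
move=> /is_derive_epsP H; apply/is_derive_epsP => e e0; have [r r0 rP] := H e e0.
exists r => // h h0 hr; have := rP (- h); rewrite oppr_eq0 normrN => /(_ h0 hr).
by rewrite invrN mulNr -opprD normrN opprK opprD scaleNr.
Qed.

Lemma continuous_shift_arg f z: continuous f -> continuous (fun y => f (y + z)).
move=> cf x; apply: continuous_comp; last exact: cf.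
by apply: continuousD; [exact: cvg_id|exact: cst_continuous].
Qed.
Lemma partial_shift i f z: C1 f -> 'd_i (fun y => f (y + z)) = fun y => 'd_i f (y + z).
move=> Cf; apply/funext => x.
by have [_ <-] := is_derive_shift_arg (C1_partial i (x + z) Cf).
Qed.
Lemma partial_opp i f: C1 f -> 'd_i (fun y => f (- y)) = fun y => - 'd_i f (- y).
move=> Cf; apply/funext => x.
by have [_ <-] := is_derive_opp_arg (C1_partial i (- x) Cf).
Qed.

Lemma smooth_shift f z: smooth f -> smooth (fun y => f (y + z)).
move=> /smoothP sf; apply/smoothP => k; elim: k f sf => [|k ih] f sf.
 exact/continuous_shift_arg/(sf 0%N).
have Cf := ksm_C1 (sf 1%N).
split; first exact/continuous_shift_arg/(sf 0%N).
split; first by move=> x; have [] := is_derive_shift_arg (C1_partial i (x + z) Cf).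
rewrite partial_shift//; apply: ih => j; by have [_ /(_ i)[]] := sf j.+1.
Qed.

Lemma partial_comp1 (g dg : R -> R) f i x: (forall t : R, is_derive t 1 g (dg t)) -> C1 f ->
 is_derive x (dx i) (fun y => g (f y)) (dg (f x) * 'd_i f x).
move=> gd Cf.
have H: is_derive (0 : R) 1 (g \o (fun s : R => f (x + s *: dx i))) (dg (f x) * 'd_i f x).
 have := C1_line x (dx i) 0 Cf; rewrite scale0r addr0 pd_dx => h.
 have gd': is_derive (f (x + 0 *: dx i)) 1 g (dg (f x)) by rewrite scale0r addr0.
 have := @is_derive1_comp _ g (fun s : R => f (x + s *: dx i)) 0 _ _ gd' h.
 by [].
move/is_derive_epsP : H => H; apply/is_derive_epsP => e e0; have [r r0 rP] := H e e0.
exists r => // h h0 hr; have := rP h h0 hr.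
by rewrite /= addr0 scale0r addr0 [h%:A]mulr1 (addrC x).
Qed.

Lemma C1_comp1 (g dg : R -> R) f: (forall t : R, is_derive t 1 g (dg t)) -> continuous dg ->
 C1 f -> C1 (fun y => g (f y)) /\
  forall i, 'd_i (fun y => g (f y)) = fun x => dg (f x) * 'd_i f x.
move=> gd cdg Cf.
have P i: 'd_i (fun y => g (f y)) = fun x => dg (f x) * 'd_i f x by apply/funext => x; have [_ <-] := partial_comp1 i x gd Cf.
have cg: continuous g by move=> t; apply/differentiable_continuous/derivable1_diffP.
split => //; split.
 by move=> x; apply: continuous_comp; [exact: Cf.1|exact: cg].
split; first by move=> x; have [] := partial_comp1 i x gd Cf.
rewrite P; apply: cts_mul; last exact: (Cf.2 i).2.
by move=> x; apply: continuous_comp; [exact: Cf.1|exact: cdg].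
Qed.

Let diff2_alg (a b c d p q h : R) : a + -1 * b - (c + -1 * d) = p * h * h ->
 a - b - c + d - q * h ^+ 2 = (p - q) * h ^+ 2.
by lra. Qed.

(** Symmetry of second derivatives, from the mean value theorem applied twice to
  the second difference. *)
Lemma schwarz i j f x: smooth f -> 'd_i ('d_j f) x = 'd_j ('d_i f) x.
move=> sf.
have key: forall i j e, 0 < e -> exists2 r, 0 < r & forall h, 0 < h -> h < r ->
 `|(f (x + h *: dx i + h *: dx j) - f (x + h *: dx i) - f (x + h *: dx j) + f x)
  - 'd_j ('d_i f) x * h ^+ 2| <= e * h ^+ 2.
 move=> {}i {}j e e0.
 have Cf := smooth_C1 sf; have sif := smooth_partial i sf.
 have /(_ x) := smooth_continuous (smooth_partial j sif).
 move=> /cvgrPdist_le /(_ _ e0) /nbhs_ballP[r /= r0 rP].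
 exists (r / 2); first by rewrite divr_gt0.
 move=> h h0 hr.
 pose g y := f (y + h *: dx j) + (-1) * f y.
 have Cg: C1 g by apply: smooth_C1; apply: smoothD; [exact: smooth_shift|exact: smoothZ].
 have [c ch cE] := C1_mvt x (dx i) h Cg.
 have gE y: 'd_i g y = 'd_i f (y + h *: dx j) - 'd_i f y.
  have Cc: C1 ((fun=> -1) : E -> R) by apply: smooth_C1; exact: smooth_cst.
  rewrite /g (partial_add i _ (C1M Cc Cf)); last by apply: smooth_C1; exact: smooth_shift.
  by rewrite (partial_shift _ _ Cf) (partial_mul i Cc Cf) partial_cst mul0r add0r mulN1r.
 have [d dh dE] := C1_mvt (x + c *: dx i) (dx j) h (smooth_C1 sif).
 move: cE; rewrite (pd_dx) gE dE (pd_dx) /g => cE.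
 set p := 'd_j ('d_i f) _ in cE; set q := 'd_j ('d_i f) x.
 rewrite (diff2_alg q cE).
 rewrite normrM (ger0_norm (sqr_ge0 h)) ler_wpM2r ?sqr_ge0// distrC; apply: rP.
 apply/ballP; rewrite opprD opprD addrA addrA addrAC subrr add0r -opprD.
 rewrite normrN (le_lt_trans (ler_normD _ _))// !normrZ.
 have d1 k: `|dx k| <= 1 by apply: rV_norm_le => // l; rewrite mxE /=; case: eqP => _; rewrite ?normr1 ?normr0.
 have := ler_piMr (normr_ge0 c) (d1 i); have := ler_piMr (normr_ge0 d) (d1 j).
 rewrite (gtr0_norm h0) in ch dh; lra.
apply/eqP; rewrite -subr_eq0 -normr_le0; apply/ler_addgt0Pl => e e0; rewrite addr0.
have e20: 0 < e / 2 by lra.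
have [r1 r10 H1] := key i j _ e20; have [r2 r20 H2] := key j i _ e20.
pose h := Num.min r1 r2 / 2.
have h0: 0 < h by rewrite divr_gt0// lt_min r10.
have [hr1 hr2] : h < r1 /\ h < r2.
 split; rewrite ltr_pdivrMr//.
  by rewrite (le_lt_trans (_ : _ <= r1)) ?ge_min ?lexx// ltr_pMr// ltr1n.
 by rewrite (le_lt_trans (_ : _ <= r2)) ?ge_min ?lexx ?orbT// ltr_pMr// ltr1n.
have {}H1 := H1 h h0 hr1; have {}H2 := H2 h h0 hr2.
have h20: 0 < h ^+ 2 by rewrite exprn_gt0.
rewrite -(ler_pM2r h20) -[X in `|_| * X](ger0_norm (ltW h20)) -normrM mulrBl.
have E1: x + h *: dx j + h *: dx i = x + h *: dx i + h *: dx j by rewrite addrAC.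
rewrite E1 in H2; move: H1 H2.
move: (f (x + h *: dx i + h *: dx j)) (f (x + h *: dx i)) (f (x + h *: dx j)) (f x) => a b c d.
move: ('d_j ('d_i f) x) ('d_i ('d_j f) x) => p q.
move: (h ^+ 2) h20 => hh hh0 H1 H2.
have ->: q * hh - p * hh = (a - b - c + d - p * hh) - (a - c - b + d - q * hh) by ring.
by rewrite (le_trans (ler_normB _ _)); lra.
Qed.

End smooth_algebra.

Definition Cc f := smooth f /\ bsupp f.

Lemma Cc_smooth f: Cc f -> smooth f. Proof. by case. Qed.
Lemma Cc_bsupp f: Cc f -> bsupp f. Proof. by case. Qed.
Lemma Cc_C1 f: Cc f -> C1 f. Proof. by move=> [/smooth_C1]. Qed.
Lemma Cc_cts f: Cc f -> continuous f. Proof. by move=> /Cc_C1[]. Qed.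
Lemma Cc_itg f: Cc f -> itg mu f.
by move=> cf; apply: continuous_itg; [exact: Cc_cts|exact: Cc_bsupp]. Qed.
Lemma Cc_sq f: Cc f -> sq mu f.
by move=> cf; apply: continuous_sq; [exact: Cc_cts|exact: Cc_bsupp]. Qed.
Lemma Cc_meas f: Cc f -> mfun f.
by move=> cf; apply: cts_meas; exact: Cc_cts. Qed.
Lemma Cc_d i f: Cc f -> Cc ('d_i f).
by move=> [sf]; split; [exact: smooth_partial|exact: bsupp_partial]. Qed.
Lemma sq_d i f: Cc f -> sq mu ('d_i f).
by move=> cf; exact: Cc_sq (Cc_d i cf). Qed.
Lemma partialC i j f: Cc f -> 'd_i ('d_j f) = 'd_j ('d_i f).
by move=> cf; apply/funext => x; exact: schwarz (Cc_smooth cf). Qed.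
Lemma CcD f g: Cc f -> Cc g -> Cc (f +' g).
by move=> [? ?] [? ?]; split; [exact: smoothD|exact: bsuppD]. Qed.
Lemma CcZ a f: Cc f -> Cc (fun x => a * f x).
by move=> [? ?]; split; [exact: smoothZ|exact: bsuppZ]. Qed.
Lemma CcN f: Cc f -> Cc (fun x => - f x).
by move=> /(CcZ (-1)); congr Cc; apply/funext => x; rewrite mulN1r. Qed.
Lemma CcB f g: Cc f -> Cc g -> Cc (f -' g).
by move=> cf /CcN; exact: CcD. Qed.
Lemma CcM f g: smooth f -> Cc g -> Cc (f *' g).
by move=> sf [sg]; split; [exact: smoothM|exact: bsuppMr]. Qed.
Lemma Cc_sum (I : Type) (r : seq I) (F : I -> E -> R):
 (forall i, Cc (F i)) -> Cc (fun x => \sum_(i <- r) F i x).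
by move=> cF; split; [apply: smooth_sum|apply: bsupp_sum] => i; case: (cF i). Qed.
Lemma Cc_pd v f: Cc f -> Cc (pd v f).
by move=> cf; apply: Cc_sum => i; apply: CcZ; exact: Cc_d. Qed.
Lemma Cc_shift z f: Cc f -> Cc (fun x => f (x + z)).
by move=> [sf]; split; [exact: smooth_shift|exact: bsupp_shift]. Qed.
Lemma Cc0: Cc (fun=> 0).
by split; [exact: smooth_cst|exists 0]. Qed.
Lemma ibp i f g: C1 f -> C1 g -> bsupp f \/ bsupp g ->
 int (fun x => 'd_i f x * g x) =
 - int (fun x => f x * 'd_i g x).
move=> Cf Cg bfg.
have b1: bsupp (f *' g) by case: bfg; [exact: bsuppMl|exact: bsuppMr].
have := int_pd0 (dx i) (C1M Cf Cg) b1.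
rewrite (@eq_int _ _ _ _ _ (fun x => 'd_i f x * g x + f x * 'd_i g x)); last first.
 by move=> x; rewrite pd_dx partial_mul.
have cf' := (Cf.2 i).2; have cg' := (Cg.2 i).2.
rewrite intD; first by move/eqP; rewrite addr_eq0 => /eqP.
- apply: continuous_itg; first exact: (cts_mul cf' Cg.1).
 by case: bfg => h; [apply: bsuppMl; exact: bsupp_partial|exact: bsuppMr].
- apply: continuous_itg; first exact: (cts_mul Cf.1).
 by case: bfg => h; [exact: bsuppMl|apply: bsuppMr; exact: bsupp_partial].
Qed.

(** * Averages of translates *)

Section averages.
Context d (T : measurableType d).
Context (nu : {sigma_finite_measure set T -> \bar R}).

(** The average of f over the translations w s with weight k s: convolution with a mollifier and
 integration along a segment are of this form. *)
Definition Av (k : T -> R) (w : T -> E) f x := Rintegral nu setT (fun s => k s * f (x + w s)).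

Lemma Av_itg (k : T -> R) (w : T -> E) f x: itg nu k -> mfun w -> continuous f -> bsupp f ->
 itg nu (fun s => k s * f (x + w s)).
move=> Ik mw cf bf; have [c c0 fc] := bsupp_bounded cf bf.
have mf: mfun (fun s => f (x + w s)).
 under eq_fun do rewrite addrC.
 apply: (measurableT_comp (f := f)); first exact: cts_meas.
 by apply: (measurableT_comp (f := fun y : E => y + x)); first exact: measurable_shift.
apply: (itg_le (g := fun s => c * `|k s|)).
- by apply: measurable_funM => //; exact: itg_meas Ik.
- by move=> s; rewrite normrM mulrC ler_wpM2r.
- exact/itgZ/itg_abs.
Qed.

Lemma Av_small (k : T -> R): itg nu k -> forall e, 0 < e ->
 exists2 c, 0 < c & forall u : T -> R, itg nu (k *' u) ->
  (forall s, `|u s| <= c) -> `|Rintegral nu setT (k *' u)| <= e.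
move=> Ik e e0.
pose K := Rintegral nu setT (fun s => `|k s|).
have K0: 0 <= K by apply: int_ge0.
have K1: 0 < K + 1 by lra.
exists (e / (K + 1)); first by rewrite divr_gt0.
move=> u Iu uc; apply: (@le_trans _ _ (e / (K + 1) * K)).
 rewrite -intZ; last exact: itg_abs.
 apply: int_abs_le => //; first exact/itgZ/itg_abs.
 by move=> s; rewrite normrM mulrC ler_wpM2r.
by rewrite mulrAC ler_pdivrMr// ler_pM2l// lerDl.
Qed.

Lemma Av_continuous (k : T -> R) (w : T -> E) f: itg nu k -> mfun w -> continuous f -> bsupp f ->
 continuous (Av k w f).
move=> Ik mw cf bf; apply: continuous_epsP => x e e0.
have [c c0 cP] := Av_small Ik e0.
have [r r0 rP] := bsupp_unif cf bf c0.
exists r => // y xy.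
rewrite /Av -intB; try exact: Av_itg.
rewrite (@eq_int _ _ _ _ _ (fun s => k s * (f (x + w s) - f (y + w s)))); last first.
 by move=> s; rewrite mulrBr.
apply: cP.
 by under eq_fun do rewrite mulrBr; apply: itgB; exact: Av_itg.
by move=> s; apply: rP; rewrite opprD addrACA subrr addr0.
Qed.

Lemma Av_is_derive (k : T -> R) (w : T -> E) f x v: itg nu k -> mfun w -> C1 f -> bsupp f ->
 is_derive x v (Av k w f) (Av k w (pd v f) x).
move=> Ik mw Cf bf; apply/is_derive_epsP => e e0.
have [c c0 cP] := Av_small Ik e0.
have [r r0 rP] := C1_unif v Cf bf c0.
have cp := continuous_pd (v := v) Cf; have bp := bsupp_pd v bf.
exists r => // h h0 hr.
have I1 y := Av_itg y Ik mw Cf.1 bf; have I2 y := Av_itg y Ik mw cp bp.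
rewrite /Av -intB; try exact: I1.
rewrite -intZ; last exact: itgB.
rewrite -intB; [|by apply: itgZ; exact: itgB|exact: I2].
have uE s: h^-1 * (k s * f (h *: v + x + w s) - k s * f (x + w s)) - k s * pd v f (x + w s) =
  k s * (h^-1 * (f (h *: v + (x + w s)) - f (x + w s)) - pd v f (x + w s)).
 by rewrite addrA; ring.
rewrite (eq_int _ uE); apply: cP.
 rewrite -(funext uE); apply: itgB => //.
 by apply: itgZ; exact: itgB.
by move=> s; exact: rP.
Qed.

Lemma partial_Av (k : T -> R) (w : T -> E) f i: itg nu k -> mfun w -> C1 f -> bsupp f ->
 'd_i (Av k w f) = Av k w ('d_i f).
move=> Ik mw Cf bf; apply/funext => x.
rewrite /partial; have [_ ->] := Av_is_derive x (dx i) Ik mw Cf bf; congr Av.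
by apply/funext => y; rewrite pd_dx.
Qed.

Lemma Av_smooth (k : T -> R) (w : T -> E) f: itg nu k -> mfun w -> Cc f -> smooth (Av k w f).
move=> Ik mw cf; apply/smoothP => j; elim: j f cf => [|j ih] f cf.
 by apply: Av_continuous => //; [exact: Cc_cts|exact: Cc_bsupp].
split.
 by apply: Av_continuous => //; [exact: Cc_cts|exact: Cc_bsupp].
split.
 by move=> x; have [] := Av_is_derive x (dx i) Ik mw (Cc_C1 cf) (Cc_bsupp cf).
by rewrite partial_Av//; [exact/ih/Cc_d|exact: Cc_C1|exact: Cc_bsupp].
Qed.

Lemma Av_bsupp (k : T -> R) (w : T -> E) f (M : R): bsupp f -> (forall s, M < `|w s| -> k s = 0) ->
 bsupp (Av k w f).
move=> /bsupp_gt0[N N0 fN] kM; exists (`|M| + N) => x xM.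
rewrite /Av int_eq0// => s.
have [wM|/kM ->] := leP `|w s| M; last by rewrite mul0r.
rewrite fN ?mulr0// => /ball0P => h; apply: xM.
apply/ball0P; rewrite -(addrK (w s) x).
by rewrite (le_lt_trans (ler_normB _ _)); have := ler_norm M; lra.
Qed.

Lemma Av_Cc (k : T -> R) (w : T -> E) f (M : R): itg nu k -> mfun w -> Cc f ->
 (forall s, M < `|w s| -> k s = 0) -> Cc (Av k w f).
by move=> Ik mw cf kM; split; [exact: Av_smooth|exact: Av_bsupp (Cc_bsupp cf) kM]. Qed.

(** Cauchy-Schwarz and Tonelli for averages with a nonnegative weight. *)
Lemma average_sq (k : T -> R) (u : T -> E -> R) (v : E -> R) (B : R):
 itg nu k -> (forall s, 0 <= k s) ->
 mfun (fun p : T * E => u p.1 p.2) -> mfun v ->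
 (forall s, k s != 0 -> sq mu (u s) /\ dot (u s) (u s) <= B) ->
 (forall x, v x = Rintegral nu setT (fun s => k s * u s x)) -> 0 <= B ->
 sq mu v /\ dot v v <= (Rintegral nu setT k) ^+ 2 * B.
move=> Ik k0 mu_ mv su vE B0.
set K := Rintegral nu setT k.
have K0: 0 <= K by exact: int_ge0.
have mk: mfun k := itg_meas Ik.
pose F (p : T * E) := (k p.1 * u p.1 p.2 ^+ 2)%:E.
have mF: mfun F.
 apply/measurable_EFinP; apply: measurable_funM; last exact: measurable_funX.
 exact: measurableT_comp measurable_fst.
have F0 p: (0 <= F p)%E by rewrite lee_fin mulr_ge0// sqr_ge0.
have mus s: mfun (fun x => u s x).
 exact: (measurableT_comp (f := fun p : T * E => u p.1 p.2) mu_ (measurable_pair1 s)).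
have mux x: mfun (fun s => u s x).
 exact: (measurableT_comp (f := fun p : T * E => u p.1 p.2) mu_ (measurable_pair2 x)).
have intF: (\int[mu]_x \int[nu]_s F (s, x) <= (K * B)%:E)%E.
 rewrite -(fubini_tonelli F mF F0).
 rewrite EFinM muleC int_EFin// -(integralZl measurableT Ik).
 apply: ge0_le_integral => //.
 - by move=> s _; apply: integral_ge0 => x _.
 - exact: measurable_fun_fubini_tonelli_F.
 - by apply/measurable_EFinP; exact: measurable_funM.
 - move=> s _; rewrite /F /=.
  have [ks0|/su[[ms Is] sB]] := eqVneq (k s) 0.
   by under eq_integral do rewrite ks0 mul0r; rewrite integral0 lee_fin mulr_ge0.
  rewrite -int_EFin; last exact: itgZ.
  by rewrite intZ// lee_fin mulrC ler_wpM2r.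
have mG: mfun (fun x => \int[nu]_s F (s, x))%E.
 exact: measurable_fun_fubini_tonelli_G.
have aeF: {ae mu, forall x, (\int[nu]_s F (s, x) \is a fin_num)%E}.
 have iG: mu.-integrable setT (fun x => \int[nu]_s F (s, x))%E.
  apply/integrableP; split => //.
  under eq_integral do rewrite gee0_abs ?integral_ge0//.
  by apply: le_lt_trans intF _; rewrite ltry.
 by have := integrable_ae measurableT iG; apply: filterS => x; apply.
have H: (\int[mu]_x ((v x) ^+ 2)%:E <= (K ^+ 2 * B)%:E)%E.
 apply: (@le_trans _ _ (\int[mu]_x (K%:E * \int[nu]_s F (s, x)))%E); last first.
  rewrite ge0_integralZl//; last by move=> x _; exact: integral_ge0.
  by rewrite -mulrA EFinM; apply: lee_wpmul2l.
 apply: ae_ge0_le_integral => //.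
 - by move=> x; rewrite lee_fin sqr_ge0.
 - by apply/measurable_EFinP; exact: measurable_funX.
 - by move=> x; rewrite mule_ge0// integral_ge0.
 - exact: measurable_funeM.
 apply: filterS aeF => x xF _.
 have I2: itg nu (fun s => k s * u s x ^+ 2).
  apply: itg_ge0P.
  - by apply: measurable_funM => //; exact: measurable_funX.
  - by move=> s; rewrite mulr_ge0// sqr_ge0.
  - by rewrite ltey_eq xF.
 have I1: itg nu (fun s => k s * u s x).
  apply: (itg_le (g := fun s => k s + k s * u s x ^+ 2)).
  - exact: measurable_funM.
  - move=> s; rewrite normrM (ger0_norm (k0 s)) -{2}(mulr1 (k s)) -mulrDr.
   by rewrite ler_wpM2l// ler_norml; nra.
  - exact: itgD.
 rewrite -int_EFin// lee_fin vE.
 have [K00|Kn0] := eqVneq K 0.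
  have k00 := int_eq0_ae Ik k0 K00.
  rewrite (@int_ae _ _ _ nu _ (fun=> 0)).
  - by rewrite int0 expr0n K00 mul0r.
  - exact: measurable_funM.
  - exact: measurable_cst.
  - by apply: filterS k00 => s + sT => /(_ sT) ->; rewrite mul0r.
 have Kp: 0 < K by lra.
 set a := Rintegral nu setT (fun s => k s * u s x).
 set b := Rintegral nu setT (fun s => k s * u s x ^+ 2).
 have : 0 <= Rintegral nu setT (fun s => k s * (u s x - a / K) ^+ 2) by apply: int_ge0 => s; rewrite mulr_ge0// sqr_ge0.
 rewrite (@eq_int _ _ _ _ _ (fun s => k s * u s x ^+ 2 + (- 2 * (a / K)) * (k s * u s x) + (a / K) ^+ 2 * k s)); last first.
  by move=> s; ring.
 rewrite intD//; [|apply: itgD => //; exact: itgZ|exact: itgZ].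
 rewrite intD//; last exact: itgZ.
 rewrite !intZ// -/a -/b -/K => h.
 have ->: a ^+ 2 = K * (b - (b + -2 * (a / K) * a + (a / K) ^+ 2 * K)) by field.
 by rewrite ler_pM2l// gerBl.
have sv: sq mu v.
 split => //; apply: itg_ge0P => //.
 - exact: measurable_funX.
 - by move=> x; rewrite sqr_ge0.
 - by apply: le_lt_trans H _; rewrite ltry.
split => //; rewrite -lee_fin int_EFin; last exact: sqM.
by [].
Qed.

(** Fubini for averages paired with a square integrable function. *)
Lemma average_ip (k : T -> R) (u : T -> E -> R) (v g : E -> R) (B : R):
 itg nu k ->
 mfun (fun p : T * E => u p.1 p.2) ->
 (forall s, k s != 0 -> sq mu (u s) /\ dot (u s) (u s) <= B) -> sq mu g ->
 mfun v -> (forall x, v x = Rintegral nu setT (fun s => k s * u s x)) -> 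
 dot v g = Rintegral nu setT (fun s => k s * dot (u s) g).
move=> Ik mu_ su sg mv vE.
have mk: mfun k := itg_meas Ik.
have [mg Ig] := sg.
pose F (p : T * E) := (k p.1 * u p.1 p.2 * g p.2)%:E.
have mF: mfun F.
 apply/measurable_EFinP; apply: measurable_funM; last exact: measurableT_comp measurable_snd.
 apply: measurable_funM => //.
 exact: measurableT_comp measurable_fst.
have mus s: mfun (fun x => u s x).
 exact: (measurableT_comp (f := fun p : T * E => u p.1 p.2) mu_ (measurable_pair1 s)).
have iF: (nu \x mu)%E.-integrable setT F.
 apply/(integrable12ltyP nu mu mF).
 apply: (@le_lt_trans _ _ (\int[nu]_s (`|k s| * (B + dot g g))%:E)%E).
  apply: ge0_le_integral => //.
  - by move=> s _; exact: integral_ge0.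
  - apply: (measurable_fun_fubini_tonelli_F (fun p => `|F p|%E)) => //.
   exact: (measurableT_comp (f := abse)).
  - by apply/measurable_EFinP; apply: measurable_funM => //; exact: measurableT_comp.
  - move=> s _; rewrite /F /=.
   have [ks0|/su[[ms Is] sB]] := eqVneq (k s) 0.
    under eq_integral do rewrite ks0 !mul0r normr0.
    by rewrite integral0 ks0 normr0 mul0r.
   apply: (@le_trans _ _ (\int[mu]_x (`|k s| * (u s x ^+ 2 + g x ^+ 2))%:E)%E).
    apply: ge0_le_integral => //.
    - by apply/measurable_EFinP; apply: measurableT_comp => //; apply: measurable_funM => //; exact: measurable_funM.
    - apply/measurable_EFinP; apply: measurable_funM => //.
     by apply: measurable_funD; exact: measurable_funX.
    - move=> x; rewrite lee_fin -mulrA normrM ler_wpM2l//.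
     by rewrite ler_norml; nra.
   rewrite -int_EFin; last by apply: itgZ; exact: itgD.
   rewrite intZ; last exact: itgD.
   rewrite lee_fin ler_wpM2l// intD// lerD//.
 rewrite -int_EFin ?ltry//; apply: itgZr; exact: itg_abs.
have := Fubini iF => FE.
have RE: Rintegral nu setT (fun s => k s * dot (u s) g) =
  fine (\int[nu]_s \int[mu]_x F (s, x))%E.
 congr fine; apply: eq_integral => s _; rewrite /F /=.
 have [ks0|/su[ss sB]] := eqVneq (k s) 0.
  by rewrite ks0 mul0r; under eq_integral do rewrite !mul0r; rewrite integral0.
 rewrite EFinM int_EFin; last exact: sqM.
 rewrite -(integralZl measurableT (sqM ss sg)).
 by apply: eq_integral => x; rewrite -EFinM mulrA.
rewrite RE FE; congr fine; apply: ae_eq_integral => //.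
- by apply/measurable_EFinP; exact: measurable_funM.
- exact: (measurable_fubini_G iF).
apply: filterS (ae_integrable2 iF) => x Ix _.
have [gx0|gx0] := eqVneq (g x) 0.
 rewrite gx0 mulr0; under eq_integral do rewrite /F gx0 mulr0.
 by rewrite integral0.
have Ik': itg nu (fun s => k s * u s x).
 have := integrableZl measurableT (g x)^-1 Ix; apply: eq_integrable => // s _.
 by congr EFin; field.
rewrite vE EFinM int_EFin// -(integralZr measurableT Ik').
by [].
Qed.
End averages.

(** * Mollifiers and test functions *)

Section smooth_cutoff_line.
Implicit Types (P Q : {poly R}) (t : R).

(** The functions P(1/t) exp(-1/t), extended by zero to t <= 0. *)
Definition expinv P t : R := if 0 < t then P.[t^-1] * expR (- t^-1) else 0.

Lemma poly_bound Q: exists2 C : R, 0 < C & forall u : R, 1 <= u -> `|Q.[u]| <= C * u ^+ (size Q).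
exists (\sum_(i < size Q) `|Q`_i| + 1); first by rewrite ltr_wpDl// sumr_ge0.
move=> u u1; rewrite horner_coef (le_trans (ler_norm_sum _ _ _))//.
have u0: 0 <= u by lra.
rewrite mulrDl mul1r mulr_suml -[leLHS]addr0 lerD ?exprn_ge0//.
apply: ler_sum => i; rewrite normrM ler_wpM2l// normrX ger0_norm//.
by rewrite ler_weXn2l// ltnW.
Qed.

Lemma expR_decay Q: exists2 C : R, 0 < C & forall u : R, 1 <= u ->
 `|Q.[u]| * expR (- u) <= C / u.
have [C C0 CP] := poly_bound Q; pose m := (size Q).+1.
have m0: 0 < m%:R :> R by [].
exists (C * m%:R ^+ m); first by rewrite mulr_gt0// exprn_gt0.
move=> u u1; have u0: 0 < u by lra.
have eu: (u / m%:R) ^+ m <= expR u.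
 have ->: expR u = expR (u / m%:R) ^+ m by rewrite -expRM_natl; congr expR; field; rewrite lt0r_neq0.
 rewrite lerXn2r ?nnegrE ?divr_ge0 ?expR_ge0 ?ltW//.
 have := expR_ge1Dx (u / m%:R); lra.
rewrite expRN ler_pdivrMr ?expR_gt0//.
apply: le_trans (CP u u1) _.
have mm0: 0 < m%:R ^+ m :> R by rewrite exprn_gt0.
apply: (@le_trans _ _ (C * m%:R ^+ m / u * (u / m%:R) ^+ m)); last first.
 by rewrite ler_wpM2l// divr_ge0 ?ltW// mulr_gt0.
rewrite expr_div_n {3}/m exprS; move: (m%:R ^+ m) mm0 (u ^+ size Q) => a a0 b.
rewrite le_eqVlt; apply/orP; left; apply/eqP; field.
by lra.
Qed.

Lemma is_derive_inv t: t != 0 -> is_derive t 1 (fun x : R => x^-1) (- t ^- 2).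
move=> t0; have := is_deriveV (f := id) t0 (is_derive_id t 1).
by rewrite [X in _ X]mulr1.
Qed.

Lemma expinv_derive P t: is_derive t 1 (expinv P) (expinv ('X^2 * (P - P^`())) t).
have [t0|t0|t0] := ltgtP 0 t.
- have H: is_derive t 1 (fun x : R => P.[x^-1] * expR (- x^-1)) (expinv ('X^2 * (P - P^`())) t).
  have d1 := is_derive_inv (lt0r_neq0 t0).
  have d2 := is_derive1_comp (is_derive_poly P t^-1) d1.
  have d3 := @is_derive1_comp _ expR (fun x : R => - x^-1) t _ _ (is_derive_expR (- t^-1)) (is_deriveN d1).
  have := is_derive_mul d2 d3.
  move=> H; apply: (is_derive_eq); rewrite /expinv t0 /=.
  rewrite hornerM hornerXn hornerD hornerN exprVn opprK.
  by lra.
 apply: near_eq_is_derive H; near=> x; rewrite /expinv ifT//.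
 near: x; exact: lt_nbhsr.
- apply: (@near_eq_is_derive _ _ _ (cst 0)).
  near=> x; rewrite /expinv ifF//; apply/negbTE; rewrite -leNgt ltW//.
  near: x; exact: lt_nbhsl.
 by rewrite /expinv ltNge ltW//=; exact: is_derive_cst.
- rewrite -t0 /expinv ltxx; apply/is_derive_epsP => e e0.
 have [C C0 CP] := expR_decay ('X * P).
 exists (Num.min 1 (e / C)); first by rewrite lt_min ltr01 divr_gt0.
 move=> h h0; rewrite lt_min => /andP[h1 he].
 rewrite ltxx addr0 [h%:A]mulr1 subr0 subr0; case: ifPn => hp; last by rewrite mulr0 normr0 ltW.
 rewrite gtr0_norm// in h1 he.
 have hi: 1 <= h^-1 by rewrite invf_ge1// ltW.
 have := CP _ hi; rewrite hornerM hornerX normrM -mulrA invrK => hC.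
 have ih0: 0 < h^-1 by lra.
 rewrite normrM normrM (gtr0_norm (expR_gt0 _)); apply: le_trans hC _.
 by rewrite mulrC -ler_pdivlMr// ltW.
Unshelve. all: by end_near. Qed.

Lemma expinvX2_ge0 t: 0 <= expinv 'X^2 t.
by rewrite /expinv; case: ifP => //; rewrite hornerXn mulr_ge0 ?expR_ge0// sqr_ge0. Qed.

End smooth_cutoff_line.

Section radial_bump.
Implicit Types (P : {poly R}).

Definition nsq (y : E) := \sum_i y 0 i ^+ 2.

Lemma coord_is_derive i j (x : E):
 is_derive x (dx j) (fun y : E => y 0 i) ((i == j)%:R).
apply/is_derive_epsP => e e0; exists 1 => // h h0 _.
by rewrite !mxE addrK mulKf// subrr normr0 ltW.
Qed.

Lemma smooth_coord i: smooth (fun y : E => y 0 i).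
have cc: continuous (fun y : E => y 0 i) by exact: coord_continuous.
apply/smoothP => -[|k] //; split => // j; split.
 by move=> x; have [] := coord_is_derive i j x.
have ->: 'd_j (fun y : E => y 0 i) = fun=> (i == j)%:R by apply/funext => x; rewrite /partial; have [_ ->] := coord_is_derive i j x.
exact: ksm_cst.
Qed.

Lemma smooth_nsq: smooth nsq.
by apply: smooth_sum => i; apply: smoothM; exact: smooth_coord. Qed.

Lemma partial_nsq i: 'd_i nsq = fun y => 2 * y 0 i.
apply/funext => x.
have H: is_derive x (dx i) nsq (2 * x 0 i).
 apply/is_derive_epsP => e e0; exists e => // h h0 he.
 have ->: nsq (h *: dx i + x) - nsq x = 2 * h * x 0 i + h ^+ 2.
  rewrite /nsq -sumrB (bigD1 i)//= big1 ?addr0.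
   by rewrite !mxE !eqxx /=; ring.
  by move=> j ji; rewrite !mxE (negPf ji) mulr0 add0r subrr.
 have ->: h^-1 * (2 * h * x 0 i + h ^+ 2) - 2 * x 0 i = h by field.
 exact: ltW.
by rewrite /partial; have [_ ->] := H.
Qed.

Lemma smooth_radial P (a : R): smooth (fun y : E => expinv P (a - nsq y)).
pose q y : R := a + (-1) * nsq y.
have sq_: smooth q by apply: smoothD; [exact: smooth_cst|apply: smoothZ; exact: smooth_nsq].
have ->: (fun y : E => expinv P (a - nsq y)) = fun y => expinv P (q y) by apply/funext => y; rewrite /q mulN1r.
have Cq := smooth_C1 sq_.
apply/smoothP => k; elim: k P => [|k ih] P.
 move=> x; apply: continuous_comp; first exact: Cq.1.
 apply/differentiable_continuous/derivable1_diffP.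
 by have [] := expinv_derive P (q x).
split.
 move=> x; apply: continuous_comp; first exact: Cq.1.
 apply/differentiable_continuous/derivable1_diffP.
 by have [] := expinv_derive P (q x).
split.
 by move=> x; have [] := partial_comp1 i x (expinv_derive P) Cq.
have ->: 'd_i (fun y => expinv P (q y)) =
  fun y => expinv ('X^2 * (P - P^`())) (q y) * 'd_i q y.
 by apply/funext => x; rewrite {1}/partial; have [_ ->] := partial_comp1 i x (expinv_derive P) Cq.
by apply: ksmM; [exact: ih|move/smoothP : (smooth_partial i sq_); exact].
Qed.

Lemma partial_radial P a i: 'd_i (fun y : E => expinv P (a - nsq y)) =
 fun y => - 2 * y 0 i * expinv ('X^2 * (P - P^`())) (a - nsq y).
pose q y : R := a + (-1) * nsq y.
have sq_: smooth q by apply: smoothD; [exact: smooth_cst|apply: smoothZ; exact: smooth_nsq].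
have ->: (fun y : E => expinv P (a - nsq y)) = fun y => expinv P (q y) by apply/funext => y; rewrite /q mulN1r.
apply/funext => x; rewrite {1}/partial.
have [_ ->] := partial_comp1 i x (expinv_derive P) (smooth_C1 sq_).
rewrite /q partial_add ?partial_mul ?partial_cst ?partial_nsq.
- by rewrite mulN1r; ring.
- by apply: smooth_C1; exact: smooth_cst.
- by apply: smooth_C1; exact: smooth_nsq.
- by apply: smooth_C1; exact: smooth_cst.
- by apply: smooth_C1; apply: smoothZ; exact: smooth_nsq.
Qed.

Lemma radial_support P e y: 0 < e -> ~ ball (0 : E) e y -> expinv P (e ^+ 2 - nsq y) = 0.
move=> e0 ey; rewrite /expinv ifF//; apply/negbTE; rewrite -leNgt subr_le0.
apply: contra_notT ey; rewrite -ltNge => ey; apply/rV_ballP; split => // i.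
rewrite mxE sub0r normrN -(ltr_pXn2r (n := 2))// ?nnegrE ?ltW// real_normK ?num_real//.
apply: le_lt_trans ey; rewrite /nsq (bigD1 i)//= lerDl sumr_ge0// => j _.
exact: sqr_ge0.
Qed.

Lemma radial_Cc P e: 0 < e -> Cc (fun y : E => expinv P (e ^+ 2 - nsq y)).
by split; [exact: smooth_radial|exists e => y; exact: radial_support].
Qed.

Lemma int_gt0 (f : E -> R) x: continuous f -> itg mu f -> (forall x, 0 <= f x) -> 0 < f x ->
 0 < int f.
move=> cf If f0 fx; have fx2: 0 < f x / 2 by rewrite divr_gt0.
have := cf x => /cvgrPdist_lt /(_ _ fx2) /nbhs_ballP[r /= r0 rP].
have mB := @meas_ball R n x r.
have IB: itg mu (\1_(ball x r)).
 apply: itg_indic => //; apply/bddP; exists (`|x| + r).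
  by rewrite ltr_wpDl.
 move=> y /ballP xy; apply/ball0P.
 rewrite -(subKr x y) (le_lt_trans (ler_normB _ _)); lra.
apply: (@lt_le_trans _ _ (f x / 2 * int \1_(ball x r))); last first.
 rewrite -intZ//; apply: int_le => //; first exact: itgZ.
 move=> y; rewrite indicE; have [By|By] := pselect (ball x r y).
  rewrite mem_set// mulr1; have := rP _ By; rewrite ltr_norml => /andP[]; lra.
 by rewrite memNset// mulr0.
rewrite mulr_gt0// -lte_fin int_EFin// integral_indic// setIT.
by have /= -> := lebesgue_rV_ball x r0; rewrite lte_fin exprn_gt0// mulrn_wgt0.
Qed.

(** Radial mollifiers. The potential M, with grad M(y) = y rho(y), makes the mean
  value property of harmonic functions an integration by parts. *)
Record mollifier e (rho : E -> R) : Prop := Mollifier {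
 moll_Cc : Cc rho;
 moll_ge0 : forall y, 0 <= rho y;
 moll_int : int rho = 1;
 moll_supp : forall y, ~ ball 0 e y -> rho y = 0;
 moll_even : forall y, rho (- y) = rho y;
 moll_pot : exists M, [/\ Cc M, forall y, ~ ball 0 e y -> M y = 0 &
  forall i y, 'd_i M y = y 0 i * rho y] }.

Lemma mollifier_exists e: 0 < e -> exists rho, mollifier e rho.
move=> e0; pose f y := expinv 'X^2 (e ^+ 2 - nsq y).
have cf: Cc f by exact: radial_Cc.
have I0: 0 < int f.
 apply: (@int_gt0 f 0); [exact: Cc_cts|exact: Cc_itg|by move=> y; exact: expinvX2_ge0|].
 rewrite /f /nsq big1 ?subr0; last by move=> i; rewrite mxE expr0n.
 have e2: 0 < e ^+ 2 by rewrite exprn_gt0.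
 by rewrite /expinv e2 hornerXn mulr_gt0 ?expR_gt0// exprn_gt0// invr_gt0.
set I := int f in I0.
exists (fun y => I^-1 * f y); split.
- exact: CcZ.
- by move=> y; apply: mulr_ge0; [rewrite invr_ge0 ltW|exact: expinvX2_ge0].
- by rewrite intZ; [rewrite -/I mulVf// gt_eqF|exact: Cc_itg].
- by move=> y ey; rewrite /f radial_support// mulr0.
- move=> y; rewrite /f (_ : nsq (- y) = nsq y)//.
 by apply: eq_bigr => i; rewrite mxE sqrrN.
- exists (fun y => (- 2 * I)^-1 * expinv 1 (e ^+ 2 - nsq y)); split.
  by apply: CcZ; exact: radial_Cc.
  by move=> y ey; rewrite radial_support// mulr0.
 move=> i y; rewrite partial_mul.
 + rewrite partial_cst mul0r add0r partial_radial derivC subr0 mulr1 /f.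
  by lra.
 + by apply: smooth_C1; exact: smooth_cst.
 + by apply: Cc_C1; exact: radial_Cc.
Qed.

End radial_bump.

Lemma measurable_rVD: mfun (fun p : E * E => p.1 + p.2).
apply: measurable_fun_rV => i; under eq_fun do rewrite mxE.
by apply: measurable_funD; apply: (measurableT_comp (measurable_coord i)).
Qed.
Lemma measurable_rVN: mfun (fun x : E => - x).
apply: measurable_fun_rV => i; under eq_fun do rewrite mxE.
by apply: measurable_funN; exact: measurable_coord.
Qed.

(** L2 functions vanishing outside of a bounded set: they can be mollified and translated. *)
Definition Lb f := sq mu f /\ bsupp f.

Lemma Lb_sq f: Lb f -> sq mu f. Proof. by case. Qed.
Lemma Lb_itg f: Lb f -> itg mu f.
by move=> [sf [M fM]]; exact: sq_itg fM. Qed.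
Lemma Lb_Cc f: Cc f -> Lb f.
by split; [exact: Cc_sq|exact: Cc_bsupp]. Qed.

Definition moll rho g := Av mu rho (id : E -> E) g.

Lemma moll_AvE e rho g: mollifier e rho -> itg mu g -> moll rho g = Av mu g -%R rho.
move=> mr Ig; apply/funext => x; rewrite /moll /Av.
have [c c0 rc] := bsupp_bounded (Cc_cts (moll_Cc mr)) (Cc_bsupp (moll_Cc mr)).
have I1: itg mu (fun s => g s * rho (x - s)).
 apply: (itg_mul_bounded (c := c)) => //.
 have := measurableT_comp (Cc_meas (moll_Cc mr)) (measurableT_comp (measurable_shift x) measurable_rVN).
 by congr measurable_fun; apply/funext => s; rewrite addrC.
rewrite -(int_shift x I1); apply: eq_int => s.
rewrite mulrC [s + x]addrC; congr (_ * _).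
by rewrite opprD addrA subrr sub0r (moll_even mr).
Qed.

Lemma moll_smooth e rho g: mollifier e rho -> Lb g -> Cc (moll rho g).
move=> mr lg; rewrite (moll_AvE mr (Lb_itg lg)).
have [_ [M gM]] := lg.
apply: (Av_Cc (M := M)); [exact: Lb_itg|exact: measurable_rVN|exact: moll_Cc mr|].
move=> s; rewrite normrN => Ms; apply: gM => /ball0P; lra.
Qed.

Lemma moll_sq e rho g: mollifier e rho -> Lb g -> dot (moll rho g) (moll rho g) <= dot g g.
move=> mr lg; have [sg bg] := lg.
have mD: mfun (fun p : E * E => g (p.2 + p.1)).
 apply: (measurableT_comp (f := g)); first exact: sg.1.
 by have := measurable_rVD; congr measurable_fun; apply/funext => p; rewrite addrC.
have sB s: rho s != 0 -> sq mu (fun x => g (x + s)) /\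
  dot (fun x => g (x + s)) (fun x => g (x + s)) <= dot g g.
 by split; [exact: (sq_shift)|rewrite (ip_shift)].
have [_] := @average_sq _ _ mu rho (fun s x => g (x + s)) (moll rho g) (dot g g)
 (Cc_itg (moll_Cc mr)) (moll_ge0 mr) mD
 (Cc_meas (moll_smooth mr lg)) sB (fun=> erefl) (ip_ge0 _ _).
by rewrite (moll_int mr) expr1n mul1r.
Qed.

Lemma partial_moll e rho g i: mollifier e rho -> Lb g ->
 'd_i (moll rho g) = fun x => int (fun s => g s * 'd_i rho (x - s)).
move=> mr lg; rewrite (moll_AvE mr (Lb_itg lg)) partial_Av//.
- exact: Lb_itg.
- exact: measurable_rVN.
- exact: Cc_C1 (moll_Cc mr).
- exact: Cc_bsupp (moll_Cc mr).
Qed.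

Lemma partial_partial_moll e rho g i j: mollifier e rho -> Lb g ->
 'd_j ('d_i (moll rho g)) =
 fun x => int (fun s => g s * 'd_j ('d_i rho) (x - s)).
move=> mr lg; have cr := moll_Cc mr; rewrite (moll_AvE mr (Lb_itg lg)).
rewrite !partial_Av//; try exact: measurable_rVN; try exact: Lb_itg;
 [exact: Cc_C1 (Cc_d _ cr)|exact: Cc_bsupp (Cc_d _ cr)|exact: Cc_C1|exact: Cc_bsupp].
Qed.

Lemma moll_cst e rho g x (c : R): mollifier e rho -> (forall y, ball x e y -> g y = c) ->
 moll rho g x = c.
move=> mr gc; rewrite /moll /Av (@eq_int _ _ _ _ _ (fun s => c * rho s)).
 by rewrite intZ ?(moll_int mr) ?mulr1//; exact: Cc_itg (moll_Cc mr).
move=> s; have [se|se] := pselect (ball 0 e s); last by rewrite (moll_supp mr se) mul0r mulr0.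
rewrite gc 1?mulrC//; apply/ballP; rewrite opprD addrA subrr.
by have /ballP := se.
Qed.

Lemma moll_ge0' e rho g x: mollifier e rho -> (forall y, 0 <= g y) -> 0 <= moll rho g x.
by move=> mr g0; apply: int_ge0 => s; rewrite mulr_ge0// (moll_ge0 mr). Qed.
Lemma moll_itg e rho g x: mollifier e rho -> Lb g -> itg mu (fun s => rho s * g (x + s)).
move=> mr lg; apply: sqM; first exact: Cc_sq (moll_Cc mr).
by under eq_fun do rewrite addrC; exact: (sq_shift x (Lb_sq lg)).
Qed.

Lemma moll_le1 e rho g x: mollifier e rho -> Lb g -> (forall y, g y <= 1) -> moll rho g x <= 1.
move=> mr lg g1; rewrite -(moll_int mr); apply: int_le.
- exact: (moll_itg x mr).
- exact: Cc_itg (moll_Cc mr).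
- by move=> s; rewrite ler_piMr// (moll_ge0 mr).
Qed.

(** The erosion of U by balls of radius r. *)
Definition er U r : set E := [set x | ball x r `<=` U].

Lemma erW U r s: s <= r -> er U r `<=` er U s.
by move=> sr x xU y xy; apply: xU; exact: le_ball xy. Qed.
Lemma er_sub U r: 0 < r -> er U r `<=` U.
by move=> r0 x; apply; exact: ballxx. Qed.
Lemma er_ball U r s x y: er U (r + s) x -> `|x - y| < s -> er U r y.
move=> xU xy z /ballP yz; apply: xU; apply/ballP.
by rewrite -(subrKA y) (le_lt_trans (ler_normD _ _)); lra.
Qed.

Lemma er_closed U r: closed (er U r).
move=> x clx y xy; have /ballP xyr := xy.
have d0: 0 < r - `|x - y| by lra.
have [z [zU /ballP xz]] := clx _ (nbhsx_ballx x _ d0).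
apply: zU; apply/ballP; rewrite -(subrKA x) (le_lt_trans (ler_normD _ _))//.
rewrite distrC; lra.
Qed.

Lemma open_er U x: open U -> U x -> exists2 r, 0 < r & er U r x.
by move=> oU Ux; have /nbhs_ballP[r] := open_nbhs_nbhs (conj oU Ux); exists r. Qed.

Lemma compact_er U (K : set E): compact K -> open U -> K `<=` U ->
 exists2 r, 0 < r & K `<=` er U r.
move=> cK oU KU.
have [] := (compact_near_coveringP K).1 cK R 0^'+ (fun r x => er U r x) _.
 move=> x /KU Ux; have [r r0 rx] := open_er oU Ux; have r20: 0 < r / 2 by rewrite divr_gt0.
 exists (ball x (r/2), [set s | s < r / 2]) => /=.
  by split; [exact: nbhsx_ballx|exact: nbhs_right_lt].
 move=> [y s] /= [/ballP xy sr]; apply: (er_ball (s := r / 2) _ xy).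
 by apply: erW rx; lra.
move=> r /= r0 H; exists (r / 2); first by rewrite divr_gt0.
by apply: H => /=; [rewrite sub0r normrN gtr0_norm; lra|lra].
Qed.

Lemma tsupport_sub (C : set E) f: closed C -> (forall x, ~ C x -> f x = 0) -> tsupport f `<=` C.
move=> cC fC; rewrite /tsupport closureE; apply: smallest_sub => //.
by move=> x /eqP fx; apply: contrapT => /fC.
Qed.
Lemma tsupport0 f x: ~ tsupport f x -> f x = 0.
by move=> nx; apply: contrapT => /eqP fx; apply: nx; exact: subset_closure. Qed.

Definition Ct U f := Cc f /\ tsupport f `<=` U.

Lemma Ct_out U f x: Ct U f -> ~ U x -> f x = 0.
by move=> [_ fU] nU; apply: tsupport0 => /fU. Qed.
Lemma Ct_sub U V f: U `<=` V -> Ct U f -> Ct V f.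
by move=> UV [cf]; split => //; exact: subset_trans UV. Qed.
Lemma Ct_er U r f: 0 < r -> Cc f -> (forall x, ~ er U r x -> f x = 0) -> Ct U f.
move=> r0 cf fU; split => //; apply: subset_trans (er_sub r0).
by apply: tsupport_sub; first exact: er_closed.
Qed.

Lemma bsupp_tsupport f: bsupp f -> compact (tsupport f).
move=> /bsupp_gt0[M M0 fM]; apply: (@subclosed_compact _ _ [set x : E | `|x| <= M]).
- exact: closed_closure.
- exact: closed_ball_compact.
apply: tsupport_sub.
 exact: compact_closed (@norm_hausdorff _ _) (@closed_ball_compact M).
move=> x xM; apply: fM => /ball0P => /ltW; exact: xM.
Qed.

Lemma Ct_erP U f: open U -> Ct U f -> exists2 r, 0 < r & forall x, ~ er U r x -> f x = 0.
move=> oU [[sf bf] fU]; have [r r0 rP] := compact_er (bsupp_tsupport bf) oU fU.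
by exists r => // x nx; apply: tsupport0 => /rP.
Qed.
Lemma Ct_tsub U f g: Ct U f -> Cc g -> (forall x, f x = 0 -> g x = 0) -> Ct U g.
move=> [cf fU] cg fg; split => //; apply: subset_trans fU.
by apply: closure_subset => x; apply: contra_neq; exact: fg.
Qed.

Lemma Ct_d U i f: Ct U f -> Ct U ('d_i f).
move=> [cf fU]; split; first exact: Cc_d.
by apply: subset_trans fU; exact: tsupport_partial.
Qed.
Lemma CtD U f g: Ct U f -> Ct U g -> Ct U (f +' g).
move=> [cf fU] [cg gU]; split; first exact: CcD.
apply: (subset_trans (B := tsupport f `|` tsupport g)); last by rewrite subUset.
apply: tsupport_sub; first by apply: closedU; exact: closed_closure.
by move=> x /not_orP[/tsupport0 -> /tsupport0 ->]; rewrite addr0.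
Qed.
Lemma CtZ U a f: Ct U f -> Ct U (fun x => a * f x).
by move=> cf; apply: (Ct_tsub cf (CcZ a cf.1)) => x ->; rewrite mulr0. Qed.
Lemma CtM U f g: smooth f -> Ct U g -> Ct U (f *' g).
by move=> sf cg; apply: (Ct_tsub cg (CcM sf cg.1)) => x ->; rewrite mulr0. Qed.
Lemma Ct0 U: Ct U (fun=> 0).
split; first exact: Cc0.
by apply: (subset_trans (tsupport_sub (C := set0) _ _)) => //; exact: closed0.
Qed.
Lemma Ct_sum U (I : Type) (r : seq I) (F : I -> E -> R):
 (forall i, Ct U (F i)) -> Ct U (fun x => \sum_(i <- r) F i x).
move=> cF; elim: r => [|a s ih].
 by under eq_fun do rewrite big_nil; exact: Ct0.
by under eq_fun do rewrite big_cons; exact: CtD.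
Qed.

Lemma Ct_moll_kernel U e rho x: 0 < e -> mollifier e rho -> er U (e + e) x ->
 Ct U (fun s => rho (x - s)).
move=> e0 mr xU; have cr := moll_Cc mr; apply: (Ct_er (r := e)) => //.
 have := Cc_shift (- x) cr; congr Cc; apply/funext => s.
 by rewrite -(moll_even mr) opprB.
move=> s sU; apply: (moll_supp mr) => /ball0P => xs.
by apply: sU; exact: er_ball xs.
Qed.

Lemma indic_Lb (A : set E): measurable A -> bounded_set A -> Lb \1_A.
move=> mA /bddP[M M0 AM]; have aM x: ~ ball 0 M x -> \1_A x = 0 :> R.
 by move=> nx; rewrite indicE memNset// => /AM.
split; last by exists M.
apply: (sq_bounded (M := M) (c := 1)) => //.
by move=> x; rewrite ger0_norm// leq_b1.
Qed.

Lemma cutoff_er O r: 0 < r -> bounded_set O -> exists2 k, Ct O k &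
 [/\ forall x, 0 <= k x <= 1, forall x, er O (r *+ 3) x -> k x = 1 &
   forall x, ~ O x -> k x = 0].
move=> r0 bO; have [rho mr] := @mollifier_exists r r0.
have mA: measurable (er O (r *+ 2)) by apply: closed_meas; exact: er_closed.
have r20: 0 < r *+ 2 by lra.
have bA: bounded_set (er O (r *+ 2)) by move/bddP: bO => [M M0 OM]; apply/bddP; exists M => // x /(er_sub r20) /OM.
have lA := indic_Lb mA bA.
have kO: Ct O (moll rho \1_(er O (r *+ 2))).
 apply: (Ct_er (r := r)) => //; first exact: moll_smooth mr lA.
 move=> x nx; apply: (moll_cst mr) => y /ballP xy; rewrite indicE memNset// => yO.
 by apply: nx; apply: (er_ball yO); rewrite distrC.
exists (moll rho \1_(er O (r *+ 2))) => //; split.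
- move=> x; apply/andP; split; first exact: (moll_ge0' x mr).
 by apply: (moll_le1 x mr lA) => y.
- move=> x xO; apply: (moll_cst mr) => y /ballP xy; rewrite indicE mem_set//.
 by apply: (er_ball (s := r) _ xy); rewrite -mulrSr.
- by move=> x; exact: Ct_out.
Qed.

Lemma cutoff (K O : set E): compact K -> open O -> K `<=` O ->
 exists2 k, Ct O k & [/\ forall x, 0 <= k x <= 1 & exists2 r, 0 < r & forall x y, K x -> ball x r y -> k y = 1].
move=> cK oO KO; have [M M0 KM] := compact_bounded_ball cK.
pose O' := O `&` ball 0 M.
have [r r0 rP] := @compact_er O' K cK (openI oO (@ball_open _ _ _ _ )) (fun x Kx => conj (KO x Kx) (KM x Kx)).
have r40: 0 < r / 4 by lra.
have bO': bounded_set O' by apply/bddP; exists M => // x [].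
have [k kO [k01 k1 _]] := cutoff_er r40 bO'.
exists k; first by apply: Ct_sub kO => x [].
split => //; exists (r / 4) => // x y /rP xr /ballP xy; apply: k1.
apply: (er_ball (s := r / 4) (x := x)) => //; apply: erW xr; lra.
Qed.

Lemma measurable_rV_open: @measurable _ E = <<s open >>.
apply/seteqP; split; last first.
 apply: smallest_sub; first exact: sigma_algebra_measurable.
 by exact: open_meas.
apply: smallest_sub; first exact: smallest_sigma_algebra.
rewrite -bigcup_seq => _ [i _ [B mB <-]]; rewrite setTI.
pose P (B : set R) := <<s (open : set (set E)) >> ((fun x : E => x 0 i) @^-1` B).
suff : @measurable _ (RR) `<=` P by apply.
rewrite [X in X `<=` _](RGenOInfty.measurableE).
apply: smallest_sub.
 have [s0 sC sU] := smallest_sigma_algebra (setT : set E) (open : set (set E)).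
 split; first by rewrite /P preimage_set0.
 - by move=> PA; exact: sC.
 - by move=> PF; exact: sU.
move=> _ [a ->]; apply: sub_sigma_algebra.
by apply: open_comp => [x _|]; [exact: coord_continuous|exact: interval_open].
Qed.

(** Fundamental lemma of the calculus of variations. *)
Lemma fundamental U g: open U -> itg mu g ->
 (forall h, Ct U h -> int (g *' h) = 0) ->
 {ae mu, forall x, U x -> g x = 0}.
move=> oU Ig g0; have mU := open_meas oU.
have mg := itg_meas Ig.
have IgU: itg mu (\1_U *' g).
 apply: (itg_le (g := fun x => `|g x|)) (itg_abs Ig).
  by apply: measurable_funM => //.
 by move=> x; rewrite normrM ger0_norm// ler_piMl// leq_b1.
suff H: ae_eq mu setT (\1_U *' g) (cst 0) by apply: filterS H => x /(_ I) + Ux; rewrite indicE mem_set// mul1r.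
apply: (pi_system_ae0 measurable_rV_open) => //.
- by exact: openI.
- exact: openT.
move=> A oA; pose O k := A `&` U `&` ball (0 : E) k%:R.
have bO k: bounded_set (O k).
 apply/bddP; exists k.+1%:R => // x [_ /ballP xk].
 by apply/ballP; rewrite (lt_trans xk)// ltr_nat.
have i0 k: 0 < k.+1%:R^-1 :> R by [].
have ex k: exists f, [/\ Ct (O k) f, forall x, 0 <= f x <= 1,
  forall x, er (O k) (k.+1%:R^-1 *+ 3) x -> f x = 1 & forall x, ~ O k x -> f x = 0].
 by have [f c [a]] := cutoff_er (i0 k) (bO k); exists f.
have [F FP] := choice ex.
have OU k: O k `<=` U by move=> x [[]].
have H: int (fun x => g x * F k x) @[k --> \oo] -->
  int (fun x => \1_A x * (\1_U x * g x)).
 apply: (@int_dct _ _ _ _ _ _ (fun x => `|g x|)).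
 - move=> k; have [fk _ _ _] := FP k; apply: measurable_funM => //.
  exact: Cc_meas fk.1.
 - apply: measurable_funM; first exact: measurable_indic (open_meas oA).
  exact: itg_meas IgU.
 - exact: itg_abs.
 - move=> k x; have [_ f01] := FP k; rewrite normrM ler_piMr//.
  by have /andP[f0] := f01 x; rewrite ger0_norm.
 - move=> x; have [[Ax Ux]|nx] := pselect ((A `&` U) x); last first.
   rewrite (_ : _ * _ = 0); last first.
    rewrite !indicE; case: (boolP (x \in A)) => xA; last by rewrite mul0r.
    case: (boolP (x \in U)) => xU; last by rewrite mul0r mulr0.
    by exfalso; apply: nx; split; [rewrite inE in xA|rewrite inE in xU].
   apply: (@cvg_eventually R _ _ 0%N) => k _; have [_ _ _ f0] := FP k.
   by rewrite f0 ?mulr0// => -[].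
  rewrite !indicE !mem_set// !mul1r.
  have [r r0 rx] := open_er (openI oA oU) (conj Ax Ux).
  pose N := (Num.truncn (3 / r) + Num.truncn (`|x| + r)).+2.
  apply: (@cvg_eventually R _ _ N) => k Nk; have [_ _ f1 _] := FP k.
  have kN: N%:R <= k.+1%:R :> R by rewrite ler_nat (leq_trans Nk).
  have h1 := truncnS_gt (3 / r); have h2 := truncnS_gt (`|x| + r).
  rewrite /N -2!addSn natrD -addn1 natrD in kN.
  have t1: 0 <= (Num.truncn (3 / r))%:R :> R by [].
  have t2: 0 <= (Num.truncn (`|x| + r))%:R :> R by [].
  rewrite -(natr1 (Num.truncn (3 / r))) in h1.
  rewrite -(natr1 (Num.truncn (`|x| + r))) in h2.
  rewrite -(natr1 (Num.truncn (3 / r))) -(natr1 k) in kN.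
  have k1: 3 / r < k%:R + 1 by lra.
  have k2: `|x| + r < k%:R by lra.
  rewrite f1 ?mulr1// => y /ballP xy.
  have xyr: `|x - y| < r.
   apply: lt_le_trans xy _; rewrite -(mulr_natl _ 3) -(natr1 k) ler_pdivrMr ?ltr_wpDl// mulrC.
   by move: k1; rewrite ltr_pdivrMr// => /ltW.
  split; first by apply: rx; apply/ballP.
  apply/ball0P; rewrite -(subKr x y).
  by rewrite (le_lt_trans (ler_normB _ _)); lra.
have H0: int (fun x => g x * F k x) @[k --> \oo] --> (0 : R).
 apply: (@cvg_eventually R _ _ 0%N) => k _; apply: g0; have [fk _ _ _] := FP k.
 exact: Ct_sub fk.
exact: cvg_unique H0.
Qed.

(** * Density and translations in L2 *)

Section segments.
Implicit Types (h : R).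

Definition seg h v f := Av leb \1_`[0, h] (fun s : RR => (s : R) *: v) f.

Lemma seg_k h: 0 <= h -> itg leb (\1_`[0, h] : RR -> R) /\
 Rintegral leb setT (\1_`[0, h] : RR -> R) = h.
move=> h0; have mI: measurable (`[0, h]%classic : set (RR)) by exact: measurable_itv.
have E1: (\int[leb]_x (\1_`[0, h] x)%:E)%E = h%:E.
 rewrite integral_indic// setIT.
 apply: (etrans (@lebesgue_measure_itv R `[0, h])); rewrite /= lte_fin.
 have [->|h1] := eqVneq h 0; first by rewrite ltxx.
 by rewrite lt_neqAle eq_sym h1 h0 oppr0 adde0.
split; last by rewrite /Rintegral E1.
apply: itg_ge0P; first exact: measurable_indic.
 by [].
by rewrite E1 ltry.
Qed.

Lemma measurable_ray v: mfun (fun s : RR => (s : R) *: v).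
apply: measurable_fun_rV => i; under eq_fun do rewrite mxE.
exact: measurable_funM.
Qed.

Lemma seg_Cc h v f: 0 <= h -> Cc f -> Cc (seg h v f).
move=> h0 cf; apply: (Av_Cc (M := h * `|v|)); [exact: (seg_k h0).1|exact: measurable_ray|by []|].
move=> s hs; rewrite indicE memNset//= in_itv/= => /andP[s0 sh].
move: hs; rewrite normrZ ger0_norm// ltNge => /negP; apply.
by rewrite ler_wpM2r.
Qed.

Lemma partial_seg h v f i: 0 <= h -> Cc f -> 'd_i (seg h v f) = seg h v ('d_i f).
move=> h0 cf; apply: partial_Av; [exact: (seg_k h0).1|exact: measurable_ray|exact: Cc_C1|exact: Cc_bsupp].
Qed.

Lemma pd_seg h v f (w : E): 0 <= h -> Cc f -> pd w (seg h v f) = seg h v (pd w f).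
move=> h0 cf; apply/funext => x.
have [_ d1] := Av_is_derive x w (seg_k h0).1 (measurable_ray v) (Cc_C1 cf) (Cc_bsupp cf).
have [_ d2] := C1_is_derive x w (Cc_C1 (seg_Cc v h0 cf)).
by rewrite -d2 /seg d1.
Qed.

Lemma seg_ftc h v f: 0 < h -> Cc f -> seg h v (pd v f) = fun x => f (x + h *: v) - f x.
move=> h0 cf; apply/funext => x; rewrite (C1_ftc x v h0 (Cc_C1 cf)) /seg /Av.
rewrite [RHS]Rintegral_mkcond; apply: eq_int => s; rewrite patchE indicE.
by case: ifP; rewrite ?mul1r ?mul0r.
Qed.

Lemma seg_nm h v f: 0 <= h -> Cc f -> nm (seg h v f) <= h * nm f.
move=> h0 cf; apply: nm_le; first by rewrite mulr_ge0 ?nm_ge0.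
have [Ik kh] := seg_k h0; rewrite exprMn nm_sq.
have mD: mfun (fun p : RR * E => f (p.2 + (p.1 : R) *: v)).
 apply: (measurableT_comp (f := f)); first exact: Cc_meas.
 have mp: mfun (fun p : RR * E => (p.2, (p.1 : R) *: v)).
  apply/measurable_fun_pair => /=; first exact: measurable_snd.
  exact: (measurableT_comp (measurable_ray v)).
 exact: (measurableT_comp (@measurable_rVD) mp).
have sf := Cc_sq cf.
have sB (s : R) : \1_`[0, h] s != 0 :> R -> sq mu (fun x => f (x + s *: v)) /\
  dot (fun x => f (x + s *: v)) (fun x => f (x + s *: v)) <= dot f f.
 by split; [exact: (sq_shift (s *: v))|rewrite (ip_shift (s *: v))].
have k0 (s : RR) : 0 <= \1_`[0, h] s :> R by [].
have [_] := @average_sq _ _ leb (\1_`[0, h]) (fun s x => f (x + s *: v))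
 (seg h v f) (dot f f) Ik k0 mD (Cc_meas (seg_Cc v h0 cf)) sB (fun=> erefl) (ip_ge0 _ _).
by rewrite kh.
Qed.

Lemma translation_nm v f: Cc f -> nm (fun x => f (x + v) - f x) <= nm (pd v f).
move=> cf; have := seg_ftc v ltr01 cf; under [RHS]eq_fun do rewrite scale1r.
by move=> <-; have := seg_nm v ler01 (Cc_pd v cf); rewrite mul1r.
Qed.

Lemma pd_nm v f: Cc f -> nm (pd v f) <= `|v| * \sum_i nm ('d_i f).
move=> cf; rewrite mulr_sumr.
have H (s : seq 'I_n) : nm (fun x => \sum_(i <- s) v 0 i * 'd_i f x) <= \sum_(i <- s) `|v| * nm ('d_i f).
 elim: s => [|a s ih].
  by rewrite big_nil /L2norm /ip int_eq0 ?sqrtr0// => x; rewrite big_nil mul0r.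
 have sp i: sq mu ('d_i f) := sq_d i cf.
 rewrite big_cons; under eq_fun do rewrite big_cons.
 apply: le_trans (nmD (sqZ _ (sp a)) (sq_sum _ (fun i => sqZ _ (sp i)))) _.
 by rewrite lerD// nmZ// ler_wpM2r ?nm_ge0// rV_norm_coord.
exact: H.
Qed.

(** Test functions are dense: a bounded linear form on them is represented by a
  Cauchy sequence of test functions, and the limit is identified by the
  fundamental lemma. *)
Lemma fundamental_sq (U : set E) g: open U -> sq mu g ->
 (forall f, Ct U f -> dot g f = 0) -> {ae mu, forall x, U x -> g x = 0}.
move=> oU sg g0.
pose B k := ball (0 : E) k.+1%:R.
have oB k: open (U `&` B k) by apply: openI => //; exact: ball_open.
have mB k := open_meas (oB k).
have bB k: bounded_set (U `&` B k) by apply/bddP; exists k.+1%:R => [].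
have H k: {ae mu, forall x, (U `&` B k) x -> g x * \1_(U `&` B k) x = 0}.
 have lI := indic_Lb (mB k) (bB k).
 apply: (fundamental (oB k) (sqM sg (Lb_sq lI))) => h ch.
 rewrite -[RHS](g0 _ (Ct_sub (@subIsetl _ _ _) ch)); apply: eq_int => x.
 have [xU|xU] := pselect ((U `&` B k) x); first by rewrite indicE mem_set// mulr1.
 by rewrite (Ct_out ch xU) !mulr0.
have /ae_foralln : forall k, {ae mu, forall x, (U `&` B k) x -> g x * \1_(U `&` B k) x = 0} := H.
apply: filterS => x Hx Ux.
have UBx: (U `&` B (Num.truncn `|x|)) x by split => //; apply/ball0P; rewrite truncnS_gt.
by have := Hx _ UBx; rewrite indicE mem_set// mulr1.
Qed.

Lemma Cc_dense g: sq mu g -> forall e, 0 < e -> exists2 f, Cc f & nm (f -' g) < e.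
move=> sg.
have C0: 0 < dot g g + 1 by rewrite ltr_wpDl// ip_ge0.
have [v [cv vc vl]] := @riesz_cauchy R (E -> R) (fun a u w x => a * u x + w x) (@Cc) (dot)
 (dot g) (dot g g + 1) (fun=> 0) (@Cc0) C0 (fun a u w cu cw => CcD (CcZ a cu) cw)
 (ipC mu) (fun a u w t cu cw ct => etrans (ipDl (sqZ a (Cc_sq cu)) (Cc_sq cw) (Cc_sq ct))
   (congr1 (fun t => t + _) (ipZl a (Cc_sq cu) (Cc_sq ct)))) (fun u _ => ip_ge0 mu u) 
 ltac:(by move=> a u w cu cw; rewrite ipC ipDl ?ipZl ?(ipC mu g)//; first [exact: Cc_sq|exact/sqZ/Cc_sq])
 ltac:(by move=> u cu; rewrite (le_trans (CS sg (Cc_sq cu)))// ler_wpM2r ?ip_ge0// lerDl).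
have E1 i j: dist2 mu (v i) (v j) <= 2 / i.+1%:R + 2 / j.+1%:R by have := vc i j; congr (_ <= _); apply: eq_int => x; ring.
have cau: cauchy2 mu v.
 move=> e e0; exists (Num.truncn (4 / e)) => i j Ni Nj; apply: le_lt_trans (E1 i j) _.
 have H k: (Num.truncn (4 / e) <= k)%N -> 2 / k.+1%:R < e / 2.
  move=> Nk; have h := truncnS_gt (4 / e).
  have h2: (Num.truncn (4 / e)).+1%:R <= k.+1%:R :> R by rewrite ler_nat ltnS.
  have := lt_le_trans h h2; rewrite !ltr_pdivrMr// => h3.
  by lra.
 by have := ltrD (H i Ni) (H j Nj); rewrite -splitr.
have [f sf vf] := L2_complete (fun k => Cc_sq (cv k)) cau.
have fg0 (h : E -> R) : Cc h -> dot (f -' g) h = 0.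
 move=> ch; have sh := Cc_sq ch.
 apply/eqP; rewrite -normr_le0; apply/ler_addgt0Pl => e e0; rewrite addr0.
 pose c := dot h h + 1; have c0: 0 < c by rewrite ltr_wpDl// ip_ge0.
 have d0: 0 < (e / 2) ^+ 2 / c by rewrite divr_gt0// exprn_gt0// divr_gt0.
 have [N NP] := vf _ d0.
 pose k := maxn N (Num.truncn (c / (e / 2) ^+ 2)).
 have h1: dot (fun x => v k x - f x) h ^+ 2 <= (e / 2) ^+ 2.
  apply: le_trans (CS (sqB (Cc_sq (cv k)) sf) sh) _.
  have := NP k (leq_maxl _ _); rewrite /dist2 ltr_pdivlMr// => hh; apply: le_trans (ltW hh).
  by rewrite ler_wpM2l ?ip_ge0// lerDl.
 have h2: (dot (v k) h - dot g h) ^+ 2 <= (e / 2) ^+ 2.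
  apply: le_trans (vl k h ch) _; rewrite ler_pdivrMr//.
  have h3 := truncnS_gt (c / (e / 2) ^+ 2).
  have h4: (Num.truncn (c / (e / 2) ^+ 2)).+1%:R <= k.+1%:R :> R by rewrite ler_nat ltnS leq_maxr.
  have := lt_le_trans h3 h4; rewrite ltr_pdivrMr ?exprn_gt0 ?divr_gt0// mulrC => h5.
  by apply: ltW; apply: lt_trans h5; rewrite ltrDl.
 have e20: 0 <= e / 2 by lra.
 rewrite -[X in X <= _]real_normK ?num_real// ler_pXn2r ?nnegrE// in h1.
 rewrite -[X in X <= _]real_normK ?num_real// ler_pXn2r ?nnegrE// in h2.
 have ->: dot (f -' g) h =
   (dot (v k) h - dot g h) - dot (fun x => v k x - f x) h.
  by rewrite !ipBl//; [ring|exact: Cc_sq].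
 by rewrite (le_trans (ler_normB _ _)); lra.
have aefg := fundamental_sq (@openT _) (sqB sf sg) (fun k ck => fg0 k ck.1).
move=> e e0; have e20: 0 < e ^+ 2 by rewrite exprn_gt0.
have [N NP] := vf _ e20; exists (v N) => //.
have ->: nm (fun x => v N x - g x) = nm (fun x => v N x - f x).
 apply: nm_ae; [exact: (sqB (Cc_sq (cv N)) sg).1|exact: (sqB (Cc_sq (cv N)) sf).1|].
 by apply: filterS aefg => x /(_ I) /eqP; rewrite subr_eq0 => /eqP ->.
by rewrite -(@ltr_pXn2r _ 2) ?nnegrE ?nm_ge0 ?ltW// nm_sq; exact: NP.
Qed.

Lemma nm_shift f z: sq mu f -> nm (fun x => f (x + z)) = nm f.
by move=> sf; rewrite [LHS]/(Num.sqrt _) ip_shift. Qed.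

(** By density it is enough to treat test functions, for which the gradient bounds the difference. *)
Lemma translation_cvg g: sq mu g -> forall e, 0 < e -> exists2 d, 0 < d &
 forall z, `|z| < d -> nm (fun x => g (x + z) - g x) <= e.
move=> sg e e0; have e30: 0 < e / 3 by rewrite divr_gt0.
have [f cf fg] := Cc_dense sg e30; have sf := Cc_sq cf.
pose c := \sum_i nm ('d_i f) + 1.
have c0: 0 < c by rewrite ltr_wpDl// sumr_ge0// => i _; exact: nm_ge0.
exists (e / 3 / c) => [|z zd]; first by rewrite divr_gt0.
have sz := sq_shift z sg; have sfz := sq_shift z sf.
apply: le_trans (nm_tri sz sfz sg) _; apply: le_trans (lerD (lexx _) (nm_tri sfz sf sg)) _.
rewrite nmBC (nm_shift z (sqB sf sg)).
have : nm (fun x => f (x + z) - f x) <= e / 3.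
 apply: le_trans (translation_nm z cf) _; apply: le_trans (pd_nm z cf) _.
 move: zd; rewrite ltr_pdivlMr// => /ltW; apply: le_trans; rewrite ler_wpM2l// lerDl//.
lra.
Qed.

Lemma moll_cvg g: Lb g -> forall e, 0 < e -> exists2 d, 0 < d &
 forall r rho, r < d -> mollifier r rho -> nm (fun x => moll rho g x - g x) <= e.
move=> lg e e0; have [sg bg] := lg.
have [d d0 dP] := translation_cvg sg e0; exists d => // r rho rd mr.
have cr := moll_Cc mr.
apply: nm_le; first exact: ltW.
have mD: mfun (fun p : E * E => g (p.2 + p.1) - g p.2).
 apply: measurable_funB; last exact: (measurableT_comp (f := g) sg.1).
 apply: (measurableT_comp (f := g)); first exact: sg.1.
 by have := @measurable_rVD; congr measurable_fun; apply/funext => p; rewrite addrC.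
have sB s: rho s != 0 -> sq mu (fun x => g (x + s) - g x) /\
  dot (fun x => g (x + s) - g x) (fun x => g (x + s) - g x) <= e ^+ 2.
 move=> rs; split; first exact: sqB (sq_shift s sg) sg.
 rewrite -nm_sq; apply: lerXn2r; [by rewrite nnegrE nm_ge0|by rewrite nnegrE ltW|apply: dP].
 apply: contraNT rs; rewrite -leNgt => ds; rewrite (moll_supp mr)// => /ballP.
 by rewrite sub0r normrN; lra.
have vE x: moll rho g x - g x = int (fun s => rho s * (g (x + s) - g x)).
 rewrite (@eq_int _ _ _ _ _ (fun s => rho s * g (x + s) - rho s * g x)); last by move=> s; rewrite mulrBr.
 rewrite intB; [|exact: (moll_itg x mr)|exact/itgZr/Cc_itg].
 congr (_ - _).
 by under eq_int do rewrite mulrC; rewrite intZ ?(moll_int mr) ?mulr1//; exact: Cc_itg.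
have [_] := @average_sq _ _ mu rho (fun s x => g (x + s) - g x)
 (fun x => moll rho g x - g x) (e ^+ 2)
 (Cc_itg cr) (moll_ge0 mr) mD
 (measurable_funB (Cc_meas (moll_smooth mr lg)) sg.1) sB vE (sqr_ge0 _).
by rewrite (moll_int mr) expr1n mul1r.
Qed.
End segments.

Lemma ftc01 (F f : R -> R): (forall s : R, 0 <= s <= 1 -> is_derive s 1 F (f s)) -> continuous f ->
 Rintegral leb setT (fun s : RR => (\1_`[0, 1] : RR -> R) s * f s) = F 1 - F 0.
move=> dF cf.
have dc s: 0 <= s <= 1 -> {for s, continuous F} by move=> /dF[df _]; apply: differentiable_continuous; exact/derivable1_diffP.
have E1: \int[leb]_(s in `[0, 1]) f s = F 1 - F 0.
 rewrite /Rintegral (@continuous_FTC2 R f F 0 1)//=.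
 - exact: continuous_subspaceT.
 - split.
  + by move=> s; rewrite in_itv/= => /andP[/ltW s0 /ltW s1]; have [] := dF s (introT andP (conj s0 s1)).
  + by apply: cvg_at_right_filter; apply: dc; rewrite lexx ler01.
  + by apply: cvg_at_left_filter; apply: dc; rewrite lexx ler01.
 - by move=> s; rewrite derive1E => /andP[/ltW s0 /ltW s1]; have [_ ->] := dF s (introT andP (conj s0 s1)).
rewrite -E1 [RHS]Rintegral_mkcond; apply: eq_int => s; rewrite patchE indicE.
by case: ifP; rewrite ?mul1r ?mul0r.
Qed.

Opaque partial Rintegral.

(** * Energy estimates for harmonic functions *)

Definition lap f x := \sum_i 'd_i ('d_i f) x.
Definition harm U g := Lb g /\ forall h, Ct U h -> dot g (lap h) = 0.
Lemma Cc_lap f: Cc f -> Cc (lap f).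
by move=> cf; apply: Cc_sum => i; exact/Cc_d/Cc_d. Qed.

Lemma lap_mollE e rho g x: mollifier e rho -> Lb g ->
 lap (moll rho g) x = dot g (lap (fun s => rho (x - s))).
move=> mr lg; have cr := moll_Cc mr.
have shE: (fun s => rho (x - s)) = (fun s => rho (s + - x)) by apply/funext => s; rewrite -(moll_even mr) opprB.
have c1 := Cc_C1 cr.
have pE i s: 'd_i ('d_i (fun s => rho (x - s))) s = 'd_i ('d_i rho) (x - s).
 rewrite shE (partial_shift i _ c1) (partial_shift i _ (Cc_C1 (Cc_d i cr))).
 rewrite -opprB; have rE: rho = fun s => rho (- s) by apply/funext => t; rewrite (moll_even mr).
 have pp: 'd_i ('d_i rho) = fun s => 'd_i ('d_i rho) (- s).
  rewrite {1}rE (partial_opp i c1); apply/funext => t.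
  have H: is_derive t (dx i) (fun s => - 'd_i rho (- s)) (- - 'd_i ('d_i rho) (- t)).
   apply: is_deriveN; apply: is_derive_opp_arg; exact: C1_partial (Cc_C1 (Cc_d i cr)).
  by rewrite (partialE) opprK.
 by rewrite [LHS](congr1 (fun f => f _) pp) opprK.
have cp i: Cc (fun s => 'd_i ('d_i rho) (x - s)).
 rewrite (_ : (fun s => _) = 'd_i ('d_i (fun s => rho (x - s)))); last first.
  by apply/funext => s; rewrite pE.
 have cs: Cc (fun s => rho (x - s)) by rewrite shE; exact: Cc_shift.
 exact/Cc_d/Cc_d.
rewrite /lap /ip (@eq_int _ _ _ _ _ (fun s => \sum_i g s * 'd_i ('d_i rho) (x - s))); last first.
 by move=> s; rewrite mulr_sumr; apply: eq_bigr => i; rewrite pE.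
rewrite int_sum; last by move=> i; apply: sqM; [exact: Lb_sq|exact: Cc_sq].
by apply: eq_bigr => i; rewrite (partial_partial_moll i i mr).
Qed.

Lemma lap_moll U e rho g x: 0 < e -> mollifier e rho -> harm U g -> er U (e + e) x ->
 lap (moll rho g) x = 0.
by move=> e0 mr [lg hg] xU; rewrite (lap_mollE x mr lg); exact: hg (Ct_moll_kernel e0 mr xU).
Qed.

Definition Cb f := continuous f /\ bsupp f.
Lemma Cb_itg f: Cb f -> itg mu f.
by move=> [cf]; exact: continuous_itg. Qed.
Lemma CbMl f g: Cb f -> continuous g -> Cb (f *' g).
by move=> [cf]; split; [exact: cts_mul|exact: bsuppMl]. Qed.
Lemma CbMr f g: continuous f -> Cb g -> Cb (f *' g).
by move=> cf [cg]; split; [exact: cts_mul|exact: bsuppMr]. Qed.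
Lemma CbD f g: Cb f -> Cb g -> Cb (f +' g).
by move=> [cf bf] [cg]; split; [exact: continuous_add|exact: bsuppD]. Qed.
Lemma Cb0: Cb (fun=> 0).
by split; [move=> x; exact: cst_continuous|exists 0]. Qed.
Lemma CbZ a f: Cb f -> Cb (fun x => a * f x).
by apply: CbMr => x; exact: cst_continuous. Qed.
Lemma CbN f: Cb f -> Cb (fun x => - f x).
by move=> /(CbZ (-1)); congr Cb; apply/funext => x; rewrite mulN1r. Qed.
Lemma Cb_sum (I : Type) (s : seq I) (F : I -> E -> R): (forall i, Cb (F i)) ->
 Cb (fun x => \sum_(i <- s) F i x).
move=> cF; elim: s => [|a s ih]; first by under eq_fun do rewrite big_nil; exact: Cb0.
by under eq_fun do rewrite big_cons; exact: CbD.
Qed.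
Lemma Cb_Cc f: Cc f -> Cb f.
by split; [exact: Cc_cts|exact: Cc_bsupp]. Qed.
Lemma Cb_partial f i: C1 f -> bsupp f -> Cb ('d_i f).
by move=> cf; split; [exact: (cf.2 i).2|exact: bsupp_partial]. Qed.

Definition gsq f x := \sum_i 'd_i f x ^+ 2.
Lemma gsq_ge0 f x: 0 <= gsq f x.
by apply: sumr_ge0 => i _; exact: sqr_ge0. Qed.
Lemma gsq_Cb f: Cc f -> Cb (gsq f).
move=> cf; apply: Cb_sum => i; have cp := Cb_Cc (Cc_d i cf).
by apply: CbMl => //; case: cp.
Qed.

Lemma CS_sum (a b : 'I_n -> R): (\sum_i a i * b i) ^+ 2 <= (\sum_i a i ^+ 2) * (\sum_i b i ^+ 2).
set A := \sum_i a i ^+ 2; set B := \sum_i b i ^+ 2; set X := \sum_i a i * b i.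
have A0: 0 <= A by apply: sumr_ge0 => i _; exact: sqr_ge0.
have H t: 0 <= A * t ^+ 2 - 2 * X * t + B.
 rewrite (_ : _ + B = \sum_i (a i * t - b i) ^+ 2); first by apply: sumr_ge0 => i _; exact: sqr_ge0.
 rewrite /A /B /X mulr_suml mulr_sumr mulr_suml -sumrB -big_split/=.
 by apply: eq_bigr => i _; ring.
have [A00|An0] := eqVneq A 0.
 have a0 i: a i = 0.
  apply/eqP; rewrite -sqrf_eq0; apply: contraT => h.
  have : 0 < A by rewrite /A (bigD1 i)//= ltr_wpDr ?sumr_ge0// => [j _|]; [exact: sqr_ge0|rewrite lt_neqAle eq_sym h sqr_ge0].
  by lra.
 by rewrite A00 mul0r /X big1 ?expr0n// => i; rewrite a0 mul0r.
have Ap: 0 < A by lra.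
have := H (X / A); rewrite (_ : _ + B = B - X ^+ 2 / A); last by field.
by rewrite subr_ge0 ler_pdivrMr// mulrC.
Qed.

Lemma caccio_pt (a b t s X M : R): 0 <= M -> X ^+ 2 <= a * b -> 0 <= a -> 0 <= b ->
 0 <= t -> a <= 4 * M * t -> - (s * X) <= 2^-1 * (t * b) + 2 * M * (s * s).
move=> M0 X2 a0 b0 tt aM.
have [t00|tp] := eqVneq t 0.
 have a00: a = 0 by apply/le_anti; rewrite a0 andbT; move: aM; rewrite t00 mulr0.
 have : X ^+ 2 <= 0 by rewrite a00 mul0r in X2.
 rewrite exprn_even_le0//= => /eqP ->; rewrite t00 mulr0 oppr0 mul0r mulr0 add0r.
 by have := sqr_ge0 s; rewrite expr2 => h; rewrite mulr_ge0// mulr_ge0.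
have tpos: 0 < t by lra.

have h1: X ^+ 2 <= 4 * M * t * b by apply: le_trans X2 _; rewrite ler_wpM2r.
have h2: (t * b - 4 * M * (s * s)) ^+ 2 + 4 * (s * X) ^+ 2 <= (t * b + 4 * M * (s * s)) ^+ 2.
 rewrite -subr_ge0 (_ : _ - _ = 4 * (s ^+ 2) * (4 * M * t * b - X ^+ 2)); last by ring.
 by rewrite mulr_ge0 ?subr_ge0// mulr_ge0 ?sqr_ge0.
have h3: (2 * (s * X)) ^+ 2 <= (t * b + 4 * M * (s * s)) ^+ 2.
 apply: le_trans h2; rewrite exprMn (_ : 2 ^+ 2 = 4) ?lerDr ?sqr_ge0//; ring.
have s2: 0 <= s * s by rewrite sqr_ge0.
have h4: 0 <= t * b + 4 * M * (s * s).
 exact: (addr_ge0 (mulr_ge0 tt b0) (mulr_ge0 (mulr_ge0 (ler0n _ 4) M0) s2)).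
have : - (2 * (s * X)) <= t * b + 4 * M * (s * s).
 rewrite (le_trans (ler_norm _))// normrN -(@ler_pXn2r _ 2) ?nnegrE//.
 by rewrite real_normK ?num_real.
clear; move: (s * X) (t * b) => p q; rewrite (_ : 4 * M * (s * s) = 2 * (2 * M * (s * s))); last by ring.
by lra.
Qed.

(** Test the equation with th G. The hypothesis on the gradient of th allows to absorb the term with
 the product of the two gradients. *)
Lemma caccioppoli th u M: 0 <= M -> C1 th -> bsupp th -> (forall x, 0 <= th x) ->
 (forall x, gsq th x <= 4 * M * th x) -> Cc u -> (forall x, th x != 0 -> lap u x = 0) ->
 int (fun x => th x * gsq u x) <= 4 * M * dot u u.
move=> M0 Ct bt t0 tM cu hu; have cc := Cc_cts cu.
have Cth: Cb th by split => //; exact: Ct.1.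
have cp i := Cb_Cc (Cc_d i cu).
have cpp i j := Cb_Cc (Cc_d j (Cc_d i cu)).
have ctp i := Cb_partial i Ct bt.
have I1 i: Cb (fun x => u x * ('d_i th x * 'd_i u x)) by apply: CbMr => //; apply: CbMl => //; case: (cp i).
have I2 i: Cb (fun x => u x * (th x * 'd_i ('d_i u) x)) by apply: CbMr => //; apply: CbMl => //; case: (cpp i i).
have E1: int (fun x => th x * gsq u x) = - int (fun x => u x * \sum_i 'd_i th x * 'd_i u x).
 have ii i: int (fun x => 'd_i u x * (th x * 'd_i u x)) =
   - int (fun x => u x * ('d_i th x * 'd_i u x)) - int (fun x => u x * (th x * 'd_i ('d_i u) x)).
  have CM := C1M Ct (Cc_C1 (Cc_d i cu)).
  rewrite (ibp i (Cc_C1 cu) CM); last by left; exact: Cc_bsupp.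
  rewrite -opprD -intD; [|exact: Cb_itg|exact: Cb_itg]; congr (- _); apply: eq_int => x.
  by rewrite (partial_mul i Ct (Cc_C1 (Cc_d i cu))) mulrDr.
 rewrite (@eq_int _ _ _ _ _ (fun x => \sum_i 'd_i u x * (th x * 'd_i u x))); last first.
  by move=> x; rewrite /gsq mulr_sumr; apply: eq_bigr => i _; ring.
 rewrite int_sum; last first.
  by move=> i; apply: Cb_itg; apply: CbMl => //; apply: cts_mul; [exact: Ct.1|case: (cp i)].
 rewrite (eq_bigr _ (fun i _ => ii i)) sumrB sumrN.
 rewrite [X in _ - X](_ : _ = 0) ?subr0.
  congr (- _); apply: etrans (esym (int_sum _ (fun i => Cb_itg (I1 i)))) _.
  by apply: eq_int => x; rewrite mulr_sumr.
 apply: etrans (esym (int_sum _ (fun i => Cb_itg (I2 i)))) _.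
 rewrite int_eq0// => x; rewrite -mulr_sumr -mulr_sumr.
 have [->|/hu h] := eqVneq (th x) 0; first by rewrite mul0r mulr0.
 by rewrite -/(lap u x) h !mulr0.
have It: Cb (fun x => th x * gsq u x) by apply: CbMl => //; case: (gsq_Cb cu).
have Iu: Cb (u *' u) by apply: CbMl => //; exact: Cb_Cc.
have : int (fun x => th x * gsq u x) <= int (fun x => 2^-1 * (th x * gsq u x) + 2 * M * (u x * u x)).
 rewrite E1 -intN; last first.
  apply: Cb_itg; apply: CbMr => //; apply: Cb_sum => i; apply: CbMl => //; by case: (cp i).
 apply: int_le.
 - apply: Cb_itg; apply: CbN; apply: CbMr => //; apply: Cb_sum => i; apply: CbMl => //; by case: (cp i).
 - by apply: Cb_itg; apply: CbD; exact: CbZ.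
 move=> x; set X := \sum_i _; have X2 := CS_sum (fun i => 'd_i th x) (fun i => 'd_i u x).
 rewrite -/X -/(gsq th x) -/(gsq u x) in X2.
 have := tM x; have := t0 x; have := gsq_ge0 u x; have := gsq_ge0 th x.
 move: X2; move: (gsq th x) (gsq u x) (th x) (u x) X => a b t s X X2 a0 b0 tt aM.
 exact: (caccio_pt s M0 X2).
rewrite intD; [|exact/Cb_itg/CbZ|exact/Cb_itg/CbZ].
rewrite (intZ _ (Cb_itg It)) (intZ _ (Cb_itg Iu)) -/(dot u u).
by clear; lra.
Qed.

(** Rellich identity: differentiate the energy density of a harmonic function in
  the direction v. *)
Lemma rellich w u v: C1 w -> bsupp w -> Cc u -> (forall x, w x != 0 -> lap u x = 0) ->
 int (fun x => pd v w x * gsq u x) =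
 2 * int (fun x => pd v u x * \sum_i 'd_i w x * 'd_i u x).
move=> Cw bw cu hu; have sw := Cc_smooth cu.
have Cwb: Cb w by split => //; exact: Cw.1.
have cp i := Cb_Cc (Cc_d i cu).
have cpp i j := Cb_Cc (Cc_d j (Cc_d i cu)).
have cwp i := Cb_partial i Cw bw.
have cv := Cb_Cc (Cc_pd v cu).
have C1p i := Cc_C1 (Cc_d i cu).
have K1 i j: int (fun x => 'd_i w x * ('d_j u x * 'd_j u x)) =
  - (2 * int (fun x => w x * ('d_j u x * 'd_i ('d_j u) x))).
 rewrite (ibp i Cw (C1M (C1p j) (C1p j))); last by left.
 rewrite -intZ; last by apply: Cb_itg; apply: CbMl => //; apply: cts_mul; [case: (cp j)|case: (cpp j i)].
 congr (- _); apply: eq_int => x; rewrite (partial_mul i (C1p j) (C1p j)).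
 by lra.
have K2 i j: int (fun x => 'd_i w x * ('d_j u x * 'd_i u x)) =
  - int (fun x => w x * ('d_i ('d_j u) x * 'd_i u x)) 
  - int (fun x => w x * ('d_j u x * 'd_i ('d_i u) x)).
 rewrite (ibp i Cw (C1M (C1p j) (C1p i))); last by left.
 rewrite -opprD -intD.
 - by congr (- _); apply: eq_int => x; rewrite (partial_mul i (C1p j) (C1p i)) mulrDr.
 - by apply: Cb_itg; apply: CbMl => //; apply: cts_mul; [case: (cpp j i)|case: (cp i)].
 - by apply: Cb_itg; apply: CbMl => //; apply: cts_mul; [case: (cp j)|case: (cpp i i)].
have L1: int (fun x => pd v w x * gsq u x) =
  \sum_i v 0 i * \sum_j int (fun x => 'd_i w x * ('d_j u x * 'd_j u x)).
 have Ij i j: itg mu (fun x => 'd_i w x * ('d_j u x * 'd_j u x)) by apply: Cb_itg; apply: CbMl => //; apply: cts_mul; case: (cp j).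
 under eq_bigr do rewrite -int_sum// -intZ ?itg_sum//.
 rewrite -int_sum; last by move=> i; apply: itgZ; exact: itg_sum.
 apply: eq_int => x; rewrite /pd /gsq mulr_suml; apply: eq_bigr => i _.
 by rewrite -mulrA mulr_sumr.
have L2: int (fun x => pd v u x * \sum_i 'd_i w x * 'd_i u x) =
  \sum_j v 0 j * \sum_i int (fun x => 'd_i w x * ('d_j u x * 'd_i u x)).
 have Ij i j: itg mu (fun x => 'd_i w x * ('d_j u x * 'd_i u x)) by apply: Cb_itg; apply: CbMl => //; apply: cts_mul; [case: (cp j)|case: (cp i)].
 under eq_bigr do rewrite -int_sum// -intZ ?itg_sum//.
 rewrite -int_sum; last by move=> i; apply: itgZ; exact: itg_sum.
 apply: eq_int => x; rewrite /pd mulr_suml; apply: eq_bigr => i _.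
 by rewrite -mulrA mulr_sumr; congr (_ * _); apply: eq_bigr => j _; ring.
rewrite L1 L2 mulr_sumr; apply: eq_bigr => i _; rewrite mulrCA; congr (_ * _).
apply: (etrans (eq_bigr _ (fun j _ => K1 i j))).
apply: etrans (congr1 (fun t => 2 * t) (esym (eq_bigr _ (fun j _ => K2 j i)))).
rewrite sumrB mulrBr.
rewrite [X in _ - 2 * X](_ : _ = 0) ?mulr0 ?subr0.
 have aux (a b : R) : a = b -> - (2 * a) = 2 * - b by move=> ->; rewrite mulrN.
 apply: (etrans _ (esym (mulr_sumr _ _ _ _))); apply: eq_bigr => j _; apply: aux.
 apply: eq_int => x; rewrite (schwarz i j x sw).
 by ring.
rewrite -int_sum; last first.
 by move=> j; apply: Cb_itg; apply: CbMl => //; apply: cts_mul; [case: (cp i)|case: (cpp j j)].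
rewrite int_eq0// => x; rewrite -mulr_sumr -mulr_sumr.
have [->|/hu h] := eqVneq (w x) 0; first by rewrite mul0r.
by rewrite -/(lap u x) h !mulr0.
Qed.

Section profiles.
Implicit Types (t : R).

Definition pos t : R := Num.max 0 t.

Lemma pos_ge0 t: 0 <= pos t. Proof. by rewrite /pos le_max lexx. Qed.
Lemma posE t: 0 <= t -> pos t = t. Proof. by move=> t0; rewrite /pos max_r. Qed.
Lemma posN t: t <= 0 -> pos t = 0. Proof. by move=> t0; rewrite /pos max_l. Qed.
Lemma pos_lip s t: `|pos s - pos t| <= `|s - t|.
have [s0|/ltW s0] := leP 0 s; have [t0|/ltW t0] := leP 0 t;
 rewrite ?(posE s0) ?(posE t0) ?(posN s0) ?(posN t0)//.
- by rewrite subr0 (ger0_norm s0) ler_normr; lra.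
- by rewrite sub0r normrN (ger0_norm t0) ler_normr; lra.
- by rewrite subrr normr0.
Qed.
Lemma continuous_lipR (f : R -> R) (c : R): (forall s t, `|f s - f t| <= c * `|s - t|) -> continuous f.
move=> fc x; apply/cvgrPdist_le => e e0; have c1: 0 < `|c| + 1 by rewrite ltr_wpDl.
near=> y; apply: le_trans (fc x y) _.
have : `|x - y| <= e / (`|c| + 1).
 near: y; apply: cvgr_dist_le; [exact: cvg_id|by rewrite divr_gt0].
rewrite ler_pdivlMr// mulrDr mulr1 => h; have := ler_norm c; have := normr_ge0 (x - y).
by nra.
Unshelve. all: by end_near. Qed.
Lemma continuous_pos: continuous pos.
by apply: (@continuous_lipR _ 1) => s t; rewrite mul1r; exact: pos_lip. Qed.

Lemma pos2_derive t: is_derive t 1 (fun s : R => pos s ^+ 2) (2 * pos t).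
apply/is_derive_epsP => e e0; exists e => // h h0 he; rewrite [h%:A]mulr1.
have H: `|pos (h + t) ^+ 2 - pos t ^+ 2 - 2 * pos t * h| <= h ^+ 2.
 have [a0|/ltW a0] := leP 0 (h + t); have [t0|/ltW t0] := leP 0 t;
 rewrite ?(posE a0) ?(posE t0) ?(posN a0) ?(posN t0) ler_norml; apply/andP; split; nra.
have ->: h^-1 * (pos (h + t) ^+ 2 - pos t ^+ 2) - 2 * pos t =
 h^-1 * (pos (h + t) ^+ 2 - pos t ^+ 2 - 2 * pos t * h) by field.
rewrite normrM normfV ler_pdivrMl ?normr_gt0//; apply: le_trans H _.
by rewrite -real_normK ?num_real// ler_wpM2l// ltW.
Qed.

(** A smoothing of the positive part whose square is controlled by its derivative. *)
Definition sig (d t : R) : R := pos t ^+ 2 / (pos t + d).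
Definition dsig (d t : R) : R := 1 - d ^+ 2 / (pos t + d) ^+ 2.

Lemma sig_derive d t: 0 < d -> is_derive t 1 (sig d) (dsig d t).
move=> d0; apply/is_derive_epsP => e e0.
have ed0: 0 < e * d by rewrite mulr_gt0.
pose r := if t == 0 then e * d else Num.min (e * d) `|t|.
have r0: 0 < r by rewrite /r; case: eqVneq => //; rewrite lt_min ed0 normr_gt0.
exists r => // h h0 hr; rewrite [h%:A]mulr1.
have he: `|h| < e * d by apply: lt_le_trans hr _; rewrite /r; case: eqVneq => //; rewrite ge_min lexx.
have ht: t != 0 -> `|h| < `|t| by move=> t0; apply: lt_le_trans hr _; rewrite /r (negPf t0) ge_min lexx orbT.
have H: `|sig d (h + t) - sig d t - dsig d t * h| <= h ^+ 2 / d.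
 have [t0|t0|t0] := ltgtP t 0.
 - have : `|h| < `|t| by apply: ht; rewrite lt_eqF.
  rewrite (ltr0_norm t0) ltr_norml => /andP[h1 h2].
  have a0: h + t <= 0 by lra.
  rewrite /sig /dsig (posN (ltW t0)) (posN a0) expr0n/= !mul0r !add0r.
  rewrite divff; last by rewrite gt_eqF// exprn_gt0.
  by rewrite !subrr mul0r oppr0 addr0 normr0 divr_ge0 ?sqr_ge0 ?(ltW d0).
 - have : `|h| < `|t| by apply: ht; rewrite gt_eqF.
  rewrite (gtr0_norm t0) ltr_norml => /andP[hh1 hh2].
  have a0: 0 <= h + t by lra.
  rewrite /sig /dsig (posE (ltW t0)) (posE a0).
  have h1: 0 < t + d by lra.
  have h2: 0 < h + t + d by lra.
  have ->: (h + t) ^+ 2 / (h + t + d) - t ^+ 2 / (t + d) - (1 - d ^+ 2 / (t + d) ^+ 2) * h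
    = h ^+ 2 * (d ^+ 2 / ((t + d) ^+ 2 * (h + t + d))) by field; rewrite !gt_eqF.
  rewrite normrM (ger0_norm (sqr_ge0 h)) ler_wpM2l ?sqr_ge0//.
  have p: 0 < (t + d) ^+ 2 * (h + t + d) by rewrite mulr_gt0// exprn_gt0.
  rewrite ger0_norm ?divr_ge0 ?sqr_ge0 ?(ltW p)// ler_pdivrMr// mulrC ler_pdivlMr//.
  have q1: d ^+ 2 <= (t + d) ^+ 2 by apply: lerXn2r; rewrite ?nnegrE; lra.
  have q2: d <= h + t + d by lra.
  by apply: ler_pM => //; [exact: sqr_ge0|exact: ltW].
 - rewrite t0 addr0 /dsig /sig (posN (lexx 0)) expr0n/= mul0r subr0 add0r.
  rewrite divff ?subrr ?mul0r ?subr0; last by rewrite gt_eqF// exprn_gt0.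
  have p0 := pos_ge0 h; have pd: 0 < pos h + d by lra.
  rewrite ger0_norm ?divr_ge0 ?sqr_ge0 ?(ltW pd)//.
  have p2: pos h ^+ 2 <= h ^+ 2 by have [/posE ->//|/ltW/posN ->] := leP 0 h; rewrite expr0n sqr_ge0.
  apply: ler_pM => //; first exact: sqr_ge0.
   by rewrite invr_ge0 ltW.
  by rewrite lef_pV2 ?posrE//; lra.
have ->: h^-1 * (sig d (h + t) - sig d t) - dsig d t =
 h^-1 * (sig d (h + t) - sig d t - dsig d t * h) by field.
rewrite normrM normfV ler_pdivrMl ?normr_gt0//; apply: le_trans H _.
by rewrite ler_pdivrMr// -real_normK ?num_real// -mulrA ler_wpM2l// ltW.
Qed.

Lemma continuous_dsig d: 0 < d -> continuous (dsig d).
move=> d0 t; have H: continuous (fun s : R => pos s + d).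
 by move=> s; apply: continuousD; [exact: continuous_pos|exact: cst_continuous].
have p2: (pos t + d) ^+ 2 != 0 by rewrite expf_neq0// gt_eqF// ltr_wpDl// pos_ge0.
have H2: {for t, continuous (fun s : R => (pos s + d) ^+ 2)}.
 exact: (continuousM (H t) (H t)).
have H3 := continuousM (@cst_continuous _ _ (d ^+ 2) t) (@continuousV _ _ _ t p2 H2).
exact: (continuousB (@cst_continuous _ _ (1 : R) t)).
Qed.

Lemma dsig_bounds d t: 0 < d -> [/\ 0 <= sig d t <= pos t, 0 <= dsig d t <= 1,
 sig d t ^+ 2 <= dsig d t * pos t ^+ 2 & d <= t -> 1/2 <= dsig d t].
move=> d0; have p0 := pos_ge0 t; rewrite /sig /dsig.
have : d <= t -> d <= pos t by move=> dt; rewrite posE//; lra.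
move: (pos t) p0 => p p0 dp; have pd: 0 < p + d by lra.
have pd2: 0 < (p + d) ^+ 2 by rewrite exprn_gt0.
have ->: 1 - d ^+ 2 / (p + d) ^+ 2 = (p ^+ 2 + 2 * p * d) / (p + d) ^+ 2 by field; rewrite gt_eqF.
have q0: 0 <= p ^+ 2 + 2 * p * d by rewrite addr_ge0 ?sqr_ge0// mulr_ge0 ?(ltW d0)// mulr_ge0.
split.
- rewrite divr_ge0 ?sqr_ge0 ?(ltW pd)//= ler_pdivrMr//; nra.
- rewrite ?(ltW pd2)//= ler_pdivrMr//; nra.
- rewrite expr_div_n ler_pdivrMr// mulrAC divfK ?gt_eqF// -subr_ge0.
 rewrite (_ : _ - _ = 2 * p * d * p ^+ 2); last by ring.
 by rewrite mulr_ge0 ?sqr_ge0// mulr_ge0 ?(ltW d0)// mulr_ge0.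
- by rewrite ler_pdivlMr//; nra.
Qed.
End profiles.

(** * The estimate near a Lipschitz boundary point *)

Definition dv phi x := \sum_i 'd_i (phi i) x.
Definition rot phi i j x := 'd_j (phi i) x - 'd_i (phi j) x.
Definition nv phi := \sum_i nm (phi i).
Definition rt phi := \sum_i \sum_j nm (rot phi i j).

Lemma nv_ge0 phi: 0 <= nv phi.
by apply: sumr_ge0 => i _; exact: nm_ge0. Qed.
Lemma rt_ge0 phi: 0 <= rt phi.
by apply: sumr_ge0 => i _; apply: sumr_ge0 => j _; exact: nm_ge0. Qed.
Lemma ler_sum1 (F : 'I_n -> R) i: (forall j, 0 <= F j) -> F i <= \sum_j F j.
by move=> F0; rewrite (bigD1 i)//= lerDl sumr_ge0. Qed.
Lemma nm_rt phi i j: nm (rot phi i j) <= rt phi.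
apply: le_trans (ler_sum1 (F := fun j => nm (rot phi i j)) j (fun => nm_ge0 _ _)) _.
apply: (ler_sum1 (F := fun i => \sum_j nm (rot phi i j))) => k.
by apply: sumr_ge0 => l _; exact: nm_ge0.
Qed.

Lemma Cc_dv phi: (forall i, Cc (phi i)) -> Cc (dv phi).
by move=> cp; apply: Cc_sum => i; exact: Cc_d. Qed.
Lemma Cc_rot phi i j: (forall i, Cc (phi i)) -> Cc (rot phi i j).
by move=> cp; apply: CcB; exact: Cc_d. Qed.
Lemma ip_partial u f i: C1 u -> Cc f -> dot u ('d_i f) = - dot ('d_i u) f.
move=> cu cf; have := ibp i cu (Cc_C1 cf) (or_intror (Cc_bsupp cf)).
by move=> h; rewrite /ip h opprK.
Qed.

Lemma ip_dv u phi: Cc u -> (forall i, Cc (phi i)) ->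
 dot u (dv phi) = - \sum_i dot ('d_i u) (phi i).
move=> cu cp; rewrite ipC ip_sql; last exact: Cc_sq.
 by rewrite -sumrN; apply: eq_bigr => i; rewrite ipC (ip_partial i (Cc_C1 cu) (cp i)).
by move=> i; exact/Cc_sq/Cc_d.
Qed.

Lemma partial_out f i x (A : set E): open A -> A x -> (forall y, A y -> f y = 0) -> 'd_i f x = 0.
move=> oA Ax fA; apply: partialE; apply/is_derive_epsP => d d0.
have [r r0 rP] := open_er oA Ax; exists r => // h h0 hr.
rewrite (fA x Ax) fA; first by rewrite subrr mulr0 subrr normr0 ltW.
apply: rP; apply/ballP; rewrite opprD addrCA subrr addr0 normrN normrZ.
apply: le_lt_trans hr; rewrite ler_piMr//; apply: rV_norm_le => // j.
by rewrite mxE; case: (_ && _); rewrite ?normr1 ?normr0.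
Qed.

(** Weighted Cauchy-Schwarz: only the energy on the support of f matters. *)
Lemma wcs th u f c i: 0 < c -> continuous th -> (forall x, 0 <= th x) ->
 (forall x, f x != 0 -> c <= th x) -> Cc u -> Cc f ->
 `|dot ('d_i u) f| <= Num.sqrt (int (fun x => th x * gsq u x) / c) * nm f.
move=> c0 cth t0 tf cu cf; have cp := Cb_Cc (Cc_d i cu).
pose S := [set x | c <= th x].
have mS: measurable S.
 apply: closed_meas.
 exact: (@closed_comp _ _ th [set t | c <= t] (fun x _ => cth x) (@closed_ge R c)).
pose p x := 'd_i u x * \1_S x.
have bI x: `|\1_S x| <= 1 :> R by rewrite ger0_norm// leq_b1.
have mI: mfun (\1_S : E -> R) by [].
have su := sq_d i cu.
have sp: sq mu p by exact: sq_mul_bounded bI.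
have ->: dot ('d_i u) f = dot p f.
 apply: eq_int => x; rewrite /p; have [->|/tf h] := eqVneq (f x) 0; first by rewrite !mulr0.
 by rewrite indicE mem_set// mulr1.
apply: le_trans (nm_CS sp (Cc_sq cf)) _; rewrite ler_wpM2r ?nm_ge0//.
have It: itg mu (fun x => th x * gsq u x) by apply: Cb_itg; apply: CbMr => //; exact: gsq_Cb.
rewrite ler_wsqrtr// ler_pdivlMr// mulrC -intZ; last exact: sqM.
apply: int_le => //; first exact/itgZ/sqM.
move=> x; rewrite /p indicE; case: (boolP (x \in S)) => [xS|_]; last first.
 by rewrite mulr0 mul0r mulr0 mulr_ge0// gsq_ge0.
rewrite mulr1 -expr2; apply: ler_pM; [exact: ltW|exact: sqr_ge0|by rewrite inE in xS|].
by rewrite /gsq (bigD1 i)//= lerDl sumr_ge0// => j _; exact: sqr_ge0.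
Qed.

Lemma cacc_wcs th u f M c i: 0 <= M -> 0 < c -> C1 th -> bsupp th -> (forall x, 0 <= th x) ->
 (forall x, gsq th x <= 4 * M * th x) -> (forall x, f x != 0 -> c <= th x) ->
 Cc u -> (forall x, th x != 0 -> lap u x = 0) -> Cc f ->
 `|dot ('d_i u) f| <= Num.sqrt (4 * M / c) * nm u * nm f.
move=> M0 c0 Ct bt t0 tM tf cu hu cf; apply: le_trans (wcs i c0 Ct.1 t0 tf cu cf) _.
rewrite ler_wpM2r ?nm_ge0// -sqrtrM; last by rewrite divr_ge0 ?(ltW c0)// mulr_ge0.
by rewrite ler_wsqrtr// mulrAC ler_wpM2r ?invr_ge0 ?(ltW c0)//; exact: caccioppoli.
Qed.

Lemma K_eps (g : E -> R) phi B d: 0 < d -> Lb g -> (forall i, Cc (phi i)) ->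
 (forall e rho, 0 < e -> e < d -> mollifier e rho -> `|dot (moll rho g) (dv phi)| <= B) ->
 `|dot g (dv phi)| <= B.
move=> d0 lg cp H; apply/ler_addgt0Pr => e e0.
have sd := Cc_sq (Cc_dv cp).
pose c := nm (dv phi) + 1; have c0: 0 < c by rewrite ltr_wpDl// nm_ge0.
have [d1 d10 dP] := moll_cvg lg (divr_gt0 e0 c0).
pose r := Num.min d d1 / 2.
have m0: 0 < Num.min d d1 by rewrite lt_min d0.
have r0: 0 < r by rewrite divr_gt0.
have rm: r < Num.min d d1 by rewrite ltr_pdivrMr// ltr_pMr// ltr1n.
have [rd rd1] : r < d /\ r < d1 by move: rm; rewrite lt_min => /andP[].
have [rho mr] := @mollifier_exists r r0.
have sg := Lb_sq lg; have sm := Cc_sq (moll_smooth mr lg).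
have ->: dot g (dv phi) = dot (moll rho g) (dv phi) - dot (fun x => moll rho g x - g x) (dv phi) by rewrite ipBl//; ring.
apply: le_trans (ler_normB _ _) _; apply: lerD; first exact: H mr.
apply: le_trans (nm_CS (sqB sm sg) sd) _.
apply: (@le_trans _ _ (e / c * c)); last by rewrite divfK// gt_eqF.
by apply: ler_pM; rewrite ?nm_ge0 ?lerDl//; exact: dP mr.
Qed.

Lemma nm_moll e rho g: mollifier e rho -> Lb g -> nm (moll rho g) <= nm g.
by move=> mr lg; rewrite ler_wsqrtr//; exact: moll_sq mr lg. Qed.

(** The estimate to be proved, for fields supported in Om and vanishing off A. *)
Definition Kb (Om A : set E) := exists2 C : R, 0 <= C & forall g phi, harm Om g ->
 (forall i, Ct Om (phi i)) -> (forall i x, ~ A x -> phi i x = 0) ->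
 `|dot g (dv phi)| <= C * nm g * (rt phi + nv phi).

(** Weights of the form k^2 (z + a)_+^2. *)
Definition wgt (k z : E -> R) (a : R) x := (k x * k x) * pos (z x + a) ^+ 2.

Lemma wgtP (k z : E -> R) (a Z K Mk : R): Cc k -> C1 z -> 0 <= K ->
 (forall x, k x != 0 -> `|pos (z x + a)| <= Z /\ gsq z x <= K) ->
 (forall x, `|k x| <= 1) -> (forall x, gsq k x <= Mk) ->
 [/\ C1 (wgt k z a), bsupp (wgt k z a), forall x, 0 <= wgt k z a x &
   forall x, gsq (wgt k z a) x <= 4 * (2 * (Z ^+ 2 * Mk + K)) * wgt k z a x].
move=> ck Cz K0 kB k1 kM; have Ck := Cc_C1 ck.
have Cza: C1 (fun x => z x + a) by apply: C1D => //; exact: C1_cst a.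
have cd: continuous (fun t : R => 2 * pos t) by move=> t; exact: (continuousM (@cst_continuous _ _ (2 : R) t) (@continuous_pos t)).
have [Cp pE] := C1_comp1 pos2_derive cd Cza.
have Ckk := C1M Ck Ck.
split; first exact: C1M.
- by apply: bsuppMl; apply: bsuppMl; exact: Cc_bsupp.
- by move=> x; rewrite /wgt mulr_ge0// ?sqr_ge0.
move=> x; set p := pos (z x + a); set t := k x.
have dE i: 'd_i (wgt k z a) x = 2 * t * p * ('d_i k x * p + t * 'd_i z x).
 rewrite (partial_mul i Ckk Cp) (partial_mul i Ck Ck) pE.
 rewrite (partial_add i Cz (C1_cst a)) partial_cst addr0.
 by rewrite -/p -/t; ring.
have ->: wgt k z a x = t * t * p ^+ 2 by [].
have gE: gsq (wgt k z a) x <= (2 * t * p) ^+ 2 * (2 * (p ^+ 2 * gsq k x + t ^+ 2 * gsq z x)).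
 rewrite /gsq !mulr_sumr -big_split/= !mulr_sumr; apply: ler_sum => i _; rewrite dE exprMn.
 rewrite ler_wpM2l ?sqr_ge0//; move: ('d_i k x) ('d_i z x) => b c.
 by rewrite -subr_ge0 (_ : _ - _ = (b * p - t * c) ^+ 2) ?sqr_ge0//; ring.
apply: le_trans gE _.
have [t0|tn] := eqVneq t 0; first by rewrite t0 !(mulr0, mul0r, expr0n)/= ?mul0r.
have [pZ zK] := kB x tn; rewrite -/p in pZ.
rewrite (_ : 4 * _ * _ = (2 * t * p) ^+ 2 * (2 * (Z ^+ 2 * Mk + K))); last by ring.
rewrite ler_wpM2l ?sqr_ge0// ler_wpM2l// lerD//.
 apply: ler_pM; rewrite ?sqr_ge0 ?gsq_ge0//.
 have p0: 0 <= p by exact: pos_ge0.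
 by rewrite ger0_norm// in pZ; apply: lerXn2r; rewrite ?nnegrE//; apply: le_trans pZ.
rewrite -[leRHS]mul1r; apply: ler_pM; rewrite ?sqr_ge0 ?gsq_ge0//.
by rewrite -real_normK ?num_real// -(expr1n R 2); apply: lerXn2r; rewrite ?nnegrE ?ler01//; exact: k1.
Qed.

Lemma Ct_er_all U phi: open U -> (forall i, Ct U (phi i)) ->
 exists2 d, 0 < d & forall i x, phi i x != 0 -> er U d x.
move=> oU cp; pose S x := \sum_i phi i x * phi i x.
have cS: Ct U S by apply: Ct_sum => i; apply: CtM => //; exact: Cc_smooth (cp i).1.
have [d d0 dP] := Ct_erP oU cS; exists d => // i x p0; apply: contrapT => /dP S0.
move/eqP: S0; rewrite gt_eqF// /S (bigD1 i)//= ltr_wpDr//.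
 by apply: sumr_ge0 => j; rewrite sqr_ge0.
by rewrite lt_neqAle eq_sym sqrf_eq0 p0 sqr_ge0.
Qed.

(** Away from the boundary the Caccioppoli inequality for g itself is enough. *)
Lemma K_interior (Om : set E) x0: open Om -> Om x0 -> exists2 r, 0 < r & Kb Om (ball x0 r).
move=> oO Ox.
have cK: compact [set x0] by exact: compact_set1.
have KO: [set x0] `<=` Om by move=> x ->.
have [k kO [k01 [r r0 kr]]] := cutoff cK oO KO.
exists r => //.
have ck := kO.1.
have [M M0 Mk] : exists2 M, 0 < M & forall x, `|gsq k x| <= M by have [c] := gsq_Cb ck; exact: bsupp_bounded.
have [dO dO0 dP] := Ct_erP oO kO.
have zC1: C1 ((fun=> 1) : E -> R) by exact: C1_cst 1.
have zB x: k x != 0 -> `|pos (1 + 0 : R)| <= 1 /\ gsq ((fun=> 1) : E -> R) x <= 0.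
 move=> _; rewrite addr0 posE ?ler01// normr1; split => //.
 by rewrite /gsq big1// => i; rewrite partial_cst expr0n.
have k1 x: `|k x| <= 1 by have /andP[a] := k01 x; rewrite ger0_norm.
have [C1w bw w0 wM] := wgtP ck zC1 (lexx _) zB k1 (fun x => le_trans (ler_norm _) (Mk x)).
set th := wgt k _ 0 in C1w bw w0 wM.
set MM := 2 * _ in wM.
have MM0: 0 <= MM by rewrite /MM expr1n mul1r addr0 mulr_ge0// ltW.
exists (Num.sqrt (4 * MM / 1)) => [|g phi hg cp pA]; first exact: sqrtr_ge0.
have cpc i := (cp i).1.
apply: (@K_eps g phi _ (dO / 2)); [by rewrite divr_gt0|exact: hg.1|exact: cpc|].
move=> e rho e0 ed mr; have cm := moll_smooth mr hg.1.
rewrite ip_dv// normrN.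
apply: (@le_trans _ _ (\sum_i Num.sqrt (4 * MM / 1) * nm g * nm (phi i))); last first.
 rewrite -mulr_sumr ler_wpM2l//; first by rewrite mulr_ge0 ?sqrtr_ge0.
 by rewrite lerDr rt_ge0.
apply: le_trans (ler_norm_sum _ _ _) _; apply: ler_sum => i _.
have t1 x: phi i x != 0 -> 1 <= th x.
 move=> px; have xB: ball x0 r x by apply: contrapT => /(pA) h; rewrite h eqxx in px.
 by rewrite /th /wgt (kr x0)// !mul1r addr0 posE// expr1n.
have tl x: th x != 0 -> lap (moll rho g) x = 0.
 move=> tx; apply: (lap_moll e0 mr hg).
 apply: (@erW _ dO); first by lra.
 by apply: contrapT => /dP k0; move: tx; rewrite /th /wgt k0 !mul0r eqxx.
apply: le_trans (cacc_wcs i MM0 ltr01 C1w bw w0 wM t1 cm tl (cpc i)) _.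
by rewrite ler_wpM2r ?nm_ge0// ler_wpM2l ?sqrtr_ge0//; exact: nm_moll mr hg.1.
Qed.

(** Near x0 the domain is the strict epigraph, in the direction v, of a Lipschitz
  function; z is the height above the graph. *)
Definition patch (Om : set E) x0 v (z : E -> R) (L r : R) := [/\ 0 < r, 0 < L,
 forall x y, `|z x - z y| <= L * `|x - y|, forall x (s : R), z (x + s *: v) = z x + s &
 forall y, ball x0 r y -> (Om y <-> 0 < z y)].
Definition patched Om := forall x, closure Om x -> ~ Om x -> exists v (z : E -> R) L r, patch Om x v z L r.

Lemma deriv_bound f x v d (c K r : R): 0 < r -> is_derive x v f d ->
 (forall h, `|h| < r -> `|f (h *: v + x) - f x - c * h| <= K * `|h|) -> `|d - c| <= K.
move=> r0 /is_derive_epsP fd H; apply/ler_addgt0Pr => e e0; have [s s0 sP] := fd _ e0.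
pose h := Num.min r s / 2.
have m0: 0 < Num.min r s by rewrite lt_min r0.
have h0: 0 < h by rewrite divr_gt0.
have : `|h| < Num.min r s by rewrite gtr0_norm// ltr_pdivrMr// ltr_pMr// ltr1n.
rewrite lt_min => /andP[hr hs].
have h1 := sP h (lt0r_neq0 h0) hs; have h2 := H h hr.
have ->: d - c = h^-1 * (f (h *: v + x) - f x - c * h) - (h^-1 * (f (h *: v + x) - f x) - d) by field; exact: lt0r_neq0.
apply: le_trans (ler_normB _ _) _; apply: lerD => //.
by rewrite normrM normfV ler_pdivrMl ?normr_gt0 ?lt0r_neq0// [leRHS]mulrC.
Qed.

Lemma norm_dx i: `|dx i| <= 1.
by apply: rV_norm_le => // j; rewrite mxE; case: (_ && _); rewrite ?normr1 ?normr0. Qed.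

(** Smooth minorants of the height function. *)
Lemma smooth_height (Om : set E) x0 v (z : E -> R) (L r : R): patch Om x0 v z L r -> forall e, 0 < e -> e <= r / 16 ->
 exists2 zeta : E -> R, C1 zeta & forall x, `|x0 - x| < r / 4 ->
  [/\ zeta x + L * e <= z x, z x <= zeta x + 3 * L * e, pd v zeta x = 1 & gsq zeta x <= n%:R * L ^+ 2].
move=> [r0 L0 zL zv _] e e0 er.
have [rho mr] := @mollifier_exists e e0.
pose B := [set x : E | `|x| <= `|x0| + r].
have cB: compact B by exact: closed_ball_compact.
have [k kT [k01 [d d0 kd]]] := cutoff cB openT (@subsetT _ B).
have k1 x: `|x0 - x| < r -> k x = 1.
 move=> xr; apply: (kd); last exact: ballxx.
 by rewrite /B /= -(subKr x0 x) (le_trans (ler_normB _ _)); lra.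
have cz: continuous z.
 apply: continuous_epsP => x t t0; exists (t / L); first by rewrite divr_gt0.
 move=> y xy; apply: le_trans (zL x y) _; move: xy; rewrite ltr_pdivlMr// mulrC => /ltW//.
have ck := kT.1.
pose f x := z x * k x.
have Cbf: Cb f by apply: CbMr => //; exact: Cb_Cc.
have lf: Lb f by split; [exact: (continuous_sq Cbf.1 Cbf.2)|exact: Cbf.2].
have cm := moll_smooth mr lf.
have loc x s: `|x0 - x| < r - e -> rho s * f (x + s) = rho s * z (x + s).
 move=> xr; have [se|se] := pselect (ball 0 e s); last by rewrite (moll_supp mr se) !mul0r.
 rewrite /f k1 ?mulr1//; have /ballP := se; rewrite sub0r normrN => h.
 by rewrite opprD addrA (le_lt_trans (ler_normB _ _)); lra.
have mE x: `|x0 - x| < r - e -> moll rho f x = int (fun s => rho s * z (x + s)).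
 by move=> xr; apply: eq_int => s; exact: loc.
have Iz x: `|x0 - x| < r - e -> itg mu (fun s => rho s * z (x + s)).
 by move=> xr; have := moll_itg x mr lf; congr itg; apply/funext => s; exact: loc.
have Ir := Cc_itg (moll_Cc mr).
have avg u (c K : R) : itg mu (rho *' u) ->
  (forall s, ball 0 e s -> `|u s - c| <= K) -> `|int (rho *' u) - c| <= K.
 move=> Iu uK.
 have ->: int (rho *' u) - c = int (fun s => rho s * u s - c * rho s) by rewrite (intB Iu (itgZ c Ir)) (intZ c Ir) (moll_int mr) mulr1.
 rewrite -[leRHS]mulr1 -(moll_int mr) -(intZ K Ir); apply: int_abs_le.
 - exact: itgB (itgZ c Ir).
 - exact: itgZ.
 move=> s; have [/uK h|se] := pselect (ball 0 e s); last first.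
  by rewrite (moll_supp mr se) !(mul0r, mulr0) subrr normr0.
 by rewrite [c * _]mulrC -mulrBr normrM (ger0_norm (moll_ge0 mr s)) mulrC ler_wpM2r// (moll_ge0 mr).
exists (fun x => moll rho f x + (- (2 * L * e))).
 by apply: C1D; [exact: Cc_C1|exact: C1_cst].
move=> x xr; have xr1: `|x0 - x| < r - e by lra.
have near (h : R) (w : E) : `|w| <= `|v| + 1 -> `|h| < r / 4 / (`|v| + 1) -> `|x0 - (h *: w + x)| < r - e.
 move=> wv hr; have v1: 0 < `|v| + 1 by rewrite ltr_wpDl.
 move: hr; rewrite ltr_pdivlMr// => hr.
 have hw: `|h *: w| < r / 4 by rewrite normrZ; apply: le_lt_trans hr; rewrite ler_wpM2l.
 rewrite opprD addrCA; have := ler_normD (- (h *: w)) (x0 - x); rewrite normrN; lra.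
have rv0: 0 < r / 4 / (`|v| + 1) by rewrite !divr_gt0// ltr_wpDl.
have dd (w : E) : is_derive x w (moll rho f) (pd w (moll rho f) x) by exact: C1_is_derive (Cc_C1 cm).
have pE (w : E) : pd w (fun x => moll rho f x + (- (2 * L * e))) x = pd w (moll rho f) x.
 apply: eq_bigr => i _; rewrite (partial_add i (Cc_C1 cm) (C1_cst _)).
 by rewrite partial_cst addr0.
have diff (h : R) (w : E) : `|w| <= `|v| + 1 -> `|h| < r / 4 / (`|v| + 1) ->
  moll rho f (h *: w + x) - moll rho f x = int (fun s => rho s * (z (x + s + h *: w) - z (x + s))).
 move=> wv hr; rewrite !mE//; last exact: near.
 rewrite -intB; [|exact/Iz/near|exact: Iz].
 by apply: eq_int => s; rewrite mulrBr; rewrite -addrA addrC.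
have IB (h : R) (w : E) : `|w| <= `|v| + 1 -> `|h| < r / 4 / (`|v| + 1) -> itg mu (fun s => rho s * (z (x + s + h *: w) - z (x + s))).
 move=> wv hr; have := itgB (Iz _ (near h w wv hr)) (Iz x xr1); congr itg; apply/funext => s.
 by rewrite -mulrBr; congr (_ * (z _ - _)); rewrite [RHS]addrC addrA.
have H0: `|moll rho f x - z x| <= L * e.
 rewrite mE//; apply: (avg (fun s => z (x + s)) _ _ (Iz x xr1)) => s /ball0P => se.
 by apply: le_trans (zL _ _) _; rewrite addrAC subrr add0r ler_wpM2l// ltW.
split.
- move: H0; rewrite ler_norml => /andP[]; lra.
- move: H0; rewrite ler_norml => /andP[]; lra.
- rewrite pE; apply/eqP; rewrite -subr_eq0 -normr_le0.
 have vv: `|v| <= `|v| + 1 by lra.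
 apply: (deriv_bound rv0 (dd v)) => h hr; rewrite mul0r mul1r diff//.
 apply: avg; first exact: IB.
 move=> s _; rewrite zv; move: (z _) => a.
 by rewrite (_ : a + h - a - h = 0) ?normr0//; ring.
- rewrite /gsq (_ : n%:R * _ = \sum_(i < n) L ^+ 2); last by rewrite sumr_const card_ord mulr_natl.
 apply: ler_sum => i _; rewrite -real_normK ?num_real//; apply: lerXn2r; rewrite ?nnegrE ?(ltW L0)//.
 have wv: `|dx i| <= `|v| + 1 by apply: le_trans (norm_dx i) _; rewrite lerDr.
 rewrite -pd_dx pE -[X in `|X|]subr0.
 apply: (deriv_bound rv0 (dd (dx i))) => h hr; rewrite mul0r diff//.
 apply: avg; first exact: IB.
 move=> s _; rewrite subr0; apply: le_trans (zL _ _) _.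
 rewrite addrAC subrr add0r normrZ ler_wpM2l ?(ltW L0)//.
 by rewrite -[leRHS]mulr1 ler_wpM2l// norm_dx.
Qed.

Lemma partial_segseg h v u i j: 0 <= h -> Cc u ->
 'd_i ('d_j (seg h v u)) = seg h v ('d_i ('d_j u)).
by move=> h0 cu; rewrite (partial_seg v j h0 cu) (partial_seg v i h0 (Cc_d j cu)). Qed.
Lemma seg_itg h v u x: 0 <= h -> Cc u ->
 itg (@lebesgue_measure R) (fun s : RR => \1_`[0, h] s * u (x + (s : R) *: v)).
by move=> h0 cu; apply: Av_itg; [exact: (seg_k h0).1|exact: measurable_ray|exact: Cc_cts|exact: Cc_bsupp].
Qed.

Lemma lap_seg h v u x: 0 <= h -> Cc u ->
 (forall s : R, 0 <= s <= h -> lap u (x + s *: v) = 0) -> lap (seg h v u) x = 0.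
move=> h0 cu H; rewrite /lap; under eq_bigr do rewrite partial_segseg//.
have cpp i: Cc ('d_i ('d_i u)) by exact/Cc_d/Cc_d.
rewrite -int_sum; last by move=> i; exact: seg_itg.
rewrite int_eq0// => s; rewrite -mulr_sumr indicE.
case: (boolP (s \in _)) => [|_]; last by rewrite mul0r.
by rewrite inE/= => hs; rewrite -/(lap u _) H// mulr0.
Qed.

(** Integration by parts moves the direction v from G to phi at the price of a
  rotation and of the Laplacian of G. *)
Lemma ip_pd_dv G phi v: Cc G -> (forall i, Cc (phi i)) ->
 (forall i x, phi i x != 0 -> lap G x = 0) ->
 dot (pd v G) (dv phi) = \sum_i \sum_j v 0 j * dot ('d_i G) (rot phi i j).
move=> cG cp hG.
have sp i: sq mu ('d_i G) := sq_d i cG.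
have sq2 i j: sq mu ('d_j (phi i)) := sq_d j (cp i).
have cG1 i := Cc_C1 (Cc_d i cG).
have E1 i j: dot ('d_j G) ('d_i (phi i)) = dot ('d_i G) ('d_j (phi i)).
 rewrite (ip_partial i (cG1 j) (cp i)) (ip_partial j (cG1 i) (cp i)).
 have ->: 'd_i ('d_j G) = 'd_j ('d_i G) by exact: partialC cG.
 by [].
have E2 j: \sum_i dot ('d_i G) ('d_i (phi j)) = 0.
 have E3 i: dot ('d_i G) ('d_i (phi j)) = - dot ('d_i ('d_i G)) (phi j).
  exact: ip_partial.
 rewrite (eq_bigr _ (fun i _ => E3 i)) sumrN.
 have ->: \sum_i dot ('d_i ('d_i G)) (phi j) = dot (lap G) (phi j).
  apply: esym; apply: ip_sql; last exact: Cc_sq.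
  by move=> i; exact/Cc_sq/Cc_d/Cc_d.
 rewrite /ip int_eq0 ?oppr0// => x.
 by have [->|/hG ->] := eqVneq (phi j x) 0; rewrite ?mulr0 ?mul0r.
have E4 i j: dot ('d_i G) (rot phi i j) =
  dot ('d_i G) ('d_j (phi i)) - dot ('d_i G) ('d_i (phi j)).
 exact: ipBr.
have sd: sq mu (dv phi) := Cc_sq (Cc_dv cp).
rewrite {1}/pd ip_sql//; last by move=> i; exact: sqZ.
rewrite (eq_bigr (fun j => v 0 j * \sum_i dot ('d_i G) ('d_j (phi i)))); last first.
 move=> j _; rewrite ipZl//; congr (_ * _).
 apply: etrans (@ip_sumr _ _ _ mu _ (index_enum 'I_n) (fun i => 'd_i (phi i)) _ (fun i => sq2 i i) (sp j)) _.
 by apply: eq_bigr => i _.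
under eq_bigr do rewrite mulr_sumr.
rewrite exchange_big/=; apply/eqP; rewrite -subr_eq0 -sumrB; apply/eqP.
rewrite (eq_bigr (fun i => \sum_j v 0 j * dot ('d_i G) ('d_i (phi j)))); last first.
 move=> i _; rewrite -sumrB; apply: eq_bigr => j _; rewrite E4 -mulrBr; congr (_ * _).
 by move: (ip) (ip) => a b; ring.
by rewrite exchange_big/= big1// => j; rewrite -mulr_sumr E2 mulr0.
Qed.

(** The pointwise inequality behind the Rellich estimate. *)
Lemma rellich_pt (a p s s' t D P q z K X1 X2 gc : R): 0 <= D -> 0 < K -> 0 <= s' <= 1 -> 0 <= s <= t ->
 s ^+ 2 <= s' * t ^+ 2 -> a ^+ 2 <= 1 -> q ^+ 2 <= gc * D -> z ^+ 2 <= K * D ->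
 p ^+ 2 <= X1 -> gc <= X2 ->
 2^-1 * (a ^+ 2 * s' * D) <= (2 * a * p * s + a ^+ 2 * s') * D - 2 * P * (2 * a * s * q + a ^+ 2 * s' * z) +
  (4 * X1 + 2 * X2) * t ^+ 2 * D + (4 * K + 2) * P ^+ 2.
move=> D0 K0 /andP[s'0 s'1] /andP[s0 st] s2 a1 qD zD pX gX.
have a0 := sqr_ge0 a; have t0: 0 <= t by lra.
set X := a ^+ 2 * s'.
have X0: 0 <= X by rewrite mulr_ge0.
have Xle1: X <= 1 by rewrite /X; nra.
have h1: - (X / 4 + 4 * (p ^+ 2 * t ^+ 2)) <= 2 * a * p * s.
 set Y := p ^+ 2 * t ^+ 2; have Y0: 0 <= Y by rewrite mulr_ge0 ?sqr_ge0.
 have B0: 0 <= X / 4 + 4 * Y by lra.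
 have : (2 * a * p * s) ^+ 2 <= (X / 4 + 4 * Y) ^+ 2.
  apply: (@le_trans _ _ (4 * (X * Y))); last first.
   rewrite -subr_ge0 (_ : _ - _ = (X / 4 - 4 * Y) ^+ 2) ?sqr_ge0//; by field.
  rewrite (_ : _ ^+ 2 = 4 * (a ^+ 2 * p ^+ 2 * s ^+ 2)); last by ring.
  rewrite ler_wpM2l// (_ : X * Y = a ^+ 2 * p ^+ 2 * (s' * t ^+ 2)); last by rewrite /X /Y; ring.
  by rewrite ler_wpM2l// mulr_ge0 ?sqr_ge0.
 rewrite -(ler_sqrt _ (sqr_ge0 _)) !sqrtr_sqr (ger0_norm B0).
 by have := ler_norm (- (2 * a * p * s)); rewrite normrN; lra.
have h2: 2 * P * (X * z) <= X * D / 4 + 4 * K * P ^+ 2.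
 have : 2 * P * z <= D / 4 + 4 * K * P ^+ 2.
  have : 0 <= (z / (2 * K) - 2 * P) ^+ 2 by exact: sqr_ge0.
  have e1: (z / (2 * K) - 2 * P) ^+ 2 = (z ^+ 2 / (4 * K) - 2 * P * z + 4 * K * P ^+ 2) / K by field; rewrite gt_eqF.
  rewrite e1 pmulr_lge0 ?invr_gt0// => h3.
  have : z ^+ 2 / (4 * K) <= D / 4 by rewrite ler_pdivrMr ?mulr_gt0// (_ : D / 4 * (4 * K) = K * D)//; field.
  by lra.
 move=> h; have hX := ler_wpM2l X0 h.
 have : X * (4 * K * P ^+ 2) <= 4 * K * P ^+ 2 by rewrite -[leRHS]mul1r ler_wpM2r// mulr_ge0 ?sqr_ge0 ?mulr_ge0 ?(ltW K0).
 move: hX; rewrite mulrDr (_ : X * (2 * P * z) = 2 * P * (X * z)); last by ring.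
 rewrite (_ : X * (D / 4) = X * D / 4); last by ring.
 by lra.
have h3: 2 * P * (2 * a * s * q) <= 2 * P ^+ 2 + 2 * X2 * t ^+ 2 * D.
 have e: 2 * P * (2 * a * s * q) <= 2 * P ^+ 2 * a ^+ 2 + 2 * (s ^+ 2 * q ^+ 2).
  rewrite -subr_ge0 (_ : _ - _ = 2 * (P * a - s * q) ^+ 2); last by ring.
  by rewrite mulr_ge0// sqr_ge0.
 apply: le_trans e _; apply: lerD.
  by rewrite -[leRHS]mulr1 ler_wpM2l// mulr_ge0// sqr_ge0.
 rewrite (_ : 2 * X2 * t ^+ 2 * D = 2 * (t ^+ 2 * (X2 * D))); last by ring.
 rewrite ler_wpM2l//.
 apply: ler_pM; rewrite ?sqr_ge0//; first by apply: lerXn2r.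
 by apply: le_trans qD _; rewrite ler_wpM2r.
have h4: (2 * a * p * s) * D >= - (X * D / 4) - 4 * X1 * t ^+ 2 * D.
 have h5: p ^+ 2 * t ^+ 2 <= X1 * t ^+ 2 by rewrite ler_wpM2r ?sqr_ge0.
 have h6: - (X / 4 + 4 * (X1 * t ^+ 2)) <= 2 * a * p * s by lra.
 have := ler_wpM2r D0 h6; congr (_ <= _); ring.
rewrite mulrDl mulrDr; move: h2 h3 h4.
move: (2 * P * (X * z)) (2 * P * (2 * a * s * q)) (2 * a * p * s * D) => b1 b2 b3.
rewrite (_ : (4 * X1 + 2 * X2) * t ^+ 2 * D = 4 * X1 * t ^+ 2 * D + 2 * X2 * t ^+ 2 * D); last by ring.
rewrite (_ : (4 * K + 2) * P ^+ 2 = 4 * K * P ^+ 2 + 2 * P ^+ 2); last by ring.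
lra.
Qed.

Lemma cball_closed x (M : R): closed [set y : E | `|x - y| <= M].
apply: (@closed_comp _ _ (fun y : E => `|x - y|) [set t | t <= M]); last exact: closed_le.
move=> y _; apply: (@continuous_epsP R n (fun y : E => `|x - y|)) => a e e0; exists e => // b ab.
apply: (le_trans (ler_dist_dist (x - a) (x - b))).
have ->: x - a - (x - b) = b - a by rewrite opprB addrC subrKA.
by rewrite distrC ltW.
Qed.

Lemma cball_compact x (M : R): compact [set y : E | `|x - y| <= M].
apply: (@subclosed_compact _ _ [set y : E | `|y| <= `|x| + M]).
- exact: cball_closed.
- exact: closed_ball_compact.
by move=> y /= xy; rewrite -(subKr x y) (le_trans (ler_normB _ _))// lerD2l.
Qed.

Lemma gsq_bounded f: Cc f -> exists2 M, 0 < M & forall x, gsq f x <= M.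
move=> cf; have [c b] := gsq_Cb cf; have [M M0 H] := bsupp_bounded c b.
by exists M => // x; exact: le_trans (ler_norm _) (H x).
Qed.

Lemma cutoff_ball x (a b : R): 0 < a -> a < b -> exists2 k, Ct (ball x b) k &
 [/\ forall y, 0 <= k y <= 1 & forall y, `|x - y| <= a -> k y = 1].
move=> a0 ab; have [k kO [k01 [r r0 kr]]] := cutoff (@cball_compact x a) (ball_open x b) 
 (fun y (h : `|x - y| <= a) => (ballP x b y).2 (le_lt_trans h ab)).
by exists k => //; split => // y xy; apply: (kr y y xy); exact: ballxx.
Qed.

(** Harmonicity along the segments [x, x + h v] above the graph. *)
Lemma er_above (Om : set E) x0 v (z zeta : E -> R) (L r eta h : R) x (s : R):
 patch Om x0 v z L r -> zeta x + L * eta <= z x -> `|x0 - x| < r / 8 -> h * `|v| <= r / 8 ->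
 eta <= r / 8 -> 0 <= s <= h -> 0 < zeta x + s -> er Om eta (x + s *: v).
move=> [r0 L0 zL zv zO] zz xr hv er_ /andP[s0 sh] zs y /ballP xy.
have sv: `|s *: v| <= r / 8 by rewrite normrZ (ger0_norm s0); apply: le_trans hv; rewrite ler_wpM2r.
apply/zO.
 apply/ballP; rewrite (_ : x0 - y = (x0 - x) - s *: v + (x + s *: v - y)); last first.
  by rewrite -[x0 - x - _]addrA -opprD subrKA.
 apply: le_lt_trans (ler_normD _ _) _; have := ler_normB (x0 - x) (s *: v).
 by lra.
have := zL (x + s *: v) y; rewrite zv => h1; have h2 := le_trans (ler_norm _) h1.
have h3: L * `|x + s *: v - y| < L * eta by rewrite ltr_pM2l.
by move: h2 h3 zz zs; clear; lra.
Qed.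

(** On the support of a test field the height is bounded below. *)
Lemma height_gt (Om : set E) x0 v (z : E -> R) (L r d : R) x: patch Om x0 v z L r -> 0 < d ->
 er Om d x -> `|x0 - x| <= r / 8 -> Num.min d (r / 2) / (2 * (`|v| + 1)) < z x.
move=> [r0 L0 zL zv zO] d0 xd xr; set s := _ / _.
have v1: 0 < `|v| + 1 by [].
have m0: 0 < Num.min d (r / 2) by rewrite lt_min d0 divr_gt0.
have s0: 0 < s by rewrite mulr_gt0.
have sv: s * `|v| < Num.min d (r / 2).
 have : s * (2 * (`|v| + 1)) = Num.min d (r / 2) by rewrite divfK// mulr_gt0.
 by lra.
have nsv: `|s *: v| < Num.min d (r / 2) by rewrite normrZ gtr0_norm.
move: nsv; rewrite lt_min => /andP[sd sr].
have Oy: Om (x + (- s) *: v) by apply: xd; apply/ballP; rewrite scaleNr opprD opprK addrA subrr add0r.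
have := (zO (x + (- s) *: v) _).1 Oy; rewrite zv => H.
suff /H : ball x0 r (x + (- s) *: v) by lra.
apply/ballP; rewrite scaleNr opprB addrCA addrC; have := ler_normD (x0 - x) (s *: v).
by lra.
Qed.

Lemma lap_shift u y x: Cc u -> lap (fun x => u (x + y)) x = lap u (x + y).
move=> cu; apply: eq_bigr => i _.
by rewrite (partial_shift i y (Cc_C1 cu)) (partial_shift i y (Cc_C1 (Cc_d i cu))).
Qed.

(** Mollify g to u and put G = seg h v u, so that pd v G = u (. + h v) - u. The field is tested
 against the translate of u by the interior estimate (T1), and against pd v G through the
 gradient of G (T2). This one is bounded on the support of phi by the Rellich identity with weight k^2
 sig(zeta), where zeta is a smooth height below which G need not be harmonic; the terms where the
 derivative falls on k are controlled by the Caccioppoli inequality with the degenerate weight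
 k'^2 zeta_+^2 (energy). *)
Lemma K_patch (Om : set E) x0 v (z : E -> R) (L r : R): open Om -> patch Om x0 v z L r ->
 Kb Om (ball x0 (r / 32)).
move=> oO pt; have [r0 L0 zL zv zO] := pt.
pose r1 := r / 32; have r10: 0 < r1 by rewrite divr_gt0.
have v1: 0 < `|v| + 1 by rewrite ltr_wpDl.
pose h := r1 / (`|v| + 1); have h0: 0 < h by rewrite divr_gt0.
have hv: h * `|v| <= r1.
 have e1: h * (`|v| + 1) = r1 by rewrite divfK// gt_eqF.
 by move: e1 h0; move: `|v| => a; clear; lra.
have r12: r1 < 2 * r1 by move: r10; clear; lra.
have r23: 2 * r1 < 3 * r1 by move: r10; clear; lra.
have [k kO [k01 k1]] := cutoff_ball x0 r10 r12.
have [k' kO' [k01' k1']] := cutoff_ball x0 (lt_trans r10 r12) r23.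
have [X2 X20 kX2] := gsq_bounded kO.1.
have [M1 M10 kM1] := gsq_bounded kO'.1.
have [X X0 kX] : exists2 X, 0 < X & forall x, `|pd v k x| <= X by apply: bsupp_bounded; [exact: Cc_cts (Cc_pd v kO.1)|exact: Cc_bsupp (Cc_pd v kO.1)].
pose X1 := X ^+ 2.
pose K := n%:R * L ^+ 2 + 1.
have nL: 0 <= n%:R * L ^+ 2 by rewrite mulr_ge0 ?sqr_ge0.
have K0: 0 < K by rewrite ltr_wpDl.
pose Z := `|z x0| + L * r + h.
pose MM := 2 * (Z ^+ 2 * M1 + K).
have MM0: 0 <= MM by rewrite mulr_ge0// addr_ge0 ?(ltW K0)// mulr_ge0 ?sqr_ge0 ?ltW.
pose c1 := Num.sqrt (4 * MM / h ^+ 2).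
pose Q := 2 * ((4 * X1 + 2 * X2) * (4 * MM) * h ^+ 2 + (4 * K + 2) * 4).
have cX: 0 <= 4 * X1 + 2 * X2 by rewrite addr_ge0// mulr_ge0 ?sqr_ge0 ?ltW.
have cK: 0 <= 4 * K + 2 by rewrite addr_ge0// mulr_ge0// ltW.
have Q0: 0 <= Q.
 exact: (mulr_ge0 (ler0n _ 2) (addr_ge0 (mulr_ge0 (mulr_ge0 cX (mulr_ge0 (ler0n _ 4) MM0)) (sqr_ge0 h)) (mulr_ge0 cK (ler0n _ 4)))).
pose C2 := Num.sqrt (Q / 2^-1).
have c10: 0 <= c1 by exact: sqrtr_ge0.
have C20: 0 <= C2 by exact: sqrtr_ge0.
exists (c1 + `|v| * C2) => [|g phi hg cp pA]; first by rewrite addr_ge0// mulr_ge0.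
have cpc i := (cp i).1.
have [d d0 dP] := Ct_er_all oO cp.
pose c := Num.min d (r / 2) / (2 * (`|v| + 1)).
have c0: 0 < c by rewrite divr_gt0 ?mulr_gt0// lt_min d0 divr_gt0.
pose eta := Num.min (r / 16) (c / (6 * L)).
have eta0: 0 < eta by rewrite lt_min; apply/andP; split; rewrite divr_gt0// mulr_gt0.
have eta1: eta <= r / 16 by rewrite ge_min lexx.
have eta2: 3 * L * eta <= c / 2.
 apply: (@le_trans _ _ (3 * L * (c / (6 * L)))); last by rewrite le_eqVlt; apply/orP; left; apply/eqP; field; rewrite gt_eqF.
 by rewrite ler_wpM2l ?mulr_ge0 ?(ltW L0)// ge_min lexx orbT.
have [zeta Cz zetaP] := smooth_height pt eta0 eta1.
pose C := [set x : E | `|x0 - x| <= r1] `&` er Om d.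
have clC: closed C by apply: closedI; [exact: cball_closed|exact: er_closed].
have phiC i x: ~ C x -> phi i x = 0.
 move=> nC; apply/eqP; apply: contraT => px; exfalso; apply: nC; split; last exact: dP px.
 have : ball x0 r1 x by apply: contrapT => /(pA i) e; rewrite e eqxx in px.
 by move/ballP/ltW.
have pphiC i j x: ~ C x -> 'd_j (phi i) x = 0.
 move=> nC; apply: tsupport0 => h1; apply: nC.
 by apply: (tsupport_sub clC (phiC i)); exact: tsupport_partial h1.
have r132: r1 <= r / 8 by move: r0; rewrite /r1; clear; lra.
have Czeta x: C x -> c / 2 <= zeta x.
 move=> [/= xr xd]; have h1 := height_gt pt d0 xd (le_trans xr r132).
 have xr4: `|x0 - x| < r / 4 by move: xr r132 r0; clear; lra.
 have [_ h2 _ _] := zetaP x xr4; rewrite -/c in h1; move: h1 h2 eta2; clear; lra.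
have in3 x: k' x != 0 -> `|x0 - x| < 3 * r1.
 move=> kx; have : ball x0 (3 * r1) x by apply: contrapT => h1; rewrite (Ct_out kO' h1) eqxx in kx.
 by move/ballP.
have in2 x: `|x0 - x| < 2 * r1 -> k' x = 1 by move=> h1; apply: k1'; exact: ltW.
have out2 x: ~ (`|x0 - x| < 2 * r1) -> k x = 0 /\ forall i, 'd_i k x = 0.
 move=> h1; have nb: ~ ball x0 (2 * r1) x by move/ballP.
 by split; [exact: Ct_out kO nb|move=> i; exact: Ct_out (Ct_d i kO) nb].
have r34: 3 * r1 < r / 8 by move: r0; rewrite /r1; clear; lra.
have r84: r / 8 < r / 4 by move: r0; clear; lra.
have eta8: eta <= r / 8 by move: eta1 r0; clear; lra.
have hv8: h * `|v| <= r / 8 by exact: le_trans hv r132.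
have above x (s : R) : `|x0 - x| < 3 * r1 -> 0 <= s <= h -> 0 < zeta x + s -> er Om eta (x + s *: v).
 move=> xr sh zs; have x8 := lt_trans xr r34; have [h1 _ _ _] := zetaP x (lt_trans x8 r84).
 exact: (er_above pt h1 x8 hv8 eta8 sh zs).
have zetaB (a : R) x : 0 <= a -> a <= h -> k' x != 0 -> `|pos (zeta x + a)| <= Z /\ gsq zeta x <= K.
 move=> a0 ah kx; have x8 := lt_trans (in3 x kx) r34; have [h1 _ _ h2] := zetaP x (lt_trans x8 r84).
 split; last by rewrite /K; move: h2; clear; lra.
 have Le0: 0 <= L * eta by rewrite mulr_ge0 ?ltW.
 have zx: z x <= `|z x0| + L * r.
  have h3 := zL x x0; have h4 := ler_norm (z x - z x0); have h5 := ler_norm (z x0).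
  have h6: L * `|x - x0| <= L * r by rewrite ler_wpM2l ?(ltW L0)// distrC; move: x8 r0; clear; lra.
  by move: h3 h4 h5 h6; clear; lra.
 have Z0: 0 <= Z by rewrite /Z !addr_ge0 ?normr_ge0 ?mulr_ge0// ltW.
 rewrite ger0_norm ?pos_ge0// /pos ge_max Z0 /= /Z; move: zx h1 Le0 ah; clear; lra.
have k'1 x: `|k' x| <= 1 by have /andP[a b] := k01' x; rewrite ger0_norm.
have [th1C th1b th10 th1M] := @wgtP k' zeta h Z K M1 kO'.1 Cz (ltW K0) (fun x => zetaB h x (ltW h0) (lexx _)) k'1 kM1.
have [th0C th0b th00 th0M] := @wgtP k' zeta 0 Z K M1 kO'.1 Cz (ltW K0) (fun x => zetaB 0 x (lexx _) (ltW h0)) k'1 kM1.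
have eta20: 0 < eta / 2 by rewrite divr_gt0.
apply: (@K_eps g phi _ (eta / 2) eta20 hg.1 cpc).
move=> e rho e0 ee mr; set u := moll rho g; have cu: Cc u := moll_smooth mr hg.1.
set S := nm g; have uS: nm u <= S by exact: nm_moll mr hg.1.
have S0: 0 <= S by exact: nm_ge0.
have lapu y: er Om eta y -> lap u y = 0 by move=> yO; apply: (lap_moll e0 mr hg); apply: erW yO; move: ee; clear; lra.
clearbody u S.
pose G := seg h v u; have cG: Cc G by exact: seg_Cc (ltW h0) cu.
have lapG x: `|x0 - x| < 3 * r1 -> 0 < zeta x -> lap G x = 0.
 move=> xr zx; apply: (lap_seg (ltW h0) cu) => s /andP[s0 sh]; apply: lapu; apply: above => //.
  by rewrite s0.
 by rewrite ltr_wpDr.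
have posn0 (t : R) : pos t != 0 -> 0 < t by rewrite ltNge; apply: contra => /posN ->.
pose u2 x := u (x + h *: v).
have cu2: Cc u2 by exact: Cc_shift.
have nu2: nm u2 <= S by rewrite (nm_shift _ (Cc_sq cu)).
have T1: `|dot u2 (dv phi)| <= c1 * S * nv phi.
 rewrite (ip_dv cu2 cpc) normrN; apply: le_trans (ler_norm_sum _ _ _) _.
 rewrite mulr_sumr; apply: ler_sum => i _.
 have h20: 0 < h ^+ 2 by rewrite exprn_gt0.
 have tf x: phi i x != 0 -> h ^+ 2 <= wgt k' zeta h x.
  move=> px; have Cx: C x by apply: contrapT => /(phiC i) e1; rewrite e1 eqxx in px.
  have zx := Czeta x Cx; have kx: k' x = 1 by apply: in2; apply: le_lt_trans Cx.1 r12.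
  rewrite /wgt kx !mul1r posE; last by move: zx c0 h0; clear; lra.
  by apply: lerXn2r; rewrite ?nnegrE; move: zx c0 h0; clear; lra.
 have tl x: wgt k' zeta h x != 0 -> lap u2 x = 0.
  rewrite /wgt mulf_eq0 negb_or mulf_eq0 negb_or => /andP[/andP[kx _]].
  rewrite expf_eq0/= => /posn0 zx; rewrite /u2 lap_shift//; apply: lapu.
  by apply: above => //; [exact: in3|rewrite lexx ltW].
 apply: le_trans (cacc_wcs i MM0 h20 th1C th1b th10 th1M tf cu2 tl (cpc i)) _.
 by rewrite ler_wpM2r ?nm_ge0// ler_wpM2l ?sqrtr_ge0.
have PE: pd v G = fun x => u2 x - u x by rewrite (pd_seg v v (ltW h0) cu) (seg_ftc v h0 cu).
have nG: nm G <= h * S by apply: le_trans (seg_nm v (ltW h0) cu) _; rewrite ler_wpM2l// ltW.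
clearbody u2 G.
have nP: nm (pd v G) <= 2 * S.
 have h1: nm (u2 -' u) <= nm u2 + nm u := nmB (Cc_sq cu2) (Cc_sq cu).
 rewrite PE; apply: (le_trans h1); rewrite mulr_natl mulr2n; exact: lerD.
pose delta := c / 2; have delta0: 0 < delta by rewrite divr_gt0.
have [Csig sigE] := C1_comp1 (fun t => sig_derive t delta0) (continuous_dsig delta0) Cz.
pose th x := k x * k x * dsig delta (zeta x).
have cth: continuous th.
 apply: cts_mul; first by apply: cts_mul; exact: Cc_cts kO.1.
 by move=> x; apply: continuous_comp; [exact: Cz.1|exact: continuous_dsig].
have th_ge0 x: 0 <= th x by have [_ /andP[s0 _] _ _] := dsig_bounds (zeta x) delta0; rewrite mulr_ge0// -expr2 sqr_ge0.
have energy: int (fun x => th x * gsq G x) <= Q * S ^+ 2.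
 pose w x := k x * k x * sig delta (zeta x).
 have Ckk := C1M (Cc_C1 kO.1) (Cc_C1 kO.1).
 have Cw: C1 w by exact: C1M.
 have bw: bsupp w by apply: bsuppMl; apply: bsuppMl; exact: Cc_bsupp kO.1.
 have wn0 x: w x != 0 -> lap G x = 0.
  rewrite /w mulf_eq0 negb_or mulf_eq0 negb_or => /andP[/andP[kx _] sx].
  have xr: `|x0 - x| < 2 * r1 by apply: contrapT => /out2[e1 _]; rewrite e1 eqxx in kx.
  apply: lapG; first by apply: lt_trans r23.
  by apply: posn0; move: sx; apply: contra; rewrite /sig => /eqP ->; rewrite expr0n mul0r.
 have RI := rellich v Cw bw cG wn0.
 pose W x := pd v w x * gsq G x - 2 * (pd v G x * \sum_i 'd_i w x * 'd_i G x).
 have cbD := gsq_Cb cG.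
 have cbP := Cb_Cc (Cc_pd v cG).
 have cpw i := Cb_partial i Cw bw.
 have IW1: Cb (fun x => pd v w x * gsq G x) by apply: CbMr => //; exact: continuous_pd.
 have IW2: Cb (fun x => pd v G x * \sum_i 'd_i w x * 'd_i G x).
  apply: CbMl => //; apply: continuous_bigsum => i; apply: cts_mul; first by case: (cpw i).
  exact: Cc_cts (Cc_d i cG).
 have IW: int W = 0.
  rewrite /W (intB (Cb_itg IW1) (itgZ 2 (Cb_itg IW2))) (intZ 2 (Cb_itg IW2)) RI subrr//.
 have IWi: itg mu W := itgB (Cb_itg IW1) (itgZ 2 (Cb_itg IW2)).
 have Ith: itg mu (fun x => th x * gsq G x) by apply: Cb_itg; apply: CbMr.
 have It0: itg mu (fun x => wgt k' zeta 0 x * gsq G x) by apply: Cb_itg; apply: CbMr => //; exact: th0C.1.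
 have IPP: itg mu (fun x => pd v G x * pd v G x) := sqM (Cc_sq (Cc_pd v cG)) (Cc_sq (Cc_pd v cG)).
 have pt_ x: 2^-1 * (th x * gsq G x) <= W x + ((4 * X1 + 2 * X2) * (wgt k' zeta 0 x * gsq G x) + (4 * K + 2) * (pd v G x * pd v G x)).
  have D0 := gsq_ge0 G x; have P0: 0 <= pd v G x * pd v G x by rewrite -expr2 sqr_ge0.
  have wE i: 'd_i w x = 2 * k x * sig delta (zeta x) * 'd_i k x + k x ^+ 2 * dsig delta (zeta x) * 'd_i zeta x.
   rewrite (partial_mul i Ckk Csig) (partial_mul i (Cc_C1 kO.1) (Cc_C1 kO.1)) sigE.
   by move: (k x) ('d_i k x) (sig _ _) (dsig _ _) ('d_i zeta x) => *; ring.
  have [xr|xr] := pselect (`|x0 - x| < 2 * r1); last first.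
   have [kx pkx] := out2 x xr.
   have w0 i: 'd_i w x = 0 by rewrite wE kx pkx; ring.
   rewrite /th kx !mul0r mulr0 /W /pd big1 ?mul0r; last by move=> i _; rewrite w0 mulr0.
   rewrite [X in _ * (_ * X)]big1 ?mulr0 ?subr0 ?add0r; last by move=> i _; rewrite w0 mul0r.
   exact: (addr_ge0 (mulr_ge0 cX (mulr_ge0 (th00 x) D0)) (mulr_ge0 cK P0)).
  have xr4: `|x0 - x| < r / 4 by apply: lt_trans xr _; move: r34 r23 r84; clear; lra.
  have [_ _ zv1 zK] := zetaP x xr4.
  have [sb sb' s2 _] := dsig_bounds (zeta x) delta0.
  have pE: pd v w x = 2 * k x * pd v k x * sig delta (zeta x) + k x ^+ 2 * dsig delta (zeta x).
   rewrite /pd (eq_bigr _ (fun i _ => congr1 (fun t => v 0 i * t) (wE i))).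
   have ->: 2 * k x * (\sum_i v 0 i * 'd_i k x) * sig delta (zeta x) + k x ^+ 2 * dsig delta (zeta x) =
    2 * k x * sig delta (zeta x) * (\sum_i v 0 i * 'd_i k x) + k x ^+ 2 * dsig delta (zeta x) * pd v zeta x.
    by rewrite zv1 mulr1 mulrAC.
   rewrite /pd !mulr_sumr -big_split/=; apply: eq_bigr => i _.
   by move: (v 0 i) (k x) ('d_i k x) (sig _ _) (dsig _ _) ('d_i zeta x) => *; ring.
  have SE: \sum_i 'd_i w x * 'd_i G x = 2 * k x * sig delta (zeta x) * (\sum_i 'd_i k x * 'd_i G x)
    + k x ^+ 2 * dsig delta (zeta x) * (\sum_i 'd_i zeta x * 'd_i G x).
   rewrite !mulr_sumr -big_split/=; apply: eq_bigr => i _; rewrite wE.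
   by move: (k x) ('d_i k x) (sig _ _) (dsig _ _) ('d_i zeta x) ('d_i G x) => *; ring.
  have a1: k x ^+ 2 <= 1 by have /andP[a b] := k01 x; rewrite expr_le1.
  have pX: pd v k x ^+ 2 <= X1 by rewrite -real_normK ?num_real//; apply: lerXn2r; rewrite ?nnegrE ?(ltW X0)//; exact: kX.
  have zKD: (\sum_i 'd_i zeta x * 'd_i G x) ^+ 2 <= K * gsq G x.
   apply: le_trans (CS_sum (fun i => 'd_i zeta x) (fun i => 'd_i G x)) _.
   by rewrite ler_wpM2r//; move: zK; rewrite /gsq /K; move: (\sum_i _) => t; clear; lra.
  have main := rellich_pt (pd v G x) D0 K0 sb' sb s2 a1
   (CS_sum (fun i => 'd_i k x) (fun i => 'd_i G x)) zKD pX (kX2 x).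
  rewrite /W pE SE /th /wgt (in2 x xr) !mul1r addr0 -!expr2.
  move: main; move: (\sum_i _) (\sum_i _) (pos _) (gsq G x) (sig _ _) (dsig _ _) (pd v k x) (pd v G x) (k x); clear.
  move=> q zz t D s s' p P a main; apply: le_trans main _.
  by rewrite le_eqVlt; apply/orP; left; apply/eqP; ring.
 have := int_le (itgZ 2^-1 Ith) (itgD IWi (itgD (itgZ _ It0) (itgZ _ IPP))) pt_.
 rewrite (intZ _ Ith) (intD IWi (itgD (itgZ _ It0) (itgZ _ IPP))) (intD (itgZ _ It0) (itgZ _ IPP)).
 rewrite (intZ _ It0) (intZ _ IPP) IW add0r => main.
 have wG x: wgt k' zeta 0 x != 0 -> lap G x = 0.
  rewrite /wgt mulf_eq0 negb_or mulf_eq0 negb_or addr0 => /andP[/andP[kx _]].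
  by rewrite expf_eq0/= => /posn0 zx; apply: lapG => //; exact: in3.
 have cac := caccioppoli MM0 th0C th0b th00 th0M cG wG.
 have G2: dot G G <= h ^+ 2 * S ^+ 2.
  rewrite -nm_sq -exprMn; apply: lerXn2r; [by rewrite nnegrE nm_ge0| |exact: nG].
  by rewrite nnegrE mulr_ge0// ltW.
 have P2: int (fun x => pd v G x * pd v G x) <= 4 * S ^+ 2.
  rewrite -/(dot (pd v G) (pd v G)) -nm_sq (_ : 4 * S ^+ 2 = (2 * S) ^+ 2); last by ring.
  apply: lerXn2r; [by rewrite nnegrE nm_ge0| |exact: nP].
  by rewrite nnegrE mulr_ge0.
 have A1 := ler_wpM2l cX (le_trans cac (ler_wpM2l (mulr_ge0 (ler0n _ 4) MM0) G2)).
 have A2 := ler_wpM2l cK P2.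
 rewrite /Q; move: main A1 A2; clear.
 move: (int _) (int _) (int _) => a b b'.
 rewrite (_ : (4 * X1 + 2 * X2) * (4 * MM * (h ^+ 2 * S ^+ 2)) = (4 * X1 + 2 * X2) * (4 * MM) * h ^+ 2 * S ^+ 2); last by ring.
 rewrite (_ : 2 * _ * S ^+ 2 = 2 * ((4 * X1 + 2 * X2) * (4 * MM) * h ^+ 2 * S ^+ 2 + (4 * K + 2) * (4 * S ^+ 2))); last by ring.
 by move: (_ * S ^+ 2) ((4 * K + 2) * (4 * S ^+ 2)) ((4 * X1 + 2 * X2) * b) ((4 * K + 2) * b') => *; lra.
have hG i x: phi i x != 0 -> lap G x = 0.
 move=> px; have Cx: C x by apply: contrapT => /(phiC i) e1; rewrite e1 eqxx in px.
 apply: lapG; first by apply: le_lt_trans Cx.1 _; exact: lt_trans r12 r23.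
 by apply: lt_le_trans (Czeta x Cx).
have T2 i j: `|dot ('d_i G) (rot phi i j)| <= C2 * S * nm (rot phi i j).
 have tf x: rot phi i j x != 0 -> 2^-1 <= th x.
  move=> px; have Cx: C x.
   by apply: contrapT => nC; move: px; rewrite /rot !pphiC// subrr eqxx.
  have [_ _ _ sd] := dsig_bounds (zeta x) delta0.
  rewrite /th k1; last exact: Cx.1.
  by rewrite !mul1r; have := sd (Czeta x Cx); rewrite mul1r.
 have i20: 0 < 2^-1 :> R by rewrite invr_gt0.
 apply: le_trans (wcs i i20 cth th_ge0 tf cG (Cc_rot i j cpc)) _.
 rewrite ler_wpM2r ?nm_ge0//.
 apply: (@le_trans _ _ (Num.sqrt (Q / 2^-1 * S ^+ 2))).
  rewrite ler_wsqrtr// [leRHS]mulrAC; apply: ler_wpM2r; [by rewrite invr_ge0|exact: energy].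
 by rewrite sqrtrM ?divr_ge0// sqrtr_sqr ger0_norm.
have uE: dot u (dv phi) = dot u2 (dv phi) - dot (pd v G) (dv phi).
 rewrite PE ipBl; [ring|exact: Cc_sq|exact: Cc_sq|exact: Cc_sq (Cc_dv cpc)].
rewrite uE (ip_pd_dv v cG cpc hG); apply: le_trans (ler_normB _ _) _.
have T3: `|\sum_i \sum_j v 0 j * dot ('d_i G) (rot phi i j)| <= `|v| * C2 * S * rt phi.
 apply: le_trans (ler_norm_sum _ _ _) _; rewrite /rt mulr_sumr; apply: ler_sum => i _.
 apply: le_trans (ler_norm_sum _ _ _) _; rewrite mulr_sumr; apply: ler_sum => j _.
 by rewrite normrM -!mulrA; apply: ler_pM => //; [exact: rV_norm_coord|rewrite mulrA; exact: T2].
apply: le_trans (lerD T1 T3) _.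
have nv0 := nv_ge0 phi; have rt0 := rt_ge0 phi.
rewrite (_ : (c1 + _) * S * _ = c1 * S * nv phi + `|v| * C2 * S * rt phi + (c1 * S * rt phi + `|v| * C2 * S * nv phi)); last by ring.
by rewrite lerDl addr_ge0// !mulr_ge0.
Qed.

(** * Gluing and compactness *)

Lemma closure_ball Om (M : R): Om `<=` ball 0 M -> closure Om `<=` [set y | `|y| <= M].
move=> OM y; suff H: closure Om `<=` [set y | `|0 - y| <= M] by move=> /H /=; rewrite sub0r normrN.
by rewrite closureE; apply: smallest_sub => [|w /OM /ballP/ltW//]; exact: cball_closed.
Qed.
Lemma compact_closure Om: bounded_set Om -> compact (closure Om).
move=> /bddP[M _ /closure_ball OM].
by apply: subclosed_compact OM; [exact: closed_closure|exact: closed_ball_compact].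
Qed.

Lemma finite_ball_cover (K : set E) (P : E -> R -> Prop): compact K ->
 (forall x, K x -> exists2 r, 0 < r & P x r) ->
 exists2 s : seq (E * R), forall p, p \in s -> 0 < p.2 /\ P p.1 p.2 &
  forall y, K y -> exists2 p, p \in s & ball p.1 p.2 y.
move=> cK KP.
have KP' x: exists r, K x -> 0 < r /\ P x r by have [/KP[r]|nK] := pselect (K x); [exists r|exists 0].
have [r rP] := choice KP'.
have cK' := cK; rewrite compact_cover in cK'.
have [|x Kx|D DK KD] := cK' E K (fun x => ball x (r x)); first by move=> x _; exact: ball_open.
 by exists x => //; apply: ballxx; exact: (rP x Kx).1.
exists [seq (x, r x) | x <- finmap.enum_fset D].
 by move=> p /mapP[x xD ->]; apply: rP; have := DK x xD; rewrite inE.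
move=> y /KD[x /= xD xy]; exists (x, r x) => //.
by apply/mapP; exists x.
Qed.

(** A property that holds near each point of a compact set, and passes to the union with a slightly
 smaller ball, holds on a neighbourhood of the set. *)
Lemma cover_ind (S : set E) (K : set E -> Prop): compact S ->
 (forall x, S x -> exists2 r, 0 < r & K (ball x (2 * r))) -> K set0 ->
 (forall A x r' r, 0 < r' -> r' < r -> K A -> K (ball x r) -> K (A `|` ball x r')) ->
 exists2 A, S `<=` A & K A.
move=> cS loc K0 KU; have [s sP cov] := finite_ball_cover cS loc.
exists (\big[setU/set0]_(p <- s) ball p.1 p.2).
 by move=> x /cov[p ps px]; rewrite (big_rem p)//=; left.
elim: s sP {cov} => [|p s ih] sP; first by rewrite big_nil.
have [p0 pK] := sP p (mem_head _ _); rewrite big_cons setUC.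
apply: (KU _ _ _ _ p0 _ _ pK); first by rewrite mulr_natl mulr2n ltrDr.
by apply: ih => q qs; apply: sP; rewrite inE qs orbT.
Qed.

Lemma mul_field k phi (c : R): smooth k -> 0 <= c -> (forall x, `|k x| <= 1) ->
 (forall i x, `|'d_i k x| <= c) -> (forall i, Cc (phi i)) ->
 rt (fun i x => k x * phi i x) + nv (fun i x => k x * phi i x) <=
 (1 + 2 * n%:R * c) * (rt phi + nv phi).
move=> sk c0 k1 kc cp; set kp := fun i x => k x * phi i x.
have mk: mfun k := cts_meas (smooth_continuous sk).
have sf i := Cc_sq (cp i).
have H1 i: nm (kp i) <= nm (phi i).
 have [_ h] := nm_mul_le (sf i) mk k1; rewrite mul1r in h.
 by rewrite /kp; under eq_fun do rewrite mulrC.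
have Ckp i x j: 'd_j (kp i) x = 'd_j k x * phi i x + k x * 'd_j (phi i) x by rewrite /kp (partial_mul j (smooth_C1 sk) (Cc_C1 (cp i))).
have H2 i j: nm (rot kp i j) <= nm (rot phi i j) + c * (nm (phi i) + nm (phi j)).
 have ->: rot kp i j = fun x => rot phi i j x * k x + (phi i x * 'd_j k x - phi j x * 'd_i k x).
  apply/funext => x; rewrite /rot !Ckp; move: (partial) (phi) (k) ('d_j (phi i))
   (partial) (phi) ('d_i (phi j)) => *; ring.
 have [s1 h1] := nm_mul_le (Cc_sq (Cc_rot i j cp)) mk k1.
 have mp l: mfun ('d_l k) by apply: cts_meas; exact: smooth_continuous (smooth_partial l sk).
 have [s2 h2] := nm_mul_le (sf i) (mp j) (kc j).
 have [s3 h3] := nm_mul_le (sf j) (mp i) (kc i).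
 apply: le_trans (nmD s1 (sqB s2 s3)) _; rewrite mul1r in h1; apply: lerD => //.
 by apply: le_trans (nmB s2 s3) _; rewrite mulrDr; exact: lerD.
have rtE: rt kp <= rt phi + 2 * n%:R * c * nv phi.
 apply: (@le_trans _ _ (\sum_i \sum_j (nm (rot phi i j) + c * (nm (phi i) + nm (phi j))))).
  by apply: ler_sum => i _; apply: ler_sum => j _.
 rewrite (eq_bigr (fun i => \sum_j nm (rot phi i j) + (n%:R * c * nm (phi i) + c * nv phi))); last first.
  move=> i _; rewrite big_split/=; congr (_ + _); rewrite -mulr_sumr big_split/= mulrDr; congr (_ + _).
  by rewrite sumr_const card_ord -[in LHS]mulr_natl mulrCA mulrA.
 rewrite big_split/= big_split/= -mulr_sumr sumr_const card_ord -[_ *+ n]mulr_natl -/(nv phi) -/(rt phi).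
 by lra.
have nvE: nv kp <= nv phi by apply: ler_sum => i _.
have r0 := rt_ge0 phi; have n0: 0 <= 2 * n%:R * c * rt phi by rewrite mulr_ge0// mulr_ge0// mulr_ge0.
move: rtE nvE r0 n0; rewrite mulrDl mul1r mulrDr.
by move: (2 * n%:R * c * rt phi) (2 * n%:R * c * nv phi) (rt) (nv) => *; lra.
Qed.

Lemma ip_dvD g phi psi: sq mu g -> (forall i, Cc (phi i)) -> (forall i, Cc (psi i)) ->
 dot g (dv (fun i x => phi i x + psi i x)) = dot g (dv phi) + dot g (dv psi).
move=> sg cp cs; rewrite -ipDr//; [|exact: Cc_sq (Cc_dv cp)|exact: Cc_sq (Cc_dv cs)].
congr (ip); apply/funext => x; rewrite /dv -big_split/=; apply: eq_bigr => i _.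
by rewrite (partial_add i (Cc_C1 (cp i)) (Cc_C1 (cs i))).
Qed.

Lemma dv0 phi: (forall i x, phi i x = 0) -> dv phi = fun=> 0.
move=> p0; apply/funext => x; rewrite /dv big1// => i _.
have ->: phi i = fun=> 0 by apply/funext => y.
by rewrite partial_cst.
Qed.

Lemma partials_bounded k: Cc k -> exists2 c, 0 <= c & forall i x, `|'d_i k x| <= c.
move=> ck; have [M M0 kM] := gsq_bounded ck; exists (Num.sqrt M); first exact: sqrtr_ge0.
move=> i x; rewrite -sqrtr_sqr; apply: ler_wsqrtr; apply: le_trans (kM x).
by apply: (ler_sum1 (F := fun i => 'd_i k x ^+ 2)) => j; exact: sqr_ge0.
Qed.

(** Split phi by a cutoff function k. Its derivatives fall on phi, which only contributes to the
 lower order term. *)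
Lemma Kb_union Om A x (r' r : R): 0 < r' -> r' < r -> Kb Om A -> Kb Om (ball x r) ->
 Kb Om (A `|` ball x r').
move=> r'0 rr [Ca Ca0 KA] [Cb Cb0 KB].
have [k kO [k01 k1]] := cutoff_ball x r'0 rr.
have ck := kO.1; have [c c0 kc] := partials_bounded ck.
pose k' y := 1 + (- 1) * k y.
have sk': smooth k' by apply: smoothD; [exact: smooth_cst|apply: smoothZ; exact: Cc_smooth].
have kn y: `|k y| <= 1 by have /andP[a] := k01 y; rewrite ger0_norm.
have k'n y: `|k' y| <= 1 by have /andP[a b] := k01 y; rewrite /k' ger0_norm; move: a b; clear; lra.
have k'c i y: `|'d_i k' y| <= c.
 rewrite /k' (partial_add i (C1_cst 1)); last first.
  by apply: smooth_C1; apply: smoothZ; exact: Cc_smooth ck.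
 rewrite (partial_mul i (C1_cst (-1)) (Cc_C1 ck)) !partial_cst.
 by rewrite add0r mul0r add0r mulN1r normrN.
pose q := 1 + 2 * n%:R * c.
have q0: 0 <= q by rewrite addr_ge0// mulr_ge0.
exists ((Ca + Cb) * q) => [|g phi hg cp pA]; first by rewrite mulr_ge0// addr_ge0.
have cpc i := (cp i).1.
pose p1 i y := k y * phi i y; pose p2 i y := k' y * phi i y.
have c1 i: Ct Om (p1 i) by apply: CtM => //; exact: Cc_smooth ck.
have c2 i: Ct Om (p2 i) by exact: CtM.
have pE: phi = fun i y => p1 i y + p2 i y by apply/funext => i; apply/funext => y; rewrite /p1 /p2 /k'; ring.
have sg := Lb_sq hg.1.
rewrite {1}pE (ip_dvD sg (fun i => (c1 i).1) (fun i => (c2 i).1)); apply: le_trans (ler_normD _ _) _.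
have B1: `|dot g (dv p1)| <= Cb * nm g * (q * (rt phi + nv phi)).
 apply: le_trans (KB g p1 hg c1 _) _.
  by move=> i y ny; rewrite /p1 (Ct_out kO ny) mul0r.
 by apply: ler_wpM2l; [rewrite mulr_ge0// nm_ge0|exact: (mul_field (Cc_smooth ck))].
have B2: `|dot g (dv p2)| <= Ca * nm g * (q * (rt phi + nv phi)).
 apply: le_trans (KA g p2 hg c2 _) _.
  move=> i y ny; rewrite /p2; have [/ballP xy|nb] := pselect (ball x r' y).
   by rewrite /k' k1 ?(ltW xy)// mulN1r subrr mul0r.
  by rewrite (pA) ?mulr0// => -[].
 by apply: ler_wpM2l; [rewrite mulr_ge0// nm_ge0|exact: (mul_field)].
apply: le_trans (lerD B1 B2) _; rewrite le_eqVlt; apply/orP; left; apply/eqP.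
by ring.
Qed.

Lemma Kb_global Om: open Om -> bounded_set Om -> patched Om -> Kb Om setT.
move=> oO bO hp; have [x clx|||A clA [C C0 H]] := cover_ind (K := Kb Om) (compact_closure bO).
- have [Ox|nOx] := pselect (Om x).
  have [r r0 Kr] := K_interior oO Ox; exists (r / 2); first by rewrite divr_gt0.
  by rewrite mulrC divfK.
 have [v [z [L [r pt]]]] := hp x clx nOx.
 have [r0 _ _ _ _] := pt; exists (r / 64); first by rewrite divr_gt0.
 by have := K_patch oO pt; congr (Kb _ (ball _ _)); field.
- exists 0 => // g phi hg cp pA; rewrite dv0; last by move=> i x; exact: (pA i x id).
 by rewrite /ip int_eq0 ?normr0 ?mul0r// => x; rewrite mulr0.
- by move=> A x r' r; exact: Kb_union.
exists C => // g phi hg cp _; apply: H => // i x nx.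
by apply: (Ct_out (cp i)) => /subset_closure/clA.
Qed.

(** Rellich compactness. Mollification is uniformly close to the identity on
  functions with bounded gradient, and its range is equicontinuous, so that
  finitely many values decide; an ultrafilter picks a limit for all of them. *)
Lemma moll_close f e rho: 0 < e -> mollifier e rho -> Cc f ->
 nm (fun x => moll rho f x - f x) <= e * \sum_i nm ('d_i f).
move=> e0 mr cf; set B := e * _.
have B0: 0 <= B by rewrite mulr_ge0 ?(ltW e0)// sumr_ge0// => i _; exact: nm_ge0.
have cr := moll_Cc mr; have lg := Lb_Cc cf; have sg := Cc_sq cf.
apply: nm_le => //.
have mD: mfun (fun p : E * E => f (p.2 + p.1) - f p.2).
 apply: measurable_funB; last exact: (measurableT_comp (f := f) sg.1).
 apply: (measurableT_comp (f := f)); first exact: sg.1.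
 by have := @measurable_rVD; congr measurable_fun; apply/funext => p; rewrite addrC.
have sB s: rho s != 0 -> sq mu (fun x => f (x + s) - f x) /\
  dot (fun x => f (x + s) - f x) (fun x => f (x + s) - f x) <= B ^+ 2.
 move=> rs; split; first exact: sqB (sq_shift s sg) sg.
 rewrite -nm_sq; apply: lerXn2r; [by rewrite nnegrE nm_ge0|by rewrite nnegrE|].
 apply: le_trans (translation_nm s cf) _; apply: le_trans (pd_nm s cf) _.
 apply: ler_wpM2r; first by apply: sumr_ge0 => i _; exact: nm_ge0.
 apply: contraNT rs; rewrite -ltNge => es; rewrite (moll_supp mr)// => /ballP.
 by rewrite sub0r normrN => h; have := lt_trans es h; rewrite ltxx.
have vE x: moll rho f x - f x = int (fun s => rho s * (f (x + s) - f x)).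
 rewrite (@eq_int _ _ _ _ _ (fun s => rho s * f (x + s) - f x * rho s)); last by move=> s; rewrite mulrBr [rho s * f x]mulrC.
 rewrite (intB (moll_itg x mr lg) (itgZ (f x) (Cc_itg cr))) (intZ _ (Cc_itg cr)) (moll_int mr) mulr1 //.
have [_] := @average_sq _ _ mu rho (fun s x => f (x + s) - f x)
 (fun x => moll rho f x - f x) (B ^+ 2)
 (Cc_itg cr) (moll_ge0 mr) mD
 (measurable_funB (Cc_meas (moll_smooth mr lg)) sg.1) sB vE (sqr_ge0 _).
by rewrite (moll_int mr) expr1n mul1r.
Qed.

Lemma moll_ipE e rho f x: mollifier e rho -> Lb f -> moll rho f x = dot f (fun s => rho (x - s)).
by move=> mr lf; rewrite (moll_AvE mr (Lb_itg lf)). Qed.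
Lemma sq_reflect e rho x: mollifier e rho -> sq mu (fun s => rho (x - s)).
move=> mr; have := sq_shift (- x) (Cc_sq (moll_Cc mr)); congr sq; apply/funext => s.
by rewrite -(moll_even mr) opprB.
Qed.

Lemma nm_sup f (M c : R): 0 <= c -> mfun f -> (forall x, `|f x| <= c) ->
 (forall x, ~ ball 0 M x -> f x = 0) -> nm f <= c * nm (\1_(ball (0 : E) M)).
move=> c0 mf fc fM.
have lb := indic_Lb (@meas_ball R n 0 M) (@bounded_ball0 M).
rewrite -[c in c * _]ger0_norm// -nmZ; last exact: Lb_sq lb.
apply: nm_abs_le => //; first exact/sqZ/Lb_sq.
move=> x; have [Bx|/fM ->] := pselect (ball 0 M x); last by rewrite normr0.
by rewrite indicE mem_set// mulr1 (ger0_norm c0).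
Qed.

Lemma rellich_ultra (f : nat -> E -> R) (M B : R) (F : set_system nat): UltraFilter F ->
 (forall k, Cc (f k)) -> (forall k x, ~ ball 0 M x -> f k x = 0) ->
 (forall k, nm (f k) <= B) -> (forall k, \sum_i nm ('d_i (f k)) <= B) ->
 forall e, 0 < e -> exists2 A, F A & forall k l, A k -> A l -> nm (fun x => f k x - f l x) <= e.
move=> UF cf fM fB pB e e0.
have B0: 0 <= B := le_trans (nm_ge0 _ _) (fB 0%N).
pose r := e / (4 * (B + 1)).
have B1: 0 < B + 1 by lra.
have r0: 0 < r by rewrite divr_gt0// mulr_gt0.
have [rho mr] := @mollifier_exists r r0.
have rB: r * B <= e / 4.
 have : r * (4 * (B + 1)) = e by rewrite divfK// gt_eqF// mulr_gt0.
 by lra.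
pose M' := `|M| + r.
pose V := nm (\1_(ball (0 : E) M')).
have V0: 0 <= V by exact: nm_ge0.
pose d := e / (4 * (V + 1)).
have d0: 0 < d by rewrite divr_gt0// mulr_gt0// ltr_wpDl.
have dV: d * V <= e / 4.
 have : d * (4 * (V + 1)) = e by rewrite divfK// gt_eqF// mulr_gt0// ltr_wpDl.
 by lra.
pose m k := moll rho (f k).
have cm k: Cc (m k) by exact: moll_smooth mr (Lb_Cc (cf k)).
have mM k x: ~ ball 0 M' x -> m k x = 0.
 move=> nx; apply: (moll_cst mr) => y /ballP xy; apply: fM => /ballP yM; apply: nx.
 apply/ballP; rewrite /M'; have := ler_normD (0 - y) (y - x); rewrite subrKA.
 by have := ler_norm M; rewrite (distrC y); lra.
(* equicontinuity *)
have c30: 0 < d / (3 * (B + 1)) by rewrite divr_gt0// mulr_gt0.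
have [t t0 tP] := translation_cvg (Cc_sq (moll_Cc mr)) c30.
have mE k x y: `|x - y| < t -> `|m k x - m k y| <= d / 3.
 move=> xy; have lf := Lb_Cc (cf k).
 rewrite /m !(moll_ipE _ mr lf) -ipBr; [|exact: sq_reflect mr|exact: sq_reflect mr|exact: Lb_sq].
 apply: le_trans (nm_CS (Lb_sq lf) (sqB (sq_reflect x mr) (sq_reflect y mr))) _.
 have ->: nm (fun s => rho (x - s) - rho (y - s)) = nm (fun s => rho (s + (y - x)) - rho s).
  rewrite -(nm_shift (- y) (sqB (sq_shift (y - x) (Cc_sq (moll_Cc mr))) (Cc_sq (moll_Cc mr)))).
  congr (L2norm); apply/funext => s; rewrite -(moll_even mr) -[rho (y - s)](moll_even mr) !opprB.
  by rewrite addrA subrK.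
 have h1: nm (fun s => rho (s + (y - x)) - rho s) <= d / (3 * (B + 1)) by apply: tP; rewrite distrC.
 apply: (@le_trans _ _ (B * (d / (3 * (B + 1))))).
  by apply: ler_pM; rewrite ?nm_ge0.
 rewrite (_ : d / 3 = (B + 1) * (d / (3 * (B + 1)))); last by field; rewrite gt_eqF.
 by rewrite ler_wpM2r ?(ltW c30)// lerDl.
have cK: compact [set y : E | `|y| <= M'] by exact: closed_ball_compact.
have [s sP cov] := finite_ball_cover (P := fun _ r => r = t) cK (fun x _ => ex_intro2 _ _ t t0 erefl).
have val x: exists2 A, F A & forall k l, A k -> A l -> `|m k x - m l x| <= d / 3.
 have [c c0 mc] : exists2 c, 0 < c & forall k, `|m k x| <= c.
  exists (B * nm (fun s => rho (x - s)) + 1) => [|k]; first by rewrite ltr_wpDl// mulr_ge0// nm_ge0.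
  rewrite /m (moll_ipE _ mr (Lb_Cc (cf k))).
  apply: le_trans (nm_CS (Cc_sq (cf k)) (sq_reflect x mr)) _.
  by rewrite -[leLHS]addr0 lerD// ler_wpM2r// nm_ge0.
 have cc: compact (`[- c, c] : set R) by exact: segment_compact.
 pose G := (fun k => m k x) @ F.
 have GI: G `[- c, c]%classic by apply: (@filterE _ F) => k /=; rewrite in_itv/= -ler_norml.
 have [a [_ Ga]] := cc G (fmap_proper_filter _ _) GI.
 have d6: 0 < d / 6 by rewrite divr_gt0.
 exists [set k | `|a - m k x| < d / 6].
  have [//|nF] := in_ultra_setVsetC [set k | `|a - m k x| < d / 6] UF.
  have GC: G [set b | ~ (`|a - b| < d / 6)] by [].
  by have [b [Gb]] := Ga _ _ GC (nbhsx_ballx a _ d6).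
 move=> k l /= h1 h2; rewrite -(subrKA a) (le_trans (ler_normD _ _))//.
 by rewrite distrC; move: h1 h2; clear; lra.
have [A FA AP] : exists2 A, F A & forall p k l, p \in s -> A k -> A l -> `|m k p.1 - m l p.1| <= d / 3.
 elim: s {sP cov} => [|p s [A FA AP]]; first by exists setT; [exact: filterT|].
 have [A' FA' AP'] := val p.1; exists (A `&` A'); first exact: filterI.
 move=> q k l; rewrite inE => /orP[/eqP ->|qs] [Ak A'k] [Al A'l]; first exact: AP'.
 exact: AP.
exists A => // k l Ak Al.
have mkl x: `|m k x - m l x| <= d.
 have [/= xM|nx] := pselect ([set y : E | `|y| <= M'] x); last first.
  rewrite !mM ?subrr ?normr0 ?(ltW d0)//; move=> /ball0P => /ltW; exact: nx.
 have [p ps /ballP px] := cov x xM; have [_ pt] := sP p ps; rewrite pt in px.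
 have h1 := mE k _ _ px; have h2 := mE l _ _ px; have h3 := AP p k l ps Ak Al.
 have ->: m k x - m l x = - (m k p.1 - m k x) + (m k p.1 - m l p.1) + (m l p.1 - m l x) by ring.
 apply: le_trans (ler_normD _ _) _; have := ler_normD (- (m k p.1 - m k x)) (m k p.1 - m l p.1).
 by rewrite normrN; move: h1 h2 h3; clear; lra.
have sk j := Cc_sq (cf j); have smk j := Cc_sq (cm j).
have h1 j: nm (fun x => m j x - f j x) <= e / 4 by apply: le_trans (moll_close r0 mr (cf j)) _; apply: le_trans rB; rewrite ler_wpM2l ?(ltW r0).
have h2: nm (fun x => m k x - m l x) <= e / 4.
 apply: le_trans dV; apply: nm_sup (ltW d0) (sqB (smk k) (smk l)).1 mkl _.
 by move=> x nx; rewrite !mM// subrr.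
apply: le_trans (nm_tri (sk k) (smk k) (sk l)) _.
apply: le_trans (lerD (lexx _) (nm_tri (smk k) (smk l) (sk l))) _.
rewrite nmBC; have := h1 k; have := h1 l; move: h2; lra.
Qed.

(** * Functions with square integrable Laplacian, vanishing outside of the domain *)

(** F has the weak gradient Psi and the weak Laplacian Lam on the whole space. *)
Definition wk F Psi Lam := [/\ Lb F, forall j, Lb (Psi j), Lb Lam,
 forall j h, Cc h -> dot F ('d_j h) = - dot (Psi j) h &
 forall h, Cc h -> \sum_j dot (Psi j) ('d_j h) = - dot Lam h].

Lemma Lb_mul k f: Cc k -> Lb f -> Lb (k *' f).
move=> ck [sf bf]; split; last exact: bsuppMr.
have [c c0 kc] := bsupp_bounded (Cc_cts ck) (Cc_bsupp ck).
by under eq_fun do rewrite mulrC; apply: sq_mul_bounded (Cc_meas ck) kc.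
Qed.
Lemma LbD f g: Lb f -> Lb g -> Lb (f +' g).
by move=> [sf bf] [sg]; split; [exact: sqD|exact: bsuppD]. Qed.
Lemma LbZ a f: Lb f -> Lb (fun x => a * f x).
by move=> [sf]; split; [exact: sqZ|exact: bsuppZ]. Qed.
Lemma LbB f g: Lb f -> Lb g -> Lb (f -' g).
by move=> lf lg; have := LbD lf (LbZ (-1) lg); congr Lb; apply/funext => x; rewrite mulN1r. Qed.
Lemma Lb_sum (I : Type) (s : seq I) (f : I -> E -> R): (forall i, Lb (f i)) ->
 Lb (fun x => \sum_(i <- s) f i x).
by move=> lf; split; [apply: sq_sum => i; exact: (lf i).1|apply: bsupp_sum => i; exact: (lf i).2]. Qed.
Lemma Lb_shift y f: Lb f -> Lb (fun x => f (x + y)).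
by move=> [sf]; split; [exact: sq_shift|exact: bsupp_shift]. Qed.

Lemma ip_mulA f g h: dot (f *' g) h = dot g (f *' h).
by apply: eq_int => x; rewrite mulrAC mulrC. Qed.
Lemma partial_mulE i k h: Cc k -> Cc h ->
 (fun x => k x * 'd_i h x) = fun x => 'd_i (k *' h) x - 'd_i k x * h x.
by move=> ck ch; apply/funext => x; rewrite (partial_mul i (Cc_C1 ck) (Cc_C1 ch)) addrC addKr.
Qed.

Lemma wk_lap F Psi Lam h: wk F Psi Lam -> Cc h -> dot F (lap h) = dot Lam h.
move=> [lF _ _ w1 w2] ch; have cp j: Cc ('d_j h) := Cc_d j ch.
rewrite /lap; apply: (etrans (@ip_sumr _ _ _ mu _ (index_enum 'I_n) (fun j => 'd_j ('d_j h)) F (fun j => sq_d j (cp j)) (Lb_sq lF))).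
by rewrite (eq_bigr _ (fun j _ => w1 j _ (cp j))) sumrN w2// opprK.
Qed.

Lemma wk_mul k F Psi Lam: Cc k -> wk F Psi Lam ->
 wk (k *' F) (fun j x => k x * Psi j x + 'd_j k x * F x)
   (fun x => k x * Lam x + (2 * (\sum_j 'd_j k x * Psi j x) + lap k x * F x)).
move=> ck [lF lP lL w1 w2]; have sk := Cc_smooth ck.
have ckp j: Cc ('d_j k) := Cc_d j ck.
have W1 j f h: (forall h, Cc h -> dot F ('d_j h) = - dot f h) -> Lb f -> Cc h ->
  forall k, Cc k -> dot (k *' F) ('d_j h) = - dot (k *' f) h
   - dot (fun x => 'd_j k x * F x) h.
 move=> Hf lf ch k1 ck1; rewrite !ip_mulA (partial_mulE j ck1 ch).
 have c1: Cc (k1 *' h) by apply: CcM => //; exact: Cc_smooth.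
 have c2: Cc (fun x => 'd_j k1 x * h x) by apply: CcM => //; exact: Cc_smooth (Cc_d j ck1).
 by rewrite ipBr ?Hf//; [exact: (sq_d j c1)|exact: Cc_sq|exact: Lb_sq].
split=> [|j||j h ch|h ch].
- exact: Lb_mul.
- by apply: LbD; apply: Lb_mul => //; exact: Cc_d.
- do 2?apply: LbD; last by apply: Lb_mul => //; exact: Cc_lap.
  exact: Lb_mul.
 by apply: LbZ; apply: Lb_sum => j; apply: Lb_mul => //; exact: Cc_d.
-
 rewrite (W1 j (Psi j) h (w1 j))// ipDl ?opprD//; first exact: Lb_sq (Lb_mul _ _).
  exact: Lb_sq (Lb_mul _ _).
 exact: Cc_sq.
have sh := Cc_sq ch; have shp j := sq_d j ch.
have s1 j: sq mu (fun x => k x * Psi j x) := Lb_sq (Lb_mul ck (lP j)).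
have s2 j: sq mu (fun x => 'd_j k x * F x) := Lb_sq (Lb_mul (ckp j) lF).
have s3 j: sq mu (fun x => 'd_j k x * Psi j x) := Lb_sq (Lb_mul (ckp j) (lP j)).
have s4 j: sq mu (fun x => 'd_j ('d_j k) x * F x) := Lb_sq (Lb_mul (Cc_d j (ckp j)) lF).
have E1 j: dot (fun x => k x * Psi j x + 'd_j k x * F x) ('d_j h) =
  dot (Psi j) ('d_j (k *' h)) - dot (fun x => 'd_j k x * Psi j x) h
  + (- dot (fun x => 'd_j k x * Psi j x) h - dot (fun x => 'd_j ('d_j k) x * F x) h).
 rewrite ipDl// -(W1 j (Psi j) h (w1 j) (lP j) ch ('d_j k) (ckp j)); congr (_ + _).
 rewrite !ip_mulA (partial_mulE j ck ch) ipBr//; last exact: Lb_sq (lP j).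
  by apply: Cc_sq; apply: Cc_d; exact: CcM.
 by apply: Cc_sq; apply: CcM => //; exact: Cc_smooth.
apply: (etrans (eq_bigr _ (fun j _ => E1 j))).
rewrite big_split/= !sumrB sumrN w2; last exact: CcM.
have sS: sq mu (fun x => \sum_j 'd_j k x * Psi j x) := sq_sum _ s3.
have sT: sq mu (fun x => lap k x * F x) := Lb_sq (Lb_mul (Cc_lap ck) lF).
rewrite ipDl//; [|exact: Lb_sq (Lb_mul ck lL)|by apply: sqD => //; exact: sqZ].
rewrite ipDl//; last exact: sqZ.
rewrite ipZl// ip_sql// -ip_mulA.
have ->: dot (fun x => lap k x * F x) h = \sum_j dot (fun x => 'd_j ('d_j k) x * F x) h by rewrite -ip_sql//; apply: eq_int => x; rewrite /lap mulr_suml.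
by lra.
Qed.

Lemma wkB F Psi Lam F' Psi' Lam': wk F Psi Lam -> wk F' Psi' Lam' ->
 wk (F -' F') (fun j x => Psi j x - Psi' j x) (Lam -' Lam').
move=> [lF lP lL a b] [lF' lP' lL' a' b']; split=> [|j||j h ch|h ch]; do ?exact: LbB.
 rewrite !ipBl ?a ?a' ?opprB//; try exact: Lb_sq; try exact: (sq_d j ch); try exact: Cc_sq.
 by lra.
rewrite (eq_bigr (fun j => dot (Psi j) ('d_j h) - dot (Psi' j) ('d_j h))).
 rewrite sumrB b// b'// ipBl; [by rewrite opprB opprK addrC|exact: Lb_sq|exact: Lb_sq|exact: Cc_sq].
by move=> j; rewrite ipBl//; [exact: Lb_sq|exact: Lb_sq|exact: (sq_d j ch)].
Qed.

Lemma ip_unshift f h y: sq mu f -> sq mu h -> dot (fun x => f (x + y)) h = dot f (fun x => h (x - y)).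
move=> sf sh; rewrite -(ip_shift y sf (sq_shift (- y) sh)).
by congr (ip); apply/funext => x; rewrite addrK.
Qed.

Lemma wk_shift F Psi Lam y: wk F Psi Lam ->
 wk (fun x => F (x + y)) (fun j x => Psi j (x + y)) (fun x => Lam (x + y)).
move=> [lF lP lL a b].
have sE j h: Cc h -> (fun x => 'd_j h (x - y)) = 'd_j (fun x => h (x - y)) by move=> ch; rewrite (partial_shift j (- y) (Cc_C1 ch)).
split=> [|j||j h ch|h ch]; do ?exact: Lb_shift.
 rewrite !ip_unshift//; try exact: Lb_sq; try exact: Cc_sq; last exact: (sq_d j ch).
 by rewrite sE// a//; exact: Cc_shift.
rewrite ip_unshift//; [|exact: Lb_sq|exact: Cc_sq].
rewrite -b; last exact: Cc_shift.
apply: eq_bigr => j; rewrite ip_unshift ?sE//; [exact: Lb_sq|exact: (sq_d j ch)].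
Qed.

Lemma ip_lim0 g Lam: sq mu g -> sq mu Lam ->
 (forall e, 0 < e -> exists2 f, sq mu f & nm (f -' Lam) <= e /\ dot g f = 0) -> dot g Lam = 0.
move=> sg sL H; apply/eqP; rewrite -normr_le0; apply/ler_addgt0Pr => e e0; rewrite add0r.
have c0: 0 < nm g + 1 by rewrite ltr_wpDl// nm_ge0.
have [f sf [fL gf]] := H _ (divr_gt0 e0 c0).
have ->: dot g Lam = - dot g (f -' Lam) by rewrite ipBr// gf sub0r opprK.
rewrite normrN; apply: le_trans (nm_CS sg (sqB sf sL)) _.
apply: (@le_trans _ _ ((nm g + 1) * (e / (nm g + 1)))); last by rewrite mulrC divfK// gt_eqF.
by apply: ler_pM; rewrite ?nm_ge0// lerDl.
Qed.

Lemma small_mollifier (d : R): 0 < d -> exists2 p : R * (E -> R), 0 < p.1 < d & mollifier p.1 p.2.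
move=> d0; have e0: 0 < d / 2 by rewrite divr_gt0.
have [rho mr] := @mollifier_exists (d / 2) e0; exists (d / 2, rho) => //=.
by lra.
Qed.

(** A function with square integrable Laplacian that can be pushed into U by
  translations has its Laplacian orthogonal to the harmonic functions of U. *)
Lemma ip_push U g F Psi Lam v (s0 : R): 0 < s0 -> harm U g -> wk F Psi Lam ->
 (forall s, 0 < s -> s < s0 -> exists2 e0, 0 < e0 & forall e rho, 0 < e -> e < e0 -> mollifier e rho ->
   Ct U (moll rho (fun x => F (x + (- s) *: v)))) -> dot g Lam = 0.
move=> s00 [lg hg] wF H; have [lF lP lL _ _] := wF; have sL := Lb_sq lL.
apply: (ip_lim0 (Lb_sq lg) sL) => t t0.
have [d d0 dP] := translation_cvg sL t0.
have v1: 0 < `|v| + 1 by [].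
pose s := Num.min s0 (d / (`|v| + 1)) / 2.
have m0: 0 < Num.min s0 (d / (`|v| + 1)) by rewrite lt_min s00 divr_gt0.
have sp: 0 < s by rewrite divr_gt0.
have : s < Num.min s0 (d / (`|v| + 1)) by rewrite ltr_pdivrMr// ltr_pMr// ltr1n.
rewrite lt_min => /andP[ss0]; rewrite ltr_pdivlMr// => sd.
have [e0 e00 eP] := H s sp ss0.
have lLs := Lb_shift ((- s) *: v) lL.
exists (fun x => Lam (x + (- s) *: v)); first exact: Lb_sq.
split.
 apply: dP; rewrite normrZ normrN gtr0_norm//; apply: le_lt_trans sd.
 by lra.
apply: (ip_lim0 (Lb_sq lg) (Lb_sq lLs)) => t' t'0.
have [d' d'0 d'P] := moll_cvg lLs t'0.
have md: 0 < Num.min e0 d' by rewrite lt_min e00.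
have [[e rho] /= /andP[ep]] := small_mollifier md; rewrite lt_min => /andP[ee ed] mr.
exists (moll rho (fun x => Lam (x + (- s) *: v))); first exact: Cc_sq (moll_smooth mr lLs).
split; first exact: d'P mr.
rewrite -[RHS](hg _ (eP e rho ep ee mr)); congr (ip); apply/funext => x.
have lFs := Lb_shift ((- s) *: v) lF.
rewrite (lap_mollE x mr lFs) (moll_ipE x mr lLs).
have cs: Cc (fun s => rho (x - s)).
 have := Cc_shift (- x) (moll_Cc mr); congr Cc; apply/funext => y.
 by rewrite -(moll_even mr) opprB.
by rewrite (wk_lap (wk_shift ((- s) *: v) wF) cs).
Qed.

(** The property to be proved, for functions vanishing off A: the Laplacian is orthogonal to
 harmonic functions. *)
Definition Nb Om A := forall g F Psi Lam, harm Om g -> wk F Psi Lam -> (forall x, ~ closure Om x -> F x = 0) -> (forall x, ~ A x -> F x = 0) -> dot g Lam = 0.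

Lemma N_interior Om x0: open Om -> Om x0 -> exists2 r, 0 < r & Nb Om (ball x0 r).
move=> oO Ox; have [d d0 dP] := open_er oO Ox; have d4: 0 < d / 4 by rewrite divr_gt0.
exists (d / 4) => // g F Psi Lam hg wF _ FA; have [lF _ _ _ _] := wF.
apply: (ip_push (v := 0) ltr01 hg wF) => s _ _; exists (d / 4) => // e rho e0 ed mr.
under eq_fun do rewrite scaler0 addr0.
apply: (Ct_er (r := d / 4)) => //; first exact: moll_smooth mr lF.
move=> x nx; apply: (moll_cst mr) => y /ballP xy; apply: FA => /ballP x0y; apply: nx.
apply: (@er_ball Om (d / 4) (3 * d / 4)); first by apply: erW dP; lra.
have := ler_distD y x0 x; rewrite (distrC y x); move: x0y xy ed d0; clear; lra.
Qed.

Lemma N_patch Om x0 v (z : E -> R) (L r : R): patch Om x0 v z L r -> Nb Om (ball x0 (r / 4)).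
move=> [r0 L0 zL zv zO] g F Psi Lam hg wF Fcl FA; have [lF _ _ _ _] := wF.
have v1: 0 < `|v| + 1 by [].
have Fz x: F x != 0 -> `|x0 - x| < r / 4 /\ 0 <= z x.
 move=> Fx; have xr: `|x0 - x| < r / 4.
  by apply/ballP; apply: contrapT => /FA e; rewrite e eqxx in Fx.
 split=> //; rewrite leNgt; apply/negP => zx.
 have : closure Om x by apply: contrapT => /Fcl e; rewrite e eqxx in Fx.
 have t0: 0 < Num.min (r / 4) (- z x / L) by rewrite lt_min !divr_gt0// oppr_gt0.
 move=> /(_ _ (nbhsx_ballx x _ t0)) [y [Oy /ballP]]; rewrite lt_min => /andP[h1].
 rewrite ltr_pdivlMr// => h2.
 have yB: ball x0 r y by apply/ballP; have := ler_distD x x0 y; move: xr r0; lra.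
 have zy := (zO y yB).1 Oy; have h3 := zL y x; have h4 := ler_norm (z y - z x).
 by rewrite distrC in h2; lra.
apply: (ip_push (v := v) (s0 := r / 4 / (`|v| + 1)) _ hg wF); first by rewrite !divr_gt0.
move=> s s0; rewrite ltr_pdivlMr// => sv.
have e00: 0 < Num.min (s / (2 * L)) (r / 8) by rewrite lt_min !divr_gt0// mulr_gt0.
exists (Num.min (s / (2 * L)) (r / 8)) => // e rho e0; rewrite lt_min => /andP[eL er_] mr.
move: eL; rewrite ltr_pdivlMr ?mulr_gt0// => eL.
apply: (Ct_er (r := e)) => //; first exact: moll_smooth mr (Lb_shift _ lF).
move=> x nx; apply: (moll_cst mr) => y /ballP xy; apply/eqP; apply: contraT => Fy.
exfalso; apply: nx; have [h1 h2] := Fz _ Fy.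
rewrite zv in h2; move=> w /ballP xw.
have svn: `|s *: v| <= s * (`|v| + 1) by rewrite normrZ gtr0_norm// ler_wpM2l ?(ltW s0)// lerDl.
have yw: `|y - w| < 2 * e by have := ler_distD x y w; rewrite (distrC y x); move: xy xw; clear; lra.
apply/zO.
 apply/ballP; have ->: x0 - w = (x0 - (y + - s *: v)) - s *: v + (y - w).
  rewrite scaleNr opprB; have ->: x0 + (s *: v - y) - s *: v = x0 - y by rewrite [s *: v - y]addrC addrA addrK.
  by rewrite subrKA.
 have := ler_normD ((x0 - (y + - s *: v)) - s *: v) (y - w).
 have := ler_normB (x0 - (y + - s *: v)) (s *: v).
 by move: h1 svn sv yw er_ r0; clear; lra.
have h3 := zL y w; have h4 := ler_norm (z y - z w).
have h5: L * `|y - w| < L * (2 * e) by rewrite ltr_pM2l.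
by move: h2 h3 h4 h5 eL; rewrite (_ : L * (2 * e) = e * (2 * L)); [clear; lra|ring].
Qed.

Lemma Nb_union Om A x (r' r : R): 0 < r' -> r' < r -> Nb Om A -> Nb Om (ball x r) ->
 Nb Om (A `|` ball x r').
move=> r'0 rr KA KB g F Psi Lam hg wF Fcl FA.
have [k kO [k01 k1]] := cutoff_ball x r'0 rr; have wkF := wk_mul kO.1 wF.
have [_ _ lL _ _] := wF; have [_ _ lkL _ _] := wkF.
have h1 := KB g _ _ _ hg wkF (fun y ny => etrans (congr1 _ (Fcl y ny)) (mulr0 _))
 (fun y ny => etrans (congr1 ( *%R^~ _) (Ct_out kO ny)) (mul0r _)).
have := KA g _ _ _ hg (wkB wF wkF); rewrite ipBr; [|exact: Lb_sq|exact: Lb_sq|exact: Lb_sq hg.1].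
rewrite h1 subr0; apply.
 by move=> y ny; rewrite Fcl// mulr0 subrr.
move=> y ny; have [/ballP xy|nb] := pselect (ball x r' y).
 by rewrite k1 ?(ltW xy)// mul1r subrr.
by rewrite FA ?mulr0 ?subrr// => -[].
Qed.

Lemma Nb_global Om: open Om -> bounded_set Om -> patched Om -> Nb Om setT.
move=> oO bO hp; have [x clx|||A clA H] := cover_ind (K := Nb Om) (compact_closure bO).
- have [Ox|nOx] := pselect (Om x).
  have [r r0 Kr] := N_interior oO Ox; exists (r / 2); first by rewrite divr_gt0.
  by rewrite mulrC divfK.
 have [v [z [L [r pt]]]] := hp x clx nOx.
 have [r0 _ _ _ _] := pt; exists (r / 8); first by rewrite divr_gt0.
 by have := N_patch pt; congr (Nb _ (ball _ _)); field.
- move=> g F Psi Lam hg wF _ FA; have [_ _ lL _ _] := wF.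
 have L0: {ae mu, forall x, setT x -> Lam x = 0}.
  apply: (fundamental_sq openT (Lb_sq lL)) => h ch; rewrite -(wk_lap wF ch.1).
  by rewrite /ip int_eq0// => x; rewrite (FA x id) mul0r.
 have ->: dot g Lam = dot g (fun=> 0).
  apply: int_ae; [exact: measurable_funM (Lb_sq hg.1).1 (Lb_sq lL).1|exact: measurable_funM (Lb_sq hg.1).1 _|].
  by apply: filterS L0 => x + xT => /(_ xT) ->.
 by rewrite /ip int_eq0// => x; rewrite mulr0.
- by move=> A x r' r; exact: Nb_union.
by move=> g F Psi Lam hg wF Fcl _; apply: (H g F Psi) => // x nx; apply: Fcl => /clA.
Qed.

Lemma segment_lc (V : Type) (c : E -> V) x v:
 (forall t : R, 0 <= t <= 1 -> exists2 r, 0 < r & forall s : R, 0 <= s <= 1 ->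
   `|(t - s) *: v| < r -> c (x + s *: v) = c (x + t *: v)) -> c (x + v) = c x.
move=> H; have := @connected_lc R R V `[0, 1]%classic (fun t => c (x + t *: v)) (@segment_connected R 0 1).
move=> /(_ _ 0 1) h; rewrite -[v in LHS]scale1r -[x in RHS](addr0) -(scale0r v); apply: h.
- move=> t; rewrite /= in_itv/= => t01; have [r r0 rP] := H t t01.
 have v1: 0 < `|v| + 1 by [].
 exists (r / (`|v| + 1)); first by rewrite divr_gt0.
 move=> s; rewrite in_itv/= => s01; rewrite -ball_normE /= ltr_pdivlMr// => ts.
 by apply: rP => //; rewrite normrZ; apply: le_lt_trans ts; rewrite ler_wpM2l// lerDl.
- by rewrite /= in_itv/= lexx ler01.
- by rewrite /= in_itv/= lexx ler01.
Qed.

Lemma ae_local (V : set E) (P : E -> Prop):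
 (forall x, V x -> exists2 r, 0 < r & {ae mu, forall y, ball x r y -> P y}) ->
 {ae mu, forall y, V y -> P y}.
move=> H.
pose B (p : 'rV[rat]_n * nat) : set E := ball (map_mx ratr p.1 : E) p.2.+1%:R^-1.
pose good p := {ae mu, forall y, B p y -> P y}.
have Q m: {ae mu, forall y, forall p, unpickle m = Some p -> good p -> B p y -> P y}.
 case E1 : (unpickle) => [p|]; last by apply: aeW => p.
 have [gp|ngp] := pselect (good p); last by apply: aeW => y q [<-].
 by move: gp; apply: filterS => y yP q [<-].
have /ae_foralln := Q; apply: filterS => y yQ Vy.
have [r r0 rP] := H y Vy.
pose k := Num.truncn (2 / r).
have k0: 0 < k.+1%:R^-1 :> R by [].
have kr: k.+1%:R^-1 + k.+1%:R^-1 < r.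
 have := truncnS_gt (2 / r); rewrite ltr_pdivrMr// -/k => h.
 rewrite -mulr2n -[_ *+ 2]mulr_natl ltr_pdivrMr// mulrC; exact: h.
have [q qy] := rat_approx y k0.
have gq: good (q, k).
 apply: filterS rP => w wP Bw; apply: wP; apply/ballP.
 move/ballP: qy => h1; move/ballP: Bw => /= h2.
 by apply: le_lt_trans (ler_distD (map_mx ratr q : E) y w) _; rewrite (distrC); apply: lt_trans kr; exact: ltrD.
exact: (yQ (pickle (q, k)) (q, k) (pickleK _)).
Qed.

Lemma ae_const_uniq f x y (r s a b : R) (z : E): {ae mu, forall w : E, ball x r w -> f w = a} ->
 {ae mu, forall w : E, ball y s w -> f w = b} -> ball x r z -> ball y s z -> a = b.
move=> ha hb xz yz; apply: contrapT => ab.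
have oB: open (ball x r `&` ball y s) by apply: openI; exact: ball_open.
have := measure_open_gt0 oB (ex_intro _ z (conj xz yz)).
suff /negligibleP : mu.-negligible (ball x r `&` ball y s) by move=> /(_ (open_meas oB)) ->; rewrite ltxx.
have : {ae mu, forall w : E, ~ (ball x r `&` ball y s) w} by apply: filterS2 ha hb => w wa wb [w1 w2]; apply: ab; rewrite -(wa w1) (wb).
by move=> [N [mN N0 sub]]; exists N; split => // w wB; apply: sub => h.
Qed.

(** * Weyl's lemma and weak gradients *)

Section weyl.
Implicit Types (h : E -> R) (s : E).

Lemma is_derive_dilate f x s i (t : R): C1 f ->
 is_derive s (dx i) (fun s => f (x + t *: s)) (t * 'd_i f (x + t *: s)).
move=> cf; have := is_deriveZ_dir t (C1_partial i (x + t *: s) cf).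
move=> /is_derive_epsP H; apply/is_derive_epsP => e e0; have [r r0 rP] := H e e0.
exists r => // k k0 kr; have := rP k k0 kr.
by rewrite [k *: (t *: _)]scalerA (mulrC k) addrCA scalerDr scalerA.
Qed.

Lemma continuous_dilate f x (t : R): continuous f -> continuous (fun s => f (x + t *: s)).
move=> cf s; apply: continuous_comp; last exact: cf.
have h := cvgD (@cvg_cst _ x _ (nbhs s) _) (@scaler_continuous _ _ t s).
exact: h.
Qed.

Lemma C1_dilate f x (t : R): C1 f -> C1 (fun s => f (x + t *: s)) /\
 forall i, 'd_i (fun s => f (x + t *: s)) = fun s => t * 'd_i f (x + t *: s).
move=> cf; have pE i: 'd_i (fun s => f (x + t *: s)) = fun s => t * 'd_i f (x + t *: s).
 by apply/funext => s; apply: partialE; exact: is_derive_dilate.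
split => //; split; first exact: continuous_dilate cf.1.
split=> [s|]; first by have [] := is_derive_dilate x s i t cf.
rewrite pE => s.
have h := cvgM (@cvg_cst _ t _ (nbhs s) _) (@continuous_dilate _ x t (cf.2 i).2 s).
exact: h.
Qed.

(** The derivative of the radial averages of h in the scale is, by the radial
  potential of the mollifier, an average of the Laplacian. *)
Lemma mean_value e rho h x: mollifier e rho -> Cc h ->
 (forall y, ball x e y -> lap h y = 0) -> moll rho h x = h x.
move=> mr ch hx; have cr := moll_Cc mr; have [M [cM Mout Mp]] := moll_pot mr.
have ir := Cc_itg cr.
have [C C0 hC] : exists2 C : R, 0 < C & forall i y, `|'d_i h y| <= C.
 have bd i: exists C : R, 0 < C /\ forall y, `|'d_i h y| <= C.
  have ci := Cc_d i ch.
  by have [c] := bsupp_bounded (Cc_cts ci) (Cc_bsupp ci); exists c.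
 have [c cP] := choice bd; exists (1 + \sum_i c i).
  by rewrite ltr_wpDr ?ltr01// sumr_ge0// => i; have [/ltW] := cP i.
 move=> i y; apply: le_trans ((cP i).2 y) _.
 apply: le_trans (_ : \sum_i c i <= _); last by rewrite lerDr.
 by apply: (ler_sum1 (F := c)) => j; have [/ltW] := cP j.
pose g (t : R) s := rho s * h (x + t *: s).
pose dg (t : R) s := \sum_i 'd_i M s * 'd_i h (x + t *: s).
have dgE t s: dg t s = rho s * pd s h (x + t *: s) by rewrite /dg /pd mulr_sumr; apply: eq_bigr => i; rewrite Mp mulrA [_ * rho s]mulrC.
have iM i: itg mu ('d_i M) := Cc_itg (Cc_d i cM).
have [Ch Ch0 ChP] := bsupp_bounded (Cc_cts ch) (Cc_bsupp ch).
have ig t: itg mu (g t).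
 apply: (@itg_le _ _ _ _ _ (fun s => Ch * `|rho s|)).
 - apply: measurable_funM; first exact: Cc_meas cr.
  apply: cts_meas; exact: continuous_dilate (Cc_cts ch).
 - by move=> s; rewrite normrM mulrC ler_wpM2r.
 - exact/itgZ/itg_abs.
have dgP (t : R) s : is_derive t 1 (g ^~ s) (dg t s) by rewrite dgE; have := is_deriveZ (rho s) (C1_line x s t (Cc_C1 ch)).
pose G s := \sum_i C * `|'d_i M s|.
have iG: itg mu G by apply: itg_sum => i; exact/itgZ/itg_abs.
have G0 s: 0 <= G s by apply: sumr_ge0 => i; rewrite mulr_ge0// ltW.
have dG t s: `|dg t s| <= G s.
 apply: le_trans (ler_norm_sum _ _ _) _; apply: ler_sum => i _.
 by rewrite normrM mulrC ler_wpM2r.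
pose Phi (t : R) := int (g t).
have dPhi (t : R) : is_derive t 1 Phi (int (dg t)).
 apply: (is_derive_int (u := t - 1) (v := t + 1) _ ig dgP iG G0); last by move=> ? ? _.
 by lra.
have [c c1 E1] := mvt0 1 dPhi.
have c0: int (dg c) = 0.
 have cdi i := C1_dilate x c (Cc_C1 (Cc_d i ch)).
 have idi i: itg mu (fun s => 'd_i M s * 'd_i h (x + c *: s)).
  apply: (@itg_le _ _ _ _ _ (fun s => C * `|'d_i M s|)).
  - apply: measurable_funM; first exact: Cc_meas (Cc_d i cM).
   exact: cts_meas (cdi i).1.1.
  - by move=> s; rewrite normrM mulrC ler_wpM2r.
  - exact/itgZ/itg_abs.
 rewrite /dg (int_sum (index_enum 'I_n) idi).
 have icM i: itg mu (fun s => M s * 'd_i ('d_i h) (x + c *: s)).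
  apply: continuous_itg; last exact: bsuppMl (Cc_bsupp cM).
  move=> s; have hc := cvgM (Cc_cts cM (x := s)) (@continuous_dilate _ x c (Cc_cts (Cc_d i (Cc_d i ch))) s).
  exact: hc.
 have Ei i: int (fun s => 'd_i M s * 'd_i h (x + c *: s)) =
   - c * int (fun s => M s * 'd_i ('d_i h) (x + c *: s)).
  rewrite (ibp i (Cc_C1 cM) (cdi i).1 (or_introl (Cc_bsupp cM))) (cdi i).2.
  rewrite mulNr -intZ//.
  by congr (- _); apply: eq_int => s; rewrite mulrCA.
 rewrite (eq_bigr _ (fun i _ => Ei i)) -mulr_sumr -int_sum//.
 rewrite int_eq0 ?mulr0// => s; rewrite -mulr_sumr.
 have [bs|nbs] := pselect (ball 0 e s); last by rewrite Mout// mul0r.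
 rewrite -/(lap h (x + c *: s)) hx ?mulr0//; apply/ballP.
 rewrite opprD addrA subrr sub0r normrN normrZ.
 move/ballP: bs; rewrite sub0r normrN; apply: le_lt_trans.
 by rewrite normr1 in c1; rewrite -[leRHS]mul1r ler_wpM2r.
move: E1; rewrite c0 mul0r => /eqP; rewrite subr_eq0 => /eqP E1.
have ->: moll rho h x = Phi 1 by apply: eq_int => s; rewrite /g scale1r.
rewrite E1 /Phi (@eq_int _ _ _ _ _ (fun s => h x * rho s)); last by move=> s; rewrite /g scale0r addr0 mulrC.
by rewrite intZ// (moll_int mr) mulr1.
Qed.

Lemma mollC d e rho sig g x: mollifier d rho -> mollifier e sig -> Lb g ->
 moll rho (moll sig g) x = moll sig (moll rho g) x.
move=> mr ms lg; have sg := Lb_sq lg; have cr := moll_Cc mr; have cs := moll_Cc ms.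
pose u t s := g (s + (x + t)).
have mu_: mfun (fun p : E * E => u p.1 p.2).
 apply: (measurableT_comp (f := g)); first exact: sg.1.
 have := measurableT_comp (f := fun p : E * E => p.1 + p.2) (@measurable_rVD)
  (_ : mfun (fun p : E * E => (p.2, x + p.1))).
 apply; apply/measurable_fun_pair => /=; first exact: measurable_snd.
 have := measurableT_comp (f := fun p : E * E => p.1 + p.2) (@measurable_rVD)
  (_ : mfun (fun p : E * E => (x, p.1))).
 by apply; apply/measurable_fun_pair => /=.
have uB t: sig t != 0 -> sq mu (u t) /\ dot (u t) (u t) <= dot g g by split; [exact: sq_shift|rewrite (ip_shift (x + t))].
pose v s := moll sig g (s + x).
have mv: mfun v := Cc_meas (Cc_shift x (moll_smooth ms lg)).
have vE s: v s = int (fun t => sig t * u t s) by apply: eq_int => t; rewrite /u addrA.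
have := @average_ip _ _ mu sig u v rho (dot g g) (Cc_itg cs) mu_ uB (Cc_sq cr) mv vE.
transitivity (dot v rho).
 by apply: eq_int => s; rewrite /v mulrC [x + s]addrC.
rewrite H; apply: eq_int => t; congr (_ * _); apply: eq_int => s.
by rewrite /u mulrC [_ + s]addrC.
Qed.

(** The mollifications of a weakly harmonic function coincide away from the
  boundary: both equal the double mollification. *)
Lemma harm_moll U g d e rho sig x: 0 < d -> 0 < e -> mollifier d rho -> mollifier e sig ->
 harm U g -> er U (d + d + (e + e)) x -> moll rho g x = moll sig g x.
move=> d0 e0 mr ms hg xU; have [lg _] := hg.
rewrite -(mean_value ms (moll_smooth mr lg)); last first.
 move=> y /ballP xy; apply: (lap_moll d0 mr hg); apply: (er_ball xU).
 by lra.
rewrite -(mean_value mr (moll_smooth ms lg)) ?(mollC x mr ms lg)//.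
move=> y /ballP xy; apply: (lap_moll e0 ms hg); rewrite addrC in xU; apply: (er_ball xU).
by lra.
Qed.

(** The mollifications of g on the scales d and a agree, and those on the scale a tend to g. *)
Lemma weyl U g d rho: open U -> 0 < d -> mollifier d rho -> harm U g ->
 {ae mu, forall x, er U (d *+ 3) x -> g x = moll rho g x}.
move=> oU d0 mr hg; have [lg _] := hg; have [sg bg] := lg.
have sm := Cc_sq (moll_smooth mr lg).
pose A := er U (d *+ 3); have mA: measurable A by apply: closed_meas; exact: er_closed.
have bI y: `|\1_A y| <= 1 :> R by rewrite ger0_norm// leq_b1.
have mI: mfun (\1_A : E -> R) by [].
pose D y := (moll rho g y - g y) * \1_A y.
have [sD _] := nm_mul_le (sqB sm sg) mI bI.
have D0: nm D <= 0.
 apply/ler_addgt0Pr => e e0; rewrite add0r; have [t t0 tP] := moll_cvg lg e0.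
 have m0: 0 < Num.min t (d / 2) by rewrite lt_min t0 divr_gt0.
 have [[a sig] /= /andP[a0]] := small_mollifier m0; rewrite lt_min => /andP[at_ ad] ms.
 apply: le_trans (tP a sig at_ ms); have sms := Cc_sq (moll_smooth ms lg).
 apply: nm_abs_le; [exact: sD.1|exact: sqB|].
 move=> y; have [Ay|nA] := pselect (A y); last by rewrite /D indicE memNset// mulr0 normr0.
 rewrite /D indicE mem_set// mulr1 (harm_moll d0 a0 mr ms hg)//; apply: (erW _ Ay).
 by lra.
have := nm_ae0 sD (le_anti (introT andP (conj D0 (nm_ge0 _ _)))); apply: filterS => y Dy Ay.
by move: (Dy I); rewrite /D indicE mem_set// mulr1 => /eqP; rewrite subr_eq0 => /eqP.
Qed.
End weyl.

Lemma partial_moll_kernel e rho f i x: mollifier e rho -> Lb f ->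
 'd_i (moll rho f) x = - dot f ('d_i (fun s => rho (x - s))).
move=> mr lf; have c1 := Cc_C1 (moll_Cc mr); pose k s := rho (x - s).
have kE: k = fun s => rho (s + - x) by apply/funext => s; rewrite /k -(moll_even mr) opprB.
have ck: Cc k by rewrite kE; exact: Cc_shift (moll_Cc mr).
have odd t: 'd_i rho t = - 'd_i rho (- t).
 have rE: rho = fun s => rho (- s) by apply/funext => s; rewrite (moll_even mr).
 by rewrite {1}rE (partial_opp).
have pE: (fun s => 'd_i rho (x - s)) = fun s => -1 * 'd_i k s.
 by apply/funext => s; rewrite kE (partial_shift i _ c1) odd opprB mulN1r.
by rewrite (partial_moll i mr lf) -mulN1r -(ipZr (-1) (sq_d i ck) (Lb_sq lf)) -pE.
Qed.

(** The function is weakly harmonic, hence equal to its mollification, which has gradient zero. *)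
Lemma zero_grad_lc U f: open U -> Lb f -> (forall i h, Ct U h -> dot f ('d_i h) = 0) ->
 forall x, U x -> exists2 r, 0 < r & exists c, {ae mu, forall y, ball x r y -> f y = c}.
move=> oU lf f0 x Ux; have [d d0 dU] := open_er oU Ux.
pose r := d / 8; have r0: 0 < r by rewrite divr_gt0.
have [rho mr] := @mollifier_exists r r0.
exists r => //; exists (moll rho f x); have hf: harm U f.
 split=> // h ch; have cd j := Cc_d j ch.1.
 apply: (etrans (@ip_sumr _ _ _ mu _ (index_enum 'I_n) (fun j => 'd_j ('d_j h)) f (fun j => sq_d j (cd j)) (Lb_sq lf))).
 by apply: big1 => j _; exact: f0 (Ct_d j ch).
apply: filterS (weyl oU r0 mr hf) => y wy /ballP xy; rewrite wy; last first.
 by apply: (@er_ball U _ r x) => //; apply: erW dU; rewrite -mulr_natl /r; lra.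
have [c c1 H] := C1_mvt x (y - x) 1 (Cc_C1 (moll_smooth mr lf)).
move: H; rewrite scale1r [x + _]addrC subrK mulr1 => H; apply/eqP; rewrite -subr_eq0 H; apply/eqP.
rewrite /pd big1// => i _; rewrite (partial_moll_kernel _ _ mr lf) f0 ?oppr0 ?mulr0//.
apply: (Ct_moll_kernel r0 mr); apply: (@er_ball U _ r x); first by apply: erW dU; rewrite /r; lra.
rewrite opprD addrA subrr sub0r normrN normrZ distrC; rewrite normr1 in c1.
by apply: le_lt_trans xy; rewrite -[leRHS]mul1r ler_wpM2r.
Qed.

(** Vanishing outside of Om is propagated from infinity through the boundary:
  a function locally constant off the closure of Om has, near a boundary point,
  only one exterior value, and this value is locally constant along the
  boundary. *)
Lemma exterior_lc (Om : set E) (M : R) (c : E -> R): open Om -> 0 < M -> Om `<=` ball 0 M ->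
 patched Om ->
 connected [set x | closure Om x /\ ~ Om x] ->
 let X := ~` closure Om `&` ball 0 (2 * M) in
 (forall x, X x -> exists2 r, 0 < r & forall y, X y -> ball x r y -> c y = c x) ->
 forall x0, X x0 -> forall x, X x -> c x = c x0.
move=> oO M0 OM hp cb X cX x0 X0 x1 X1.
have clM := closure_ball OM.
have oX: open X by apply: openI; [exact/closed_openC/closed_closure|exact: ball_open].
have segX p v: (forall t : R, 0 <= t <= 1 -> X (p + t *: v)) -> c (p + v) = c p.
 move=> Hp; apply: segment_lc => t t01; have [r r0 rP] := cX _ (Hp t t01).
 exists r => // s s01 ts; apply: rP; first exact: Hp.
 by apply/ballP; rewrite opprD addrACA subrr add0r -scalerBl.
pose bd := [set x | closure Om x /\ ~ Om x].
(* one exterior value near each boundary point *)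
have loc b: bd b -> exists2 r, 0 < r & (forall s, 0 < s -> exists2 y, ball b s y & X y) /\
  forall y y', ball b r y -> ball b r y' -> X y -> X y' -> c y = c y'.
 move=> [clb nOb]; have [v [z [L [r [r0 L0 zL zv zO]]]]] := hp b clb nOb.
 pose r1 := Num.min r (M / 2).
 have r10: 0 < r1 by rewrite lt_min r0 divr_gt0.
 have [r1r r1M] : r1 <= r /\ r1 <= M / 2 by rewrite /r1 !ge_min !lexx orbT.
 have v1: 0 < `|v| + 1 by [].
 have den: 0 < 4 + 2 * L * (`|v| + 1) by rewrite addr_gt0// !mulr_gt0.
 pose d := r1 / (4 + 2 * L * (`|v| + 1)).
 have d0: 0 < d by rewrite divr_gt0.
 have dE: 4 * d + 2 * L * d * (`|v| + 1) = r1.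
  have : d * (4 + 2 * L * (`|v| + 1)) = r1 by rewrite divfK// gt_eqF.
  by lra.
 pose t := 2 * L * d.
 have t0: 0 < t by apply: mulr_gt0 => //; exact: mulr_gt0.
 have tv: 4 * d + t * `|v| + t = r1 by rewrite -dE /t; ring.
 have inX y: `|b - y| < r1 -> z y < 0 -> X y.
  move=> yb zy; split.
   have s0: 0 < Num.min (r - `|b - y|) (- z y / L) by rewrite lt_min subr_gt0 (lt_le_trans yb r1r) divr_gt0// oppr_gt0.
   move=> /(_ _ (nbhsx_ballx y _ s0)) [w [Ow /ballP]]; rewrite lt_min => /andP[h1].
   rewrite ltr_pdivlMr// => h2.
   have wB: ball b r w by apply/ballP; have := ler_distD y b w; move: h1; clear; lra.
   have zw := (zO w wB).1 Ow; have h3 := zL w y; have h4 := ler_norm (z w - z y).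
   by rewrite distrC in h2; move: h2 h3 h4 zw; clear; lra.
  apply/ball0P; have /= := clM b clb; have := ler_normB b (b - y).
  by rewrite subKr; move: yb r1M M0; clear; lra.
 have Xz y: `|b - y| < r1 -> X y -> z y < 0.
  move=> yb [ncl _]; rewrite ltNge; apply/negP => zy; apply: ncl => U /nbhs_ballP[s /= s0 sU].
  pose u := Num.min s (r1 - `|b - y|) / (2 * (`|v| + 1)).
  have m0: 0 < Num.min s (r1 - `|b - y|) by rewrite lt_min s0 subr_gt0.
  have u0: 0 < u by rewrite mulr_gt0.
  have : `|u *: v| < Num.min s (r1 - `|b - y|).
   rewrite normrZ gtr0_norm//.
   have : u * (2 * (`|v| + 1)) = Num.min s (r1 - `|b - y|) by rewrite divfK// mulr_gt0.
   by have := normr_ge0 v; move: u0; clear; nra.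
  rewrite lt_min => /andP[us ur]; exists (y + u *: v); split.
   apply/zO; last by rewrite zv; move: zy u0; clear; lra.
   apply/ballP; rewrite opprD addrA; have := ler_normB (b - y) (u *: v).
   by move: ur r1r; clear; lra.
  by apply: sU; apply/ballP; rewrite opprD addrA subrr sub0r normrN.
 have db: d < r1 by rewrite -tv; move: d0 t0 (mulr_ge0 (ltW t0) (normr_ge0 v)); clear; lra.
 exists d => //; split.
  move=> s s0; pose m := Num.min s d; have m0: 0 < m by rewrite lt_min s0.
  pose u := m / (`|v| + 1).
  have u0: 0 < u by rewrite divr_gt0.
  have ud: `|u *: v| < m.
   rewrite normrZ gtr0_norm//; have : u * (`|v| + 1) = m by rewrite divfK// gt_eqF.
   by move=> <-; rewrite mulrDr mulr1 ltrDl.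
  have : `|b - (b + (- u) *: v)| < m by rewrite opprD addrA subrr sub0r scaleNr opprK.
  rewrite lt_min => /andP[bs bd_].
  exists (b + (- u) *: v); first exact/ballP.
  apply: inX; first exact: lt_trans db.
  rewrite zv; have : z b <= 0.
   by rewrite leNgt; apply/negP => zb; apply: nOb; apply/zO => //; exact: ballxx.
  by move: u0; clear; lra.
 move=> y y' /ballP by_ /ballP by' Xy Xy'.
 have zy := Xz y (lt_trans by_ db) Xy; have zy' := Xz y' (lt_trans by' db) Xy'.
 have yy': `|y - y'| < 2 * d by have := ler_distD b y y'; rewrite (distrC y b); move: by_ by'; clear; lra.
 have down p: `|b - p| < d -> z p < 0 -> c (p + (- t) *: v) = c p.
  move=> bp zp; apply: segX => s /andP[s0 s1]; rewrite scalerA; apply: inX.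
   rewrite opprD addrA; have h1 := ler_normB (b - p) ((s * - t) *: v).
   have : `|(s * - t) *: v| <= t * `|v|.
    rewrite normrZ ler_wpM2r// normrM normrN (ger0_norm s0) (gtr0_norm t0).
    by rewrite -[leRHS]mul1r ler_wpM2r// ltW.
   by rewrite -tv; move: h1 bp d0 t0; clear; lra.
  rewrite zv; have : 0 <= s * t by rewrite mulr_ge0// ltW.
  by move: zp; clear; lra.
 rewrite -(down y by_ zy) -(down y' by' zy').
 have ->: y' + (- t) *: v = (y + (- t) *: v) + (y' - y) by rewrite addrAC [y + (y' - y)]addrC subrK.
 apply: esym; apply: segX => s /andP[s0 s1].
 have sy: `|s *: (y' - y)| < 2 * d.
  rewrite normrZ (ger0_norm s0) distrC; apply: le_lt_trans yy'; rewrite -[leRHS]mul1r ler_wpM2r//.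
 apply: inX.
  have ->: b - (y + (- t) *: v + s *: (y' - y)) = (b - y) + t *: v - s *: (y' - y) by rewrite scaleNr opprD opprB [t *: v - y]addrC addrA addrA.
  have h1 := ler_normB (b - y + t *: v) (s *: (y' - y)); have h2 := ler_normD (b - y) (t *: v).
  have h3: `|t *: v| = t * `|v| by rewrite normrZ gtr0_norm.
  by rewrite -tv; move: h1 h2 h3 sy by_ d0 t0; clear; lra.
 have h1 := zL (y + (- t) *: v + s *: (y' - y)) (y + (- t) *: v).
 have h2 := ler_norm (z (y + (- t) *: v + s *: (y' - y)) - z (y + (- t) *: v)).
 have e1: y + (- t) *: v + s *: (y' - y) - (y + (- t) *: v) = s *: (y' - y) by rewrite addrAC subrr add0r.
 rewrite e1 in h1.
 have h3: L * `|s *: (y' - y)| < t by rewrite /t (_ : 2 * L * d = L * (2 * d)) ?ltr_pM2l//; ring.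
 rewrite zv in h1 h2; move: h1 h2 h3 zy; clear; lra.
have loc' b: exists p : R * E, bd b -> [/\ 0 < p.1, ball b p.1 p.2, X p.2, 
  (forall s, 0 < s -> exists2 y, ball b s y & X y) &
  forall y y', ball b p.1 y -> ball b p.1 y' -> X y -> X y' -> c y = c y'].
 have [/loc[r r0 [E1 H]]|n0] := pselect (bd b); last by exists (0, 0).
 by have [y] := E1 r r0; exists (r, y) => _.
have [p pP] := choice loc'.
(* the value is constant along the boundary *)
have cbE b: bd b -> forall b', bd b' -> c (p b').2 = c (p b).2.
 move=> bb b' bb'; apply: (connected_lc (c := fun b => c (p b).2) cb _ bb bb') => a ba.
 have [r0 ay Xy _ H] := pP a ba; exists (p a).1 => // a' ba' /ballP aa'.
 have [r0' ay' Xy' E1 H'] := pP a' ba'.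
 have s0: 0 < Num.min (p a').1 ((p a).1 - `|a - a'|) by rewrite lt_min r0' subr_gt0.
 have [w /ballP] := E1 _ s0; rewrite lt_min => /andP[w1 w2] Xw.
 have aw: ball a (p a).1 w by apply/ballP; have := ler_distD a' a w; move: w2; clear; lra.
 have aw': ball a' (p a').1 w by apply/ballP.
 by rewrite -(H w _ aw ay Xw Xy) (H' w _ aw' ay').
have [c0 c0P] : exists c0, forall b, bd b -> c (p b).2 = c0.
 have [[b bb]|nb] := pselect (exists b, bd b); first by exists (c (p b).2) => b' /(cbE b bb).
 by exists 0 => b bb; exfalso; apply: nb; exists b.
pose ct x := if pselect (X x) then c x else c0.
have ctX x: X x -> ct x = c x by rewrite /ct; case: pselect.
have ctN x: ~ X x -> ct x = c0 by rewrite /ct; case: pselect.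
have ctlc x: ball 0 (2 * M) x -> exists2 r, 0 < r & forall y, ball 0 (2 * M) y -> ball x r y -> ct y = ct x.
 move=> Wx; have [Xx|nXx] := pselect (X x).
  have [r r0 H] := cX x Xx; have [s s0 sX] := open_er oX Xx.
  exists (Num.min r s); first by rewrite lt_min r0.
  move=> y _ /ballP; rewrite lt_min => /andP[h1 h2].
  have Xy: X y by apply: sX; apply/ballP.
  by rewrite !ctX// H//; apply/ballP.
 have clx: closure Om x by apply: contrapT => ncl; apply: nXx.
 rewrite (ctN x nXx); have [Ox|nOx] := pselect (Om x).
  have [s s0 sO] := open_er oO Ox; exists s => // y _ /sO Oy; apply: ctN => -[nc _]; apply: nc.
  exact: subset_closure.
 have bx: bd x by [].
 have [r0 ay Xy _ H] := pP x bx; exists (p x).1 => // y _ xy.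
 have [Xy'|/ctN //] := pselect (X y).
 by rewrite ctX// (H y (p x).2 xy ay Xy' Xy) c0P.
rewrite -(ctX x1 X1) -(ctX x0 X0).
have ->: x1 = x0 + (x1 - x0) by rewrite addrC subrK.
have Wx0 := X0.2; have Wx1 := X1.2.
have Wt t: 0 <= t <= 1 -> ball 0 (2 * M) (x0 + t *: (x1 - x0)) by exact: ball_segment.
apply: segment_lc => t t01; have [r r0 rP] := ctlc _ (Wt t t01).
exists r => // s s01 ts; apply: rP; first exact: Wt.
by apply/ballP; rewrite opprD addrACA subrr add0r -scalerBl.
Qed.

(** * Limits of fields with vanishing rotation *)

Section curl_free_limits.
Context (i0 : 'I_n).

Lemma partial_locally_cst chi i x r (c : R): Cc chi -> 0 < r -> (forall y, ball x r y -> chi y = c) ->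
 'd_i chi x = 0.
move=> cc r0 H.
have E1: 'd_i (fun y => chi y + (- c)) x = 'd_i chi x by rewrite (partial_add i (Cc_C1 cc) (C1_cst (- c))) partial_cst addr0.
rewrite -E1; apply: (partial_out i (ball_open x r) (ballxx _ r0)).
by move=> y xy; rewrite (H y xy) subrr.
Qed.

Lemma segB h v f g: 0 <= h -> Cc f -> Cc g ->
 seg h v (f -' g) = fun x => seg h v f x - seg h v g x.
move=> h0 cf cg; apply/funext => x; rewrite /seg /Av -(intB (seg_itg v x h0 cf) (seg_itg v x h0 cg)).
by apply: eq_int => s; rewrite mulrBr.
Qed.

Lemma coord_ray x (s : R): (x + s *: dx i0) 0 i0 = x 0 i0 + s.
by rewrite !mxE !eqxx mulr1. Qed.

Section setting.
Context (Om : set E) (M : R) (oO : open Om) (M0 : 0 < M) (OM : Om `<=` ball 0 M) (hp : patched Om).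
Context (cb : connected [set x | closure Om x /\ ~ Om x]).

(** A potential, supported in the half space below M, of a field that vanishes
  off Om vanishes off the closure of Om. *)
Lemma potential_out (q : E -> R) (psi : VF): Lb q ->
 (forall x, M < x 0 i0 -> q x = 0) ->
 (forall j x, ~ Om x -> psi j x = 0) ->
 (forall j h, Ct (ball 0 (2 * M)) h -> dot q ('d_j h) = - dot (psi j) h) ->
 {ae mu, forall x, (~` closure Om `&` ball 0 (2 * M)) x -> q x = 0}.
move=> lq q0 p0 qp; set X := ~` closure Om `&` ball 0 (2 * M).
have oX: open X by apply: openI; [exact/closed_openC/closed_closure|exact: ball_open].
have grad0 i h: Ct X h -> dot q ('d_i h) = 0.
 move=> ch; rewrite qp; last by apply: Ct_sub ch; exact: subIsetr.
 rewrite /ip int_eq0 ?oppr0// => x.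
 have [Ox|nO] := pselect (Om x); last by rewrite p0// mul0r.
 by rewrite (Ct_out ch) ?mulr0// => -[nc _]; apply: nc; exact: subset_closure.
have loc := zero_grad_lc oX lq grad0.
have loc' x: exists p : R * R, X x -> 0 < p.1 /\ {ae mu, forall y, ball x p.1 y -> q y = p.2} by have [/loc[r r0 [c H]]|n0] := pselect (X x); [exists (r, c)|exists (0, 0)].
have [p pP] := choice loc'.
pose c x := (p x).2.
have clc x: X x -> exists2 r, 0 < r & forall y, X y -> ball x r y -> c y = c x.
 move=> Xx; have [r0 H] := pP x Xx; exists (p x).1 => // y Xy xy; have [s0 H'] := pP y Xy.
 exact: (ae_const_uniq (z := y) H' H (ballxx _ s0) xy).
pose x0 : E := (3 / 2 * M) *: dx i0.
have x00: x0 0 i0 = 3 / 2 * M by rewrite !mxE !eqxx mulr1.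
have X0: X x0.
 split.
  move=> /(closure_ball OM)/=; have := rV_norm_coord x0 i0; rewrite x00 => h1 h2.
  have := le_trans (ler_norm _) (le_trans h1 h2); move: M0; lra.
 apply/ball0P; rewrite normrZ gtr0_norm ?mulr_gt0 ?divr_gt0//.
 apply: (@le_lt_trans _ _ (3 / 2 * M)); last by move: M0; lra.
 by rewrite -[leRHS]mulr1 ler_wpM2l ?norm_dx// mulr_ge0 ?divr_ge0 ?ltW.
have c0: c x0 = 0.
 have [r0 H] := pP x0 X0.
 have s0: 0 < M / 2 by rewrite divr_gt0.
 apply: (ae_const_uniq (z := x0) H (_ : {ae mu, forall y, ball x0 (M / 2) y -> q y = 0}) (ballxx _ r0) (ballxx _ s0)).
 apply: aeW => y /ballP xy; apply: q0.
 have h := rV_norm_coord (x0 - y) i0.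
 have e1: (x0 - y) 0 i0 = x0 0 i0 - y 0 i0 by rewrite !mxE.
 rewrite e1 x00 in h; have h2 := ler_norm (3 / 2 * M - y 0 i0).
 by move: h h2 xy M0; move: (y 0 i0) `|x0 - y| => a b; lra.
have cX x: X x -> c x = 0 by move=> Xx; rewrite -c0; exact: (exterior_lc oO M0 OM hp cb clc X0 Xx).
apply: ae_local => x Xx; have [r0 H] := pP x Xx; exists (p x).1 => //.
by apply: filterS H => y yP /yP ->; exact: cX.
Qed.

Context (phi : nat -> VF) (cphi : forall k i, Ct Om (phi k i)) (c1 : forall i, cau mu (fun k => phi k i)).
Context (c2 : forall i j, cau mu (fun k => 'd_j (phi k i))).
Context (c3 : forall e, 0 < e -> exists K, forall k, (K <= k)%N -> rt (phi k) <= e).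

Let L := 4 * M.
Let q k x := - seg L (dx i0) (phi k i0) x.
Let L0 : 0 < L. Proof. by rewrite mulr_gt0. Qed.
Let phiO k i x : ~ Om x -> phi k i x = 0. Proof. exact: Ct_out (cphi k i). Qed.
Let phiM k i x : M <= `|x| -> phi k i x = 0.
by move=> xM; apply: phiO => /OM /ball0P; rewrite ltNge xM. Qed.
Let cq k : Cc (q k). Proof. by apply: CcN; apply: seg_Cc (ltW L0) (cphi k i0).1. Qed.

Let qB k x : ~ (ball (0 : E) (6 * M) `&` [set x : E | x 0 i0 <= M]) x -> q k x = 0.
move=> nx; rewrite /q /seg /Av int_eq0 ?oppr0// => s.
rewrite indicE; case: (boolP (s \in _)) => [|_]; last by rewrite mul0r.
rewrite inE/= in_itv/= => /andP[s0 sL]; rewrite phiM ?mulr0//.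
have [xM|xM] := pselect (x 0 i0 <= M).
 have nb: 6 * M <= `|x|.
  rewrite leNgt; apply/negP => h; apply: nx; split => //; apply/ballP; by rewrite sub0r normrN.
 have h1: `|(s : R) *: dx i0| <= L.
  rewrite normrZ ger0_norm//; apply: le_trans sL; rewrite -[leRHS]mulr1 ler_wpM2l//; exact: norm_dx.
 have := ler_normB (x + (s : R) *: dx i0) ((s : R) *: dx i0); rewrite addrK.
 by move: nb h1 M0; rewrite /L; lra.
have := rV_norm_coord (x + (s : R) *: dx i0) i0; rewrite coord_ray => h.
have := ler_norm (x 0 i0 + (s : R)); move/negP: xM; rewrite -ltNge.
by move: h s0; lra.
Qed.

Let mB : measurable (ball (0 : E) (6 * M) `&` [set x : E | x 0 i0 <= M]).
apply: measurableI; first exact: meas_ball.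
apply: closed_meas; apply: (@closed_comp _ _ (fun x : E => x 0 i0) [set t | t <= M]); last exact: closed_le.
by move=> x _; exact: coord_continuous.
Qed.

Let cauq : cau mu q.
move=> e e0; have [K KP] := c1 i0 (divr_gt0 e0 L0); exists K => k l Kk Kl.
have ->: (fun x => q k x - q l x) = fun x => - seg L (dx i0) (fun x => phi k i0 x - phi l i0 x) x by rewrite (segB _ (ltW L0) (cphi k i0).1 (cphi l i0).1); apply/funext => x; rewrite /q; ring.
rewrite nmN; apply: le_trans (seg_nm _ (ltW L0) (CcB (cphi k i0).1 (cphi l i0).1)) _.
apply: (@le_trans _ _ (L * (e / L))); last by rewrite mulrC divfK// gt_eqF.
by rewrite ler_wpM2l ?(ltW L0)//; exact: KP.
Qed.

(* on the ball of radius 2 M the gradient of q k is phi k up to the rotation *)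
Let qgrad k j h : Ct (ball 0 (2 * M)) h ->
 dot (q k) ('d_j h) = - dot (phi k j) h + dot (seg L (dx i0) (rot (phi k) i0 j)) h.
move=> ch; have cp i := (cphi k i).1; have sh := Cc_sq ch.1.
rewrite (ip_partial j (Cc_C1 (cq k)) ch.1).
have cs := seg_Cc (dx i0) (ltW L0) (Cc_rot i0 j cp).
have ->: 'd_j (q k) = fun x => phi k j x - phi k j (x + L *: dx i0) - seg L (dx i0) (rot (phi k) i0 j) x.
 have Eq: 'd_j (q k) = fun x => - seg L (dx i0) ('d_j (phi k i0)) x.
  rewrite -(partial_seg _ j (ltW L0) (cp i0)); apply/funext => x; apply: partialE; apply: is_deriveN.
  exact: C1_partial (Cc_C1 (seg_Cc _ (ltW L0) (cp i0))).
 rewrite Eq; apply/funext => x.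
 have ->: phi k j x - phi k j (x + L *: dx i0) = - seg L (dx i0) (pd (dx i0) (phi k j)) x by rewrite (seg_ftc _ L0 (cp j)) opprB.
 have Er: rot (phi k) i0 j = fun x => 'd_j (phi k i0) x - pd (dx i0) (phi k j) x by apply/funext => y; rewrite pd_dx.
 rewrite Er (segB _ (ltW L0) (Cc_d j (cp i0)) (Cc_pd _ (cp j))); ring.
have s1 := Cc_sq (cp j); have s2 := sq_shift (L *: dx i0) s1; have s3 := Cc_sq cs.
rewrite ipBl//; last exact: sqB.
rewrite ipBl// [X in - (_ - X - _)](_ : _ = 0); first by rewrite subr0 opprB addrC.
rewrite /ip int_eq0// => x.
have [/ballP|nx] := pselect (ball 0 (2 * M) x); last by rewrite (Ct_out ch nx) mulr0.
rewrite sub0r normrN => xM; rewrite phiM ?mul0r//.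
have := rV_norm_coord (x + L *: dx i0) i0; rewrite coord_ray => h1.
apply: le_trans h1; apply: le_trans (ler_norm _).
have h2: - `|x| <= x 0 i0 by have := rV_norm_coord x i0; rewrite ler_norml => /andP[].
by move: h2 xM M0; rewrite /L; move: (x 0 i0) `|x| => a b; lra.
Qed.

(** Let q k be minus the integral of the component i0 of phi k along a half line in the direction
 i0. The q k tend to a function ql whose gradient is the limit of the phi k, because the
 rotations tend to zero. Its Laplacian is the limit of the divergences. *)
Lemma harmonic_limit g: harm Om g ->
 forall e, 0 < e -> exists K, forall k, (K <= k)%N -> `|dot g (dv (phi k))| <= e.
move=> hg; have mO := open_meas oO.
have scp k i := Cc_sq (cphi k i).1; have scpp k i j := sq_d j (cphi k i).1.
have lim1 j: exists f, [/\ sq mu f, (forall x, ~ Om x -> f x = 0) & tends mu (fun k => phi k j) f] by apply: (cau_limit mO (fun k => scp k j) (c1 j)) => k x; exact: phiO.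
have [psi psiP] := choice lim1.
have lim2 j: exists f, [/\ sq mu f, (forall x, ~ Om x -> f x = 0) & tends mu (fun k => 'd_j (phi k j)) f].
 apply: (cau_limit mO (fun k => scpp k j j) (c2 j j)) => k x; exact: Ct_out (Ct_d j (cphi k j)).
have [chi chiP] := choice lim2.
have [ql [sq_ql qlB tq]] := cau_limit mB (fun k => Cc_sq (cq k)) cauq qB.
have bO f: (forall x, ~ Om x -> f x = 0) -> bsupp f by move=> f0; exists M => x nx; apply: f0 => /OM.
have lpsi j: Lb (psi j) by have [a b c] := psiP j; split => //; exact: bO.
have lq: Lb ql by split => //; exists (6 * M) => x nx; apply: qlB => -[].
have q0 x: M < x 0 i0 -> ql x = 0 by move=> xM; apply: qlB => -[_ /=]; rewrite leNgt xM.
have p0 j x: ~ Om x -> psi j x = 0 by have [_ b _] := psiP j; exact: b.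
have qp j h: Ct (ball 0 (2 * M)) h -> dot ql ('d_j h) = - dot (psi j) h.
 move=> ch; have sh := Cc_sq ch.1; have shp := sq_d j ch.1.
 have t1 := tends_ip (fun k => Cc_sq (cq k)) sq_ql shp tq.
 have [sp _ tp] := psiP j; have t2 := tends_ip (fun k => scp k j) sp sh tp.
 have t3: dot (seg L (dx i0) (rot (phi k) i0 j)) h @[k --> \oo] --> (0 : R).
  apply/cvgrPdist_le => t t0; have d0: 0 < L * nm h + 1 by rewrite ltr_wpDl// mulr_ge0 ?nm_ge0// ltW.
  have [K KP] := c3 (divr_gt0 t0 d0); exists K => // k /= Kk; rewrite sub0r normrN.
  have cr := Cc_rot i0 j (fun i => (cphi k i).1).
  apply: le_trans (nm_CS (Cc_sq (seg_Cc _ (ltW L0) cr)) sh) _.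
  have h1 := seg_nm (dx i0) (ltW L0) cr.
  have h2: nm (rot (phi k) i0 j) <= t / (L * nm h + 1) := le_trans (nm_rt _ _ _) (KP k Kk).
  apply: (@le_trans _ _ (L * (t / (L * nm h + 1)) * nm h)).
   by rewrite ler_wpM2r ?nm_ge0//; apply: le_trans h1 _; rewrite ler_wpM2l ?(ltW L0).
  rewrite (_ : _ * nm h = (L * nm h) * (t / (L * nm h + 1))); last by ring.
  rewrite -[leRHS](divfK (lt0r_neq0 d0)) [leRHS]mulrC ler_wpM2r ?lerDl//.
  by rewrite divr_ge0 ?(ltW t0) ?(ltW d0).
 have t4: (fun k => - dot (phi k j) h + dot (seg L (dx i0) (rot (phi k) i0 j)) h) @ \oo --> - dot (psi j) h + 0 by apply: cvgD => //; exact: cvgN.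
 have Ek: (fun k => dot (q k) ('d_j h)) = (fun k => - dot (phi k j) h + dot (seg L (dx i0) (rot (phi k) i0 j)) h) by apply/funext => k; exact: qgrad.
 by rewrite addr0 -Ek in t4; exact: (cvg_unique _ t1 t4).
have out := potential_out lq q0 p0 qp.
have mcl: measurable (closure Om) by apply: closed_meas; exact: closed_closure.
pose F x := ql x * \1_(closure Om) x.
have bI x: `|\1_(closure Om) x| <= 1 :> R by rewrite ger0_norm// indicE lern1 leq_b1.
have mI: mfun (\1_(closure Om) : E -> R) by exact: measurable_indic.
have [sF _] := nm_mul_le sq_ql mI bI.
have lF: Lb F by split => //; apply: bsuppMl; exact: lq.2.
have Fcl x: ~ closure Om x -> F x = 0 by move=> nx; rewrite /F indicE memNset// mulr0.
pose D x := \sum_j chi j x.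
have schi j: sq mu (chi j) by have [] := chiP j.
have sD: sq mu D by exact: sq_sum.
have lD: Lb D by split => //; apply: bO => x nx; rewrite /D big1// => j _; have [_ b _] := chiP j; exact: b.
have tD: tends mu (fun k => dv (phi k)) D by apply: tends_sum => [i k|//|i]; [exact: scpp|have [] := chiP i].
have sdv k: sq mu (dv (phi k)) := Cc_sq (Cc_dv (fun i => (cphi k i).1)).
have wF: wk F psi D.
 split=> [//|//|//|j h ch|h ch].
  have cK: compact (closure Om) by apply: compact_closure; apply/bddP; exists M.
  have KW: closure Om `<=` ball 0 (2 * M).
   move=> y /(closure_ball OM)/= yM; apply/ball0P.
   by apply: le_lt_trans yM _; move: M0; lra.
  have [k kW [_ [r r0 k1]]] := cutoff cK (ball_open (0 : E) (2 * M)) KW.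
  have ckh: Ct (ball 0 (2 * M)) (k *' h) by have := CtM (Cc_smooth ch) kW; congr Ct; apply/funext => x; rewrite mulrC.
  have k1x x: closure Om x -> k x = 1 by move=> cx; apply: (k1 x x cx); exact: ballxx.
  have pk0 x: closure Om x -> 'd_j k x = 0 by move=> cx; exact: partial_locally_cst kW.1 r0 (fun y => k1 x y cx).
  transitivity (dot ql ('d_j (k *' h))).
   apply: int_ae; [exact: measurable_funM sF.1 (Cc_meas (Cc_d j ch))|exact: measurable_funM sq_ql.1 (Cc_meas (Cc_d j ckh.1))|].
   apply: filterS out => x xP _; rewrite (partial_mul j (Cc_C1 kW.1) (Cc_C1 ch)).
   have [cx|ncx] := pselect (closure Om x).
    by rewrite /F indicE mem_set// mulr1 k1x// pk0// mul0r add0r mul1r.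
   rewrite Fcl// mul0r; have [Wx|nW] := pselect (ball 0 (2 * M) x); first by rewrite xP// mul0r.
   by rewrite (Ct_out kW nW) (Ct_out (Ct_d j kW) nW) !mul0r addr0 mulr0.
  rewrite qp//; congr (- _); apply: eq_int => x; have [Ox|nO] := pselect (Om x).
   by rewrite k1x ?mul1r//; exact: subset_closure.
  by rewrite p0// !mul0r.
 have sh := Cc_sq ch; have shp j := sq_d j ch.
 have t1: \sum_j dot (phi k j) ('d_j h) @[k --> \oo] --> \sum_j dot (psi j) ('d_j h).
  apply: cvg_fsum => j; have [sp _ tp] := psiP j; exact: tends_ip (fun k => scp k j) sp (shp j) tp.
 have t2: (fun k => - dot (dv (phi k)) h) @ \oo --> - dot D h by apply: cvgN; exact: (tends_ip sdv sD sh tD).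
 have Ek: (fun k => \sum_j dot (phi k j) ('d_j h)) = (fun k => - dot (dv (phi k)) h).
  apply/funext => k; rewrite (ipC mu (dv _)) (ip_dv ch (fun i => (cphi k i).1)) opprK.
  by apply: eq_bigr => j _; exact: ipC.
 by rewrite Ek in t1; exact: (cvg_unique _ t1 t2).
have bOm: bounded_set Om by apply/bddP; exists M.
have gD: dot g D = 0 by apply: (Nb_global oO bOm hp hg wF Fcl) => x [].
have := tends_ip sdv sD (Lb_sq hg.1) tD; rewrite (ipC mu D) gD => /cvgrPdist_le H e e0.
by have [K _ KP] := H e e0; exists K => k Kk; have := KP k Kk; rewrite sub0r normrN ipC.
Qed.
End setting.
End curl_free_limits.

(** * The rotation controls the harmonic part of the divergence *)

Section rotation.
Context (i0 : 'I_n).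
Implicit Types (q : E -> R).

Definition lcf (a : R) phi psi : VF := fun i x => a * phi i x + psi i x.
Definition gr q : VF := fun i => 'd_i q.
Definition Ctf U phi := forall i, Ct U (phi i).
Lemma Ctf_lc U a phi psi: Ctf U phi -> Ctf U psi -> Ctf U (lcf a phi psi).
by move=> cp cs i; apply: CtD; [exact: CtZ|]. Qed.
Lemma Ctf_gr U q: Ct U q -> Ctf U (gr q).
by move=> cq i; exact: Ct_d. Qed.

Lemma partial_lc i a f g: Cc f -> Cc g ->
 'd_i (fun x => a * f x + g x) = fun x => a * 'd_i f x + 'd_i g x.
move=> cf cg; rewrite (partial_add i (Cc_C1 (CcZ a cf)) (Cc_C1 cg)); apply/funext => x.
by rewrite (partial_mul i (C1_cst a) (Cc_C1 cf)) partial_cst mul0r add0r.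
Qed.

Lemma dv_lc a phi psi: (forall i, Cc (phi i)) -> (forall i, Cc (psi i)) ->
 dv (lcf a phi psi) = fun x => a * dv phi x + dv psi x.
move=> cp cs; apply/funext => x; rewrite /dv mulr_sumr -big_split/=; apply: eq_bigr => i _.
by rewrite /lcf partial_lc.
Qed.

Lemma rot_lc a phi psi i j: (forall i, Cc (phi i)) -> (forall i, Cc (psi i)) ->
 rot (lcf a phi psi) i j = fun x => a * rot phi i j x + rot psi i j x.
move=> cp cs; apply/funext => x; rewrite /rot /lcf !partial_lc//.
by move: ('d_j (phi i) x) ('d_j (psi i) x) ('d_i (phi j) x) ('d_i (psi j) x) => *; ring.
Qed.

Lemma rot_gr q i j: Cc q -> rot (gr q) i j = fun=> 0.
by move=> cq; apply/funext => x; rewrite /rot /gr (schwarz i j x (Cc_smooth cq)) subrr. Qed.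
Lemma dv_gr q: dv (gr q) = lap q. Proof. by []. Qed.
Lemma nm0: nm (fun=> 0) = 0.
by rewrite /L2norm /ip int_eq0 ?sqrtr0// => x; rewrite mulr0. Qed.

Lemma rt_sub_gr phi q: (forall i, Cc (phi i)) -> Cc q -> rt (lcf (-1) (gr q) phi) = rt phi.
move=> cp cq; apply: eq_bigr => i _; apply: eq_bigr => j _.
rewrite rot_lc ?rot_gr//; last by move=> k; exact: Cc_d.
by congr (L2norm mu _); apply/funext => x; rewrite mulr0 add0r.
Qed.

Lemma rt_lc0 a phi: (forall i, Cc (phi i)) -> rt (lcf a phi (gr (fun=> 0))) = `|a| * rt phi.
move=> cp; rewrite /rt mulr_sumr; apply: eq_bigr => i _; rewrite mulr_sumr; apply: eq_bigr => j _.
rewrite rot_lc//; last by move=> k; exact: Cc_d (@Cc0).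
rewrite rot_gr; last exact: Cc0.
by under eq_fun do rewrite addr0; exact: nmZ (Cc_sq (Cc_rot i j cp)).
Qed.

Lemma lcB phi psi: lcf (-1) psi phi = fun i x => phi i x - psi i x.
by apply/funext => i; exact: N1D. Qed.
Lemma dv_sub phi psi: (forall i, Cc (phi i)) -> (forall i, Cc (psi i)) ->
 dv (fun i x => phi i x - psi i x) = fun x => dv phi x - dv psi x.
by move=> cp cs; rewrite -lcB dv_lc// N1D. Qed.

Lemma rt_sub phi psi: (forall i, Cc (phi i)) -> (forall i, Cc (psi i)) ->
 rt (fun i x => phi i x - psi i x) <= rt phi + rt psi.
move=> cp cs; rewrite -lcB /rt -big_split/=; apply: ler_sum => i _; rewrite -big_split/=; apply: ler_sum => j _.
by rewrite rot_lc// N1D; exact: nmB (Cc_sq (Cc_rot i j cp)) (Cc_sq (Cc_rot i j cs)).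
Qed.

Lemma sum_alg (X Z V : 'I_n -> 'I_n -> R): (forall a b, V a b = X a b + X b a - 2 * Z a b) ->
 2 * (\sum_a \sum_b X a b) = \sum_a \sum_b V a b + 2 * \sum_a \sum_b Z a b.
move=> VE; rewrite [in RHS](eq_bigr (fun a => \sum_b X a b + (\sum_b X b a - 2 * \sum_b Z a b))); last first.
 move=> a _; rewrite mulr_sumr -sumrB -big_split/=; apply: eq_bigr => b _.
 by rewrite VE addrA.
rewrite big_split/= sumrB -mulr_sumr [X in _ + (X - _)]exchange_big/=.
by move: (\sum_a _) (\sum_a _) => *; ring.
Qed.

(** Integrating by parts twice, the squares of all derivatives sum to those of the divergence and of
 the rotation. *)
Lemma grad_rot_dv phi i j: (forall i, Cc (phi i)) ->
 nm ('d_j (phi i)) <= rt phi + nm (dv phi).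
move=> cp; have s i j: sq mu ('d_j (phi i)) := sq_d j (cp i).
pose X i j := dot ('d_j (phi i)) ('d_j (phi i)).
pose Y i j := dot ('d_j (phi i)) ('d_i (phi j)).
pose Z i j := dot ('d_i (phi i)) ('d_j (phi j)).
have YZ a b: Y a b = Z a b.
 rewrite /Y /Z (ip_partial a (Cc_C1 (Cc_d b (cp a))) (cp b)).
 rewrite (ip_partial b (Cc_C1 (Cc_d a (cp a))) (cp b)).
 have ->: 'd_a ('d_b (phi a)) = 'd_b ('d_a (phi a)) by exact: partialC (cp a).
 by [].
have XR a b: dot (rot phi a b) (rot phi a b) = X a b + X b a - 2 * Y a b.
 rewrite /rot ipBl//; last exact: sqB.
 rewrite !ipBr// /X /Y (ipC mu ('d_a (phi b)) ('d_b (phi a))).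
 by move: (dot _ _) (dot _ _) (dot _ _) => *; ring.
have ZZ: dot (dv phi) (dv phi) = \sum_a \sum_b Z a b.
 rewrite /dv [LHS]ip_sql//; last exact: sq_sum.
 by apply: eq_bigr => a _; rewrite [LHS]ip_sumr.
have S: 2 * (\sum_a \sum_b X a b) = \sum_a \sum_b dot (rot phi a b) (rot phi a b) + 2 * dot (dv phi) (dv phi) by rewrite ZZ; apply: sum_alg => a b; rewrite XR YZ.
have rr: \sum_a \sum_b dot (rot phi a b) (rot phi a b) <= rt phi ^+ 2.
 rewrite [leRHS]expr2 [X in _ <= X * _]/rt mulr_suml; apply: ler_sum => a _.
 rewrite mulr_suml; apply: ler_sum => b _; rewrite -nm_sq expr2.
 by apply: ler_wpM2l; [exact: nm_ge0|exact: nm_rt].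
apply: nm_le; first by rewrite addr_ge0 ?rt_ge0 ?nm_ge0.
have Xle: X i j <= \sum_a \sum_b X a b.
 apply: (le_trans (ler_sum1 (F := fun b => X i b) j (fun b => ip_ge0 _ _))).
 by apply: (ler_sum1 (F := fun a => \sum_b X a b)) => a; apply: sumr_ge0 => b _; exact: ip_ge0.
apply: le_trans Xle _.
have := rt_ge0 phi; have := nm_ge0 mu (dv phi); move: S rr; rewrite -nm_sq.
move: (\sum_a \sum_b X a b) (\sum_a \sum_b dot (rot phi a b) (rot phi a b)) (rt phi) (nm (dv phi)).
by clear => x a r d h1 h2 d0 r0; have : 0 <= r * d by [exact: mulr_ge0]; nra.
Qed.

Section setting.
Context (Om : set E) (M : R) (oO : open Om) (M0 : 0 < M) (OM : Om `<=` ball 0 M).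

(** Compare f with its translate by the diameter of the domain. *)
Lemma poincare f: Ct Om f -> nm f <= 2 * M * nm ('d_i0 f).
move=> cf; have cc := cf.1; pose L := 2 * M; have L0: 0 < L by rewrite mulr_gt0.
have fM x: M <= `|x| -> f x = 0 by move=> xM; apply: (Ct_out cf) => /OM /ball0P; rewrite ltNge xM.
have sh := sq_shift (L *: dx i0) (Cc_sq cc).
apply: (@le_trans _ _ (nm (fun x => f (x + L *: dx i0) - f x))).
 apply: nm_abs_le; [exact: Cc_meas|exact: sqB (Cc_sq cc)|].
 move=> x; have [xM|xM] := lerP M `|x|; first by rewrite fM// normr0.
 rewrite [f (x + _)]fM ?sub0r ?normrN//.
 have h1 := rV_norm_coord (x + L *: dx i0) i0; rewrite coord_ray in h1.
 apply: le_trans h1; apply: le_trans (ler_norm _).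
 have : - `|x| <= x 0 i0 by have := rV_norm_coord x i0; rewrite ler_norml => /andP[].
 by move: xM; rewrite /L; move: (x 0 i0) `|x| => a b; lra.
apply: le_trans (translation_nm _ cc) _.
have ->: pd (L *: dx i0) f = fun x => L * 'd_i0 f x.
 apply/funext => x; rewrite -pd_dx /pd mulr_sumr; apply: eq_bigr => i _.
 by rewrite mxE mulrA.
by rewrite nmZ ?gtr0_norm//; exact: (sq_d _ cc).
Qed.

(** g is the harmonic part of the divergence of phi: its projection orthogonal to
  the Laplacians of test functions. *)
Definition hpart phi g := [/\ harm Om g, (forall x, ~ Om x -> g x = 0) &
 forall e, 0 < e -> exists2 q, Ct Om q & nm (fun x => dv phi x - lap q x - g x) <= e].

Let bO f : (forall x, ~ Om x -> f x = 0) -> bsupp f.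
by move=> f0; exists M => x nx; apply: f0 => /OM. Qed.

Lemma lap_lc a f g: Cc f -> Cc g -> lap (fun x => a * f x + g x) = fun x => a * lap f x + lap g x.
move=> cf cg; have := dv_lc a (fun i => Cc_d i cf) (fun i => Cc_d i cg).
rewrite !dv_gr => <-; apply/funext => x; apply: eq_bigr => i _.
by rewrite partial_lc.
Qed.

Lemma hpart_exists phi: Ctf Om phi -> exists g, hpart phi g.
move=> cp; have mO := open_meas oO; have cpc i := (cp i).1.
have sd := Cc_sq (Cc_dv cpc).
have sl q: Ct Om q -> sq mu (lap q) by move=> cq; exact: Cc_sq (Cc_lap cq.1).
have [|||||||v [w [cv sw w0 tm wl]]] := @riesz_fields _ _ _ mu _ (fun a f g x => a * f x + g x) (Ct Om)
 (fun=> 0) 'I_1 (fun _ f => lap f) (fun f => dot (dv phi) (lap f)) (nm (dv phi)) Om mO (Ct0 Om).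
- by move=> a f g cf cg; exact: CtD (CtZ a cf) cg.
- by move=> _ q; exact: sl.
- by move=> _ q x cq; exact: (Ct_out (Ct_sum _ (fun i => Ct_d i (Ct_d i cq)))).
- by move=> _ a f g cf cg; exact: lap_lc cf.1 cg.1.
- by move=> a f g cf cg; rewrite (lap_lc a cf.1 cg.1) ipDr ?ipZr//; [exact: sl|apply: sqZ; exact: sl|exact: sl].
- exact: nm_ge0.
- by move=> q cq; rewrite big_ord1; exact: nm_CS sd (sl q cq).
pose g x := dv phi x - w ord0 x; have sg: sq mu g by exact: sqB.
have g0 x: ~ Om x -> g x = 0.
 move=> nx; rewrite /g w0// subr0; exact: (Ct_out (Ct_sum _ (fun i => Ct_d i (cp i)))).
exists g; split => //.
- split=> [|h ch]; first by split => //; exact: bO.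
 by rewrite ipBl ?wl ?big_ord1 ?subrr//; exact: sl.
- move=> e /(tm ord0)[K KP]; exists (v K) => //.
 rewrite /g; have := KP K (leqnn _); rewrite nmBC; congr (L2norm mu _ <= _).
 by apply/funext => x; move: (w _ x) (lap (v K) x) (dv phi x) => a b c; ring.
Qed.

Lemma hpart_ip phi g: Ctf Om phi -> hpart phi g -> dot g g = dot g (dv phi).
move=> cp [hg g0 H]; have sg := Lb_sq hg.1; have sd := Cc_sq (Cc_dv (fun i => (cp i).1)).
apply/esym/eqP; rewrite -subr_eq0 -ipBr//; apply/eqP; apply: ip_lim0 => //; first exact: sqB.
move=> e e0; have [q cq qe] := H e e0; exists (lap q); first exact: Cc_sq (Cc_lap cq.1).
split; last exact: hg.2.
rewrite nmBC; move: qe; congr (L2norm mu _ <= _); apply/funext => x; ring.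
Qed.

Lemma hpart_lc a phi g psi h: Ctf Om phi -> Ctf Om psi -> hpart phi g -> hpart psi h ->
 hpart (lcf a phi psi) (fun x => a * g x + h x).
move=> cp cs [hg g0 Hg] [hh h0 Hh]; have sg := Lb_sq hg.1; have sh := Lb_sq hh.1.
have cpc i := (cp i).1; have csc i := (cs i).1.
split.
- split; first exact: (LbD (LbZ a hg.1) hh.1).
 move=> f cf; have sf := Cc_sq (Cc_lap cf.1).
 by rewrite ipDl ?ipZl//; [rewrite hg.2// hh.2// mulr0 addr0|exact: sqZ].
- by move=> x nx; rewrite g0// h0// mulr0 addr0.
- move=> e e0; have c0: 0 < `|a| + 1 by rewrite ltr_wpDl.
 have d0: 0 < e / 2 / (`|a| + 1) by rewrite !divr_gt0.
 have [q cq qe] := Hg _ d0; have [q' cq' qe'] := Hh _ (divr_gt0 e0 (ltr0n _ 2)).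
 exists (fun x => a * q x + q' x); first by apply: CtD => //; exact: CtZ.
 rewrite (lap_lc a cq.1 cq'.1) (dv_lc a cpc csc).
 have s1: sq mu (fun x => dv phi x - lap q x - g x) by apply: sqB => //; apply: sqB; [exact: Cc_sq (Cc_dv cpc)|exact: Cc_sq (Cc_lap cq.1)].
 have s2: sq mu (fun x => dv psi x - lap q' x - h x) by apply: sqB => //; apply: sqB; [exact: Cc_sq (Cc_dv csc)|exact: Cc_sq (Cc_lap cq'.1)].
 have ->: (fun x => a * dv phi x + dv psi x - (a * lap q x + lap q' x) - (a * g x + h x)) =
   fun x => a * (dv phi x - lap q x - g x) + (dv psi x - lap q' x - h x).
  apply/funext => x; move: (dv phi x) (dv psi x) (lap q x) (lap q' x) (g x) (h x) => *; ring.
 apply: le_trans (nmD (sqZ a s1) s2) _; rewrite nmZ// [leRHS]splitr; apply: lerD => //.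
 apply: (@le_trans _ _ ((`|a| + 1) * (e / 2 / (`|a| + 1)))); last by rewrite mulrC divfK// gt_eqF.
 by apply: ler_pM => //; [exact: nm_ge0|rewrite lerDl].
Qed.

Lemma hpart_gr q: Ct Om q -> hpart (gr q) (fun=> 0).
move=> cq; split => //.
- split; first exact: Lb_Cc (@Cc0).
 by move=> h ch; rewrite /ip int_eq0// => x; rewrite mul0r.
- move=> e e0; exists q => //; rewrite dv_gr (_ : (fun x => _) = fun=> 0) ?nm0 ?ltW//.
 by apply/funext => x; rewrite !subrr.
Qed.

Lemma hpart_sub phi g psi h: Ctf Om phi -> Ctf Om psi -> hpart phi g -> hpart psi h ->
 hpart (fun i x => phi i x - psi i x) (g -' h).
by move=> cp cs hg hh; rewrite -lcB -N1D; exact: hpart_lc. Qed.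

Context (hp : patched Om) (cb : connected [set x | closure Om x /\ ~ Om x]).

(** The harmonic part of the divergence is controlled by the rotation. By the key
  estimate it is controlled by the rotation and the field itself; the latter is
  removed by compactness, since a limit field would be the gradient of a function
  vanishing outside of Om. *)
Lemma hpart_rot: exists2 C : R, 0 <= C & forall phi g, Ctf Om phi -> hpart phi g -> nm g <= C * rt phi.
have bOm: bounded_set Om by apply/bddP; exists M.
have [CK CK0 KbP] := Kb_global oO bOm hp.
have Kest phi g: Ctf Om phi -> hpart phi g -> nm g <= CK * (rt phi + nv phi).
 move=> cp hg; have [hg1 _ _] := hg.
 have := KbP g phi hg1 cp (fun i x (nx : ~ setT x) => False_ind _ (nx I)).
 rewrite -(hpart_ip cp hg) ger0_norm ?ip_ge0// -nm_sq expr2 mulrAC.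
 have [->|gn] := eqVneq (nm g) 0; first by rewrite mulr_ge0// addr_ge0 ?rt_ge0 ?nv_ge0.
 by rewrite ler_pM2r// lt_neqAle eq_sym gn nm_ge0.
apply: contrapT => nC.
have step k: exists p : VF * (E -> R), [/\ Ctf Om p.1, hpart p.1 p.2, nm p.2 = 1,
  rt p.1 <= k.+1%:R^-1 & nm (fun x => dv p.1 x - p.2 x) <= k.+1%:R^-1].
 have k0: 0 < k.+1%:R :> R by rewrite ltr0n.
 have [phi [g [cp hg lt_]]] : exists phi g, [/\ Ctf Om phi, hpart phi g & k.+1%:R * rt phi < nm g].
  apply: contrapT => H; apply: nC; exists k.+1%:R; first exact: ltW.
  move=> phi g cp hg; rewrite leNgt; apply/negP => lt_; apply: H; exists phi, g; by split.
 have gp: 0 < nm g by apply: le_lt_trans lt_; rewrite mulr_ge0 ?rt_ge0// ltW.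
 have cpc i := (cp i).1.
 pose a := (nm g)^-1; have a0: 0 < a by rewrite invr_gt0.
 pose pa := lcf a phi (gr (fun=> 0)); have cz: Ctf Om (gr (fun=> 0)) := Ctf_gr (Ct0 Om).
 have cp1: Ctf Om pa by exact: Ctf_lc.
 have h1: hpart pa (fun x => a * g x).
  have := hpart_lc a cp cz hg (hpart_gr (Ct0 Om)); congr (hpart _ _).
  by apply/funext => x; rewrite addr0.
 have [_ _ Hq] := h1; have [q cq qe] := Hq k.+1%:R^-1 ltac:(by rewrite invr_gt0).
 have c1c i := (cp1 i).1; have cgq i := (Ctf_gr cq i).1.
 have h2 := hpart_sub cp1 (Ctf_gr cq) h1 (hpart_gr cq).
 exists ((fun i x => pa i x - gr q i x), (fun x => a * g x - 0)) => /=.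
 have gE: (fun x => a * g x - 0) = fun x => a * g x by apply/funext => x; rewrite subr0.
 have sg: sq mu g by case: hg => -[[]].
 split => //.
 - by rewrite -lcB; exact: Ctf_lc (Ctf_gr cq) cp1.
 - by rewrite gE nmZ// gtr0_norm// mulVf// gt_eqF.
 - rewrite -lcB (rt_sub_gr c1c cq.1) rt_lc0// gtr0_norm// /a.
  rewrite ler_pdivrMl// -(ler_pM2l k0) mulrCA mulfV ?gt_eqF// mulr1; exact: ltW.
 - by rewrite (dv_sub c1c cgq) dv_gr; under eq_fun do rewrite subr0.
have [p pP] := choice step.
pose ph k := (p k).1; pose g k := (p k).2.
have cph k: Ctf Om (ph k) by have [] := pP k.
have cphc k i: Cc (ph k i) := (cph k i).1.
have hg k: hpart (ph k) (g k) by have [] := pP k.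
have sg k: sq mu (g k) by have [[[]]] := hg k.
have rp k: rt (ph k) <= k.+1%:R^-1 by have [] := pP k.
have vp k: nm (fun x => dv (ph k) x - g k x) <= k.+1%:R^-1 by have [] := pP k.
have gr3 k i j: nm ('d_j (ph k i)) <= 3.
 have i1: k.+1%:R^-1 <= 1 :> R by rewrite invf_le1 ?ltr0n// ler1n.
 have v2: nm (dv (ph k)) <= nm (fun x => dv (ph k) x - g k x) + 1.
  have := nmD (sqB (Cc_sq (Cc_dv (cphc k))) (sg k)) (sg k); under eq_fun do rewrite subrK.
  by rewrite [nm (g k)](_ : _ = 1)//; have [] := pP k.
 apply: le_trans (grad_rot_dv i j (cphc k)) (le_trans (lerD (rp k) (le_trans v2 (lerD (vp k) (lexx 1)))) _).
 by rewrite (_ : 3 = 1 + (1 + 1)) ?lerD//; ring.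
pose B := 6 * M + n%:R * 3.
have nB: 0 <= n%:R * 3 :> R by rewrite mulr_ge0.
have phB k i: nm (ph k i) <= B.
 apply: le_trans (poincare (cph k i)) _; rewrite -[leLHS]addr0; apply: lerD => //.
 by have := ler_wpM2l (ltW (mulr_gt0 (ltr0n R 2) M0)) (gr3 k i i0); rewrite (_ : 6 * M = 2 * M * 3)//; ring.
have pB k i: \sum_j nm ('d_j (ph k i)) <= B.
 apply: (@le_trans _ _ (\sum_(j < n) 3)); first by apply: ler_sum => j _; exact: gr3.
 by rewrite sumr_const card_ord -[_ *+ n]mulr_natl lerDr mulr_ge0// ltW.
have [F [UF subF]] := ultraFilterLemma (eventually_filter : ProperFilter \oo).
have phM i k x: ~ ball 0 M x -> ph k i x = 0 by move=> nx; apply: (Ct_out (cph k i)) => /OM.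
pose Q : R := 4 + CK * (2 + n%:R); have Q0: 0 < Q by rewrite ltr_wpDr// mulr_ge0// addr_ge0.
pose dif k l : VF := fun i x => ph k i x - ph l i x.
have cdif k l: Ctf Om (dif k l) by rewrite /dif -lcB; exact: Ctf_lc.
have hdif k l: hpart (dif k l) (fun x => g k x - g l x) by exact: hpart_sub.
have good e: 0 < e -> exists A : set nat, F A /\ forall k l, A k -> A l -> [/\ k.+1%:R^-1 <= e,
  forall i, nm (dif k l i) <= Q * e, forall i j, nm ('d_j (dif k l i)) <= Q * e &
  nm (fun x => g k x - g l x) <= Q * e].
 move=> e0.
 have A1 i: exists A : set nat, F A /\ forall k l, A k -> A l -> nm (fun x => ph k i x - ph l i x) <= e.
  have [A FA H] := rellich_ultra UF (fun k => cphc k i) (fun k => phM i k) (fun k => phB k i) (fun k => pB k i) e0.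
  by exists A.
 have [A AP] := choice A1.
 pose A' := [set k : nat | (forall i, A i k) /\ k.+1%:R^-1 <= e :> R].
 exists A'; split.
  apply: filterI; first by apply: filter_forall => i; exact: (AP i).1.
  apply: subF; have [K HK] := riesz_small e0; exists K => // k /= Kk; have := HK k Kk.
  by have : 0 <= k.+1%:R^-1 :> R by []; move: (k.+1%:R^-1) => a; lra.
 move=> k l [Ak ke] [Al le_]; have d1 i: nm (dif k l i) <= e := (AP i).2 k l (Ak i) (Al i).
 have d2: rt (dif k l) <= 2 * e.
  apply: le_trans (rt_sub (cphc k) (cphc l)) (le_trans (lerD (rp k) (rp l)) _).
  by rewrite mulr2n mulrDl mul1r; exact: lerD.
 have d3: nm (fun x => g k x - g l x) <= CK * (2 + n%:R) * e.
  apply: le_trans (Kest _ _ (cdif k l) (hdif k l)) _; rewrite -mulrA ler_wpM2l// mulrDl lerD//.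
  by rewrite mulr_natl -[X in _ *+ X]card_ord -sumr_const; apply: ler_sum.
 have d4: nm (dv (dif k l)) <= 2 * e + CK * (2 + n%:R) * e.
  rewrite dv_sub//; have sr j := sqB (Cc_sq (Cc_dv (cphc j))) (sg j).
  rewrite (_ : (fun x => _) = fun x => ((dv (ph k) x - g k x) - (dv (ph l) x - g l x)) + (g k x - g l x)); last first.
   by apply/funext => x; move: (dv _ x) (dv _ x) (g _ x) (g _ x) => *; ring.
  apply: le_trans (nmD (sqB (sr k) (sr l)) (sqB (sg k) (sg l))) _; apply: lerD => //.
  apply: le_trans (nmB (sr k) (sr l)) (le_trans (lerD (vp k) (vp l)) _).
  by rewrite mulr2n mulrDl mul1r; exact: lerD.
 have p0: 0 <= CK * (2 + n%:R) * e by rewrite !mulr_ge0// ?addr_ge0// ltW.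
 rewrite /Q mulrDl; move: (CK * _ * e) p0 d3 d4 => c p0 d3 d4; split => // [i|i j|].
 - by apply: le_trans (d1 i) _; rewrite ler_wpDr// -[leLHS]mul1r ler_wpM2r ?ler1n// ltW.
 - apply: le_trans (grad_rot_dv i j (fun i => (cdif k l i).1)) (le_trans (lerD d2 d4) _).
  by rewrite addrA lerD2r -mulrDl -natrD.
 - by apply: le_trans d3 _; rewrite lerDr mulr_ge0// ltW.
have [A AP] := choice (fun j : nat => good j.+1%:R^-1 ltac:(by rewrite invr_gt0)).
have FA j: F [set k : nat | forall i, (i <= j)%N -> A i k].
 elim: j => [|j ih].
  by apply: filterS (AP 0%N).1 => k Ak i; rewrite leqn0 => /eqP ->.
 apply: filterS (filterI ih (AP j.+1).1) => k [H Ak] i; rewrite leq_eqVlt => /orP[/eqP->//|].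
 by rewrite ltnS; exact: H.
have [s sP] := choice (fun j => filter_ex (FA j)).
have small t: 0 < t -> exists K, forall k, (K <= k)%N -> (s k).+1%:R^-1 <= t /\ Q * K.+1%:R^-1 <= t.
 move=> t0; have u0: 0 < t / (Q + 1) by rewrite divr_gt0// ltr_wpDl// ltW.
 have [K KP] := riesz_small u0; exists K => k Kk.
 have [h1 _ _ _] := (AP K).2 _ _ (sP k K Kk) (sP k K Kk).
 have h2: K.+1%:R^-1 <= t / (Q + 1).
  apply: le_trans (le_trans (_ : _ <= 2 / K.+1%:R) (KP K (leqnn _))) _; first by rewrite ler_peMl// ler1n.
  by rewrite ler_pdivrMr// ler_peMr ?ler1n// ltW.
 have h3: (Q + 1) * K.+1%:R^-1 <= t by rewrite mulrC -ler_pdivlMr// ltr_wpDl// ltW.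
 split; last by apply: le_trans h3; rewrite ler_wpM2r// lerDl.
 apply: le_trans h1 _; apply: le_trans h3; rewrite -[leLHS]mul1r ler_wpM2r// lerDr; exact: ltW.
have cauI (U : nat -> E -> R) : (forall j k l, A j k -> A j l -> nm (fun x => U k x - U l x) <= Q * j.+1%:R^-1) ->
  cau mu (fun k => U (s k)).
 move=> H e /small[K KP]; exists K => k l Kk Kl.
 by apply: le_trans (H K _ _ (sP k K Kk) (sP l K Kl)) _; exact: (KP k Kk).2.
have q1 i: cau mu (fun k => ph (s k) i) by apply: (cauI (fun k => ph k i)) => j k l Ak Al; have [_ H _ _] := (AP j).2 k l Ak Al; exact: H i.
have q2 i j: cau mu (fun k => 'd_j (ph (s k) i)).
 apply: (cauI (fun k => 'd_j (ph k i))) => m k l Ak Al; have [_ _ H _] := (AP m).2 k l Ak Al.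
 by have := H i j; rewrite /dif -N1D partial_lc// N1D.
have q3: forall e, 0 < e -> exists K, forall k, (K <= k)%N -> rt (ph (s k)) <= e.
 move=> e /small[K KP]; exists K => k Kk; apply: le_trans (rp _) _; exact: (KP k Kk).1.
have q4: cau mu (fun k => g (s k)) by apply: cauI => m k l Ak Al; have [_ _ _ H] := (AP m).2 k l Ak Al.
have mO := open_meas oO.
have g0 k x: ~ Om x -> g (s k) x = 0 by have [_ h _] := hg (s k); exact: h.
have [gl [sgl gl0 tg]] := cau_limit mO (fun k => sg (s k)) q4 g0.
have hgl: harm Om gl.
 split; first by split => //; exact: bO.
 move=> h ch; have sl := Cc_sq (Cc_lap ch.1).
 have t1 := tends_ip (fun k => sg (s k)) sgl sl tg.
 have Ek: (fun k => dot (g (s k)) (lap h)) = fun=> 0 by apply/funext => k; have [[_ H] _ _] := hg (s k); exact: H.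
 have t2: (fun k => dot (g (s k)) (lap h)) @ \oo --> (0 : R) by rewrite Ek; exact: cvg_cst.
 exact: (cvg_unique _ t1 t2).
have e8: 0 < 8^-1 :> R by rewrite invr_gt0.
have [K1 P1] := harmonic_limit i0 oO M0 OM hp cb (fun k => cph (s k)) q1 q2 q3 hgl e8.
have [K2 P2] := tg _ e8; have [K3 P3] := small _ e8.
pose k := maxn K1 (maxn K2 K3).
have b1 := P1 k (leq_maxl _ _).
have b2 := P2 k (leq_trans (leq_maxl _ _) (leq_maxr _ _)).
have [b3 _] := P3 k (leq_trans (leq_maxr _ _) (leq_maxr _ _)).
have [_ _ g1 _ b4] := pP (s k); rewrite -/(g (s k)) -/(ph (s k)) in g1 b4.
have b5 := le_trans b4 b3.
have sd := Cc_sq (Cc_dv (cphc (s k))).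
have lo: 1 <= 8^-1 + nm gl.
 have gE: g (s k) = fun x => (g (s k) x - gl x) + gl x by apply/funext => x; rewrite subrK.
 have h := nmD (sqB (sg (s k)) sgl) sgl; rewrite -gE g1 in h.
 by apply: le_trans h _; rewrite lerD2r.
have E1: dot gl gl = dot gl (dv (ph (s k))) - dot gl (fun x => dv (ph (s k)) x - g (s k) x)
  - dot gl (fun x => g (s k) x - gl x).
 rewrite !ipBr//; move: (dot _ _) (dot _ _) (dot _ _) => *; ring.
have c1 := le_trans (nm_CS sgl (sqB sd (sg (s k)))) (ler_wpM2l (nm_ge0 mu gl) b5).
have c2 := le_trans (nm_CS sgl (sqB (sg (s k)) sgl)) (ler_wpM2l (nm_ge0 mu gl) b2).
rewrite -nm_sq in E1; move: E1 b1 c1 c2 lo; rewrite !ler_norml.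
move: (nm gl) (dot _ _) (dot _ _) (dot _ _) => N a b c.
by move=> E1 /andP[_ b1] /andP[c1 _] /andP[c2 _] lo; nra.
Qed.

Context (T : VF -> R) (C0 : R) (C00 : 0 <= C0).
Context (Tlin : forall a phi psi, Ctf Om phi -> Ctf Om psi -> T (lcf a phi psi) = a * T phi + T psi).
Context (Tgr : forall q, Ct Om q -> T (gr q) = 0).
Context (Tb : forall phi, Ctf Om phi -> `|T phi| <= C0 * (nv phi + \sum_i \sum_j nm ('d_j (phi i)))).

(** Subtract from phi the gradient of q, where the Laplacian of q is close to div phi - g. This
 changes neither T phi nor rot phi, and leaves a field whose divergence is nearly g. *)
Lemma rot_bound: exists2 C1 : R, 0 <= C1 & forall phi, Ctf Om phi -> `|T phi| <= C1 * rt phi.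
have [C C_ge0 HC] := hpart_rot.
pose P : R := n%:R * (2 * M) + n%:R * n%:R; have P0: 0 <= P.
 by rewrite addr_ge0 ?mulr_ge0 // ltW.
pose K := C0 * P; have K0: 0 <= K by rewrite mulr_ge0.
exists (K * (1 + C)); first by rewrite mulr_ge0// addr_ge0.
move=> phi cp; have [g hg] := hpart_exists cp; have gC := HC _ _ cp hg.
have cpc i := (cp i).1.
apply/ler_addgt0Pr => e e0; have d0: 0 < e / (K + 1) by rewrite divr_gt0// ltr_wpDl.
have [[[sg _] _] _ Hq] := hg; have [q cq qe] := Hq _ d0; move: qe; set d := e / (K + 1) => qe.
have cgq := Ctf_gr cq; have cgc i := (cgq i).1.
have cs: Ctf Om (lcf (-1) (gr q) phi) by exact: Ctf_lc.
have csc i := (cs i).1.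
have ->: T phi = T (lcf (-1) (gr q) phi) by rewrite Tlin// Tgr// mulr0 add0r.
apply: le_trans (Tb cs) _.
have sd := Cc_sq (Cc_dv cpc); have sl := Cc_sq (Cc_lap cq.1).
have dvs: nm (dv (lcf (-1) (gr q) phi)) <= d + C * rt phi.
 rewrite (dv_lc _ cgc cpc) dv_gr.
 have ->: (fun x => -1 * lap q x + dv phi x) = fun x => (dv phi x - lap q x - g x) + g x by rewrite N1D; apply/funext => x; rewrite subrK.
 by apply: le_trans (nmD (sqB (sqB sd sl) sg) sg) _; apply: lerD.
have r0 := rt_ge0 phi.
pose G := rt phi + (d + C * rt phi).
have G0: 0 <= G by apply: addr_ge0 => //; apply: addr_ge0; [exact: ltW|exact: mulr_ge0].
have grG i j: nm ('d_j (lcf (-1) (gr q) phi i)) <= G.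
 apply: le_trans (grad_rot_dv i j csc) _; rewrite rt_sub_gr//; last exact: cq.1.
 by rewrite lerD2l.
have h1: nv (lcf (-1) (gr q) phi) <= n%:R * (2 * M) * G.
 rewrite -mulrA mulr_natl -[X in _ *+ X]card_ord -sumr_const; apply: ler_sum => i _.
 apply: le_trans (poincare (cs i)) _; by rewrite ler_wpM2l ?grG// mulr_ge0// ltW.
have h2: \sum_i \sum_j nm ('d_j (lcf (-1) (gr q) phi i)) <= n%:R * n%:R * G.
 rewrite -mulrA mulr_natl -[X in _ *+ X]card_ord -sumr_const; apply: ler_sum => a _.
 rewrite mulr_natl -[X in _ *+ X]card_ord -sumr_const; apply: ler_sum => j _; exact: grG.
apply: (@le_trans _ _ (K * G)).
 by rewrite /K -mulrA ler_wpM2l// /P mulrDl; exact: lerD.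
have ->: K * G = K * (1 + C) * rt phi + K * d by rewrite /G mulrDr (mulrDr K d) mulrDr mulr1 mulrDl mulrA addrCA addrC.
rewrite lerD2l; apply: (@le_trans _ _ ((K + 1) * d)).
 by rewrite ler_wpM2r ?(ltW d0)// lerDl.
by rewrite /d mulrC divfK// gt_eqF// ltr_wpDl.
Qed.

(** A functional annihilating gradients is, by the bound above, continuous for
  the rotation seminorm; the Riesz representation in that seminorm gives the
  skew potential. *)
Lemma rot_represent: exists w : 'I_n -> VF,
 [/\ forall i j, sq mu (w i j), forall i j x, ~ Om x -> w i j x = 0,
   forall i j x, w i j x = - w j i x &
   forall phi, Ctf Om phi -> T phi = \sum_i \sum_j dot (w i j) ('d_j (phi i))].
have [C1 C10 HT] := rot_bound; have mO := open_meas oO.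
have cc phi (cp : Ctf Om phi) i : Cc (phi i) := (cp i).1.
have [||||||v [w0 [_ sw w00 _ wl]]] := @riesz_fields _ _ _ mu _ lcf (Ctf Om) (fun _ _ => 0) ('I_n * 'I_n)%type
 (fun p phi => rot phi p.1 p.2) T C1 Om mO _ _ _ _ _ Tlin C10.
- by move=> i; exact: Ct0.
- by move=> a p q; exact: Ctf_lc.
- by move=> p q cq; exact: Cc_sq (Cc_rot _ _ (cc _ cq)).
- by move=> p q x cq nx; rewrite /rot (Ct_out (Ct_d _ (cq _)) nx) (Ct_out (Ct_d _ (cq _)) nx) subrr.
- by move=> p a f g cf cg; rewrite rot_lc//; exact: cc.
- by move=> q cq; apply: le_trans (HT q cq) _; rewrite /rt pair_bigA.
exists (fun i j x => w0 (i, j) x - w0 (j, i) x); split.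
- by move=> i j; exact: sqB.
- by move=> i j x nx; rewrite !w00// subrr.
- by move=> i j x; rewrite opprB.
move=> phi cp; have sp i j: sq mu ('d_j (phi i)) := sq_d j (cc _ cp i).
rewrite (wl _ cp) (eq_bigr (fun p => dot (w0 (p.1, p.2)) (rot phi p.1 p.2))); last by case.
rewrite -(pair_bigA _ (fun i j => dot (w0 (i, j)) (rot phi i j)))/=.
have ->: \sum_i \sum_j dot (w0 (i, j)) (rot phi i j) =
  \sum_i \sum_j dot (w0 (i, j)) ('d_j (phi i)) - \sum_i \sum_j dot (w0 (i, j)) ('d_i (phi j)).
 rewrite -sumrB; apply: eq_bigr => i _; rewrite -sumrB; apply: eq_bigr => j _.
 exact: (ipBr (sp i j) (sp j i) (sw (i, j))).
rewrite [X in _ - X]exchange_big/= -sumrB; apply: eq_bigr => i _; rewrite -sumrB; apply: eq_bigr => j _.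
by rewrite (ipBl (sw (i, j)) (sw (j, i)) (sp i j)).
Qed.
End setting.
End rotation.

(** * Line integrals *)

Section line_integrals.
Implicit Types (a b d c : E) (h : VF).
Notation k01 := (\1_`[0, 1] : RR -> R).

Lemma is_deriveS m (F : 'I_m -> R -> R) (dF : 'I_m -> R) (t : R):
 (forall i, is_derive t 1 (F i) (dF i)) -> is_derive t 1 (fun s => \sum_i F i s) (\sum_i dF i).
by move=> H; have := is_derive_sum H; rewrite fct_sumE. Qed.
Definition line_int h a b :=
 Rintegral leb setT (fun t : RR => k01 t * \sum_i h i (a + (t : R) *: (b - a)) * (b - a) 0 i).
Let k01_itg : itg leb k01. Proof. exact: (seg_k ler01).1. Qed.
Let k01_in (t : R) : k01 t != 0 -> 0 <= t <= 1.
by rewrite indicE; case: (boolP (t \in _)) => [|_]; rewrite ?eqxx// inE/= in_itv.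
Qed.

Section triangle.
Context (h : VF) (c : E) (r : R) (ch : forall i, Cc (h i)).
Context (rh : forall i j y, ball c r y -> rot h i j y = 0) (a b d : E).
Context (ca : ball c r a) (cb : ball c r b) (cd : ball c r d).

Let u := d - b.
Let w (s : R) : E := b + s *: u - a.
Let g (s : R) (t : RR) := k01 t * \sum_i h i (a + (t : R) *: w s) * w s 0 i.
Let dg (s : R) (t : RR) := k01 t * \sum_i
 (h i (a + (t : R) *: w s) * u 0 i + w s 0 i * pd ((t : R) *: u) (h i) (a + (t : R) *: w s)).

Let g_itg s : itg leb (g s).
have ->: g s = fun t : RR => \sum_i k01 t * h i (a + (t : R) *: w s) * w s 0 i by apply/funext => t; rewrite /g mulr_sumr; apply: eq_bigr => i; rewrite mulrA.
apply: itg_sum => i; apply: itgZr.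
exact: (Av_itg a k01_itg (measurable_ray (w s)) (Cc_cts (ch i)) (Cc_bsupp (ch i))).
Qed.

Let dgP (s : R) (t : RR) : is_derive s 1 (g ^~ t) (dg s t).
have H: is_derive s 1 (fun s : R => \sum_i h i (a + (t : R) *: w s) * w s 0 i)
  (\sum_i (h i (a + (t : R) *: w s) * u 0 i + w s 0 i * pd ((t : R) *: u) (h i) (a + (t : R) *: w s))).
 apply: is_deriveS => i.
 have d1: is_derive s 1 (fun s : R => h i (a + (t : R) *: w s)) (pd ((t : R) *: u) (h i) (a + (t : R) *: w s)).
  have := C1_line (a + (t : R) *: (b - a)) ((t : R) *: u) s (Cc_C1 (ch i)).
  have E1 s': a + (t : R) *: (b - a) + s' *: ((t : R) *: u) = a + (t : R) *: w s' by apply/rowP => j; rewrite !mxE; ring.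
  by rewrite E1; under eq_fun do rewrite E1.
 have d2: is_derive s 1 (fun s : R => w s 0 i) (u 0 i).
  have E2: (fun s : R => w s 0 i) = fun s : R => (b 0 i - a 0 i) + s * u 0 i by apply/funext => s'; rewrite /w !mxE; ring.
  rewrite E2; apply/is_derive_epsP => e e0; exists 1 => // k k0 _.
  by rewrite [X in _ * X](_ : _ = k * u 0 i) ?mulKf// ?subrr ?normr0 ?ltW//; rewrite [k *: 1]mulr1; ring.
 exact: (is_deriveM).
by have := is_deriveZ (k01 t) H.
Qed.

Let bound : exists2 C : R, 0 <= C & forall (s : R) (t : RR), -1 < s < 2 -> `|dg s t| <= C * k01 t.
have B f: Cc f -> exists C : R, 0 <= C /\ forall y, `|f y| <= C by move=> cf; have [C] := bsupp_bounded (Cc_cts cf) (Cc_bsupp cf); exists C; rewrite ltW.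
have [C1 C1P] := choice (fun i => B _ (ch i)).
have [C2 C2P] := choice (fun p : 'I_n * 'I_n => B _ (Cc_d p.2 (ch p.1))).
pose D i := C1 i * `|u 0 i| + (`|(b - a) 0 i| + 2 * `|u 0 i|) * \sum_j `|u 0 j| * C2 (i, j).
have S0 i: 0 <= \sum_j `|u 0 j| * C2 (i, j) by apply: sumr_ge0 => j; rewrite mulr_ge0//; exact: (C2P (i, j)).1.
have D0 i: 0 <= D i by rewrite ?addr_ge0 ?mulr_ge0//; exact: (C1P i).1.
exists (\sum_i D i); first exact: sumr_ge0.
move=> s t /andP[s1 s2]; rewrite /dg normrM mulrC.
have [->|kt] := eqVneq (k01 t) 0; first by rewrite normr0 !mulr0.
have /andP[t0 t1] := k01_in kt.
have k0: 0 <= k01 t by [].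
rewrite (ger0_norm k0) ler_wpM2r//; apply: le_trans (ler_norm_sum _ _ _) _; apply: ler_sum => i _.
apply: le_trans (ler_normD _ _) _; rewrite !normrM; apply: lerD.
 by rewrite ler_wpM2r//; exact: (C1P i).2.
apply: ler_pM => //.
 have ->: w s 0 i = (b - a) 0 i + s * u 0 i by rewrite /w !mxE; ring.
 apply: le_trans (ler_normD _ _) _; rewrite lerD2l normrM ler_wpM2r//.
 by rewrite ler_norml; lra.
apply: le_trans (ler_norm_sum _ _ _) _; apply: ler_sum => j _; rewrite !normrM mxE normrM.
apply: ler_pM => //; last exact: (C2P (i, j)).2.
by rewrite -[leRHS]mul1r ler_wpM2r// ger0_norm.
Qed.

Let psi (s : R) := \sum_i h i (b + s *: u) * u 0 i.

Let dPhi (s : R) : 0 <= s <= 1 -> is_derive s 1 (fun s => Rintegral leb setT (g s)) (psi s).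
move=> s01; have [C C0 CP] := bound; have /andP[s0 s1] := s01.
have cs: ball c r (b + s *: u) by exact: ball_segment.
have G0 (t : RR) : 0 <= C * k01 t by rewrite mulr_ge0// ler0n.
have sI: -1 < s < 2 by lra.
have := is_derive_int sI g_itg dgP (itgZ C k01_itg) G0 CP.
congr (is_derive s 1).
pose P (t : R) := t * \sum_i u 0 i * h i (a + t *: w s).
pose dP (t : R) := \sum_i u 0 i * h i (a + t *: w s) + t * \sum_i u 0 i * pd (w s) (h i) (a + t *: w s).
have dPP (t : R) : is_derive t 1 P (dP t).
 have dS: is_derive t 1 (fun t : R => \sum_i u 0 i * h i (a + t *: w s)) (\sum_i u 0 i * pd (w s) (h i) (a + t *: w s)).
  apply: is_deriveS => i; have hd := is_deriveZ (u 0 i) (C1_line a (w s) t (Cc_C1 (ch i))); exact: hd.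
 have := is_deriveM (is_derive_id t 1) dS; congr is_derive; rewrite /dP addrC; congr (_ + _).
 exact: mulr1.
have cdP: continuous dP.
 have c1 (f : VF) : (forall i, continuous (f i)) -> continuous (fun t : R => \sum_i u 0 i * f i (a + t *: w s)).
  move=> cf; have cS: continuous (fun y => \sum_i u 0 i * f i y).
   apply: continuous_bigsum => i y; apply: continuousM; [exact: cst_continuous|exact: cf].
  exact: continuous_line cS.
 move=> t; apply: cvgD; first exact: (c1 h (fun i => Cc_cts (ch i))).
 apply: cvgM; first exact: cvg_id.
 have c2: continuous (fun t : R => \sum_i u 0 i * pd (w s) (h i) (a + t *: w s)) by apply: (c1 (fun i => pd (w s) (h i))) => i; apply: continuous_pd; exact: Cc_C1.
 exact: c2.
have E1: Rintegral leb setT (dg s) = Rintegral leb setT (fun t : RR => k01 t * dP t).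
 apply: eq_int => t; rewrite /dg; have [->|/k01_in t01] := eqVneq (k01 t) 0; first by rewrite !mul0r.
 congr (_ * _); rewrite big_split/= /dP; congr (_ + _).
  by apply: eq_bigr => i; rewrite mulrC.
 have ct: ball c r (a + (t : R) *: w s) by exact: (ball_segment).
 have sy i j: 'd_j (h i) (a + (t : R) *: w s) = 'd_i (h j) (a + (t : R) *: w s) by apply/eqP; rewrite -subr_eq0; apply/eqP; exact: rh.
 transitivity (\sum_i \sum_j (t : R) * (u 0 j * (w s 0 i * 'd_i (h j) (a + (t : R) *: w s)))).
  apply: eq_bigr => i _; rewrite /pd mulr_sumr; apply: eq_bigr => j _.
  have ->: ((t : R) *: u) 0 j = (t : R) * u 0 j by rewrite mxE.
  by rewrite sy; ring.
 rewrite exchange_big/= mulr_sumr; apply: eq_bigr => j _.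
 by rewrite /pd !mulr_sumr.
rewrite E1 (ftc01 (fun t _ => dPP t) cdP) /P mul0r subr0 mul1r; apply: eq_bigr => i _.
by rewrite mulrC scale1r /w addrC subrK.
Qed.

(** The derivative in s of the integral from a to the point b + s u is, as the rotation vanishes,
 the total derivative of t * sum_i u_i h_i. *)
Lemma line_int_triangle: line_int h a b + line_int h b d = line_int h a d.
have cpsi: continuous psi.
 have cS: continuous (fun y => \sum_i u 0 i * h i y).
  apply: continuous_bigsum => i y; apply: continuousM; [exact: cst_continuous|exact: Cc_cts (ch i) y].
 have ->: psi = fun s : R => \sum_i u 0 i * h i (b + s *: u) by apply/funext => s; apply: eq_bigr => i; rewrite mulrC.
 exact: continuous_line cS.
have H := ftc01 dPhi cpsi.
have e1: Rintegral leb setT (g 0) = line_int h a b by rewrite /g /w scale0r addr0.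
have e2: Rintegral leb setT (g 1) = line_int h a d.
 have w1: w 1 = d - a by apply/rowP => j; rewrite /w /u !mxE; ring.
 by rewrite /g w1.
have e3: Rintegral leb setT (fun s : RR => k01 s * psi s) = line_int h b d by [].
by rewrite -e1 -e3 H addrC subrK.
Qed.
End triangle.

(** The potential by line integrals from a point has the field as gradient. *)
Lemma line_int_derive h c r (p : E -> R) x i: (forall i, Cc (h i)) ->
 (forall y z, ball c r y -> ball c r z -> p z = p y + line_int h y z) -> ball c r x ->
 is_derive x (dx i) p (h i x).
move=> ch pP cx; apply/is_derive_epsP => e e0.
have /nbhs_ballP[s /= s0 sP] : nbhs x (ball c r) by apply: open_nbhs_nbhs; split => //; exact: ball_open.
have chc := Cc_cts (ch i).
have /cvgrPdist_le/(_ e e0)/nbhs_ballP[q /= q0 qP] := chc x.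
exists (Num.min s q); first by rewrite lt_min s0.
move=> k k0; rewrite lt_min => /andP[ks kq].
have nk: `|k *: dx i| <= `|k| by rewrite normrZ -[leRHS]mulr1 ler_wpM2l ?norm_dx.
have cxk: ball c r (k *: dx i + x) by apply: sP; apply/ballP; rewrite opprD addrCA subrr addr0 normrN; exact: le_lt_trans ks.
rewrite (pP x _ cx cxk) [p x + _]addrC addrK.
have ->: line_int h x (k *: dx i + x) =
  k * Rintegral leb setT (fun t : RR => k01 t * h i (x + (t : R) *: (k *: dx i))).
 rewrite -intZ; last exact: (Av_itg x k01_itg (measurable_ray (k *: dx i)) (Cc_cts (ch i)) (Cc_bsupp (ch i))).
 apply: eq_int => t; rewrite addrK mulrCA; congr (_ * _); rewrite (bigD1 i)//= big1 ?addr0.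
  by rewrite !mxE !eqxx mulr1 mulrC.
 by move=> j ji; rewrite !mxE (negPf ji) !mulr0.
rewrite mulKf//.
have Ii := Av_itg x k01_itg (measurable_ray (k *: dx i)) (Cc_cts (ch i)) (Cc_bsupp (ch i)).
have k1: Rintegral leb setT (fun t => h i x * k01 t) = h i x by rewrite intZ// (seg_k ler01).2 mulr1.
rewrite -[X in - X]k1 -intB//; last exact: itgZ.
have e1: Rintegral leb setT (fun t => e * k01 t) = e by rewrite intZ// (seg_k ler01).2 mulr1.
rewrite -[leRHS]e1; apply: int_abs_le; [apply: itgB => //; exact: itgZ|exact: itgZ|].
move=> t; rewrite [h i x * _]mulrC -mulrBr normrM mulrC.
have [->|/k01_in/andP[t0 t1]] := eqVneq (k01 t) 0; first by rewrite normr0 !mulr0.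
have kt0: 0 <= k01 t by [].
rewrite (ger0_norm kt0) ler_wpM2r// distrC; apply: qP; apply/ballP.
rewrite opprD addrA subrr sub0r normrN normrZ; apply: le_lt_trans kq.
by rewrite -[leRHS]mul1r ler_pM// ger0_norm.
Qed.
End line_integrals.

(** * Square integrability of a potential up to the boundary *)

Section c1_on_open.
Implicit Types (h : E -> R) (a b c : E).

Lemma continuous_atP f x:
 (forall e, 0 < e -> exists2 r, 0 < r & forall y, `|x - y| < r -> `|f x - f y| <= e) ->
 {for x, continuous f}.
move=> H A /nbhs_ballP[e /= e0 eA]; have e20: 0 < e / 2 by rewrite divr_gt0.
have [r r0 rP] := H _ e20; apply/nbhs_ballP; exists r => //= y /ballP xy.
apply: eA; apply: le_lt_trans (rP y xy) _.
by lra.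
Qed.

Lemma continuous_cut (Om : set E) chi (q : E -> R): Ct Om chi -> (forall x, Om x -> {for x, continuous q}) ->
 continuous (chi *' q).
move=> cc cq x; have [Ox|nO] := pselect (Om x).
 have h := cvgM (Cc_cts cc.1 (x := x)) (cq x Ox); exact: h.
have oT: open (~` tsupport chi) by exact/closed_openC/closed_closure.
have nT: (~` tsupport chi) x by move=> /cc.2.
have [r r0 rP] := open_er oT nT.
apply: continuous_atP => e e0; exists r => // y /ballP xy.
by rewrite (Ct_out cc nO) (tsupport0 (rP _ xy)) !mul0r subrr normr0 ltW.
Qed.

Context (Om : set E) (M : R) (p : E -> R) (G : VF) (oO : open Om) (M0 : 0 < M) (OM : Om `<=` ball 0 M).
Context (dp : forall x i, Om x -> is_derive x (dx i) p (G i x)).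
Context (cp : forall x, Om x -> {for x, continuous p}) (cG : forall i x, Om x -> {for x, continuous (G i)}).
Context (sG : forall i, sq mu (fun x => G i x * \1_Om x)) (hp : patched Om).

Lemma C1_cut chi: Ct Om chi -> C1 (chi *' p) /\
 forall i, 'd_i (chi *' p) = fun x => 'd_i chi x * p x + chi x * G i x.
move=> cc.
have D i x: is_derive x (dx i) (chi *' p) ('d_i chi x * p x + chi x * G i x).
 have [Ox|nO] := pselect (Om x).
  have := is_deriveM (C1_partial i x (Cc_C1 cc.1)) (dp i Ox); congr is_derive.
  by rewrite addrC; congr (_ + _); exact: mulrC.
 have oT: open (~` tsupport chi) by exact/closed_openC/closed_closure.
 have nT: (~` tsupport chi) x by move=> /cc.2.
 have [r r0 rP] := open_er oT nT.
 rewrite (Ct_out cc nO) (Ct_out (Ct_d i cc) nO) !mul0r addr0.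
 apply/is_derive_epsP => e e0; exists r => // k k0 kr.
 have b1: ball x r (k *: dx i + x).
  apply/ballP; rewrite opprD addrCA subrr addr0 normrN normrZ; apply: le_lt_trans kr.
  by rewrite -[leRHS]mulr1 ler_wpM2l ?norm_dx.
 by rewrite (tsupport0 (rP _ b1)) (tsupport0 nT) !mul0r !subr0 mulr0 normr0 ltW.
have pE i: 'd_i (chi *' p) = fun x => 'd_i chi x * p x + chi x * G i x by apply/funext => x; exact: partialE (D i x).
split; last exact: pE.
split; first exact: (continuous_cut cc).
split=> [x|]; first by have [] := D i x.
rewrite pE => x.
have h1 := continuous_cut (Ct_d i cc) cp; have h2 := continuous_cut cc (fun y => @cG i y).
have h3 := cvgD (h1 x) (h2 x); exact: h3.
Qed.

Lemma measurable_cut (q : E -> R): (forall x, Om x -> {for x, continuous q}) ->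
 mfun (q *' \1_Om).
move=> cq; have bO: bounded_set Om by apply/bddP; exists M.
have cut (k : nat) : exists chi, Ct Om chi /\ forall x, er Om (k.+1%:R^-1 *+ 3) x -> chi x = 1.
 have k0: 0 < k.+1%:R^-1 :> R by [].
 by have [chi cc [_]] := cutoff_er k0 bO; exists chi.
have [chi cP] := choice cut.
apply: (@measurable_fun_cvg _ _ _ _ (fun k x => chi k x * q x)).
 by move=> k; apply: cts_meas; exact: continuous_cut (cP k).1 cq.
move=> x _; have [Ox|nO] := pselect (Om x); last first.
 apply: (@cvg_eventually _ _ _ 0) => k; by rewrite (Ct_out (cP k).1 nO) mul0r indicE memNset// mulr0.
have [r r0 rO] := open_er oO Ox.
have [K KP] := riesz_small (divr_gt0 (divr_gt0 r0 (ltr0n R 2)) (ltr0n R 2)).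
apply: (@cvg_eventually _ _ _ K) => k Kk; rewrite indicE mem_set// mulr1 (cP k).2 ?mul1r//.
apply: erW rO; rewrite -(mulr_natl _ 3); have := KP k Kk; have : 0 <= k.+1%:R^-1 :> R by [].
by move: (k.+1%:R^-1) => t; lra.
Qed.

Lemma c1_weak_gradient h i: Ct Om h ->
 dot (p *' \1_Om) ('d_i h) = - dot (fun x => G i x * \1_Om x) h.
move=> ch; have [chi cc [_ [r r0 c1]]] := cutoff (bsupp_tsupport (Cc_bsupp ch.1)) oO ch.2.
have [C pE] := C1_cut cc.
transitivity (dot (chi *' p) ('d_i h)).
 apply: eq_int => x; have [Ox|nO] := pselect (Om x); last first.
  by rewrite (Ct_out (Ct_d i ch) nO) !mulr0.
 rewrite indicE mem_set// mulr1; have [tx|nt] := pselect (tsupport h x).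
  by rewrite (c1 x x tx (ballxx _ r0)) mul1r.
 have [_ tp] := ch; have n2: ~ tsupport ('d_i h) x by move=> /(@tsupport_partial R n i h).
 by rewrite (tsupport0 n2) !mulr0.
rewrite (ip_partial i C ch.1) pE; congr (- _); apply: eq_int => x.
have [tx|nt] := pselect (tsupport h x); last by rewrite (tsupport0 nt) !mulr0.
rewrite indicE mem_set ?mulr1; last exact: ch.2.
by rewrite (partial_locally_cst i cc.1 r0 (fun y => c1 x y tx)) (c1 x x tx (ballxx _ r0)) mul0r add0r mul1r.
Qed.

Lemma c1_ftc y v (s : R): 0 < s -> (forall t : R, 0 <= t <= s -> Om (y + t *: v)) ->
 p (y + s *: v) - p y = Rintegral leb setT (fun t : RR =>
  \1_`[0, s] t * \sum_i v 0 i * (G i (y + (t : R) *: v))).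
move=> s0 sO; pose K := (fun t : R => y + t *: v) @` `[0, s].
have cK: compact K.
 apply: continuous_compact; last exact: segment_compact.
 apply: continuous_subspaceT => t.
 have h := cvgD (@cvg_cst _ y _ (nbhs t) _) (@scalel_continuous _ _ v t); exact: h.
have KO: K `<=` Om by move=> _ [t ts <-]; apply: sO.
have [chi cc [_ [r r0 c1]]] := cutoff cK oO KO.
have [C pE] := C1_cut cc.
have inK (t : R) : 0 <= t <= s -> K (y + t *: v) by exists t => //=.
have ck (t : R) : 0 <= t <= s -> chi (y + t *: v) = 1 by move=> /inK kt; exact: (c1 _ _ kt (ballxx _ r0)).
have := C1_ftc y v s0 C; rewrite ck ?lexx ?(ltW s0)//.
have ->: chi y = 1 by have := ck 0; rewrite scale0r addr0; apply; rewrite lexx ltW.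
rewrite !mul1r => ->; rewrite Rintegral_mkcond; apply: eq_int => t; rewrite patchE indicE.
case: ifPn => [|_]; last by rewrite mul0r.
rewrite inE/= in_itv/= mul1r => ts; apply: eq_bigr => i _; congr (_ * _).
rewrite pE (partial_locally_cst i cc.1 r0 (fun z => c1 _ z (inK _ ts))) (ck _ ts).
by lra.
Qed.

Lemma c1_compact_bounded (K : set E): compact K -> K `<=` Om -> exists2 C : R, 0 <= C & forall x, K x -> `|p x| <= C.
move=> cK KO; have [chi cc [_ [r r0 c1]]] := cutoff cK oO KO.
have bc: bsupp (chi *' p) by apply: bsuppMl; exact: Cc_bsupp cc.1.
have [C C0 CP] := bsupp_bounded (continuous_cut cc cp) bc; exists C; first exact: ltW.
by move=> x Kx; have := CP x; rewrite (c1 x x Kx (ballxx _ r0)) mul1r.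
Qed.

(** Near a boundary point p y = p (y + s v) - w y, where y + s v stays in a compact part of Om and w
 is the average of the derivative of p over the segment from y to y + s v. *)
Lemma c1_sq_at x: closure Om x -> exists2 r, 0 < r & sq mu (p *' \1_(Om `&` ball x r)).
move=> clx; have mp := measurable_cut cp; have mO := open_meas oO.
have mB r: measurable (ball x r : set E) by exact: meas_ball.
have pB r: (p *' \1_(Om `&` ball x r)) = fun y => (p y * \1_Om y) * \1_(ball x r) y by apply/funext => y; rewrite indicI/= mulrA.
have mpB r: mfun (p *' \1_(Om `&` ball x r)) by rewrite pB; apply: measurable_funM => //.
have outM r y: ~ ball 0 M y -> p y * \1_(Om `&` ball x r) y = 0 by move=> nM; rewrite indicE memNset ?mulr0// => -[/OM].
have [Ox|nO] := pselect (Om x).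
 have [r r0 rO] := open_er oO Ox; have r20: 0 < r / 2 by rewrite divr_gt0.
 have cK := @cball_compact x (r / 2).
 have [|C C0 CP] := c1_compact_bounded cK.
  by move=> y xy; apply: rO; apply/ballP; apply: le_lt_trans xy _; rewrite ltr_pdivrMr// ltr_pMr// ltr1n.
 exists (r / 2) => //; apply: (@sq_bounded _ M C) => // [y|y]; last exact: outM.
 rewrite indicE; case: (boolP (y \in _)) => [|_]; last by rewrite mulr0 normr0.
 by rewrite inE => -[_ /ballP/ltW]; rewrite mulr1; exact: CP.
have [v [z [L [r [r0 L0 zL zs zO]]]]] := hp clx nO.
pose s := r / (4 * (`|v| + 1)); have v1: 0 < `|v| + 1 by rewrite ltr_wpDl.
have s0: 0 < s by rewrite mulr_gt0.
have sv (t : R) : 0 <= t <= s -> `|t *: v| <= r / 4.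
 move=> /andP[t0 ts]; rewrite normrZ ger0_norm//; apply: (@le_trans _ _ (s * (`|v| + 1))).
  by apply: ler_pM => //; rewrite lerDl.
 by rewrite /s invfM mulrA divfK// gt_eqF.
have r40: 0 < r / 4 by lra.
exists (r / 4) => //.
have inO y (t : R) : Om y -> ball x (r / 4) y -> 0 <= t <= s -> Om (y + t *: v).
 move=> Oy /ballP xy ts; have h1 := sv t ts; have /andP[t0 _] := ts.
 apply/(zO); first apply/ballP.
  rewrite opprD addrA; apply: le_lt_trans (ler_normB _ _) _.
  by lra.
 rewrite zs; have : 0 < z y by apply/(zO) => //; apply/ballP; lra.
 by move=> zy; rewrite ltr_wpDr.
pose A := Om `&` ball x (r / 4).
have mA: measurable A by exact: measurableI.
pose H y := \sum_i v 0 i * (G i y * \1_Om y).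
have sH: sq mu H by apply: sq_sum => i; exact: sqZ.
pose w y := (p (y + s *: v) - p y) * \1_A y.
pose K := [set y : E | `|x - y| <= r / 2 /\ s <= z y].
have zc: continuous z.
 apply: continuous_epsP => y e e0; exists (e / L); first exact: divr_gt0.
 by move=> y' yy; apply: le_trans (zL _ _) _; rewrite mulrC -ler_pdivlMr// ltW.
have cK: compact K.
 apply: (@subclosed_compact _ _ [set y : E | `|x - y| <= r / 2]).
 - apply: closedI; first exact: cball_closed.
  by apply: (@closed_comp _ _ z [set t | s <= t]) => [y|].
 - exact: cball_compact.
 - by move=> y [].
have KO: K `<=` Om.
 move=> y [xy sz]; apply/(zO); last exact: lt_le_trans sz.
 by apply/ballP; apply: le_lt_trans xy _; rewrite ltr_pdivrMr// ltr_pMr// ltr1n.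
have [C C0 CP] := c1_compact_bounded cK KO.
have AK y: A y -> K (y + s *: v).
 move=> [Oy /ballP xy]; have ss: 0 <= s <= s by rewrite lexx ltW.
 split.
  rewrite opprD addrA; apply: le_trans (ler_normB _ _) _.
  by have := sv s; lra.
 rewrite zs lerDr ltW//; apply/(zO) => //.
 by apply/ballP; lra.
pose B1 y := p (y + s *: v) * \1_A y.
have mB1: mfun B1.
 have ->: B1 = fun y => (p (y + s *: v) * \1_Om (y + s *: v)) * \1_A y.
  apply/funext => y; rewrite /B1; have [Ay|nA] := pselect (A y).
   by rewrite [\1_Om _]indicE mem_set ?mulr1//; exact: KO (AK y Ay).
  by rewrite indicE memNset// !mulr0.
 apply: measurable_funM; last exact: measurable_indic.
 by apply: (measurableT_comp (f := fun y => p y * \1_Om y)) => //; exact: measurable_shift.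
have sB1: sq mu B1.
 apply: (@sq_bounded _ M C) => // y.
  rewrite /B1 indicE; case: (boolP (y \in _)) => [|_]; last by rewrite mulr0 normr0.
  by rewrite inE mulr1 => /AK; exact: CP.
 by move=> nM; rewrite /B1 indicE memNset ?mulr0// => -[/OM].
have mw: mfun w.
 have ->: w = fun y => B1 y - p y * \1_A y by apply/funext => y; rewrite /w mulrBl.
 by apply: measurable_funB => //; exact: mpB.
have sw: sq mu w.
 pose uu (t : RR) y := H (y + (t : R) *: v) * \1_A y.
 have mD: mfun (fun q : RR * E => uu q.1 q.2).
  apply: measurable_funM; last first.
   by apply: (measurableT_comp (f := \1_A : E -> R)).
  apply: (measurableT_comp (f := H)); first exact: sH.1.
  have mq: mfun (fun q : RR * E => (q.2, (q.1 : R) *: v)).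
   apply/measurable_fun_pair => /=; first exact: measurable_snd.
   exact: (measurableT_comp (measurable_ray v)).
  exact: (measurableT_comp (@measurable_rVD) mq).
 have Ik := (@seg_k s (ltW s0)).1.
 have bA y: `|\1_A y| <= 1 :> R by rewrite ger0_norm// leq_b1.
 have uB (t : RR) : (\1_`[0, s] : RR -> R) t != 0 ->
   sq mu (uu t) /\ dot (uu t) (uu t) <= nm H ^+ 2.
  move=> _; have sHt := sq_shift ((t : R) *: v) sH.
  have [s1 s2] := nm_mul_le sHt (measurable_indic mA) bA; split => //.
  rewrite -nm_sq ler_pXn2r ?nnegrE ?nm_ge0//; apply: le_trans s2 _.
  by rewrite mul1r -(nm_shift ((t : R) *: v) sH).
 have wE y: w y = Rintegral leb setT (fun t : RR => \1_`[0, s] t * uu t y).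
  rewrite /w; have [Ay|nA] := pselect (A y); last first.
   rewrite indicE memNset// mulr0 int_eq0// => t.
   have ->: uu t y = 0 by rewrite /uu [\1_A y]indicE memNset// mulr0.
   by rewrite mulr0.
  have [Oy xy] := Ay; rewrite [\1_A y]indicE mem_set// mulr1.
  rewrite (c1_ftc s0 (fun t => inO y t Oy xy)); apply: eq_int => t; rewrite indicE.
  case: (boolP (t \in _)) => [|_]; last by rewrite !mul0r.
  rewrite inE/= in_itv/= => ts; rewrite !mul1r /uu indicE mem_set// mulr1 /H; apply: eq_bigr => i _.
  by rewrite indicE mem_set ?mulr1//; exact: inO.
 have k0 (t : RR) : 0 <= (\1_`[0, s] : RR -> R) t by [].
 by have [] := average_sq Ik k0 mD mw uB wE (sqr_ge0 _).
have ->: (p *' \1_A) = fun y => B1 y - w y by apply/funext => y; rewrite /w /B1 mulrBl opprB addrC subrK.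
exact: sqB.
Qed.

Lemma c1_sq: sq mu (p *' \1_Om).
have bO: bounded_set Om by apply/bddP; exists M.
pose K A := measurable A /\ sq mu (p *' \1_(Om `&` A)).
have [x clx|||A clA [_ sA]] := cover_ind (K := K) (compact_closure bO).
- have [r r0 sr] := c1_sq_at clx; exists (r / 2); first by rewrite divr_gt0.
 by rewrite mulrC divfK//; split => //; exact: meas_ball.
- split=> //; under eq_fun do rewrite setI0 indic0 mulr0; exact: Cc_sq Cc0.
- move=> A x r' r _ rr [mA sA] [mB sB].
 have mB' := meas_ball x r'; have mU := measurableU _ _ mA mB'; split => //.
 have I1 B y: `|\1_B y| <= 1 :> R by rewrite ger0_norm// indicE lern1 leq_b1.
 have [s1 _] := nm_mul_le sB (measurable_indic mB') (I1 _).
 have [s2 _] := nm_mul_le s1 (measurable_indic (measurableC mA)) (I1 _).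
 have iE (B B' : set E) y : B' `<=` B ->
   \1_(Om `&` (A `|` B')) y = \1_(Om `&` A) y + \1_(Om `&` B) y * \1_B' y * \1_(~` A) y :> R.
  move=> BB; rewrite !indicE !in_setI in_setU in_setC.
  have [yb|] := boolP (y \in B'); last by case: (y \in Om); case: (y \in A); rewrite /= ?(mulr0, mul0r, addr0).
  have ->: y \in B by move: yb; rewrite !inE; exact: BB.
  by case: (y \in Om); case: (y \in A); rewrite /= ?(mulr0, mulr1, addr0, add0r, mul0r).
 have := sqD sA s2; congr (sq mu _); apply/funext => y.
 by rewrite (iE (ball x r) (ball x r')); [rewrite mulrDr !mulrA|apply: le_ball; exact: ltW].
move: sA; congr (sq mu _); apply/funext => y; rewrite !indicE in_setI; congr (_ * _%:R).
by have [yO|//] := boolP (y \in Om); rewrite /= mem_set//; apply/clA/subset_closure; rewrite inE in yO.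
Qed.
End c1_on_open.

(** * Curl free harmonic fields *)

Section curl_free_harmonic.
Implicit Types (h : E -> R) (a b c : E) (d : R).

Lemma moll_rot U (F : VF) d rho i j x: 0 < d -> mollifier d rho ->
 (forall i, Lb (F i)) -> (forall i j h, Ct U h -> dot (F i) ('d_j h) = dot (F j) ('d_i h)) ->
 er U (d + d) x -> rot (fun i => moll rho (F i)) i j x = 0.
move=> d0 mr lF rF xU; have ck := Ct_moll_kernel d0 mr xU.
by rewrite /rot !(partial_moll_kernel _ _ mr (lF _)) rF// subrr.
Qed.

Lemma line_int_le (h : VF) (C : R) a b: 0 <= C -> (forall i, Cc (h i)) ->
 (forall i y, `|h i y| <= C) -> `|line_int h a b| <= n%:R * C * `|b - a|.
move=> C0 ch hC.
have [Ik k1] := @seg_k 1 ler01.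
have k0 (t : RR) : 0 <= (\1_`[0, 1] : RR -> R) t by [].
have Ig: itg leb (fun t : RR => \1_`[0, 1] t * \sum_i h i (a + (t : R) *: (b - a)) * (b - a) 0 i).
 have ->: (fun t : RR => \1_`[0, 1] t * \sum_i h i (a + (t : R) *: (b - a)) * (b - a) 0 i) =
   fun t : RR => \sum_i \1_`[0, 1] t * h i (a + (t : R) *: (b - a)) * (b - a) 0 i.
  by apply/funext => t; rewrite mulr_sumr; apply: eq_bigr => i; rewrite mulrA.
 apply: itg_sum => i; apply: itgZr.
 exact: (Av_itg a Ik (measurable_ray (b - a)) (Cc_cts (ch i)) (Cc_bsupp (ch i))).
apply: le_trans (int_abs_le Ig (itgZ (n%:R * C * `|b - a|) Ik) _) _; last by rewrite intZ// k1 mulr1.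
move=> t; rewrite normrM mulrC (ger0_norm (k0 t)); apply: ler_wpM2r => //.
apply: le_trans (ler_norm_sum _ _ _) _.
rewrite -mulrA mulr_natl -[X in _ *+ X]card_ord -sumr_const; apply: ler_sum => i _; rewrite normrM.
by apply: ler_pM => //; exact: rV_norm_coord.
Qed.

Context (Om : set E) (M : R) (F : VF) (oO : open Om) (M0 : 0 < M) (OM : Om `<=` ball 0 M) (hp : patched Om).
Context (pot : has_potentials Om) (hF : forall i, harm Om (F i)) (F0 : forall i x, ~ Om x -> F i x = 0).
Context (rF : forall i j h, Ct Om h -> dot (F i) ('d_j h) = dot (F j) ('d_i h)).

(* the smooth representative of F *)
Let rep : exists G : VF, forall d rho x, 0 < d -> mollifier d rho -> er Om (4 * d) x ->
 forall i, G i x = moll rho (F i) x.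
have H x: exists q : R * (E -> R), Om x -> [/\ 0 < q.1, mollifier q.1 q.2 & er Om (4 * q.1) x].
 have [Ox|nO] := pselect (Om x); last by exists (0, fun=> 0).
 have [r r0 rO] := open_er oO Ox.
 have [q /andP[q0 qr] mq] := small_mollifier (divr_gt0 r0 (ltr0n R 4)).
 by exists q => _; split => //; apply: erW rO; rewrite mulrC -ler_pdivlMr// ltW.
have [q qP] := choice H; exists (fun i x => moll (q x).2 (F i) x) => d rho x d0 mr xO i.
have Ox: Om x by apply: (er_sub _ xO); rewrite mulr_gt0.
have [q0 mq qO] := qP x Ox.
have [dq|qd] := leP d (q x).1.
 by apply: (harm_moll q0 d0 mq mr (hF i)); apply: erW qO; lra.
by apply: (harm_moll q0 d0 mq mr (hF i)); apply: erW xO; lra.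
Qed.

(** The smooth representative G of F has locally path independent line integrals. Their potential p
 is C1 with gradient G, and then square integrable up to the boundary. *)
Lemma harmonic_potential: exists p : E -> R, sq mu (p *' \1_Om) /\
 forall i h, Ct Om h -> dot (p *' \1_Om) ('d_i h) = - dot (F i) h.
have [G GP] := rep.
have lF i: Lb (F i) := (hF i).1.
(* on a smaller ball the representative is a single smooth field *)
have loc c r r': 0 < r' < r -> ball c r `<=` Om -> exists h : VF,
  [/\ forall i, Cc (h i), forall i y, ball c r' y -> G i y = h i y &
    forall i j y, ball c r' y -> rot h i j y = 0].
 move=> /andP[r0 rr] cO; pose d := (r - r') / 4; have d0: 0 < d by rewrite divr_gt0// subr_gt0.
 have [rho mr] := @mollifier_exists d d0.
 have eO y: ball c r' y -> er Om (4 * d) y.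
  move=> /ballP cy w /ballP yw; apply: cO; apply/ballP.
  rewrite -(subrKA y); apply: le_lt_trans (ler_normD _ _) _; move: cy yw; rewrite /d.
  by lra.
 exists (fun i => moll rho (F i)); split.
 - by move=> i; exact: moll_smooth mr (lF i).
 - by move=> i y /eO yO; exact: (GP d).
 - by move=> i j y /eO yO; apply: (moll_rot i j d0 mr lF rF); apply: erW yO; lra.
have liE (h : VF) c r a b : (forall i y, ball c r y -> G i y = h i y) -> ball c r a -> ball c r b ->
  line_int G a b = line_int h a b.
 move=> Gh ca cb; apply: eq_int => t; rewrite indicE; case: (boolP (t \in _)) => [|_]; last by rewrite !mul0r.
 rewrite inE/= in_itv/= => t01; congr (_ * _); apply: eq_bigr => i _.
 by rewrite Gh//; exact: ball_segment.
have tri: path_additive Om (line_int G).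
 move=> c r r0 cO a b d /ballP ca /ballP cb /ballP cd.
 pose m := Num.max `|c - a| (Num.max `|c - b| `|c - d|).
 have [ma mb md] : [/\ `|c - a| <= m, `|c - b| <= m & `|c - d| <= m] by split; rewrite /m !le_max lexx ?orbT.
 have mr: m < r by rewrite /m !gt_max ca cb cd.
 have m0: 0 <= m := le_trans (normr_ge0 _) ma.
 pose r' := (m + r) / 2; have mr': m < r' by rewrite /r'; lra.
 have rr: 0 < r' < r by rewrite /r'; lra.
 have a': ball c r' a by apply/ballP; exact: le_lt_trans mr'.
 have b': ball c r' b by apply/ballP; exact: le_lt_trans mr'.
 have d': ball c r' d by apply/ballP; exact: le_lt_trans mr'.
 have [h [ch Gh rh]] := loc c r r' rr cO.
 rewrite (liE h c r')// (liE h c r')// (liE h c r')//.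
 exact: (line_int_triangle ch rh).
have [p pP] := pot tri.
have loc2 x: Om x -> exists r (h : VF), [/\ 0 < r, forall i, Cc (h i), forall i y, ball x r y -> Om y /\ G i y = h i y &
  forall y z, ball x r y -> ball x r z -> p z = p y + line_int h y z].
 move=> Ox; have [r r0 rO] := open_er oO Ox.
 have r2: 0 < r / 2 < r by lra.
 have [h [ch Gh _]] := loc x r (r / 2) r2 rO; have /andP[r20 r2r] := r2.
 have sub: ball x (r / 2) `<=` ball x r by apply: le_ball; exact: ltW.
 exists (r / 2), h; split => //.
  by split; [apply: rO; exact: sub|exact: Gh].
 by move=> y w xy xw; rewrite -(liE h x (r / 2))//; apply: (pP x r r0 rO); exact: sub.
have cG i x: Om x -> {for x, continuous (G i)}.
 move=> /loc2[r [h [r0 ch Gh _]]]; apply: continuous_atP => e e0.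
 have chc := Cc_cts (ch i).
 have /cvgrPdist_le/(_ e e0)/nbhs_ballP[q /= q0 qP] := chc x.
 exists (Num.min r q); first by rewrite lt_min r0.
 move=> y; rewrite lt_min => /andP[/ballP xy /ballP xq].
 by rewrite (Gh i x (ballxx _ r0)).2 (Gh i y xy).2; exact: qP.
have dp x i: Om x -> is_derive x (dx i) p (G i x).
 move=> /loc2[r [h [r0 ch Gh ph]]]; rewrite (Gh i x (ballxx _ r0)).2.
 exact: (line_int_derive i ch ph (ballxx _ r0)).
have cp x: Om x -> {for x, continuous p}.
 move=> /loc2[r [h [r0 ch Gh ph]]]; apply: continuous_atP => e e0.
 have B i: exists C : R, 0 <= C /\ forall y, `|h i y| <= C by have [C] := bsupp_bounded (Cc_cts (ch i)) (Cc_bsupp (ch i)); exists C; rewrite ltW.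
 have [C CP] := choice B; pose D := \sum_i C i.
 have D0: 0 <= D by apply: sumr_ge0 => i _; exact: (CP i).1.
 have hD i y: `|h i y| <= D by apply: le_trans ((CP i).2 y) _; apply: (ler_sum1 (F := C)) => j; exact: (CP j).1.
 have nD: 0 <= n%:R * D by rewrite mulr_ge0.
 have nD1: 0 < n%:R * D + 1 by lra.
 exists (Num.min r (e / (n%:R * D + 1))); first by rewrite lt_min r0 divr_gt0.
 move=> y; rewrite lt_min => /andP[/ballP xy xe].
 rewrite (ph x y (ballxx _ r0) xy) opprD addrA subrr sub0r normrN.
 apply: le_trans (line_int_le x y D0 ch hD) _; rewrite distrC.
 rewrite -(divfK (lt0r_neq0 nD1) e) mulrC; apply: ler_pM => //; first exact: ltW.
 by rewrite lerDl.
have aeG i: {ae mu, forall x, Om x -> F i x = G i x}.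
 apply: ae_local => x Ox; have [r r0 rO] := open_er oO Ox.
 have d0: 0 < r / 8 by lra.
 have [rho mr] := @mollifier_exists _ d0; exists (r / 8) => //.
 apply: filterS (weyl oO d0 mr (hF i)) => y yP xy.
 have yO: er Om (4 * (r / 8)) y.
  move=> w /ballP yw; apply: rO; apply/ballP; move/ballP: xy => xy.
  rewrite -(subrKA y); apply: le_lt_trans (ler_normD _ _) _; move: xy yw.
  by lra.
 rewrite (GP _ _ _ d0 mr yO); apply: yP; apply: erW yO; lra.
have FG i: ae_eq mu setT (F i) (fun x => G i x * \1_Om x).
 apply: filterS (aeG i) => x xP _; have [Ox|nO] := pselect (Om x).
  by rewrite indicE mem_set// mulr1 xP.
 by rewrite F0// indicE memNset// mulr0.
have mG i := measurable_cut oO M0 OM (cG i).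
have sG i: sq mu (fun x => G i x * \1_Om x).
 split => //; apply: (itg_ae _ (Lb_sq (lF i)).2); first exact: measurable_funX.
 by apply: filterS (FG i) => x xP; rewrite xP.
exists p; split; first exact: (c1_sq oO M0).
move=> i h ch; rewrite (c1_weak_gradient oO dp cp cG i ch); congr (- _).
apply: int_ae; [exact: measurable_funM (sG i).1 (Cc_meas ch.1)|exact: measurable_funM (Lb_sq (lF i)).1 (Cc_meas ch.1)|].
by apply: filterS (FG i) => x xP; rewrite xP.
Qed.
End curl_free_harmonic.

End euclidean.
Opaque partial Rintegral.

(** * Lipschitz domains *)

Section lipschitz_patches.
Context (R : realType) (n : nat).
Notation E := 'rV[R]_n.+1.

Lemma norm_mulmx m k (y : 'rV[R]_m) (A : 'M[R]_(m, k)) : `|y *m A| <= (\sum_i \sum_j `|A i j|) * `|y|.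
have S0 i: 0 <= \sum_j `|A i j| by apply: sumr_ge0.
apply: rV_norm_le; first by rewrite mulr_ge0// sumr_ge0.
move=> j; rewrite mxE mulr_suml; apply: le_trans (ler_norm_sum _ _ _) _; apply: ler_sum => i _.
rewrite normrM mulrC; apply: ler_pM => //; last exact: rV_norm_coord.
by rewrite (bigD1 j)//= lerDl sumr_ge0.
Qed.

(** In the coordinates y *m Q the height above the graph grows at unit speed along
  the last axis. *)
Lemma lipschitz_patch (Om : set E) x0: lipschitz_boundary Om -> bdry Om x0 ->
 exists v (h : E -> R) L r, patch Om x0 v h L r.
move=> lb /lb[Q [z [k [r [QQ zk r0 zO]]]]].
have QTQ: Q^T *m Q = 1%:M by exact: mulmx1C.
pose S := \sum_i \sum_j `|Q i j|.
have S0: 0 <= S by apply: sumr_ge0 => i _; exact: sumr_ge0.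
exists (delta_mx 0 ord_max *m Q^T), (fun y => (y *m Q) 0 ord_max - z (col' ord_max (y *m Q))).
exists (S + `|k| * S + 1), r; split => //.
- by rewrite ltr_wpDl// addr_ge0// mulr_ge0.
- move=> x y; have xy: `|(x - y) *m Q| <= S * `|x - y| by exact: norm_mulmx.
 have h1: `|(x *m Q) 0 ord_max - (y *m Q) 0 ord_max| <= S * `|x - y|.
  apply: le_trans xy; rewrite mulmxBl; have := rV_norm_coord (x *m Q - y *m Q) ord_max.
  by rewrite !mxE.
 have h2: `|z (col' ord_max (x *m Q)) - z (col' ord_max (y *m Q))| <= `|k| * (S * `|x - y|).
  have /= := zk (col' ord_max (x *m Q), col' ord_max (y *m Q)) (conj I I) => h.
  apply: le_trans h _; apply: (@le_trans _ _ (`|k| * `|col' ord_max (x *m Q) - col' ord_max (y *m Q)|)).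
   by rewrite ler_wpM2r// ler_norm.
  rewrite ler_wpM2l//; apply: le_trans xy; apply: rV_norm_le => // j.
  rewrite mulmxBl; have := rV_norm_coord (x *m Q - y *m Q) (lift ord_max j).
  by rewrite !mxE.
 move: h1 h2; move: ((x *m Q) 0 ord_max) ((y *m Q) 0 ord_max) (z _) (z _) => a b c d h1 h2.
 have ->: a - d - (b - c) = (a - b) - (d - c) by ring.
 apply: le_trans (ler_normB _ _) _; rewrite !mulrDl mul1r -mulrA.
 by apply: le_trans (lerD h1 h2) _; rewrite lerDl.
- move=> y s; have ->: (y + s *: (delta_mx 0 ord_max *m Q^T)) *m Q = y *m Q + s *: delta_mx 0 ord_max.
  by rewrite mulmxDl -scalemxAl -mulmxA QTQ mulmx1.
 have ->: col' ord_max (y *m Q + s *: delta_mx 0 ord_max) = col' ord_max (y *m Q) by apply/rowP => j; rewrite !mxE eq_sym (negPf (neq_lift _ _)) andbF mulr0 addr0.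
 have ->: (y *m Q + s *: delta_mx 0 ord_max) 0 ord_max = (y *m Q) 0 ord_max + s by move: (y *m Q) => u; rewrite !mxE !eqxx mulr1.
 by rewrite addrAC.
- by move=> y xy; rewrite subr_gt0; exact: zO.
Qed.

Lemma domain_data (Om : set E): bounded_lipschitz_domain Om -> connected (bdry Om) ->
 exists M : R, [/\ 0 < M, Om `<=` ball 0 M,
  patched Om &
  connected [set x | closure Om x /\ ~ Om x]].
move=> [_ oO _ /bddP[M M0 OM] lb] cb; exists M.
have E1: bdry Om = [set x | closure Om x /\ ~ Om x] by rewrite /bdry (interior_id _).1.
split => //; last by rewrite -E1.
by move=> x cx nx; apply: lipschitz_patch => //; rewrite E1.
Qed.
End lipschitz_patches.

(** * Functionals on test functions *)

Section sobolev.
Context (R : realType) (n : nat).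
Notation E := 'rV[R]_n.
Notation mu := (lebesgue_rV R n).
Notation nm := (L2norm mu).
Context (Om : set E) (oO : open Om).
Implicit Types (f g u v h : E -> R) (T S : distr Om) (a e : R).

Lemma L2P f: L2 Om f <-> sq mu (f \_ Om).
rewrite /L2 /=; split=> [fL|[mf If]].
 split; last exact: Lfun2_integrable_sqr fL.
 by move: fL; rewrite inE => /andP[]; rewrite inE.
rewrite inE; apply/andP; split; rewrite inE//= /finite_norm unlock /Lnorm.
apply: poweR_lty; have /integrableP[_] := If; congr (_ < _)%E.
apply: eq_integral => x _.
change (`|(f \_ Om) x ^+ 2|%:E = (`|(f \_ Om) x|%:E `^ 2)%E).
by rewrite poweR_EFin powR_mulrn// normrX.
Qed.

Lemma distr_ofE f (phi : testfun Om): distr_of Om f phi = ip mu (f \_ Om) phi.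
rewrite /distr_of Rintegral_mkcond; apply: eq_int => x; rewrite !patchE.
by case: ifP; rewrite ?mul0r.
Qed.

Lemma testP (phi : testfun Om): Ct Om phi.
split; last exact: testfun_sub.
split; first exact: testfun_smooth.
have [M M0 H] := compact_bounded_ball (@testfun_compact _ _ _ phi).
by exists M => x nx; apply: tsupport0 => /H.
Qed.

Definition to_test h (ch : Ct Om h) : testfun Om :=
 TestFun (Cc_smooth ch.1) (bsupp_tsupport (Cc_bsupp ch.1)) ch.2.

(* the value of a functional at a function, which is meant to be a test function *)
Definition ev T h : R := if pselect (Ct Om h) is left ch then T (to_test ch) else 0.

Lemma testfun_ext (phi psi : testfun Om): testfun_fun phi = testfun_fun psi -> phi = psi.
case: phi psi => [f a1 a2 a3] [g b1 b2 b3] /= E; subst g.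
by rewrite (Prop_irrelevance a1 b1) (Prop_irrelevance a2 b2) (Prop_irrelevance a3 b3).
Qed.
Lemma ev_test T (phi : testfun Om): ev T phi = T phi.
by rewrite /ev; case: pselect => [c|/(_ (testP phi))//]; congr T; exact: testfun_ext.
Qed.
Lemma distr_eq T S: (forall h, Ct Om h -> ev T h = ev S h) -> T = S.
by move=> H; apply/funext => phi; rewrite -!ev_test; apply: H; exact: testP. Qed.
Lemma ev_distr_of f h: Ct Om h -> ev (distr_of Om f) h = ip mu (f \_ Om) h.
by rewrite /ev; case: pselect => // c _; rewrite distr_ofE. Qed.
Lemma ev_dpartial i T h: Ct Om h -> ev (dpartial i T) h = - ev T ('d_i h).
move=> ch; rewrite /ev; case: pselect => // c; case: pselect => [c'|]; last by move/(_ (Ct_d i ch)).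
by rewrite /dpartial; congr (- T _); exact: testfun_ext.
Qed.

Lemma evD T S h: ev (T + S) h = ev T h + ev S h.
by rewrite /ev; case: pselect => // _; rewrite addr0. Qed.
Lemma evN T h: ev (- T) h = - ev T h.
by rewrite /ev; case: pselect => // _; rewrite oppr0. Qed.
Lemma ev0 h: ev 0 h = 0.
by rewrite /ev; case: pselect. Qed.
Lemma ev_sum m (F : 'I_m -> distr Om) h: ev (\sum_i F i) h = \sum_i ev (F i) h.
by elim/big_ind2 : _ => [|a b c d <- <-|]; rewrite ?ev0 ?evD. Qed.

Lemma ev_div (F : 'I_n -> distr Om) h: Ct Om h -> ev (div F) h = - \sum_i ev (F i) ('d_i h).
by move=> ch; rewrite /div ev_sum -sumrN; apply: eq_bigr => i _; exact: ev_dpartial. Qed.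

Lemma restrict_out (f : E -> R) x: ~ Om x -> (f \_ Om) x = 0.
by move=> nx; rewrite patchE memNset. Qed.
Lemma restrict_id (f : E -> R): (forall x, ~ Om x -> f x = 0) -> f \_ Om = f.
move=> f0; apply/funext => x; rewrite patchE; case: (boolP (x \in Om)) => // nx.
by rewrite f0// => Ox; rewrite mem_set in nx.
Qed.
Lemma restrict_lc a f g: (fun x => a * f x + g x) \_ Om = fun x => a * (f \_ Om) x + (g \_ Om) x.
by apply/funext => x; rewrite !patchE; case: ifP => // _; rewrite mulr0 addr0. Qed.
Lemma restrictB f g: (f -' g) \_ Om = fun x => (f \_ Om) x - (g \_ Om) x.
by apply/funext => x; rewrite !patchE; case: ifP => // _; rewrite subr0. Qed.

Lemma weak_partialE i u g: is_weak_partial Om i u g <->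
 sq mu (g \_ Om) /\ forall h, Ct Om h -> ip mu (u \_ Om) ('d_i h) = - ip mu (g \_ Om) h.
split=> [[/L2P sg E]|[sg H]].
 split => // h ch; have := congr1 (fun T => ev T h) E; rewrite ev_dpartial// !ev_distr_of//.
  by move=> <-; rewrite opprK.
 exact: Ct_d.
split; first exact/L2P.
apply: distr_eq => h ch; rewrite ev_dpartial// !ev_distr_of//; last exact: Ct_d.
by rewrite H// opprK.
Qed.

Lemma weak_partial_uniq i u g g': is_weak_partial Om i u g -> is_weak_partial Om i u g' ->
 ae_eq mu setT (g \_ Om) (g' \_ Om).
move=> /weak_partialE[sg H] /weak_partialE[sg' H'].
have : {ae mu, forall x, Om x -> (g \_ Om) x - (g' \_ Om) x = 0}.
 apply: (fundamental_sq oO (sqB sg sg')) => h ch; rewrite ipBl//; last exact: Cc_sq ch.1.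
 by apply/eqP; rewrite subr_eq0 -eqr_opp -H// -H'.
apply: filterS => x xP _; have [Ox|nO] := pselect (Om x); last by rewrite !restrict_out.
by apply/eqP; rewrite -subr_eq0; apply/eqP; exact: xP.
Qed.

Lemma weak_partialP i u g: is_weak_partial Om i u g -> is_weak_partial Om i u (weak_partial Om i u).
by move=> wg; rewrite /weak_partial; apply: (@xgetPex _ (cst 0) [set g | is_weak_partial Om i u g]); exists g.
Qed.

Lemma H1_normE u (g : 'I_n -> E -> R): (forall i, is_weak_partial Om i u (g i)) ->
 H1_norm Om u = Num.sqrt (nm (u \_ Om) ^+ 2 + \sum_i nm (g i \_ Om) ^+ 2).
have E1 f: \int[mu]_(x in Om) (f x ^+ 2) = nm (f \_ Om) ^+ 2.
 rewrite nm_sq Rintegral_mkcond; apply: eq_int => x; rewrite !patchE.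
 by case: ifP; rewrite ?mulr0// expr2.
move=> wg; rewrite /H1_norm E1; congr (Num.sqrt (_ + _)); apply: eq_bigr => i _; rewrite E1.
have w2 := weak_partialP (wg i).
have [[mg _] _] := (weak_partialE i u (g i)).1 (wg i); have [[mg' _] _] := (weak_partialE _ _ _).1 w2.
by rewrite (nm_ae mg' mg (weak_partial_uniq w2 (wg i))).
Qed.

Lemma H1_norm_ge u (g : 'I_n -> E -> R): (forall i, is_weak_partial Om i u (g i)) ->
 nm (u \_ Om) <= H1_norm Om u /\ forall i, nm (g i \_ Om) <= H1_norm Om u.
move=> wg; rewrite (H1_normE wg).
have S0: 0 <= \sum_i nm (g i \_ Om) ^+ 2 by apply: sumr_ge0 => i _; exact: sqr_ge0.
have H a X: 0 <= a -> a ^+ 2 <= X -> a <= Num.sqrt X by move=> a0 aX; rewrite -(ger0_norm a0) -sqrtr_sqr ler_wsqrtr.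
split; first by apply: H; [exact: nm_ge0|rewrite lerDl].
move=> i; apply: H; first exact: nm_ge0.
apply: (le_trans (ler_sum1 (F := fun i => nm (g i \_ Om) ^+ 2) i (fun i => sqr_ge0 _))).
by rewrite lerDr sqr_ge0.
Qed.

Lemma H1_norm_le u (g : 'I_n -> E -> R): (forall i, is_weak_partial Om i u (g i)) ->
 H1_norm Om u <= nm (u \_ Om) + \sum_i nm (g i \_ Om).
move=> wg; rewrite (H1_normE wg).
have n0 := nm_ge0 mu (u \_ Om); have S0: 0 <= \sum_i nm (g i \_ Om) by apply: sumr_ge0 => i _; exact: nm_ge0.
rewrite -[leRHS](ger0_norm (addr_ge0 n0 S0)) -sqrtr_sqr ler_wsqrtr//.
have h: \sum_i nm (g i \_ Om) ^+ 2 <= (\sum_i nm (g i \_ Om)) ^+ 2.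
 rewrite [leRHS]expr2 mulr_suml; apply: ler_sum => i _; rewrite expr2 ler_wpM2l ?nm_ge0//.
 by apply: (ler_sum1 (F := fun i => nm (g i \_ Om))) => j; exact: nm_ge0.
by move: h n0 S0; move: (nm _) (\sum_i _) (\sum_i _) => a b c; nra.
Qed.

Lemma test_weak_partial h i: Ct Om h -> is_weak_partial Om i h ('d_i h).
move=> ch; have cp := Ct_d i ch; apply/weak_partialE.
rewrite (restrict_id (fun x => Ct_out (x := x) ch)) (restrict_id (fun x => Ct_out (x := x) cp)).
split; first exact: Cc_sq cp.1.
by move=> k ck; exact: ip_partial (Cc_C1 ch.1) ck.1.
Qed.

Lemma weak_partialB i u v g k: L2 Om u -> L2 Om v -> is_weak_partial Om i u g -> is_weak_partial Om i v k ->
 is_weak_partial Om i (u -' v) (g -' k).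
move=> /L2P su /L2P sv /weak_partialE[sg Hg] /weak_partialE[sk Hk]; apply/weak_partialE.
rewrite !restrictB; split; first exact: sqB.
move=> h ch; have sh := Cc_sq ch.1; have sp := sq_d i ch.1.
by rewrite !ipBl// Hg// Hk// opprB opprK addrC.
Qed.

Lemma weak_partial_lc i a u v g k: L2 Om u -> L2 Om v -> is_weak_partial Om i u g -> is_weak_partial Om i v k ->
 is_weak_partial Om i (fun x => a * u x + v x) (fun x => a * g x + k x).
move=> /L2P su /L2P sv /weak_partialE[sg Hg] /weak_partialE[sk Hk]; apply/weak_partialE.
rewrite !restrict_lc; split; first by apply: sqD => //; exact: sqZ.
move=> h ch; have sh := Cc_sq ch.1; have sp := sq_d i ch.1.
by rewrite !ipDl ?ipZl// ?Hg ?Hk//; [ring|exact: sqZ|exact: sqZ].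
Qed.

Lemma test_L2 h: Ct Om h -> L2 Om h.
by move=> ch; apply/L2P; rewrite restrict_id; [exact: Cc_sq ch.1|move=> x; exact: Ct_out]. Qed.

Lemma H10_of_limit u (g : 'I_n -> E -> R) (v : nat -> E -> R): sq mu u -> (forall x, ~ Om x -> u x = 0) ->
 (forall i, sq mu (g i)) -> (forall i x, ~ Om x -> g i x = 0) -> (forall k, Ct Om (v k)) ->
 tends mu v u -> (forall i, tends mu (fun k => 'd_i (v k)) (g i)) ->
 H10 Om u /\ forall i, is_weak_partial Om i u (g i).
move=> su u0 sg g0 cv vu vg; have Eu := restrict_id u0.
have Eg i: g i \_ Om = g i by apply: restrict_id; exact: g0.
have Lu: L2 Om u by apply/L2P; rewrite Eu.
have scv k := Cc_sq (cv k).1; have scp k i := sq_d i (cv k).1.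
have wg i: is_weak_partial Om i u (g i).
 apply/weak_partialE; rewrite Eu Eg; split => // h ch.
 have sh := Cc_sq ch.1; have sp := sq_d i ch.1.
 have t1 := tends_ip scv su sp vu.
 have t2 := tends_ip (fun k => scp k i) (sg i) sh (vg i).
 have t3: (fun k => - ip mu ('d_i (v k)) h) @ \oo --> - ip mu (g i) h by exact: cvgN.
 have Ek: (fun k => ip mu (v k) ('d_i h)) = fun k => - ip mu ('d_i (v k)) h by apply/funext => k; exact: ip_partial (Cc_C1 (cv k).1) ch.1.
 by rewrite Ek in t1; exact: (cvg_unique _ t1 t3).
split => //; split; first by split => // i; exists (g i).
move=> e e0; have d0: 0 < e / (n%:R + 2) by rewrite divr_gt0.
have [K0 P0] := vu _ d0; have [K KP] := choice (fun i => vg i _ d0).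
pose k := (K0 + \sum_i K i)%N.
have kK i: (K i <= k)%N by apply: leq_trans (leq_addl _ _); rewrite (bigD1 i)//= leq_addr.
exists (to_test (cv k)) => /=.
have w i := weak_partialB Lu (test_L2 (cv k)) (wg i) (test_weak_partial i (cv k)).
apply: le_lt_trans (H1_norm_le w) _.
have h0: nm ((fun x => u x - v k x) \_ Om) <= e / (n%:R + 2).
 rewrite restrict_id; last by move=> x nx; rewrite u0// (Ct_out (cv k))// subrr.
 by rewrite nmBC; apply: P0; exact: leq_addr.
have h1: \sum_i nm ((fun x => g i x - 'd_i (v k) x) \_ Om) <= n%:R * (e / (n%:R + 2)).
 rewrite mulr_natl -[X in _ *+ X]card_ord -sumr_const; apply: ler_sum => i _.
 rewrite restrict_id; last by move=> x nx; rewrite g0// (Ct_out (Ct_d i (cv k)))// subrr.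
 by rewrite nmBC; apply: KP; exact: kK.
apply: le_lt_trans (lerD h0 h1) _.
have ->: e / (n%:R + 2) + n%:R * (e / (n%:R + 2)) = e - e / (n%:R + 2) by field; rewrite gt_eqF.
by rewrite ltrBlDr ltrDl.
Qed.

Lemma H10_limit u: H10 Om u -> exists v : nat -> E -> R, [/\ forall k, Ct Om (v k),
 tends mu v (u \_ Om) & forall i, tends mu (fun k => 'd_i (v k)) (weak_partial Om i u \_ Om)].
move=> [[Lu wu] ap].
have w0 i: is_weak_partial Om i u (weak_partial Om i u) by have [g wg] := wu i; exact: weak_partialP wg.
have ip0 k: 0 < k.+1%:R^-1 :> R by rewrite invr_gt0.
have [v vP] := choice (fun k => ap _ (ip0 k)).
have cv k := testP (v k).
have w k i := weak_partialB Lu (test_L2 (cv k)) (w0 i) (test_weak_partial i (cv k)).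
have small k := H1_norm_ge (w k).
have fin e: 0 < e -> exists K, forall k, (K <= k)%N -> H1_norm Om (fun x => u x - v k x) <= e.
 move=> e0; have [K KP] := riesz_small e0; exists K => k Kk; apply: le_trans (ltW (vP k)) _.
 by have := KP k Kk; have := ip0 k; move: (k.+1%:R^-1) => t; lra.
exists (fun k => v k : E -> R); split=> //.
- move=> e /fin[K KP]; exists K => k Kk; apply: le_trans (KP k Kk); apply: le_trans (small k).1.
 by rewrite restrictB (restrict_id (fun x => Ct_out (x := x) (cv k))) nmBC.
- move=> i e /fin[K KP]; exists K => k Kk; apply: le_trans (KP k Kk); apply: le_trans ((small k).2 i).
 by rewrite restrictB (restrict_id (fun x => Ct_out (x := x) (Ct_d i (cv k)))) nmBC.
Qed.

Lemma H10_test h: Ct Om h -> H10 Om h.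
move=> ch; have out x: ~ Om x -> h x = 0 by exact: Ct_out.
have t f: tends mu (fun _ : nat => f) f.
 move=> e e0; exists 0%N => k _; rewrite (_ : (fun x => _) = fun=> 0) ?nm0 ?ltW//.
 by apply/funext => x; rewrite subrr.
by have [] := H10_of_limit (Cc_sq ch.1) out (fun i => sq_d i ch.1)
 (fun i x => Ct_out (x := x) (Ct_d i ch)) (fun _ => ch) (t h) (fun i => t ('d_i h)).
Qed.

(** Functionals in divergence form extend to the closure of the test functions. *)
Lemma Hm1_form T (a : 'I_n -> E -> R): (forall i, sq mu (a i)) ->
 (forall h, Ct Om h -> ev T h = \sum_i ip mu (a i) ('d_i h)) -> Hm1 Om T.
move=> sa Ta; pose wp i u := weak_partial Om i u \_ Om.
have H1w u i: H10 Om u -> is_weak_partial Om i u (weak_partial Om i u) by move=> [[_ wu] _]; have [g wg] := wu i; exact: weak_partialP wg.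
have swp u i: H10 Om u -> sq mu (wp i u) by move=> hu; have [] := (weak_partialE _ _ _).1 (H1w u i hu).
have ipw u i g: is_weak_partial Om i u g -> ip mu (a i) (wp i u) = ip mu (a i) (g \_ Om).
 move=> wg; have w2 := weak_partialP wg.
 have [s1 _] := (weak_partialE _ _ _).1 wg; have [s2 _] := (weak_partialE _ _ _).1 w2.
 apply: int_ae; [exact: measurable_funM (sa i).1 s2.1|exact: measurable_funM (sa i).1 s1.1|].
 by apply: filterS (weak_partial_uniq w2 wg) => x xP _; rewrite /wp xP.
exists (fun u => \sum_i ip mu (a i) (wp i u)), (\sum_i nm (a i)); split.
- move=> c u v hu hv; rewrite mulr_sumr -big_split/=; apply: eq_bigr => i _.
 have Lu := hu.1.1; have Lv := hv.1.1.
 rewrite (ipw _ _ _ (weak_partial_lc c Lu Lv (H1w u i hu) (H1w v i hv))) restrict_lc.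
 have s1: sq mu (weak_partial Om i u \_ Om) := swp u i hu.
 have s2: sq mu (weak_partial Om i v \_ Om) := swp v i hv.
 by rewrite ipDr ?ipZr//; exact: sqZ.
- move=> u hu; have [_ ge] := H1_norm_ge (fun i => H1w u i hu).
 apply: le_trans (ler_norm_sum _ _ _) _; rewrite mulr_suml; apply: ler_sum => i _.
 apply: le_trans (nm_CS (sa i) (swp u i hu)) _; rewrite ler_wpM2l ?nm_ge0//; exact: ge.
- move=> phi; have cphi := testP phi; rewrite -ev_test Ta//; apply: eq_bigr => i _.
 rewrite (ipw _ _ _ (test_weak_partial i cphi)) restrict_id// => x.
 exact: Ct_out (Ct_d i cphi).
Qed.

Lemma Hm1_bound T: Hm1 Om T -> (forall a h k, Ct Om h -> Ct Om k ->
  ev T (fun x => a * h x + k x) = a * ev T h + ev T k) /\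
 exists2 C : R, 0 <= C & forall h, Ct Om h -> `|ev T h| <= C * (nm h + \sum_i nm ('d_i h)).
move=> [F [C [Flin FC TF]]].
have evF h: Ct Om h -> ev T h = F h by move=> ch; rewrite /ev; case: pselect => // c; rewrite TF.
split.
 move=> a h k ch ck; rewrite !evF//; first by apply: Flin; exact: H10_test.
 exact: CtD (CtZ a ch) ck.
exists `|C|; first exact: normr_ge0.
move=> h ch; rewrite evF//; apply: le_trans (FC h (H10_test ch)) _.
have := H1_norm_le (fun i => test_weak_partial i ch).
rewrite restrict_id; last by move=> x; exact: Ct_out.
have ->: \sum_i nm ('d_i h \_ Om) = \sum_i nm ('d_i h) by apply: eq_bigr => i _; rewrite restrict_id// => x; exact: Ct_out (Ct_d i ch).
move=> le1; apply: (@le_trans _ _ (`|C| * H1_norm Om h)).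
 by rewrite ler_wpM2r ?sqrtr_ge0// ler_norm.
by rewrite ler_wpM2l.
Qed.
End sobolev.

(** * The decomposition by skew matrices *)

Section decomposition.
Context (R : realType) (n : nat) (i0 : 'I_n).
Notation E := 'rV[R]_n.
Notation mu := (lebesgue_rV R n).
Notation nm := (L2norm mu).
Context (Om : set E) (M : R) (oO : open Om) (M0 : 0 < M) (OM : Om `<=` ball 0 M).
Implicit Types (f g u v h : E -> R) (phi psi : 'I_n -> E -> R).

Lemma sum_single (Y : 'I_n -> R) i: (forall a, a != i -> Y a = 0) -> \sum_a Y a = Y i.
by move=> Y0; rewrite (bigD1 i)//= big1 ?addr0. Qed.

(** Dirichlet problem: a functional bounded on the closure of the test functions
  is the divergence of a gradient. *)
Lemma dirichlet (l : (E -> R) -> R) (C : R) : 0 <= C ->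
 (forall a h k, Ct Om h -> Ct Om k -> l (fun x => a * h x + k x) = a * l h + l k) ->
 (forall h, Ct Om h -> `|l h| <= C * (nm h + \sum_i nm ('d_i h))) ->
 exists u (g : 'I_n -> E -> R), [/\ H10 Om u, forall i, is_weak_partial Om i u (g i),
  forall i, sq mu (g i), forall i x, ~ Om x -> g i x = 0 &
  forall h, Ct Om h -> \sum_i ip mu (g i) ('d_i h) = l h].
move=> C0 llin lb; have mO := open_meas oO.
have sp i h: Ct Om h -> sq mu ('d_i h) by move=> ch; exact: (sq_d i ch.1).
have M20: 0 <= 2 * M by rewrite mulr_ge0// ltW.
have [||||||v [g [cv sg g0 vg gl]]] := @riesz_fields _ _ _ mu _ (fun a f h x => a * f x + h x) (Ct Om) (fun=> 0) 'I_n
 (fun i => 'd_i) l (C * (2 * M + 1)) Om mO (Ct0 Om) _ _ _ _ llin.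
- by move=> a f h cf ch; exact: CtD (CtZ a cf) ch.
- by move=> i h; exact: sp.
- by move=> i h x ch; exact: Ct_out (Ct_d i ch).
- by move=> i a f h cf ch; exact: partial_lc cf.1 ch.1.
- by rewrite mulr_ge0// addr_ge0.
- move=> h ch; apply: le_trans (lb h ch) _; rewrite -mulrA ler_wpM2l// mulrDl mul1r lerD2r.
 apply: le_trans (poincare i0 M0 OM ch) _; rewrite ler_wpM2l//.
 exact: (ler_sum1 (F := fun i => nm ('d_i h)) i0 (fun i => nm_ge0 _ _)).
have cauv: cau mu v.
 move=> e e0; have d0: 0 < e / (2 * M) by rewrite divr_gt0// mulr_gt0.
 have [K KP] := tends_cau (fun k => sp i0 _ (cv k)) (sg i0) (vg i0) d0; exists K => k j Kk Kj.
 rewrite -N1D; apply: le_trans (poincare i0 M0 OM (CtD (CtZ (-1) (cv j)) (cv k))) _.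
 by rewrite (partial_lc i0 _ (cv j).1 (cv k).1) N1D mulrC -ler_pdivlMr ?mulr_gt0//; exact: KP.
have [u [su u0 vu]] := cau_limit mO (fun k => Cc_sq (cv k).1) cauv (fun k x => Ct_out (x := x) (cv k)).
have [hu wg] := H10_of_limit oO su u0 sg g0 cv vu vg.
by exists u, g; split => // h /gl.
Qed.

Lemma ev_grad u (g : 'I_n -> E -> R) i h: (forall i, is_weak_partial Om i u (g i)) -> Ct Om h ->
 ev (grad (distr_of Om u) i) h = ip mu (g i \_ Om) h.
move=> wg ch; have [_ H] := (weak_partialE Om i u (g i)).1 (wg i).
by rewrite ev_dpartial// ev_distr_of ?H ?opprK//; exact: Ct_d.
Qed.

Context (hp : patched Om) (cb : connected [set x | closure Om x /\ ~ Om x]).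

(** The remainder Tt vanishes on gradients because the Dirichlet problem prescribes the divergence. *)
Lemma hodge (T : 'I_n -> distr Om): Hm1_div Om T -> exists u (w : 'I_n -> 'I_n -> E -> R),
 [/\ H10 Om u, forall i j, L2 Om (w i j), forall i j x, w i j x = - w j i x &
  forall i h, Ct Om h -> ev (T i) h = ev (grad (distr_of Om u) i) h + \sum_j ip mu (w i j \_ Om) ('d_j h)].
move=> [hT hdiv]; have [dlin [C C0 db]] := Hm1_bound oO hdiv.
pose l h := - ev (div T) h.
have llin a h k: Ct Om h -> Ct Om k -> l (fun x => a * h x + k x) = a * l h + l k by move=> ch ck; rewrite /l dlin// opprD mulrN.
have lb h: Ct Om h -> `|l h| <= C * (nm h + \sum_i nm ('d_i h)) by rewrite /l normrN; exact: db.
have [u [g [hu wg sg g0 ug]]] := dirichlet C0 llin lb.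
have Tl i := (Hm1_bound oO (hT i)).1.
have [Ci CiP] := choice (fun i => let: conj _ (ex_intro2 c c0 cP) := Hm1_bound oO (hT i) in
 ex_intro (fun c => 0 <= c /\ forall h, Ct Om h -> `|ev (T i) h| <= c * (nm h + \sum_i nm ('d_i h))) c (conj c0 cP)).
have gE i: g i \_ Om = g i by apply: restrict_id; exact: g0.
(* the remainder is divergence free *)
pose S i h := ev (T i) h - ip mu (g i) h.
pose Tt phi := \sum_i S i (phi i).
have Slin i a h k: Ct Om h -> Ct Om k -> S i (fun x => a * h x + k x) = a * S i h + S i k.
 move=> ch ck; rewrite /S Tl//; have s1 := Cc_sq ch.1; have s2 := Cc_sq ck.1.
 by rewrite ipDr ?ipZr//; [ring|exact: sqZ].
have Ttlin a phi psi: Ctf Om phi -> Ctf Om psi -> Tt (lcf a phi psi) = a * Tt phi + Tt psi by move=> cp cs; rewrite /Tt mulr_sumr -big_split/=; apply: eq_bigr => i _; exact: Slin.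
have Ttgr q: Ct Om q -> Tt (gr q) = 0 by move=> cq; rewrite /Tt /S sumrB ug// /l ev_div// opprK subrr.
pose B := \sum_i Ci i + \sum_i nm (g i).
have Ci0 i: 0 <= Ci i by have [] := CiP i.
have B0: 0 <= B by rewrite addr_ge0// sumr_ge0// => i _; exact: nm_ge0.
have Ttb phi: Ctf Om phi -> `|Tt phi| <= B * (nv phi + \sum_i \sum_j nm ('d_j (phi i))).
 move=> cp; pose X i := nm (phi i) + \sum_j nm ('d_j (phi i)).
 have X0 i: 0 <= X i by rewrite addr_ge0 ?nm_ge0// sumr_ge0// => j _; exact: nm_ge0.
 have XS: \sum_i X i = nv phi + \sum_i \sum_j nm ('d_j (phi i)) by rewrite /X big_split.
 rewrite -XS mulr_sumr; apply: le_trans (ler_norm_sum _ _ _) _; apply: ler_sum => i _.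
 apply: le_trans (ler_normB _ _) _; rewrite /B mulrDl; apply: lerD.
  apply: le_trans ((CiP i).2 _ (cp i)) _; apply: ler_wpM2r; first exact: X0.
  exact: (ler_sum1 (F := Ci)).
 apply: le_trans (nm_CS (sg i) (Cc_sq (cp i).1)) _; apply: ler_pM; rewrite ?nm_ge0//.
  by apply: (ler_sum1 (F := fun i => nm (g i))) => j; exact: nm_ge0.
 by rewrite lerDl sumr_ge0// => j _; exact: nm_ge0.
have [w [sw w0 wa wT]] := rot_represent i0 oO M0 OM hp cb B0 Ttlin Ttgr Ttb.
have wE i j: w i j \_ Om = w i j by apply: restrict_id; exact: w0.
exists u, w; split => //; first by move=> i j; apply/L2P; rewrite wE.
move=> i h ch; rewrite (ev_grad i wg ch) gE.
pose phi a : E -> R := if a == i then h else fun=> 0.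
have cphi: Ctf Om phi by move=> a; rewrite /phi; case: ifP => // _; exact: Ct0.
have S0 a: S a (fun=> 0) = 0.
 have := Slin a (-1) h h ch ch; have ->: (fun x => -1 * h x + h x) = fun=> 0.
  by apply/funext => x; rewrite mulN1r addNr.
 by rewrite mulN1r addNr.
have p0 a: a != i -> phi a = fun=> 0 by rewrite /phi => /negPf ->.
have pi_: phi i = h by rewrite /phi eqxx.
have e1: Tt phi = S i h.
 rewrite -[in RHS]pi_; apply: (sum_single (Y := fun a => S a (phi a))) => a ai.
 by rewrite p0.
have e2: \sum_a \sum_j ip mu (w a j) ('d_j (phi a)) = \sum_j ip mu (w i j) ('d_j h).
 rewrite -[in RHS]pi_; apply: (sum_single (Y := fun a => \sum_j ip mu (w a j) ('d_j (phi a)))) => a ai.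
 apply: big1 => j _; rewrite p0// partial_cst /ip.
 by rewrite int_eq0// => x; rewrite mulr0.
have e3: \sum_j ip mu (w i j \_ Om) ('d_j h) = \sum_j ip mu (w i j) ('d_j h) by apply: eq_bigr => j _; rewrite wE.
have e4: ev (T i) h - ip mu (g i) h = \sum_j ip mu (w i j) ('d_j h) by rewrite -e2 -(wT phi cphi) e1.
by rewrite e3 -e4; move: (ev _ _) (ip _ _ _) => a b; ring.
Qed.

(** A space of vector fields c x encoded by all skew matrices of L2 functions
  complements the gradients. *)
Lemma skew_direct_sum (X : zmodType) (L : set X) (c : X -> 'I_n -> distr Om) (A : X -> 'I_n -> 'I_n -> E -> R):
 L 0 -> c 0 = 0 ->
 (forall x i j, L x -> L2 Om (A x i j)) -> (forall x i j y, A x i j y = - A x j i y) ->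
 (forall x i h, L x -> Ct Om h -> ev (c x i) h = \sum_j ip mu (A x i j \_ Om) ('d_j h)) ->
 (forall w : 'I_n -> 'I_n -> E -> R, (forall i j, L2 Om (w i j)) -> (forall i j y, w i j y = - w j i y) ->
   exists2 x, L x & forall i j, A x i j = w i j) ->
 direct_sum (Hm1_div Om) (grad_H10 Om) (c @` L).
move=> L0 c0 AL As cA Aw.
have H1w u: H10 Om u -> forall i, is_weak_partial Om i u (weak_partial Om i u) by move=> [[_ wu] _] i; have [g wg] := wu i; exact: weak_partialP wg.
have sA x i j: L x -> sq mu (A x i j \_ Om) by move=> Lx; exact: (L2P _ _).1 (AL x i j Lx).
have div0 x h: L x -> Ct Om h -> \sum_i ev (c x i) ('d_i h) = 0.
 move=> Lx ch; rewrite (eq_bigr _ (fun i _ => cA x i _ Lx (Ct_d i ch))).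
 pose Z := \sum_i \sum_j ip mu (A x i j \_ Om) ('d_j ('d_i h)).
 have : Z = - Z.
  rewrite {1}/Z exchange_big/= -sumrN; apply: eq_bigr => i _; rewrite -sumrN; apply: eq_bigr => j _.
  have E1: A x j i \_ Om = fun y => -1 * (A x i j \_ Om) y by apply/funext => y; rewrite !patchE; case: ifP => _; rewrite ?mulr0// As mulN1r.
  have s1 := sA x i j Lx; have s2 := sq_d i (Cc_d j ch.1).
  have E2: 'd_j ('d_i h) = 'd_i ('d_j h) by exact: partialC ch.1.
  by rewrite E2 E1; apply: etrans (ipZl (-1) s1 s2) _; exact: mulN1r.
 by rewrite -/Z; move: Z => Z ZN; lra.
split; last first.
 apply/seteqP; split => [T [[u hu <-] [x Lx xu]]|T ->].
  have wg := H1w u hu; pose g i := weak_partial Om i u \_ Om.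
  have sg i: sq mu (g i) by have [] := (weak_partialE _ _ _ _).1 (wg i).
  have [v [cv _ vg]] := H10_limit oO hu.
  have orth h: Ct Om h -> \sum_i ip mu (g i) ('d_i h) = 0.
   move=> ch; rewrite -[RHS](div0 x h Lx ch); apply: eq_bigr => i _.
   by rewrite xu (ev_grad i wg (Ct_d i ch)).
  have t1: (fun k => \sum_i ip mu ('d_i (v k)) (g i)) @ \oo --> \sum_i ip mu (g i) (g i) by apply: cvg_fsum => i; exact: tends_ip (fun k => sq_d i (cv k).1) (sg i) (sg i) (vg i).
  have Ek: (fun k => \sum_i ip mu ('d_i (v k)) (g i)) = fun=> 0 by apply/funext => k; rewrite -[RHS](orth _ (cv k)); apply: eq_bigr => i _; exact: ipC.
  have t2: (fun k => \sum_i ip mu ('d_i (v k)) (g i)) @ \oo --> (0 : R) by rewrite Ek; exact: cvg_cst.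
  have S0: \sum_i ip mu (g i) (g i) = 0 by exact: (cvg_unique _ t1 t2).
  have gi0 i: nm (g i) = 0.
   apply/le_anti/andP; split; last exact: nm_ge0.
   apply: nm_le => //; rewrite expr0n /= -[leRHS]S0.
   by apply: (ler_sum1 (F := fun i => ip mu (g i) (g i))) => j; exact: ip_ge0.
  apply/funext => i; apply: distr_eq => h ch; rewrite (ev_grad i wg ch) [RHS]ev0.
  apply/eqP; rewrite -normr_le0; apply: le_trans (nm_CS (sg i) (Cc_sq ch.1)) _.
  by rewrite gi0 mul0r.
 split; last by exists 0.
 exists (fun=> 0); first exact: H10_test (Ct0 Om).
 apply/funext => i; apply: distr_eq => h ch; rewrite ev_dpartial// ev_distr_of; last exact: Ct_d.
 rewrite [RHS]ev0 /ip int_eq0 ?oppr0// => y.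
 by rewrite patchE; case: ifP; rewrite mul0r.
apply/seteqP; split => [T hT|T [S [u hu <-] [S' [x Lx <-] <-]]].
 have [u [w [hu wL wa TE]]] := hodge hT; have [x Lx xw] := Aw w wL wa.
 exists (grad (distr_of Om u)); first by exists u.
 exists (c x); first by exists x.
 apply/funext => i; apply: distr_eq => h ch; rewrite TE// evD; congr (_ + _).
 by rewrite cA//; apply: eq_bigr => j _; rewrite xw.
have wg := H1w u hu; have [[Lu _] _] := hu; have su := (L2P _ _).1 Lu.
pose g i := weak_partial Om i u \_ Om.
have sg i: sq mu (g i) by have [] := (weak_partialE _ _ _ _).1 (wg i).
split=> [i|].
 pose a j y := (if j == i then -1 else 0) * (u \_ Om) y + (A x i j \_ Om) y.
 apply: (@Hm1_form _ _ _ oO _ a) => [j|h ch]; first by apply: sqD; [exact: sqZ|exact: sA].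
 rewrite [LHS]evD ev_dpartial// ev_distr_of ?cA//; last exact: Ct_d.
 have ipa j: ip mu (a j) ('d_j h) =
   (if j == i then -1 else 0) * ip mu (u \_ Om) ('d_j h) + ip mu (A x i j \_ Om) ('d_j h).
  have s1 := sq_d j ch.1; have s2 := sA x i j Lx.
  by rewrite /a ipDl ?ipZl//; exact: sqZ.
 rewrite (eq_bigr _ (fun j _ => ipa j)) big_split/=; congr (_ + _).
 rewrite (bigD1 i)//= eqxx mulN1r big1 ?addr0// => j /negPf ->; exact: mul0r.
apply: (@Hm1_form _ _ _ oO _ (fun i y => -1 * g i y)) => [i|h ch]; first exact: sqZ.
rewrite ev_div// -sumrN.
have E1 i: - ev ((grad (distr_of Om u) + c x) i) ('d_i h) =
  ip mu (fun y => -1 * g i y) ('d_i h) - ev (c x i) ('d_i h).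
 rewrite [ev _ _]evD opprD; congr (_ - _); have s1 := sq_d i ch.1.
 by rewrite (ev_grad i wg (Ct_d i ch)) (ipZl _ (sg i) s1) mulN1r.
by rewrite (eq_bigr _ (fun i _ => E1 i)) sumrB div0// subr0.
Qed.
End decomposition.

(** * Curl free fields are gradients *)

Section gradient_fields.
Context (R : realType) (n : nat) (i0 : 'I_n).
Notation E := 'rV[R]_n.
Notation mu := (lebesgue_rV R n).
Notation nm := (L2norm mu).
Context (Om : set E) (M : R) (oO : open Om) (M0 : 0 < M) (OM : Om `<=` ball 0 M) (hp : patched Om).
Context (pot : has_potentials Om).

Definition curl_free (f : 'I_n -> E -> R) := forall i j h, Ct Om h ->
 ip mu (f i \_ Om) ('d_j h) = ip mu (f j \_ Om) ('d_i h).

Lemma grad_curl_free u (f : 'I_n -> E -> R): (forall i, is_weak_partial Om i u (f i)) -> curl_free f.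
move=> wf i j h ch; have [_ Hi] := (weak_partialE Om i u (f i)).1 (wf i).
have [_ Hj] := (weak_partialE Om j u (f j)).1 (wf j).
have E2: 'd_j ('d_i h) = 'd_i ('d_j h) by exact: partialC ch.1.
have e1 := Hi _ (Ct_d j ch); have e2 := Hj _ (Ct_d i ch); rewrite E2 in e2.
by apply: oppr_inj; exact: (etrans (esym e1) e2).
Qed.

(** Subtracting the gradient with the same divergence leaves a curl free and
  divergence free, hence harmonic, field. *)
Lemma curl_free_grad (f : 'I_n -> E -> R): (forall i, L2 Om (f i)) -> curl_free f ->
 exists2 u, H1 Om u & forall i, is_weak_partial Om i u (f i).
move=> Lf cf; have sf i := (L2P Om (f i)).1 (Lf i).
pose l h := \sum_i ip mu (f i \_ Om) ('d_i h).
have llin a h k: Ct Om h -> Ct Om k -> l (fun x => a * h x + k x) = a * l h + l k.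
 move=> ch ck; rewrite /l mulr_sumr -big_split/=; apply: eq_bigr => i _.
 have s1 := sq_d i ch.1; have s2 := sq_d i ck.1.
 by rewrite (partial_lc i a ch.1 ck.1) ipDr ?ipZr//; exact: sqZ.
pose C := \sum_i nm (f i \_ Om); have C0: 0 <= C by apply: sumr_ge0 => i _; exact: nm_ge0.
have lb h: Ct Om h -> `|l h| <= C * (nm h + \sum_i nm ('d_i h)).
 move=> ch; apply: le_trans (ler_norm_sum _ _ _) _; rewrite /C mulr_suml; apply: ler_sum => i _.
 apply: le_trans (nm_CS (sf i) (sq_d i ch.1)) _; rewrite ler_wpM2l ?nm_ge0//.
 apply: (le_trans (ler_sum1 (F := fun i => nm ('d_i h)) i (fun i => nm_ge0 _ _))).
 by rewrite lerDr nm_ge0.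
have [u [g [hu wg sg g0 ug]]] := dirichlet i0 oO M0 OM C0 llin lb.
pose F i x := (f i \_ Om) x - g i x.
have sF i: sq mu (F i) by exact: sqB.
have F0 i x: ~ Om x -> F i x = 0 by move=> nx; rewrite /F restrict_out// g0// subrr.
have gE i: g i \_ Om = g i by apply: restrict_id; exact: g0.
have rF i j h: Ct Om h -> ip mu (F i) ('d_j h) = ip mu (F j) ('d_i h).
 move=> ch; have s1 := sq_d j ch.1; have s2 := sq_d i ch.1.
 have e1: ip mu (F i) ('d_j h) = _ := ipBl (sf i) (sg i) s1.
 have e2: ip mu (F j) ('d_i h) = _ := ipBl (sf j) (sg j) s2.
 have e4 := @grad_curl_free u g wg i j h ch; rewrite !gE in e4.
 exact: (etrans e1 (etrans (f_equal2 (fun a b => a - b) (cf i j h ch) e4) (esym e2))).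
have dF h: Ct Om h -> \sum_i ip mu (F i) ('d_i h) = 0.
 move=> ch; have E1 i: ip mu (F i) ('d_i h) = ip mu (f i \_ Om) ('d_i h) - ip mu (g i) ('d_i h).
  by rewrite ipBl//; exact: (sq_d i ch.1).
 by rewrite (eq_bigr _ (fun i _ => E1 i)) sumrB ug// subrr.
have hF i: harm Om (F i).
 split; first by split => //; exists M => x nx; apply: F0 => /OM.
 move=> h ch; rewrite -[RHS](dF _ (Ct_d i ch)).
 have ->: ip mu (F i) (lap h) = \sum_j ip mu (F i) ('d_j ('d_j h)).
  exact: (@ip_sumr _ _ _ mu _ (index_enum 'I_n) (fun j => 'd_j ('d_j h)) (F i)
   (fun j => sq_d j (Cc_d j ch.1)) (sF i)).
 apply: eq_bigr => j _; apply: etrans (rF i j _ (Ct_d j ch)) _.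
 have ->: 'd_i ('d_j h) = 'd_j ('d_i h) by exact: partialC ch.1.
 by [].
have [p [sp pF]] := harmonic_potential oO M0 OM hp pot hF F0 rF.
have Lu := hu.1.1; have su := (L2P Om u).1 Lu.
pose U x := (u \_ Om) x + p x * \1_Om x.
have UE: U \_ Om = U by apply: restrict_id => x nx; rewrite /U restrict_out// indicE memNset// mulr0 addr0.
have wU i: is_weak_partial Om i U (f i).
 apply/weak_partialE; split => // h ch; rewrite UE.
 have [_ H] := (weak_partialE Om i u (g i)).1 (wg i).
 have s1 := sq_d i ch.1; have sh := Cc_sq ch.1.
 rewrite (ipDl su sp s1) H// pF// gE (ipBl (sf i) (sg i) sh).
 by move: (ip _ _ _) (ip _ _ _) => a b; ring.
exists U => //; split; last by move=> i; exists (f i).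
by apply/L2P; rewrite UE; exact: sqD.
Qed.
End gradient_fields.

(** * Quotients and linearity *)

Section quotients.
Context {X Y : zmodType}.

Lemma quotient_imageE (c : X -> Y) (L : set X): L 0 -> c 0 = 0 ->
 (forall x k, L x -> L k -> c (x + k) = c x + c k) ->
 quotient_image c (quotient L (ker_on L c)) = c @` L.
move=> L0 c0 cD.
have img x: L x -> c @` [set x + k | k in ker_on L c] = [set c x].
 move=> Lx; apply/seteqP; split => [y [_ [k [Lk ck] <-] <-]|y ->].
  by rewrite cD// ck addr0.
 by exists x => //; exists 0 => //; rewrite addr0.
apply/seteqP; split => [y [C [x Lx <-]]|y [x Lx <-]].
 by rewrite img// => /esym E; exists x => //; have : [set y] y by []; rewrite E.
by exists [set x + k | k in ker_on L c]; [exists x|rewrite img].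
Qed.
End quotients.

Section distr_linear.
Context (R : realType) (n : nat) (Om : set 'rV[R]_n).

Lemma distr_ofD f g: L2 Om f -> L2 Om g -> distr_of Om (f + g) = distr_of Om f + distr_of Om g.
move=> /L2P sf /L2P sg; apply: distr_eq => h ch; rewrite evD !ev_distr_of//.
rewrite -ipDl//; last exact: Cc_sq ch.1.
by apply: eq_int => x; congr (_ * _); rewrite !patchE; case: ifP => //; rewrite addr0.
Qed.

Lemma dpartialD i (T S : distr Om): dpartial i (T + S) = dpartial i T + dpartial i S.
by apply/funext => phi; exact: opprD. Qed.
Lemma L2_0: L2 Om 0.
apply/L2P; rewrite restrict_id//; exact: Cc_sq (@Cc0 R n).
Qed.
Lemma L2N f: L2 Om f -> L2 Om (- f).
move=> /L2P sf; apply/L2P; have := sqZ (-1) sf; congr sq; apply/funext => x; rewrite !patchE.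
by case: ifP => _; rewrite ?mulr0// mulN1r.
Qed.
Lemma L2D f g: L2 Om f -> L2 Om g -> L2 Om (f + g).
move=> /L2P sf /L2P sg; apply/L2P; have := sqD sf sg; congr sq; apply/funext => x; rewrite !patchE.
by case: ifP => // _; rewrite addr0.
Qed.

Lemma ip0 h: ip (lebesgue_rV R n) ((0 : 'rV[R]_n -> R) \_ Om) h = 0.
rewrite /ip int_eq0// => x.
by rewrite patchE; case: ifP; rewrite mul0r.
Qed.
Lemma ip_restrictN f h: L2 Om f -> Ct Om h ->
 ip (lebesgue_rV R n) ((- f) \_ Om) h = - ip (lebesgue_rV R n) (f \_ Om) h.
move=> /L2P sf ch; have := ipZl (-1) sf (Cc_sq ch.1); rewrite mulN1r => <-.
apply: eq_int => x; congr (_ * _); rewrite !patchE.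
by case: ifP => _; rewrite ?mulr0// mulN1r.
Qed.
End distr_linear.

(** * Mean values and constants *)

Section pairings.
Context (R : realType) (n : nat) (Om : set 'rV[R]_n).
Notation E := 'rV[R]_n.
Notation mu := (lebesgue_rV R n).
Implicit Types (f g h : E -> R).

(* kept folded so that the Lebesgue measure in concrete dimensions does not compute *)
Definition pairing f h := ip mu (f \_ Om) h.

Lemma ev_dpartial_of i f h: Ct Om h -> ev (dpartial i (distr_of Om f)) h = - pairing f ('d_i h).
by move=> ch; rewrite ev_dpartial// ev_distr_of//; exact: Ct_d. Qed.
Lemma pairing0 h: pairing 0 h = 0. Proof. exact: ip0. Qed.
Lemma pairingN f h: L2 Om f -> Ct Om h -> pairing (- f) h = - pairing f h.
exact: ip_restrictN. Qed.

Lemma pairing_cst (m : R) i h: Ct Om h -> pairing (cst m) ('d_i h) = 0.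
move=> ch; have := ip_partial i (@C1_cst R n m) ch.1.
rewrite partial_cst => H; transitivity (ip mu (fun=> m) ('d_i h)).
 apply: eq_int => x; have [Ox|nO] := pselect (Om x); first by rewrite patchE mem_set.
 by rewrite (Ct_out (Ct_d i ch) nO) !mulr0.
rewrite H /ip int_eq0 ?oppr0// => x.
by rewrite mul0r.
Qed.

Section means.
Context (M : R) (oO : open Om) (M0 : 0 < M) (OM : Om `<=` ball 0 M) (neO : Om !=set0) (cO : connected Om).

Definition total f := \int[mu]_(x in Om) f x.

Lemma L2_itg f: L2 Om f -> itg mu (f \_ Om).
move=> /L2P sf; apply: Lb_itg; split => //; exists M => x nx.
by apply: restrict_out => /OM.
Qed.
Lemma totalE f: total f = Rintegral mu setT (f \_ Om).
by rewrite /total Rintegral_mkcond. Qed.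

Lemma L2_cst (m : R): L2 Om (cst m).
have bO: bounded_set Om by apply/bddP; exists M.
have [s1 _] := indic_Lb (open_meas oO) bO.
apply/L2P; have := sqZ m s1; congr sq; apply/funext => x.
by rewrite patchE indicE; case: (x \in Om); rewrite ?mulr1 ?mulr0.
Qed.

Lemma totalD f g: L2 Om f -> L2 Om g -> total (f + g) = total f + total g.
move=> Lf Lg; rewrite !totalE -intD; [|exact: L2_itg|exact: L2_itg].
by apply: eq_int => x; rewrite !patchE; case: ifP => //; rewrite addr0.
Qed.
Lemma total_cst (m : R): total (cst m) = m * total (cst 1).
rewrite !totalE -intZ; last exact: L2_itg (L2_cst 1).
by apply: eq_int => x; rewrite !patchE; case: ifP; rewrite ?mulr1 ?mulr0.
Qed.

Lemma total_gt0: 0 < total (cst 1).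
have [x0 Ox0] := neO.
have sO: [set x0] `<=` Om by move=> _ ->.
have [chi cc [c01 [r r0 c1]]] := cutoff (@compact_set1 _ x0) oO sO.
have c1x: chi x0 = 1 by apply: (c1 x0 x0) => //; exact: ballxx.
have ic := Cc_itg cc.1.
have := int_gt0 (Cc_cts cc.1) ic (fun x => (andP (c01 x)).1) (_ : 0 < chi x0).
rewrite c1x ltr01 => /(_ isT) /lt_le_trans; apply; rewrite totalE; apply: int_le => //; first exact: L2_itg (L2_cst 1).
move=> x; rewrite patchE; case: ifPn => [_|nx]; first by have /andP[] := c01 x.
by rewrite (Ct_out cc)// => Ox; rewrite mem_set in nx.
Qed.

Lemma mean_zero f: L2 Om f -> exists m : R, L20 Om (f + cst m).
move=> Lf; exists (- (total f / total (cst 1))); split; first exact: L2D Lf (L2_cst _).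
rewrite -/(total _) (totalD Lf (L2_cst _)) total_cst mulNr divfK ?subrr//.
by rewrite gt_eqF// total_gt0.
Qed.

(** On a connected set a mean zero function with zero weak gradient vanishes. *)
Lemma zero_gradient f: L20 Om f -> (forall i h, Ct Om h -> pairing f ('d_i h) = 0) ->
 {ae mu, forall x, Om x -> f x = 0}.
move=> [Lf tf] gf; have /L2P sf := Lf.
have lf: Lb (f \_ Om) by split => //; exists M => x nx; apply: restrict_out => /OM.
have loc := zero_grad_lc oO lf (fun i h => gf i h).
have H x: exists p : R * R, Om x -> 0 < p.1 /\ {ae mu, forall y, ball x p.1 y -> (f \_ Om) y = p.2} by have [/loc[r r0 [c Hc]]|n0] := pselect (Om x); [exists (r, c)|exists (0, 0)].
have [p pP] := choice H; pose c x := (p x).2.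
have clc x: Om x -> exists2 r, 0 < r & forall y, Om y -> ball x r y -> c y = c x.
 move=> Ox; have [r0 Hx] := pP x Ox; exists (p x).1 => // y Oy xy; have [s0 Hy] := pP y Oy.
 exact: (ae_const_uniq (z := y) Hy Hx (ballxx _ s0) xy).
have [x0 Ox0] := neO.
have cc x: Om x -> c x = c x0 by move=> Ox; exact: (connected_lc cO clc Ox0 Ox).
have aec: {ae mu, forall x, Om x -> (f \_ Om) x = c x0}.
 apply: ae_local => x Ox; have [r0 Hx] := pP x Ox; exists (p x).1 => //.
 by apply: filterS Hx => y yP /yP ->; exact: cc.
have E1: total f = total (cst (c x0)).
 rewrite !totalE; apply: int_ae; [exact: sf.1|exact: itg_meas (L2_itg (L2_cst _))|].
 apply: filterS aec => x xP _; have [Ox|nO] := pselect (Om x); last by rewrite !restrict_out.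
 by rewrite xP// patchE mem_set.
have c0: c x0 = 0.
 apply/eqP; move: E1; rewrite total_cst [total f]tf => /esym/eqP.
 by rewrite mulf_eq0 [total _ == 0]gt_eqF ?total_gt0// orbF.
by apply: filterS aec => x xP Ox; have := xP Ox; rewrite patchE mem_set// c0.
Qed.
End means.
Lemma curl_freeP (v : 'I_n -> E -> R): curl_free Om v <->
 forall i j h, Ct Om h -> pairing (v i) ('d_j h) = pairing (v j) ('d_i h).
by []. Qed.
End pairings.

Opaque pairing.

(** * Dimension two *)

Section dimension_two.
Context (R : realType) (Om : set 'rV[R]_2) (dO : bounded_lipschitz_domain Om) (cbO : connected (bdry Om)).
Implicit Types v : 'rV[R]_2 -> R.

Definition skew2 v (i j : 'I_2) : 'rV[R]_2 -> R :=
 tnth (tnth [tuple [tuple 0; - v]; [tuple v; 0]] i) j.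
Lemma ord2_ind (P : 'I_2 -> Prop): P 0 -> P 1 -> forall i, P i.
move=> P0 P1 [[|[|m]] lt] //; first by rewrite (_ : Ordinal lt = 0)//; exact: val_inj.
by rewrite (_ : Ordinal lt = 1)//; exact: val_inj.
Qed.
Lemma sum2 (F : 'I_2 -> R): \sum_j F j = F 0 + F 1.
by rewrite !big_ord_recr big_ord0 /= add0r; congr (F _ + F _); exact: val_inj. Qed.

Lemma ev_curl2 v i h: L2 Om v -> Ct Om h ->
 ev (curl2 Om v i) h = \sum_j pairing Om (skew2 v i j) ('d_j h).
move=> Lv ch; rewrite sum2; move: i; apply: ord2_ind.
 have ->: curl2 Om v 0 = dpartial 1 (distr_of Om v) by [].
 have ->: skew2 v 0 0 = 0 by []. have ->: skew2 v 0 1 = - v by [].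
 by rewrite ev_dpartial_of// pairing0 add0r (pairingN Lv (Ct_d 1 ch)).
have ->: curl2 Om v 1 = - dpartial 0 (distr_of Om v) by [].
have ->: skew2 v 1 0 = v by []. have ->: skew2 v 1 1 = 0 by [].
by rewrite evN ev_dpartial_of// pairing0 addr0 opprK.
Qed.

Lemma curl2D v w: L2 Om v -> L2 Om w -> curl2 Om (v + w) = curl2 Om v + curl2 Om w.
move=> Lv Lw; apply/funext; apply: ord2_ind.
 change (dpartial 1 (distr_of Om (v + w)) = dpartial 1 (distr_of Om v) + dpartial 1 (distr_of Om w)).
 by rewrite distr_ofD// dpartialD.
change (- dpartial 0 (distr_of Om (v + w)) = - dpartial 0 (distr_of Om v) + - dpartial 0 (distr_of Om w)).
by rewrite distr_ofD// dpartialD opprD.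
Qed.

Lemma curl2_eq0 v: L2 Om v -> (forall i h, Ct Om h -> pairing Om v ('d_i h) = 0) -> curl2 Om v = 0.
move=> Lv H; apply/funext => i; apply: distr_eq => h ch; rewrite (ev_curl2 i Lv ch) [RHS]ev0 sum2.
move: i; apply: ord2_ind.
 have ->: skew2 v 0 0 = 0 by []. have ->: skew2 v 0 1 = - v by [].
 by rewrite pairing0 (pairingN Lv (Ct_d 1 ch)) H// subrr.
have ->: skew2 v 1 0 = v by []. have ->: skew2 v 1 1 = 0 by [].
by rewrite pairing0 H// addr0.
Qed.

Lemma curl2_inj v w i h: L2 Om v -> L2 Om w -> curl2 Om v = curl2 Om w -> Ct Om h ->
 pairing Om v ('d_i h) = pairing Om w ('d_i h).
move=> Lv Lw E ch; have H j := congr1 (fun T => ev (T j) h) E.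
move: i; apply: ord2_ind.
 have := H 1; rewrite (ev_curl2 1 Lv ch) (ev_curl2 1 Lw ch) !sum2.
 have e v': skew2 v' 1 0 = v' by []. have e' v': skew2 v' 1 1 = 0 by [].
 by rewrite !e !e' !pairing0 !addr0.
have := H 0; rewrite (ev_curl2 0 Lv ch) (ev_curl2 0 Lw ch) !sum2.
have e v': skew2 v' 0 1 = - v' by []. have e' v': skew2 v' 0 0 = 0 by [].
rewrite !e !e' !pairing0 !add0r (pairingN Lv (Ct_d 1 ch)) (pairingN Lw (Ct_d 1 ch)).
exact: oppr_inj.
Qed.

Lemma curl2_0: curl2 Om 0 = 0.
by apply: (curl2_eq0 (@L2_0 R 2 Om)) => i h ch; exact: pairing0. Qed.

Lemma skew2_skew v i j y: skew2 v i j y = - skew2 v j i y.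
move: i j; apply: ord2_ind; apply: ord2_ind.
- change ((0 : R) = - 0); by rewrite oppr0.
- by [].
- change (v y = - - v y); by rewrite opprK.
- change ((0 : R) = - 0); by rewrite oppr0.
Qed.

Lemma direct_sum2: direct_sum (Hm1_div Om) (grad_H10 Om) (curl2 Om @` L2 Om).
have [M [M0 OM hp cb]] := domain_data dO cbO; have [_ oO _ _ _] := dO.
apply: (skew_direct_sum 0 oO M0 OM hp cb (A := skew2)).
- exact: L2_0.
- exact: curl2_0.
- move=> v i j Lv; move: i j; apply: ord2_ind; apply: ord2_ind.
 + exact: L2_0.
 + exact: L2N.
 + exact: Lv.
 + exact: L2_0.
- exact: skew2_skew.
- move=> v i h Lv ch; exact: ev_curl2.
- move=> w Lw ws; have z (i : 'I_2) : w i i = 0.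
  by apply/funext => y; have := ws i i y; move: (w i i y) => t /esym/eqP; rewrite -subr_eq0 -opprD oppr_eq0 -mulr2n mulrn_eq0 => /orP[//|/eqP].
 exists (w 1 0); first exact: Lw.
 apply: ord2_ind; apply: ord2_ind.
 + by rewrite z.
 + by apply/funext => y; exact: esym (ws 0 1 y).
 + by [].
 + by rewrite z.
Qed.

(** The kernel of curl consists of the functions that are constant almost everywhere. *)
Lemma coset_mean_zero C: quotient (L2 Om) (ker_on (L2 Om) (curl2 Om)) C ->
 exists2 p : 'rV_2 -> R, (C `&` L20 Om) p & forall q : 'rV_2 -> R, (C `&` L20 Om) q ->
  ae_eq (lebesgue_rV R 2) Om p q.
move=> [x Lx <-]; have [M [M0 OM _ _]] := domain_data dO cbO; have [neO oO cO _ _] := dO.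
have [m hm] := mean_zero oO M0 OM neO Lx.
have Lm: L2 Om (cst m) := L2_cst oO M0 OM m.
have cm: curl2 Om (cst m) = 0 by apply: (curl2_eq0 Lm) => i h ch; exact: pairing_cst.
exists (x + cst m); first by split => //; exists (cst m).
move=> q [[k [Lk ck] <-] [Lq tq]].
have Lp := L2D Lx Lm.
have E1: curl2 Om (x + cst m) = curl2 Om (x + k) by rewrite !curl2D// cm ck.
pose f := (x + cst m) + - (x + k).
have Lf: L2 Om f := L2D Lp (L2N Lq).
have f0: L20 Om f.
 split => //; have E2: total Om f + total Om (x + k) = total Om (x + cst m).
  by rewrite -(totalD OM Lf Lq) /f subrK.
 change (total Om f = 0); move: E2; rewrite [total Om (x + k)]tq addr0 => ->; exact: hm.2.
have gf i h: Ct Om h -> pairing Om f ('d_i h) = 0.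
 move=> ch; have cf: curl2 Om f = curl2 Om 0.
  rewrite curl2_0; have := curl2D Lf Lq; rewrite /f subrK E1 => E3.
  by apply: (addIr (curl2 Om (x + k))); rewrite add0r; exact: esym E3.
 by rewrite (curl2_inj i Lf (@L2_0 R 2 Om) cf ch) pairing0.
have := zero_gradient oO M0 OM neO cO f0 gf; apply: filterS => y yP Oy.
by apply/eqP; rewrite -subr_eq0; apply/eqP; exact: yP.
Qed.

Lemma curl2_L20: curl2 Om @` L2 Om = curl2 Om @` L20 Om.
have [M [M0 OM _ _]] := domain_data dO cbO; have [neO oO cO _ _] := dO.
apply/seteqP; split => [T [x Lx <-]|T [x [Lx _] <-]]; last by exists x.
have [m hm] := mean_zero oO M0 OM neO Lx; exists (x + cst m) => //.
have Lm: L2 Om (cst m) := L2_cst oO M0 OM m.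
rewrite curl2D// (curl2_eq0 Lm) ?addr0// => i h ch; exact: pairing_cst.
Qed.
End dimension_two.

(** * Dimension three *)

Section dimension_three.
Context (R : realType) (Om : set 'rV[R]_3) (dO : bounded_lipschitz_domain Om) (scO : simply_connected Om).
Context (cbO : connected (bdry Om)).
Implicit Types v : 'I_3 -> 'rV[R]_3 -> R.

Definition skew3 v (i j : 'I_3) : 'rV[R]_3 -> R :=
 tnth (tnth [tuple [tuple 0; - v 2; v 1]; [tuple v 2; 0; - v 0]; [tuple - v 1; v 0; 0]] i) j.

Lemma ord3_ind (P : 'I_3 -> Prop): P 0 -> P 1 -> P 2 -> forall i, P i.
move=> P0 P1 P2 [[|[|[|m]]] lt] //; first by rewrite (_ : Ordinal lt = 0)//; exact: val_inj.
 by rewrite (_ : Ordinal lt = 1)//; exact: val_inj.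
by rewrite (_ : Ordinal lt = 2)//; exact: val_inj.
Qed.

Lemma sum3 (F : 'I_3 -> R): \sum_j F j = F 0 + F 1 + F 2.
by rewrite !big_ord_recr big_ord0 /= add0r; congr (F _ + F _ + F _); exact: val_inj. Qed.

Lemma ev_curl3 v i h: L2v Om 3 v -> Ct Om h ->
 ev (curl3 Om v i) h = \sum_j pairing Om (skew3 v i j) ('d_j h).
move=> Lv ch; rewrite sum3.
have D (k l : 'I_3) : ev (dpartial k (distr_of Om (v l))) h = - pairing Om (v l) ('d_k h).
 exact: ev_dpartial_of.
have S (k l a b : 'I_3) : ev (dpartial k (distr_of Om (v l)) - dpartial a (distr_of Om (v b))) h =
  - pairing Om (v l) ('d_k h) - - pairing Om (v b) ('d_a h).
 apply: etrans (evD _ _ _) _; apply: f_equal2 (D k l) _.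
 by apply: etrans (evN _ _) _; congr (- _); exact: D.
have N (l k : 'I_3) : pairing Om (- v l) ('d_k h) = - pairing Om (v l) ('d_k h).
 exact: pairingN (Lv l) (Ct_d k ch).
have z (k : 'I_3) : pairing Om 0 ('d_k h) = 0 by exact: pairing0.
move: i; apply: ord3_ind.
- have ->: curl3 Om v 0 = dpartial 1 (distr_of Om (v 2)) - dpartial 2 (distr_of Om (v 1)) by [].
 have ->: skew3 v 0 0 = 0 by []. have ->: skew3 v 0 1 = - v 2 by []. have ->: skew3 v 0 2 = v 1 by [].
 apply: etrans (S 1 2 2 1) _; apply: esym.
 apply: etrans (f_equal2 +%R (f_equal2 +%R (z 0) (N 2 1)) (erefl (pairing Om (v 1) (partial 2 h)))) _.
 by move: (pairing _ _ _) (pairing _ _ _) => a b; ring.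
- have ->: curl3 Om v 1 = dpartial 2 (distr_of Om (v 0)) - dpartial 0 (distr_of Om (v 2)) by [].
 have ->: skew3 v 1 0 = v 2 by []. have ->: skew3 v 1 1 = 0 by []. have ->: skew3 v 1 2 = - v 0 by [].
 apply: etrans (S 2 0 0 2) _; apply: esym.
 apply: etrans (f_equal2 +%R (f_equal2 +%R (erefl (pairing Om (v 2) ('d_0 h))) (z 1)) (N 0 2)) _.
 by move: (pairing _ _ _) (pairing _ _ _) => a b; ring.
- have ->: curl3 Om v 2 = dpartial 0 (distr_of Om (v 1)) - dpartial 1 (distr_of Om (v 0)) by [].
 have ->: skew3 v 2 0 = - v 1 by []. have ->: skew3 v 2 1 = v 0 by []. have ->: skew3 v 2 2 = 0 by [].
 apply: etrans (S 0 1 1 0) _; apply: esym.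
 apply: etrans (f_equal2 +%R (f_equal2 +%R (N 1 0) (erefl (pairing Om (v 0) (partial 1 h)))) (z 2)) _.
 by move: (pairing _ _ _) (pairing _ _ _) => a b; ring.
Qed.

Lemma curl3D v w: L2v Om 3 v -> L2v Om 3 w -> curl3 Om (v + w) = curl3 Om v + curl3 Om w.
move=> Lv Lw; have dD i j: dpartial i (distr_of Om ((v + w) j)) =
  dpartial i (distr_of Om (v j)) + dpartial i (distr_of Om (w j)).
 change (dpartial i (distr_of Om (v j + w j)) = dpartial i (distr_of Om (v j)) + dpartial i (distr_of Om (w j))).
 by rewrite (distr_ofD (Lv j) (Lw j)) dpartialD.
pose d v i j := dpartial i (distr_of Om (v j)).
have comp i j k l: d (v + w) i j - d (v + w) k l = (d v i j - d v k l) + (d w i j - d w k l) by rewrite /d !dD opprD addrACA.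
apply/funext; apply: ord3_ind; exact: comp.
Qed.

Lemma curl3_0: curl3 Om 0 = 0.
have L0: L2v Om 3 0 by move=> i; exact: L2_0.
by have := curl3D L0 L0; rewrite addr0 => /eqP; rewrite -subr_eq subrr => /eqP <-.
Qed.

Lemma skew3_skew v i j y: skew3 v i j y = - skew3 v j i y.
have z: (0 : R) = - 0 by rewrite oppr0.
have n (t : R) : t = - - t by rewrite opprK.
move: i j; apply: ord3_ind; apply: ord3_ind; first [exact: z|exact: n|by []].
Qed.

Lemma skew3_L2 v i j: L2v Om 3 v -> L2 Om (skew3 v i j).
move=> Lv; move: i j; apply: ord3_ind; apply: ord3_ind.
- exact: L2_0.
- exact: L2N (Lv 2).
- exact: Lv 1.
- exact: Lv 2.
- exact: L2_0.
- exact: L2N (Lv 0).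
- exact: L2N (Lv 1).
- exact: Lv 0.
- exact: L2_0.
Qed.

Lemma direct_sum3: direct_sum (Hm1_div Om) (grad_H10 Om) (curl3 Om @` L2v Om 3).
have [M [M0 OM hp cb]] := domain_data dO cbO; have [_ oO _ _ _] := dO.
apply: (skew_direct_sum 0 oO M0 OM hp cb (A := skew3)).
- by move=> i; exact: L2_0.
- exact: curl3_0.
- by move=> v i j; exact: skew3_L2.
- exact: skew3_skew.
- by move=> v i h Lv ch; exact: ev_curl3.
move=> w Lw ws; have z (i : 'I_3) : w i i = 0.
 apply/funext => y; have := ws i i y; move: (w i i y) => t h.
 by change (t = 0); lra.
have wN i j: w i j = - w j i by apply/funext => y; exact: ws.
pose v : 'I_3 -> 'rV[R]_3 -> R := tnth [tuple w 2 1; w 0 2; w 1 0].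
have v0: v 0 = w 2 1 by []. have v1: v 1 = w 0 2 by []. have v2: v 2 = w 1 0 by [].
exists v; first by apply: ord3_ind; exact: Lw.
apply: ord3_ind; apply: ord3_ind.
- exact: esym (z 0).
- exact: esym (wN 0 1).
- by [].
- by [].
- exact: esym (z 1).
- exact: esym (wN 1 2).
- exact: esym (wN 2 0).
- by [].
- exact: esym (z 2).
Qed.

Lemma curl3_free v: L2v Om 3 v -> (curl3 Om v = 0 <-> curl_free Om v).
move=> Lv; have N (l k : 'I_3) h : Ct Om h -> pairing Om (- v l) ('d_k h) = - pairing Om (v l) ('d_k h).
 by move=> ch; exact: pairingN (Lv l) (Ct_d k ch).
have z (k : 'I_3) h : pairing Om 0 ('d_k h) = 0 by exact: pairing0.
split=> [c0|/curl_freeP Q].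
 have H i h (ch : Ct Om h) : \sum_j pairing Om (skew3 v i j) ('d_j h) = 0 by rewrite -(ev_curl3 i Lv ch) c0 ev0.
 have e12 h: Ct Om h -> pairing Om (v 1) (partial 2 h) = pairing Om (v 2) (partial 1 h).
  move=> ch; have := H 0 h ch; rewrite sum3.
  have ->: skew3 v 0 0 = 0 by []. have ->: skew3 v 0 1 = - v 2 by []. have ->: skew3 v 0 2 = v 1 by [].
  rewrite z (N 2 1 h ch).
  by move: (pairing _ _ _) (pairing _ _ _) => a b; lra.
 have e02 h: Ct Om h -> pairing Om (v 0) (partial 2 h) = pairing Om (v 2) ('d_0 h).
  move=> ch; have := H 1 h ch; rewrite sum3.
  have ->: skew3 v 1 0 = v 2 by []. have ->: skew3 v 1 1 = 0 by []. have ->: skew3 v 1 2 = - v 0 by [].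
  rewrite z (N 0 2 h ch).
  by move: (pairing _ _ _) (pairing _ _ _) => a b; lra.
 have e01 h: Ct Om h -> pairing Om (v 0) (partial 1 h) = pairing Om (v 1) ('d_0 h).
  move=> ch; have := H 2 h ch; rewrite sum3.
  have ->: skew3 v 2 0 = - v 1 by []. have ->: skew3 v 2 1 = v 0 by []. have ->: skew3 v 2 2 = 0 by [].
  rewrite z (N 1 0 h ch).
  by move: (pairing _ _ _) (pairing _ _ _) => a b; lra.
 apply/curl_freeP => i j h ch; move: i j; apply: ord3_ind; apply: ord3_ind.
 - exact: erefl.
 - exact: e01 h ch.
 - exact: e02 h ch.
 - exact: esym (e01 h ch).
 - exact: erefl.
 - exact: e12 h ch.
 - exact: esym (e02 h ch).
 - exact: esym (e12 h ch).
 - exact: erefl.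
apply/funext => i; apply: distr_eq => h ch; rewrite (ev_curl3 i Lv ch) [RHS]ev0 sum3; move: i; apply: ord3_ind.
- have ->: skew3 v 0 0 = 0 by []. have ->: skew3 v 0 1 = - v 2 by []. have ->: skew3 v 0 2 = v 1 by [].
 by rewrite z (N 2 1 h ch) (Q 1 2 h ch) add0r addNr.
- have ->: skew3 v 1 0 = v 2 by []. have ->: skew3 v 1 1 = 0 by []. have ->: skew3 v 1 2 = - v 0 by [].
 by rewrite z (N 0 2 h ch) (Q 0 2 h ch) addr0 subrr.
- have ->: skew3 v 2 0 = - v 1 by []. have ->: skew3 v 2 1 = v 0 by []. have ->: skew3 v 2 2 = 0 by [].
 by rewrite z (N 1 0 h ch) (Q 0 1 h ch) addr0 addNr.
Qed.

Lemma ker_curl3: ker_on (L2v Om 3) (curl3 Om) = grad_H1 Om.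
have [M [M0 OM hp cb]] := domain_data dO cbO; have [neO oO _ _ _] := dO.
apply/seteqP; split => [f [Lf c0]|f [u hu wf]].
 have pot := @potential_exists R 2 Om oO neO scO.
 exact: (curl_free_grad 0 oO M0 OM hp pot Lf ((curl3_free Lf).1 c0)).
have Lf: L2v Om 3 f by move=> i; exact: (wf i).1.
by split => //; apply/(curl3_free Lf); exact: (grad_curl_free wf).
Qed.
End dimension_three.

(** * The decompositions *)

Theorem mainTheorem2 (R : realType) :
 (forall Omega : set 'rV[R]_2,
  bounded_lipschitz_domain Omega -> simply_connected Omega ->
  connected (bdry Omega) ->
  let curl := curl2 Omega in
  let L2_mod_ker := quotient (L2 Omega) (ker_on (L2 Omega) curl) in
  [/\ direct_sum (Hm1_div Omega) (grad_H10 Omega)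
     (quotient_image curl L2_mod_ker),
    (forall C, L2_mod_ker C -> exists2 p : 'rV_2 -> R, (C `&` L20 Omega) p &
      forall q : 'rV_2 -> R, (C `&` L20 Omega) q ->
       ae_eq (lebesgue_rV R 2) Omega p q) &
    direct_sum (Hm1_div Omega) (grad_H10 Omega) (curl @` L20 Omega)])
 /\
 (forall Omega : set 'rV[R]_3,
  bounded_lipschitz_domain Omega -> simply_connected Omega ->
  connected (bdry Omega) ->
  let curl := curl3 Omega in
  let L2_mod_ker := quotient (L2v Omega 3) (ker_on (L2v Omega 3) curl) in
  [/\ direct_sum (Hm1_div Omega) (grad_H10 Omega)
     (quotient_image curl L2_mod_ker),
    ker_on (L2v Omega 3) curl = grad_H1 Omega &
    direct_sum (Hm1_div Omega) (grad_H10 Omega)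
     (quotient_image curl (quotient (L2v Omega 3) (grad_H1 Omega)))]).
split=> Om dO scO cbO curl L2k.
 have E1: quotient_image curl L2k = curl @` L2 Om.
  apply: quotient_imageE; [exact: L2_0|exact: curl2_0|exact: curl2D].
 split; [rewrite E1; exact: direct_sum2|exact: coset_mean_zero|].
 by rewrite /curl -(curl2_L20 dO cbO); exact: direct_sum2.
have E1: quotient_image curl L2k = curl @` L2v Om 3 by apply: quotient_imageE; [move=> i; exact: L2_0|exact: curl3_0|exact: curl3D].
have kE := ker_curl3 dO scO cbO.
split => //; first by rewrite E1; exact: direct_sum3.
by rewrite -kE [quotient_image _ _]E1; exact: direct_sum3.
Qed.
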